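(* In the setting described in the context, if $\rho(T)$ has finite order and $r\in\overline{\mathbf{Q}}$, then all Fourier coefficients of both component functions of $F'$ lie in $\mathbf{Q}(r)$ (and so are algebraic numbers). Moreover, for each $k\in\mathbf{Z}$ there is a basis of $M_k(\rho')$ consisting of vector-valued modular forms whose component functions have all Fourier coefficients in $\mathbf{Q}(r)$.
   Context: $\Gamma=\mathrm{SL}_2(\mathbf{Z})$, $\Gamma_0(2)=\{\begin{pmatrix}a&b\\c&d\end{pmatrix}\in\Gamma:2\mid c\}$, $T=\begin{pmatrix}1&1\\0&1\end{pmatrix}$, $q=e^{2\pi i\tau}$, $q^s:=e^{2\pi is\tau}$. $(F|_k\gamma)(\tau)=(c\tau+d)^{-k}F(\frac{a\tau+b}{c\tau+d})$. For a representation $\sigma$ of $\Gamma_0(2)$ on $\mathbf{C}^2$, $M_k(\sigma)$ is the space of holomorphic $F:\mathfrak{H}\to\mathbf{C}^2$ with $F|_k\gamma=\sigma(\gamma)F$ for $\gamma\in\Gamma_0(2)$, holomorphic at all cusps (for each $\gamma\in\Gamma$, the expansions of the components of $F|_k\gamma$ in powers $e^{2\pi i(n+\mu)\tau/N}$ have no terms with $\mathrm{Re}(n+\mu)<0$). $E_2=1-24\sum\sigma(n)q^n$, $E_4=1+240\sum\sigma_3(n)q^n$, $G(\tau)=-E_2(\tau)+2E_2(2\tau)$, $D_kA=\frac{1}{2\pi i}A'-\frac{k}{12}E_2A$. Setting: $\rho:\Gamma_0(2)\to\mathrm{GL}_2(\mathbf{C})$ is irreducible with $\rho(T)$ diagonalizable;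 $k_0$ is the least integer with $M_{k_0}(\rho)\ne0$ and $F\ne0$ in $M_{k_0}(\rho)$. There are unique $a,b,c\in\mathbf{C}$ with $D_{k_0+2}(D_{k_0}F)+aG\,D_{k_0}F+(bG^2+cE_4)F=0$, and $r$ denotes a complex root of $r^2-(a+\frac13)r+b+4c=0$. The eigenvalues $e^{2\pi im_1},e^{2\pi im_2}$ ($|m_1|\le|m_2|$) of $\rho(T)$ are distinct; fix $X\in\mathrm{GL}_2(\mathbf{C})$ with $X\rho(T)X^{-1}=\mathrm{diag}(e^{2\pi im_1},e^{2\pi im_2})$. Each component of $XF$ has the form $\lambda_iq^{k_0/12+l_i}(1+\sum_{n\ge1}c_{i,n}q^n)$ with $\lambda_i\neq0$. Put $E=\mathrm{diag}(\lambda_1^{-1},\lambda_2^{-1})X$, $F'=EF$ (so the components of $F'$ have leading coefficient $1$) and $\rho'=E\rho E^{-1}$; then $F'\in M_{k_0}(\rho')$. Since $\rho'(T)$ is diagonal, each component of any $Z\in M_k(\rho')$ has the form $q^{\mu}\sum_{n\ge0}c_nq^n$; the $c_n$ are its Fourier coefficients. *)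

(* Defs.v *)
From HB Require Import structures.
From mathcomp Require Import all_boot all_order all_algebra complex.
From mathcomp Require Import all_classical all_reals all_analysis.

Set Implicit Arguments.
Unset Strict Implicit.
Unset Printing Implicit Defensive.

Import Order.TTheory GRing.Theory Num.Theory.
Import numFieldNormedType.Exports.

Local Open Scope classical_set_scope.
Local Open Scope ring_scope.
Local Open Scope complex_scope.

(* Going through numFieldType gives the complex numbers the topology of their
   norm, hence limits, series and complex derivatives. *)
Notation CC R := (R[i] : numFieldType).

Definition SL2Z : {pred 'M[int]_2} := [pred A | \det A == 1].
Definition Gamma0_2 : {pred 'M[int]_2} :=
  [pred A | (A \in SL2Z) && (2 %| A 1%R 0%R)%Z].
Definition Tmx : 'M[int]_2 := 1%:M + delta_mx 0 1.

Section VVMF.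
Variable R : realType.
Local Notation C := (CC R).

Definition upper_half (tau : C) : Prop := 0 < complex.Im tau.

Definition twopii : C := 0 +i* (2 * pi).
Definition cexp (z : C) : C :=
  (expR (complex.Re z) * cos (complex.Im z)) +i*
  (expR (complex.Re z) * sin (complex.Im z)).
Definition qpow (s tau : C) : C := cexp (twopii * s * tau).

(* Representations are functions on all integer matrices of which only the
   values on Gamma0_2 matter. *)
Definition is_rep (rho : 'M[int]_2 -> 'M[C]_2) : Prop :=
  [/\ forall g, g \in Gamma0_2 -> rho g \in unitmx,
      rho 1%:M = 1%:M
    & forall g h, g \in Gamma0_2 -> h \in Gamma0_2 ->
        rho (g *m h) = rho g *m rho h].

Definition rep_irreducible (rho : 'M[int]_2 -> 'M[C]_2) : Prop :=
  forall U : {vspace 'cV[C]_2},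
    (forall g v, g \in Gamma0_2 -> v \in U -> rho g *m v \in U) ->
    U = 0%VS \/ U = fullv.

Definition conj_rep (E : 'M[C]_2) (rho : 'M[int]_2 -> 'M[C]_2) g : 'M[C]_2 :=
  E *m rho g *m invmx E.

Definition slash (k : int) (g : 'M[int]_2) (F : C -> 'cV[C]_2) (tau : C) :
    'cV[C]_2 :=
  ((g 1 0)%:~R * tau + (g 1 1)%:~R) ^ (- k) *:
  F (((g 0 0)%:~R * tau + (g 0 1)%:~R) / ((g 1 0)%:~R * tau + (g 1 1)%:~R)).

Definition zseries_to (u : int -> C) (l : C) : Prop :=
  exists lp ln : C,
    [/\ series (fun n : nat => u n%:Z) @ \oo --> lp,
        series (fun n : nat => u (- n.+1%:Z)) @ \oo --> ln
      & l = lp + ln].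

(* f is a finite sum of expansions in the powers e^(2 pi i (n + mu) tau / N),
   n in Z, without terms of Re (n + mu) < 0.  The sum ranges over the exponents
   mu; the factors tau ^+ j are needed exactly when the monodromy
   rho (g T^N g^-1) at the cusp is not diagonalizable. *)
Definition holomorphic_expansion (N : nat) (f : C -> C) : Prop :=
  exists (M : nat) (j : 'I_M -> nat) (mu : 'I_M -> C) (c : 'I_M -> int -> C),
    (forall m n, complex.Re (n%:~R + mu m : C) < 0 -> c m n = 0) /\
    (forall tau, upper_half tau -> exists h : 'I_M -> C,
       (forall m, zseries_to
          (fun n => c m n * qpow ((n%:~R + mu m) / N%:R) tau) (h m)) /\
       f tau = \sum_m tau ^+ j m * h m).

Definition holomorphic_at_cusps (k : int) (F : C -> 'cV[C]_2) : Prop :=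
  forall g, g \in SL2Z -> exists N : nat,
    [/\ (0 < N)%N, g *m Tmx ^+ N *m invmx g \in Gamma0_2
      & forall i, holomorphic_expansion N (fun tau => slash k g F tau i 0)].

(* The space M_k(sigma); a form is represented by any function on C with the
   prescribed values on the upper half-plane. *)
Definition modform (k : int) (sigma : 'M[int]_2 -> 'M[C]_2)
    (F : C -> 'cV[C]_2) : Prop :=
  [/\ forall i tau, upper_half tau -> derivable (fun t : C => F t i 0 : C) tau 1,
      forall g tau, g \in Gamma0_2 -> upper_half tau ->
        slash k g F tau = sigma g *m F tau
    & holomorphic_at_cusps k F].

Definition nonzero_on_H (F : C -> 'cV[C]_2) : Prop :=
  exists2 tau, upper_half tau & F tau != 0.

Definition modform_basis (k : int) (sigma : 'M[int]_2 -> 'M[C]_2) (n : nat)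
    (B : 'I_n -> C -> 'cV[C]_2) : Prop :=
  [/\ forall j, modform k sigma (B j),
      forall x : 'I_n -> C,
        (forall tau, upper_half tau -> \sum_j x j *: B j tau = 0) ->
        forall j, x j = 0
    & forall Z, modform k sigma Z -> exists x : 'I_n -> C,
        forall tau, upper_half tau -> Z tau = \sum_j x j *: B j tau].

Definition divisor_sum (k n : nat) : nat := (\sum_(d <- divisors n) d ^ k)%N.

Definition E2 (tau : C) : C :=
  1 - 24 * limn (series (fun n : nat =>
    (divisor_sum 1 n.+1)%:R * qpow n.+1%:R tau : C)).
Definition E4 (tau : C) : C :=
  1 + 240 * limn (series (fun n : nat =>
    (divisor_sum 3 n.+1)%:R * qpow n.+1%:R tau : C)).
Definition Gform (tau : C) : C := - E2 tau + 2 * E2 (2 * tau).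

Definition Dserre (k : int) (F : C -> 'cV[C]_2) (tau : C) : 'cV[C]_2 :=
  \col_i (twopii^-1 * derive1 (fun t : C => F t i 0 : C) tau
          - k%:~R / 12 * E2 tau * F tau i 0).

Definition qexpansion (mu : C) (c : nat -> C) (f : C -> C) : Prop :=
  forall tau, upper_half tau ->
    series (fun n : nat => c n * qpow (mu + n%:R) tau) @ \oo --> f tau.

Definition fourier_coefs_in (K : C -> Prop) (f : C -> C) : Prop :=
  (exists mu c, qexpansion mu c f) /\
  (forall mu c, qexpansion mu c f -> forall n, K (c n)).

Definition Qadjoin (r z : C) : Prop :=
  exists P Q : {poly rat}, (map_poly ratr Q).[r] != 0 /\
    z = (map_poly ratr P).[r] / (map_poly ratr Q).[r].

End VVMF.

(* Main.v *)
(* Let W be the Wronskian det (F', D F').  By the differential equation it is an eta quotient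
   up to a constant, hence has no zeros in the half-plane, and Cramer's rule writes every form Z
   as f F' + g D F' with scalar functions f and g that are modular on Gamma0(2) and have poles at
   most at the cusps.  The poles do not occur: let Delta be the eta quotient of weight 4 whose only
   zero is at one cusp.  If Delta Z = f F' + g D F' with f and g holomorphic, and x and y are the
   suitably normalized values of f and g at that cusp, then (x G F' + y D F') / Delta is a form of
   weight k0 - 2, so that it vanishes by the minimality of k0; hence x = y = 0, and f and g are
   divisible by Delta.  So M(rho') is free with basis F', D F' over the ring of scalar forms,
   which by a Liouville argument is generated by G and the Delta belonging to the cusp infinity;
   both have rational Fourier coefficients.

   The coefficients of F' satisfy the Frobenius recursion of the differential equation.  Its
   indicial roots l_0, l_1 are rational, because rho(T) has finite order, and do not differ by an
   integer, because the eigenvalues are distinct.  As l_0 + l_1 = 1/6 - a, l_0 l_1 = b + c and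
   b + 4 c = (a + 1/3) r - r^2, the numbers a, b, c and hence all coefficients lie in Q(r).

   The analytic input is the law E2(-1/t) = t^2 E2(t) + 6 t / (pi i), obtained by exchanging the
   order of summation in the Eisenstein series of weight 2. *)

Require Import Defs.
From HB Require Import structures.
From mathcomp Require Import all_boot all_order all_algebra complex.
From mathcomp Require Import all_classical all_reals all_analysis.
From mathcomp Require Import ring lra zify.

Set Implicit Arguments.
Unset Strict Implicit.
Unset Printing Implicit Defensive.

Import Order.TTheory GRing.Theory Num.Theory.
Import numFieldNormedType.Exports.

Local Open Scope ring_scope.

(** * Series of complex numbers *)

(** The equation has three unknown constants, but infinity supplies only two exponents. The third
    relation comes from the cusp 0: there G has the constant term -1/2, so an exponent x of q
    satisfies x (x - 1/6) - a x / 2 + b / 4 + c = 0, and r = 2 x is the exponent of q^(1/2), the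
    local parameter at that cusp.

    The translation at the cusp 0 need not act diagonalizably, so the components of a form may
    contain powers of tau there. The coefficients f and g do not: they are quotients of two
    determinants on which the group acts by the same character, hence they are periodic, and a
    periodic function with such an expansion is an ordinary q-series.

    In x G F' + y D F' the factor G balances the weights; it is usable at either cusp because its
    constant term vanishes at neither.

    Contour integrals are replaced by averages over roots of unity on a circle. They bound the
    coefficients of a series by its real part, and since every point of the half-plane can be moved
    to a place where q^(1/2) has modulus at most 1/4, this bound forces forms of weight 0 to be
    constant. *)

Section ComplexModulus.
Variable R : realType.
Local Notation C := (CC R).
Implicit Types (x y z w : C) (t e : R).

(** The norm of [C] takes its values in [C]; [md] is the same modulus as a real number, so that
    estimates take place in the ordered field [R]. *)
Definition md (z : C) : R := Normc.normc z.

Lemma normE z : `|z| = (md z)%:C%C.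
Proof. by []. Qed.

Lemma mdE z : md z = Num.sqrt (complex.Re z ^+ 2 + complex.Im z ^+ 2).
Proof. by case: z. Qed.

Lemma md_ge0 z : 0 <= md z.
Proof. by rewrite mdE sqrtr_ge0. Qed.

Lemma mdM z w : md (z * w) = md z * md w.
Proof. exact: Normc.normcM. Qed.

Lemma mdV z : md z^-1 = (md z)^-1.
Proof. exact: Normc.normcV. Qed.

Lemma md0 : md 0 = 0. Proof. exact: Normc.normc0. Qed.
Lemma md1 : md 1 = 1. Proof. exact: Normc.normc1. Qed.

Lemma mdX z n : md (z ^+ n) = md z ^+ n.
Proof. by elim: n => [|n IH]; rewrite ?expr0 ?md1// !exprS mdM IH. Qed.

Lemma md_eq0 z : (md z == 0) = (z == 0).
Proof.
apply/eqP/eqP => [/Normc.eq0_normc //|->]; exact: md0.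
Qed.

Lemma md_gt0 z : (0 < md z) = (z != 0).
Proof. by rewrite lt_def md_ge0 andbT md_eq0. Qed.

Lemma mdN z : md (- z) = md z.
Proof. by case: z => a b; rewrite !mdE /= !sqrrN. Qed.

Lemma mdB z w : md (z - w) = md (w - z).
Proof. by rewrite -mdN opprB. Qed.

Lemma mdD z w : md (z + w) <= md z + md w.
Proof. by have := ler_normD z w; rewrite !normE -rmorphD lecR. Qed.

Lemma md_tri z w : md z - md w <= md (z - w).
Proof. by rewrite lerBlDr (le_trans _ (mdD _ _)) ?subrK. Qed.

Lemma md_sum (I : Type) (r : seq I) (P : pred I) (F : I -> C) :
  md (\sum_(i <- r | P i) F i) <= \sum_(i <- r | P i) md (F i).
Proof.
elim/big_rec2: _ => [|i y z _ h]; first by rewrite md0.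
by rewrite (le_trans (mdD _ _)) ?lerD2l.
Qed.

Lemma md_real t : md t%:C%C = `|t|.
Proof. by rewrite mdE /= expr0n addr0 sqrtr_sqr. Qed.

Lemma md_nat n : md n%:R = n%:R.
Proof. by rewrite -(rmorph_nat (real_complex R)) md_real ger0_norm. Qed.

Lemma md_Re z : `|complex.Re z| <= md z.
Proof. by rewrite mdE -sqrtr_sqr ler_sqrt ?addr_ge0 ?sqr_ge0 // lerDl sqr_ge0. Qed.

Lemma md_Im z : `|complex.Im z| <= md z.
Proof. by rewrite mdE -sqrtr_sqr ler_sqrt ?addr_ge0 ?sqr_ge0 // lerDr sqr_ge0. Qed.

Lemma cReD z w : complex.Re (z + w) = complex.Re z + complex.Re w.
Proof. by case: z; case: w. Qed.
Lemma cImD z w : complex.Im (z + w) = complex.Im z + complex.Im w.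
Proof. by case: z; case: w. Qed.
Lemma cReN z : complex.Re (- z) = - complex.Re z.
Proof. by case: z. Qed.
Lemma cImN z : complex.Im (- z) = - complex.Im z.
Proof. by case: z. Qed.
Lemma cReM z w : complex.Re (z * w) =
  complex.Re z * complex.Re w - complex.Im z * complex.Im w.
Proof. by case: z; case: w. Qed.
Lemma cImM z w : complex.Im (z * w) =
  complex.Re z * complex.Im w + complex.Im z * complex.Re w.
Proof. by case: z; case: w. Qed.
Lemma complex_ext z w : complex.Re z = complex.Re w ->
  complex.Im z = complex.Im w -> z = w.
Proof. by case: z => a b; case: w => c d /= -> ->. Qed.
Lemma Re_sum (I : Type) (r : seq I) (P : pred I) (F : I -> C) :
  complex.Re (\sum_(i <- r | P i) F i) = \sum_(i <- r | P i) complex.Re (F i).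
Proof. by elim/big_rec2: _ => // i y z _ <-; rewrite cReD. Qed.
Lemma Im_sum (I : Type) (r : seq I) (P : pred I) (F : I -> C) :
  complex.Im (\sum_(i <- r | P i) F i) = \sum_(i <- r | P i) complex.Im (F i).
Proof. by elim/big_rec2: _ => // i y z _ <-; rewrite cImD. Qed.
Lemma natC n : (n%:R : C) = (n%:R : R)%:C%C.
Proof. by rewrite rmorph_nat. Qed.
Lemma intC (n : int) : (n%:~R : C) = (n%:~R : R)%:C%C.
Proof. by rewrite rmorph_int. Qed.

Lemma md_le z : md z <= `|complex.Re z| + `|complex.Im z|.
Proof.
set a := complex.Re z; set b := complex.Im z.
rewrite mdE -[X in _ <= X]ger0_norm ?addr_ge0 // -(sqrtr_sqr (`|a| + `|b|)).
rewrite ler_sqrt ?sqr_ge0 // sqrrD !real_normK ?num_real //.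
have : 0 <= `|a| * `|b| by rewrite mulr_ge0.
by rewrite -/a -/b mulr2n; lra.
Qed.

(** A positive element of [C] is a positive real, so real tolerances suffice. *)
Lemma cvgCP (T : Type) (F : set_system T) {FF : Filter F} (f : T -> C) (l : C) :
  (f x @[x --> F] --> l)%classic <->
  (forall e, 0 < e -> \forall x \near F, md (f x - l) < e).
Proof.
split=> [/cvgrPdist_lt h e e0|h].
  have e0C : (0 : C) < e%:C%C by rewrite ltcR.
  by apply: filterS (h _ e0C) => x; rewrite mdB normE ltcR.
apply/cvgrPdist_lt => e; rewrite ltcE /= => /andP[/eqP e1 e2].
have -> : e = (complex.Re e)%:C%C by apply: complex_ext.
by apply: filterS (h _ e2) => x; rewrite normE ltcR mdB.
Qed.

Lemma cvgnC (u : nat -> C) (l : C) : (u n @[n --> \oo] --> l)%classic <->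
  (forall e, 0 < e -> exists N, forall n, (N <= n)%N -> md (u n - l) < e).
Proof.
rewrite cvgCP; split=> h e /h; first by case=> N _ hN; exists N => n /hN.
by case=> N hN; exists N.
Qed.

Lemma cvgC_uniq (T : Type) (F : set_system T) {FF : ProperFilter F}
    (f : T -> C) (l l' : C) :
  (f x @[x --> F] --> l)%classic -> (f x @[x --> F] --> l')%classic -> l = l'.
Proof. exact: (cvg_unique (@norm_hausdorff _ C)). Qed.

Lemma cvgC_ReIm (u : nat -> C) (a b : R) :
  (complex.Re (u n) @[n --> \oo] --> a)%classic ->
  (complex.Im (u n) @[n --> \oo] --> b)%classic ->
  (u n @[n --> \oo] --> ((a +i* b)%C : C))%classic.
Proof.
move=> /cvgrPdist_lt ha /cvgrPdist_lt hb; apply/cvgCP => e e0.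
have e20 : 0 < e / 2 by lra.
near=> n; apply: le_lt_trans (md_le _) _; rewrite (splitr e) ltrD //.
  by rewrite cReD cReN distrC; near: n; apply: ha.
by rewrite cImD cImN distrC; near: n; apply: hb.
Unshelve. all: by end_near. Qed.

Lemma cvgC_D (T : Type) (F : set_system T) {FF : Filter F} (f g : T -> C) (a b : C) :
  (f x @[x --> F] --> a)%classic -> (g x @[x --> F] --> b)%classic ->
  (f x + g x @[x --> F] --> a + b)%classic.
Proof. move=> h1 h2. exact: (@cvgD C C T F FF f g a b h1 h2). Qed.
Lemma cvgC_M (T : Type) (F : set_system T) {FF : Filter F} (f g : T -> C) (a b : C) :
  (f x @[x --> F] --> a)%classic -> (g x @[x --> F] --> b)%classic ->
  (f x * g x @[x --> F] --> a * b)%classic.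
Proof. move=> h1 h2. exact: (@cvgM C T F FF f g a b h1 h2). Qed.
Lemma cvgC_V (T : Type) (F : set_system T) {FF : Filter F} (f : T -> C) (a : C) :
  a != 0 -> (f x @[x --> F] --> a)%classic -> 
  ((f x)^-1 @[x --> F] --> a^-1)%classic.
Proof. move=> a0 h1. exact: (@cvgV C T F FF f a a0 h1). Qed.
Lemma cvgC_cst (T : Type) (F : set_system T) {FF : Filter F} (a : C) :
  ((fun=> a) x @[x --> F] --> a)%classic.
Proof. exact: cvg_cst. Qed.
Arguments cvgC_D {T F FF f g a b} _ _.
Arguments cvgC_M {T F FF f g a b} _ _.
Arguments cvgC_V {T F FF f a} _ _.
Arguments cvgC_cst {T F FF} a.

Lemma cvgC_Z (T : Type) (F : set_system T) {FF : Filter F} (k : C) (f : T -> C) (a : C) :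
  (f x @[x --> F] --> a)%classic -> (k * f x @[x --> F] --> k * a)%classic.
Proof. by move=> h; exact: (cvgC_M (f := fun=> k) (cvgC_cst k) h). Qed.

End ComplexModulus.

Arguments cvgC_D {R T F FF f g a b} _ _.
Arguments cvgC_M {R T F FF f g a b} _ _.
Arguments cvgC_V {R T F FF f a} _ _.
Arguments cvgC_cst {R T F FF} a.
Arguments cvgC_Z {R T F FF} k {f a} _.
Arguments cvgCP {R T F FF f l}.
Arguments cvgnC {R u l}.
Arguments cvgC_uniq {R T F FF f l l'} _ _.

Section Sums.
Variable R : realType.
Local Notation C := (CC R).
Implicit Types (u v : nat -> C) (b : nat -> R).

Definition csum u : C := limn (series u).
Definition rbd b (M : R) := (forall n, 0 <= b n) /\ (forall n, \sum_(i < n) b i <= M).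
Definition summable b := exists M, rbd b M.
Definition asum u := summable (fun n => md (u n)).

Lemma summable_le b b' : summable b' -> (forall n, 0 <= b n <= b' n) -> summable b.
Proof.
move=> [M [h0 h]] hb; exists M; split=> n; first by case/andP: (hb n).
by apply: le_trans (h n); apply: ler_sum => i _; case/andP: (hb i).
Qed.

Lemma summableZ b (k : R) : 0 <= k -> summable b -> summable (fun n => k * b n).
Proof.
move=> k0 [M [h0 h]]; exists (k * M); split=> n; first by rewrite mulr_ge0.
by rewrite -mulr_sumr ler_wpM2l.
Qed.

Lemma summableD b b' : summable b -> summable b' -> summable (fun n => b n + b' n).
Proof.
move=> [M [h0 h]] [M' [h0' h']]; exists (M + M'); split=> n; first by rewrite addr_ge0.
by rewrite big_split lerD.
Qed.

Lemma rbd_shift b M N : rbd b M -> rbd (fun n => b (N + n)%N) M.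
Proof.
move=> [h0 h]; split=> // n; apply: le_trans (h (N + n)%N).
by rewrite big_split_ord /= lerDr sumr_ge0.
Qed.

Lemma summable_unshift b N : (forall n, 0 <= b n) ->
  summable (fun n => b (N + n)%N) -> summable b.
Proof.
move=> h0 [M [_ h]]; exists (\sum_(i < N) b i + M); split=> // n.
apply: (@le_trans _ _ (\sum_(i < N + n) b i)).
  by rewrite addnC big_split_ord /= lerDl sumr_ge0.
rewrite big_split_ord /= lerD2l; exact: h.
Qed.

(** If no tail were bounded by e, then beyond every index there would be a block of sum larger than
    e, and enough such blocks would exceed the bound M. *)
Lemma summable_tail b : summable b ->
  forall e, 0 < e -> exists N, rbd (fun n => b (N + n)%N) e.
Proof.
move=> [M [h0 h]] e e0; apply: contrapT => hN.
have step k : exists n, k%:R * e <= \sum_(i < n) b i.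
  elim: k => [|k [n hk]]; first by exists 0%N; rewrite mul0r big_ord0.
  have : exists m, e < \sum_(i < m) b (n + i)%N.
    apply: contrapT => hm; apply: hN; exists n; split=> // m.
    by rewrite leNgt; apply/negP => hm'; apply: hm; exists m.
  case=> m hm; exists (n + m)%N; rewrite big_split_ord /= -natr1 mulrDl mul1r.
  by rewrite lerD // ltW.
pose k := (Num.bound `|M / e|).+1.
have [n hn] := step k.
have := le_trans hn (h n); rewrite leNgt => /negP; apply.
rewrite -ltr_pdivrMr //.
apply: le_lt_trans (ler_norm _) _.
apply: lt_le_trans (archi_boundP (normr_ge0 _)) _.
by rewrite ler_nat.
Qed.

Lemma asum_cvg u : asum u -> (series u n @[n --> \oo] --> csum u)%classic.
Proof.
move=> [M [h0 h]].
have key (f : C -> R) : (forall z, `|f z| <= md z) -> cvgn (series (f \o u)).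
  move=> hf; apply: normed_cvg; apply: nondecreasing_is_cvgn.
    have -> : [normed series (f \o u)] = series (fun k => `|f (u k)|) by [].
    by apply: nondecreasing_series.
  exists M => _ [n _ <-].
  have -> : [normed series (f \o u)] = series (fun k => `|f (u k)|) by [].
  rewrite /series /= big_mkord.
  by apply: le_trans (h n); apply: ler_sum => i _; apply: hf.
have hr := key _ (@md_Re R); have hi := key _ (@md_Im R).
have : (series u n @[n --> \oo] --> ((limn (series (@complex.Re R \o u))
   +i* limn (series (@complex.Im R \o u)))%C : C))%classic.
  apply: cvgC_ReIm.
    have -> : (fun n => complex.Re (series u n)) = series (@complex.Re R \o u).
      by apply/funext => n; rewrite /series /= Re_sum.
    exact: hr.
  have -> : (fun n => complex.Im (series u n)) = series (@complex.Im R \o u).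
    by apply/funext => n; rewrite /series /= Im_sum.
  exact: hi.
by move=> hc; apply/cvg_ex; eexists; exact: hc.
Qed.

Lemma csum_uniq u l : (series u n @[n --> \oo] --> l)%classic -> csum u = l.
Proof. by move/cvg_lim; apply; exact: norm_hausdorff. Qed.

Lemma asumP u : asum u -> forall e, 0 < e -> exists N, forall n, (N <= n)%N ->
  md (\sum_(i < n) u i - csum u) < e.
Proof.
move=> /asum_cvg /cvgnC h e /h [N hN]; exists N => n /hN.
by rewrite /series /= big_mkord.
Qed.

Lemma csum_md u M : rbd (fun n => md (u n)) M -> md (csum u) <= M.
Proof.
move=> hu; have /asumP h : asum u by exists M.
rewrite leNgt; apply/negP => hM.
have [N /(_ N (leqnn _))] := h (md (csum u) - M) ltac:(by rewrite subr_gt0).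
apply/negP; rewrite -leNgt mdB; apply: le_trans (md_tri _ _).
rewrite lerD2l lerN2; apply: le_trans (md_sum _ _ _) _.
by case: hu => _; apply.
Qed.

Lemma asum_le u b : summable b -> (forall n, md (u n) <= b n) -> asum u.
Proof. by move=> h hu; apply: summable_le h _ => n; rewrite md_ge0 hu. Qed.

Lemma asumD u v : asum u -> asum v -> asum (fun n => u n + v n).
Proof. by move=> hu hv; apply: asum_le (summableD hu hv) _ => n; exact: mdD. Qed.

Lemma asumZ (k : C) u : asum u -> asum (fun n => k * u n).
Proof.
move=> hu; apply: asum_le (summableZ (md_ge0 k) hu) _ => n; by rewrite mdM.
Qed.

Lemma asum_shift u N : asum u -> asum (fun n => u (N + n)%N).
Proof. by move=> [M hM]; exists M; apply: rbd_shift hM. Qed.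

Lemma csumD u v : asum u -> asum v -> csum (fun n => u n + v n) = csum u + csum v.
Proof.
move=> /asum_cvg hu /asum_cvg hv; apply: csum_uniq.
have -> : series (fun n => u n + v n) = fun n => series u n + series v n.
  by apply/funext => n; rewrite /series /= big_split.
exact: (cvgC_D hu hv).
Qed.

Lemma csumZ (k : C) u : asum u -> csum (fun n => k * u n) = k * csum u.
Proof.
move=> /asum_cvg hu; apply: csum_uniq.
have -> : series (fun n => k * u n) = fun n => k * series u n.
  by apply/funext => n; rewrite /series /= mulr_sumr.
exact: (cvgC_Z k hu).
Qed.

Lemma eq_csum u v : u =1 v -> csum u = csum v.
Proof. by move=> /funext ->. Qed.

Lemma csum_finite u N : (forall n, (N <= n)%N -> u n = 0) -> csum u = \sum_(i < N) u i.
Proof.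
move=> h; apply: csum_uniq; apply/cvgnC => e e0; exists N => n hn.
rewrite /series /= big_mkord -(subnKC hn) big_split_ord /=.
rewrite [X in _ + X - _]big1 ?addr0 ?subrr ?md0 // => i _.
by rewrite h // leq_addr.
Qed.

Lemma csum_split u N : asum u ->
  csum u = \sum_(i < N) u i + csum (fun n => u (N + n)%N).
Proof.
move=> hu; apply: csum_uniq; apply/cvgnC => e e0.
have [K hK] := asumP (asum_shift N hu) e0.
exists (N + K)%N => n hn; rewrite /series /= big_mkord.
have hN : (N <= n)%N by apply: leq_trans hn; rewrite leq_addr.
rewrite -(subnKC hN) big_split_ord /= opprD addrACA subrr add0r.
by apply: hK; rewrite leq_subRL.
Qed.

Lemma csum_recl u : asum u -> csum u = u 0%N + csum (fun n => u n.+1).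
Proof. by move=> /csum_split -/(_ 1%N) ->; rewrite big_ord1. Qed.

Lemma cvgC_sum (T : Type) (F : set_system T) {FF : Filter F} N
    (t : T -> nat -> C) (l : nat -> C) :
  (forall n, (t x n @[x --> F] --> l n)%classic) ->
  (\sum_(i < N) t x i @[x --> F] --> \sum_(i < N) l i)%classic.
Proof.
move=> h; elim: N => [|N IH].
  rewrite big_ord0; under eq_fun do rewrite big_ord0; exact: (cvgC_cst 0).
rewrite big_ord_recr /=; under eq_fun do rewrite big_ord_recr /=.
exact: (cvgC_D IH (h N)).
Qed.

Lemma cvgC_md_le (T : Type) (F : set_system T) {FF : ProperFilter F}
    (t : T -> C) (l : C) (M : R) :
  (\forall x \near F, md (t x) <= M) ->
  (t x @[x --> F] --> l)%classic -> md l <= M.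
Proof.
move=> hM /cvgCP h; rewrite leNgt; apply/negP => hl.
have e0 : 0 < md l - M by rewrite subr_gt0.
have [x [h1 h2]] := filter_ex (filterI hM (h _ e0)).
have := md_tri l (t x); rewrite mdB => h3.
by have := le_lt_trans h3 h2; rewrite ltrD2l ltrN2 ltNge h1.
Qed.

(** Dominated convergence for series: the head converges termwise and the tails are small uniformly
    because of [b]. Cauchy products, termwise derivatives, partial fractions, double series and
    Fourier averages all rest on it. *)
Theorem tannery (T : Type) (F : set_system T) {FF : ProperFilter F}
    (t : T -> nat -> C) (l : nat -> C) b :
  summable b -> (\forall x \near F, forall n, md (t x n) <= b n) ->
  (forall n, (t x n @[x --> F] --> l n)%classic) ->
  asum l /\ (csum (t x) @[x --> F] --> csum l)%classic.
Proof.
move=> hb ht hl.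
have lb n : md (l n) <= b n.
  by apply: cvgC_md_le (hl n) => //; apply: filterS ht => x; apply.
have al : asum l by apply: asum_le hb lb.
split=> //; apply/cvgCP => e e0.
have e3 : 0 < e / 4 by lra.
have [N hN] := summable_tail hb e3.
have FF' : Filter F by typeclasses eauto.
have hs := (@cvgCP R T F FF' _ _).1 (@cvgC_sum T F FF' N t l hl) _ e3.
near=> x.
have tx : forall n, md (t x n) <= b n by near: x.
have atx : asum (t x) by apply: asum_le hb tx.
have h1 : md (csum (fun n => t x (N + n)%N)) <= e / 4.
  apply: csum_md; split=> [n|n]; first exact: md_ge0.
  by apply: le_trans (hN.2 n); apply: ler_sum => i _.
have h2 : md (csum (fun n => l (N + n)%N)) <= e / 4.
  apply: csum_md; split=> [n|n]; first exact: md_ge0.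
  by apply: le_trans (hN.2 n); apply: ler_sum => i _.
have h3 : md (\sum_(i < N) t x i - \sum_(i < N) l i) < e / 4 by near: x.
rewrite (csum_split N atx) (csum_split N al) opprD addrACA.
apply: le_lt_trans (mdD _ _) _; apply: le_lt_trans (lerD (lexx _) (mdD _ _)) _.
rewrite mdN; lra.
Unshelve. all: by end_near. Qed.

Lemma summable_geo (x : R) : 0 <= x < 1 -> summable (fun n => x ^+ n).
Proof.
move=> /andP[x0 x1]; exists (1 - x)^-1; split=> n; first by rewrite exprn_ge0.
rewrite -[X in _ <= X]mul1r ler_pdivlMr ?subr_gt0 //.
have -> : (\sum_(i < n) x ^+ i) * (1 - x) = 1 - x ^+ n.
  rewrite mulrC -[X in _ = X - _](expr1n _ n) subrXX; congr (_ * _).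
  by apply: eq_bigr => i _; rewrite expr1n mul1r.
by rewrite lerBlDr lerDl exprn_ge0.
Qed.

Lemma summable_inv2 : summable (fun n => (n.+1%:R ^+ 2)^-1 : R).
Proof.
exists 2; split=> n; first by rewrite invr_ge0 sqr_ge0.
(* The sharper bound is inductive, since 1 / (m + 1)^2 <= 1 / m - 1 / (m + 1). *)
suff : \sum_(i < n.+1) (i.+1%:R ^+ 2)^-1 <= (2 - n.+1%:R^-1 : R).
  move=> h; apply: (@le_trans _ _ (\sum_(i < n.+1) (i.+1%:R ^+ 2)^-1)).
    by rewrite big_ord_recr /= lerDl invr_ge0 sqr_ge0.
  by apply: le_trans h _; rewrite lerBlDr lerDl invr_ge0.
elim: n => [|n IH]; first by rewrite big_ord1 /= expr1n invr1; lra.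
rewrite big_ord_recr /=; apply: le_trans (lerD IH (lexx _)) _.
set m : R := n.+1%:R; have -> : n.+2%:R = m + 1 :> R by rewrite -natr1.
have m0 : 0 < m by rewrite ltr0n.
rewrite -subr_ge0.
have -> : 2 - (m + 1)^-1 - (2 - m^-1 + ((m + 1) ^+ 2)^-1) = (m * (m + 1) ^+ 2)^-1.
  by field; rewrite !gt_eqF //; lra.
by rewrite invr_ge0 mulr_ge0 ?sqr_ge0 // ltW.
Qed.

End Sums.

Arguments tannery {R T F FF t l b} _ _ _.
Arguments csum_uniq {R u l} _.

(** * The complex exponential and its periods *)

Section ComplexExp.
Variable R : realType.
Local Notation C := (CC R).
Local Notation cexp := (@cexp R).
Local Notation twopii := (@twopii R).
Implicit Types (z w s tau : C).

Lemma cexpD z w : cexp (z + w) = cexp z * cexp w.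
Proof.
rewrite /cexp cReD cImD expRD cosD sinD.
apply: complex_ext; rewrite ?cReM ?cImM /=; ring.
Qed.

Lemma cexp0 : cexp 0 = 1.
Proof. by rewrite /cexp expR0 cos0 sin0 mulr1 mulr0. Qed.

Lemma md_cexp z : md (cexp z) = expR (complex.Re z).
Proof.
rewrite mdE /= !exprMn -mulrDr cos2Dsin2 mulr1 sqrtr_sqr ger0_norm //.
Qed.

Lemma cexp_neq0 z : cexp z != 0.
Proof. by rewrite -md_gt0 md_cexp expR_gt0. Qed.

Lemma cexpN z : cexp (- z) = (cexp z)^-1.
Proof.
apply: (mulfI (cexp_neq0 z)).
by rewrite -cexpD subrr cexp0 divff ?cexp_neq0.
Qed.

Lemma cexpMn z n : cexp (z * n%:R) = cexp z ^+ n.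
Proof.
elim: n => [|n IH]; first by rewrite mulr0 cexp0.
by rewrite -natr1 mulrDr mulr1 cexpD IH exprSr.
Qed.

Lemma twopii_neq0 : twopii != 0.
Proof.
rewrite /twopii eq_complex /= eqxx /= mulf_neq0 ?pnatr_eq0 //.
by rewrite gt_eqF // pi_gt0.
Qed.

Lemma cexp_twopii : cexp twopii = 1.
Proof.
rewrite /cexp /= expR0 !mul1r.
by rewrite mulrC -[2]/(2%:R) mulr_natr cos2pi sin2pi.
Qed.

Lemma cexp_int (n : int) : cexp (twopii * n%:~R) = 1.
Proof.
case: n => n; first by rewrite cexpMn cexp_twopii expr1n.
by rewrite NegzE rmorphN mulrN cexpN cexpMn cexp_twopii expr1n invr1.
Qed.

(* The angle is brought into [0, 2 pi) with the floor, where cos is injective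
   on each half. *)
Lemma cexp_eq1 z : cexp (twopii * z) = 1 -> exists n : int, z = n%:~R.
Proof.
move=> h; have hm : md (cexp (twopii * z)) = 1 by rewrite h md1.
have imz : complex.Im z = 0.
  move: hm; rewrite md_cexp cReM /= mul0r sub0r -[X in _ = X]expR0 => /expR_inj /eqP.
  rewrite oppr_eq0 mulf_eq0 mulf_eq0 pnatr_eq0 /= (gt_eqF (pi_gt0 _)) /=.
  by move/eqP.
pose n := Num.floor (complex.Re z); exists n.
pose w : C := z - n%:~R.
have hw : cexp (twopii * w) = 1.
  by rewrite mulrBr cexpD cexpN h cexp_int invr1 mulr1.
suff w0 : complex.Re w = 0.
  apply/eqP; rewrite -subr_eq0; apply/eqP/complex_ext => //.
  by rewrite cImD cImN imz intC /= oppr0 addr0.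
have rw : complex.Re w = complex.Re z - n%:~R by rewrite cReD cReN intC.
have iw : complex.Im w = 0 by rewrite cImD cImN imz intC /= oppr0 addr0.
have w1 : 0 <= complex.Re w by rewrite rw subr_ge0 floor_le.
have w2 : complex.Re w < 1.
  by rewrite rw ltrBlDl; have := floorD1_gt (complex.Re z); rewrite rmorphD.
have : cos (2 * pi * complex.Re w) = 1.
  move/(congr1 (@complex.Re R)): hw; rewrite /cexp /= cReM cImM /= iw.
  by rewrite !mul0r mulr0 subr0 expR0 mul1r add0r.
move: (complex.Re w) w1 w2 => x x0 x1 hx.
have pi0 := pi_gt0 R.
have [xh|xh] := leP x 2^-1.
  have : 2 * pi * x = 0.
    apply: (@cos_inj R); rewrite ?cos0 // in_itv /=; apply/andP; split; nra.
  by move/eqP; rewrite !mulf_eq0 pnatr_eq0 /= (gt_eqF pi0) => /eqP.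
have : 2 * pi * (1 - x) = 0.
  apply: (@cos_inj R); rewrite ?cos0 ?in_itv /=; try by apply/andP; split; nra.
  have -> : 2 * pi * (1 - x) = - (2 * pi * x) + pi *+ 2 by rewrite mulr2n; ring.
  by rewrite cosD2pi cosN.
move/eqP; rewrite !mulf_eq0 pnatr_eq0 /= (gt_eqF pi0) /= => /eqP; lra.
Qed.

Lemma cexp_eq (z w : C) : cexp (twopii * z) = cexp (twopii * w) ->
  exists n : int, z = w + n%:~R.
Proof.
move=> h; have [|n hn] := @cexp_eq1 (z - w).
  by rewrite mulrBr cexpD cexpN h divff // cexp_neq0.
by exists n; rewrite -hn addrC subrK.
Qed.

End ComplexExp.

(** * Power series on the unit disc and q-series *)

Section DiscSeries.
Variable R : realType.
Local Notation C := (CC R).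
Implicit Types (A B : nat -> C) (z : C) (t : R).

(** Coefficient sequences with radius of convergence at least 1. On the series themselves [pm] is
    the product, [theta mu] is q d/dq applied after multiplication by q^mu, [zshift j] is
    multiplication by z^j and [dil] is the substitution of z^2. *)
Definition disc A := forall t, 0 <= t < 1 -> summable (fun n => md (A n) * t ^+ n).
Definition ev A z := csum (fun n => A n * z ^+ n).
Definition pm A B n := \sum_(i < n.+1) A i * B (n - i)%N.
Definition theta (mu : C) A n := (mu + n%:R) * A n.
Definition zshift j A n : C := if (n < j)%N then 0 else A (n - j)%N.
Definition dil A n : C := if odd n then 0 else A n./2.
Definition cst0 (c : C) n : C := if n is 0 then c else 0.

(** Bounded terms at a radius s between t and 1 dominate the terms at t by a geometric series of
    ratio t / s. Recursions and subsequences give bounds more readily than sums. *)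
Lemma disc_bd A : (forall t, 0 <= t < 1 -> exists M, forall n, md (A n) * t ^+ n <= M) ->
  disc A.
Proof.
move=> h t /andP[t0 t1].
pose s := (1 + t) / 2; have s1 : 0 <= s < 1 by rewrite /s; apply/andP; split; lra.
have s0 : 0 < s by rewrite /s; lra.
have [M hM] := h _ s1.
have ts : 0 <= t / s < 1.
  rewrite divr_ge0 ?(ltW s0) //= ltr_pdivrMr // mul1r /s; lra.
have M0 : 0 <= M by apply: le_trans (hM 0%N); rewrite mulr_ge0 ?md_ge0 ?exprn_ge0 // ltW.
apply: summable_le (summableZ M0 (summable_geo ts)) _ => n.
rewrite mulr_ge0 ?md_ge0 ?exprn_ge0 //=.
have -> : md (A n) * t ^+ n = (md (A n) * s ^+ n) * (t / s) ^+ n.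
  by rewrite -mulrA -exprMn mulrCA divff ?mulr1 // gt_eqF.
by rewrite ler_wpM2r ?exprn_ge0 //; case/andP: ts.
Qed.

Lemma summable_bounded (b : nat -> R) : summable b -> exists M, forall n, b n <= M.
Proof.
move=> [M [h0 h]]; exists M => n; apply: le_trans (h n.+1).
by rewrite big_ord_recr /= lerDr sumr_ge0.
Qed.

Lemma disc_le A B : disc B -> (forall n, md (A n) <= md (B n)) -> disc A.
Proof.
move=> hB h t ht; apply: summable_le (hB t ht) _ => n; case/andP: ht => t0 _.
by rewrite mulr_ge0 ?md_ge0 ?exprn_ge0 //= ler_wpM2r ?exprn_ge0.
Qed.

Lemma discD A B : disc A -> disc B -> disc (fun n => A n + B n).
Proof.
move=> hA hB t ht; apply: summable_le (summableD (hA t ht) (hB t ht)) _ => n.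
case/andP: ht => t0 _.
by rewrite mulr_ge0 ?md_ge0 ?exprn_ge0 //= -mulrDl ler_wpM2r ?exprn_ge0 // mdD.
Qed.

Lemma discZ k A : disc A -> disc (fun n => k * A n).
Proof.
move=> hA t ht; apply: summable_le (summableZ (md_ge0 k) (hA t ht)) _ => n.
by case/andP: ht => t0 _; rewrite mdM !mulr_ge0 ?md_ge0 ?exprn_ge0 //= mulrA.
Qed.

Lemma eq_disc A B : A =1 B -> disc A -> disc B.
Proof. by move=> /funext ->. Qed.

Lemma disc_asum A z : disc A -> md z < 1 -> asum (fun n => A n * z ^+ n).
Proof.
move=> hA hz; have ht : 0 <= md z < 1 by rewrite md_ge0.
by apply: asum_le (hA _ ht) _ => n; rewrite mdM mdX.
Qed.

Lemma evD A B z : disc A -> disc B -> md z < 1 ->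
  ev (fun n => A n + B n) z = ev A z + ev B z.
Proof.
move=> hA hB hz; rewrite /ev -csumD; try exact: disc_asum.
by apply: eq_csum => n; rewrite mulrDl.
Qed.

Lemma evZ k A z : disc A -> md z < 1 -> ev (fun n => k * A n) z = k * ev A z.
Proof.
move=> hA hz; rewrite /ev -csumZ; try exact: disc_asum.
by apply: eq_csum => n; rewrite mulrA.
Qed.

Lemma ev_cst0 c z : ev (cst0 c) z = c.
Proof.
rewrite /ev (@csum_finite R _ 1); first by rewrite big_ord1 /= mulr1.
by case=> // n _; rewrite /= mul0r.
Qed.

Lemma disc_cst0 c : disc (cst0 c).
Proof.
move=> t /andP[t0 _]; exists (md c); split=> [n|n].
  by rewrite mulr_ge0 ?md_ge0 ?exprn_ge0.
case: n => [|n]; first by rewrite big_ord0 md_ge0.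
rewrite big_ord_recl expr0 mulr1 big1 ?addr0 // => i _.
by rewrite [cst0 c _]/(0 : C) md0 mul0r.
Qed.

Lemma sum_triangle (f : nat -> nat -> C) N :
  \sum_(n < N) \sum_(i < n.+1) f i (n - i)%N = \sum_(i < N) \sum_(j < N - i) f i j.
Proof.
elim: N => [|N IH]; first by rewrite !big_ord0.
rewrite big_ord_recr /= IH [RHS]big_ord_recr /= subSnn big_ord1.
rewrite [in X in _ + X]big_ord_recr /= subnn addrA; congr (_ + _).
rewrite -big_split /=; apply: eq_bigr => i _.
by rewrite subSn ?(ltnW (ltn_ord i)) // big_ord_recr.
Qed.

Lemma pm_abs A B t : 0 <= t -> summable (fun n => md (A n) * t ^+ n) ->
  summable (fun n => md (B n) * t ^+ n) -> summable (fun n => md (pm A B n) * t ^+ n).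
Proof.
move=> t0 [M [h0 h]] [M' [h0' h']]; exists (M * M'); split=> n.
  by rewrite mulr_ge0 ?md_ge0 ?exprn_ge0.
have M0 : 0 <= M by apply: le_trans (h 0%N); rewrite big_ord0.
pose a i : R := md (A i) * t ^+ i; pose b i : R := md (B i) * t ^+ i.
apply: (@le_trans _ _ ((\sum_(i < n) a i) * (\sum_(i < n) b i))).
  rewrite mulr_suml.
  apply: (@le_trans _ _ (\sum_(k < n) \sum_(i < k.+1) a i * b (k - i)%N)).
    apply: ler_sum => k _; apply: le_trans (ler_wpM2r (exprn_ge0 _ t0) (md_sum _ _ _)) _.
    rewrite mulr_suml; apply: ler_sum => i _.
    rewrite /a /b mdM mulrACA -exprD subnKC // -ltnS; exact: ltn_ord.
  have := @sum_triangle (fun i j => (a i * b j)%:C%C) n.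
  have e (m : nat) (g : 'I_m -> R) : (\sum_(i < m) ((g i)%:C%C : C)) = (\sum_(i < m) g i)%:C%C
    by rewrite rmorph_sum.
  under eq_bigr do rewrite e; under [X in _ = X -> _]eq_bigr do rewrite e.
  rewrite !e => /complexI ->; apply: ler_sum => i _.
  rewrite mulr_sumr; have e2 := subnK (ltnW (ltn_ord i)).
  rewrite -(big_mkord xpredT (fun j => a i * b j)) -[X in _ <= X](big_mkord xpredT (fun j => a i * b j)).
  rewrite [X in _ <= X](big_cat_nat (leq0n _) (leq_subr i n)) /= lerDl sumr_ge0 // => j _.
  by rewrite mulr_ge0 // /a /b mulr_ge0 ?md_ge0 ?exprn_ge0.
by apply: ler_pM; rewrite ?sumr_ge0 // => i _; rewrite /a /b mulr_ge0 ?md_ge0 ?exprn_ge0.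
Qed.

Lemma discM A B : disc A -> disc B -> disc (pm A B).
Proof. by move=> hA hB t ht; case/andP: (ht) => t0 _; apply: pm_abs (hA t ht) (hB t ht). Qed.

(* Mertens' theorem: the partial sums of the Cauchy product are
   sum_i A_i S_(N-i), where S_m are the partial sums of B. *)
Lemma evM A B z : disc A -> disc B -> md z < 1 -> ev (pm A B) z = ev A z * ev B z.
Proof.
move=> hA hB hz.
pose a i := A i * z ^+ i; pose b i := B i * z ^+ i.
have ha : asum a by exact: disc_asum.
have hb : asum b by exact: disc_asum.
apply: csum_uniq.
pose t N i := if (i < N)%N then a i * \sum_(j < N - i) b j else 0.
have -> : series (fun n => pm A B n * z ^+ n) = fun N => csum (t N).
  apply/funext => N; rewrite /series /= big_mkord (@csum_finite R _ N); last first.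
    by move=> n hn; rewrite /t ltnNge hn.
  transitivity (\sum_(n < N) \sum_(i < n.+1) a i * b (n - i)%N).
    apply: eq_bigr => n _; rewrite mulr_suml; apply: eq_bigr => i _.
    rewrite /a /b mulrACA -exprD subnKC // -ltnS; exact: ltn_ord.
  rewrite (sum_triangle (fun i j => a i * b j)); apply: eq_bigr => i _.
  by rewrite /t ltn_ord mulr_sumr.
have [M [h0 h]] := hb.
have M0 : 0 <= M by apply: le_trans (h 0%N); rewrite big_ord0.
have [| |_] := @tannery R nat \oo%classic _ t (fun i => a i * csum b) _ (summableZ M0 ha).
- apply: nearW => N n; rewrite /t; case: ifP => _; last by rewrite md0 mulr_ge0 ?md_ge0.
  rewrite mdM mulrC ler_wpM2r ?md_ge0 //.
  by apply: le_trans (h (N - n)%N); apply: md_sum.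
- move=> n; apply/cvgnC => e e0.
  have e1 : 0 < e / (md (a n) + 1) by rewrite divr_gt0 // ltr_wpDl ?md_ge0.
  have [K hK] := asumP hb e1.
  exists (n + K.+1)%N => N hN.
  have nN : (n < N)%N by lia.
  rewrite /t nN -mulrBr mdM.
  have := hK (N - n)%N ltac:(lia); rewrite ltr_pdivlMr ?ltr_wpDl ?md_ge0 // mulrC.
  apply: le_lt_trans; rewrite ler_wpM2r ?md_ge0 // lerDl //.
have -> : csum (fun i => a i * csum b) = ev A z * ev B z.
  by rewrite (eq_csum (v := fun i => csum b * a i)) ?csumZ 1?mulrC // => i; rewrite mulrC.
by [].
Qed.

Lemma disc_one : disc (fun=> 1).
Proof. by move=> t /summable_geo h; rewrite md1; under eq_fun do rewrite mul1r. Qed.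

(** Each of the n powers t^i with i < n is at least t^n, and their sum is at most 1 / (1 - t). *)
Lemma expn_linear_bd t : 0 <= t < 1 -> exists M, forall n, n%:R * t ^+ n <= M.
Proof.
move=> /andP[t0 t1]; exists (1 - t)^-1 => n.
rewrite -[X in _ <= X]mul1r ler_pdivlMr ?subr_gt0 //.
apply: (@le_trans _ _ (1 - t ^+ n)); last by rewrite lerBlDr lerDl exprn_ge0.
have -> : 1 - t ^+ n = (1 - t) * \sum_(i < n) 1 ^+ (n.-1 - i) * t ^+ i by rewrite -subrXX expr1n.
rewrite mulrC ler_wpM2l ?subr_ge0 ?(ltW t1) //.
rewrite -[X in X%:R * _](card_ord n) -sum1_card natr_sum mulr_suml.
apply: ler_sum => i _; rewrite mul1r expr1n mul1r.
by apply: ler_wiXn2l => //; first [exact: ltW | exact: ltnW].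
Qed.

Lemma disc_theta0 A : disc A -> disc (fun n => n%:R * A n).
Proof.
move=> hA; apply: disc_bd => t /andP[t0 t1].
pose s := (1 + t) / 2.
have s0 : 0 < s by rewrite /s; lra.
have s1 : 0 <= s < 1 by rewrite /s; apply/andP; split; lra.
have ts : 0 <= t / s < 1 by rewrite divr_ge0 ?(ltW s0) //= ltr_pdivrMr // mul1r /s; lra.
have [M hM] := summable_bounded (hA _ s1); have [K hK] := expn_linear_bd ts.
have M0 : 0 <= M by apply: le_trans (hM 0%N); rewrite mulr_ge0 ?md_ge0 ?exprn_ge0 // ltW.
exists (M * K) => n; rewrite mdM md_nat.
have -> : n%:R * md (A n) * t ^+ n = (md (A n) * s ^+ n) * (n%:R * (t / s) ^+ n).
  rewrite (expr_div_n t s); have : s ^+ n != 0 by rewrite expf_neq0 // gt_eqF.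
  by move: (s ^+ n) (t ^+ n) (md _) => x y w x0; field.
apply: ler_pM => //; rewrite mulr_ge0 ?md_ge0 ?exprn_ge0 //; first exact: ltW.
by case/andP: ts.
Qed.

Lemma disc_theta mu A : disc A -> disc (theta mu A).
Proof.
move=> hA; apply: eq_disc (discD (discZ mu hA) (disc_theta0 hA)) => n.
by rewrite /theta mulrDl.
Qed.

Lemma ev_zshift j A z : disc A -> md z < 1 -> ev (zshift j A) z = z ^+ j * ev A z.
Proof.
move=> hA hz; rewrite /ev -csumZ; last exact: disc_asum.
have e : (fun n => zshift j A (j + n) * z ^+ (j + n)) =
    (fun n => z ^+ j * (A n * z ^+ n)).
  apply/funext => n; rewrite /zshift ltnNge leq_addr /= addKn exprD; ring.
rewrite (@csum_split R _ j).
  rewrite e big1 ?add0r // => i _; by rewrite /zshift ltn_ord mul0r.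
have := asumZ (z ^+ j) (disc_asum hA hz); rewrite -e.
by apply: summable_unshift => n; exact: md_ge0.
Qed.

Lemma disc_zshift j A : disc A -> disc (zshift j A).
Proof.
move=> hA t ht; case/andP: (ht) => t0 t1.
apply: (@summable_unshift _ _ j) => [n|]; first by rewrite mulr_ge0 ?md_ge0 ?exprn_ge0.
apply: summable_le (summableZ (exprn_ge0 j t0) (hA t ht)) _ => n.
rewrite mulr_ge0 ?md_ge0 ?exprn_ge0 //= /zshift ltnNge leq_addr /= addKn exprD.
by rewrite mulrCA lexx.
Qed.

Lemma disc_tail A : disc A -> disc (fun n => A n.+1).
Proof.
move=> hA; apply: disc_bd => t /andP[t0 t1].
pose s := (1 + t) / 2.
have s0 : 0 < s by rewrite /s; lra.
have s1 : 0 <= s < 1 by rewrite /s; apply/andP; split; lra.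
have [M hM] := summable_bounded (hA _ s1).
exists (M / s) => n; rewrite ler_pdivlMr //; apply: le_trans (hM n.+1).
rewrite exprSr mulrA ler_wpM2r ?(ltW s0) // ler_wpM2l ?md_ge0 //.
by apply: lerXn2r; rewrite ?nnegrE // ?(ltW s0) // /s; lra.
Qed.

Lemma ev_tail A z : disc A -> md z < 1 -> ev A z = A 0%N + z * ev (fun n => A n.+1) z.
Proof.
move=> hA hz; rewrite {1}/ev csum_recl; last exact: disc_asum.
rewrite expr0 mulr1 /ev -csumZ; last exact: disc_asum (disc_tail hA) hz.
by congr (_ + _); apply: eq_csum => n; rewrite exprS; ring.
Qed.

Lemma ev_bound A (t : R) : 0 <= t < 1 -> disc A -> exists M, forall z, md z <= t -> md (ev A z) <= M.
Proof.
move=> ht hA; have [M [h0 h]] := hA t ht; exists M => z hz.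
apply: csum_md; split=> n; first exact: md_ge0.
apply: le_trans (h n); apply: ler_sum => i _.
rewrite mdM mdX ler_wpM2l ?md_ge0 //; apply: lerXn2r; rewrite ?nnegrE ?md_ge0 //.
by case/andP: ht.
Qed.

Lemma ev_eq0_0 A : disc A -> (forall t : R, 0 < t < 1 -> ev A t%:C%C = 0) -> A 0%N = 0.
Proof.
move=> hA h; apply/eqP; rewrite -md_eq0 eq_le md_ge0 andbT leNgt; apply/negP => a0.
have h2 : 0 <= (2^-1 : R) < 1 by apply/andP; split; lra.
have [M hM] := ev_bound h2 (disc_tail hA).
have M0 : 0 <= M by apply: le_trans (hM 0 _); rewrite ?md_ge0 // md0; lra.
(* At a point this small the tail has at most half the modulus of [A 0] and cannot cancel it. *)
pose t := Num.min 2^-1 (md (A 0%N) / (M + 1) / 2).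
have t0 : 0 < t by rewrite lt_min; apply/andP; split; [lra|rewrite !divr_gt0 //; lra].
have t1 : t <= 2^-1 by rewrite ge_min lexx.
have t2 : t * (M + 1) <= md (A 0%N) / 2.
  rewrite -ler_pdivlMr; last by lra.
  by rewrite mulrAC ge_min lexx orbT.
have ht : 0 < t < 1 by apply/andP; split => //; lra.
have mt : md (t%:C%C : C) = t by rewrite md_real gtr0_norm.
have := h t ht; rewrite ev_tail ?mt //; last by lra.
move/eqP; rewrite addr_eq0 => /eqP/(congr1 (@md R)); rewrite mdN mdM mt => e.
have := hM (t%:C%C) ltac:(by rewrite mt); set y := md (ev _ _) in e *.
move=> hy; have : t * y <= t * M by rewrite ler_wpM2l // ltW.
rewrite -e; nra.
Qed.

Lemma ev_eq0 A : disc A -> (forall t : R, 0 < t < 1 -> ev A t%:C%C = 0) -> forall n, A n = 0.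
Proof.
move=> hA h n; elim: n A hA h => [|n IH] A hA h; first exact: ev_eq0_0.
apply: (IH (fun n => A n.+1)) => [|t ht]; first exact: disc_tail.
have := h t ht; case/andP: (ht) => t0 t1.
have mt : md (t%:C%C : C) < 1 by rewrite md_real gtr0_norm.
rewrite ev_tail // (ev_eq0_0 hA h) add0r => /eqP; rewrite mulf_eq0 => /orP[|/eqP //].
by move/eqP/complexI => t00; rewrite t00 ltxx in t0.
Qed.

Lemma ev_inj A B : disc A -> disc B -> (forall t : R, 0 < t < 1 -> ev A t%:C%C = ev B t%:C%C) ->
  A = B.
Proof.
move=> hA hB h; apply/funext => n; apply/eqP; rewrite -subr_eq0; apply/eqP.
have hN : disc (fun n => -1 * B n) by exact: discZ.
have := @ev_eq0 (fun n => A n + -1 * B n) (discD hA hN).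
move=> /(_ _ n); rewrite mulN1r; apply => t ht; case/andP: (ht) => t0 t1.
have mt : md (t%:C%C : C) < 1 by rewrite md_real gtr0_norm.
by rewrite evD // evZ // h // mulN1r subrr.
Qed.

Lemma disc_dil A : disc A -> disc (dil A).
Proof.
move=> hA; apply: disc_bd => t /andP[t0 t1].
have t2 : 0 <= t ^+ 2 < 1 by rewrite sqr_ge0 /= expr_lt1.
have [M hM] := summable_bounded (hA _ t2).
have M0 : 0 <= M by apply: le_trans (hM 0%N); rewrite mulr_ge0 ?md_ge0 ?exprn_ge0.
exists M => n; rewrite /dil; case: ifP => o; first by rewrite md0 mul0r.
apply: le_trans (hM n./2); rewrite -exprM mul2n; have := odd_double_half n.
by rewrite o add0n => ->.
Qed.

Lemma ev_dil A z : disc A -> md z < 1 -> ev (dil A) z = ev A (z ^+ 2).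
Proof.
move=> hA hz.
have hz2 : md (z ^+ 2) < 1 by rewrite mdX expr_lt1 ?md_ge0.
have /asum_cvg := disc_asum (disc_dil hA) hz.
move=> /cvgnC h1; symmetry; apply: csum_uniq; apply/cvgnC => e /h1 [N hN].
exists N => n hn; have := hN n.*2 ltac:(lia); rewrite /series /= !big_mkord.
suff -> : \sum_(i < n.*2) dil A i * z ^+ i = \sum_(i < n) A i * (z ^+ 2) ^+ i by [].
elim: n {hn} => [|n IH]; first by rewrite !big_ord0.
rewrite doubleS !big_ord_recr /= IH {2}/dil /= odd_double /= mul0r addr0.
by rewrite /dil odd_double doubleK -exprM mul2n.
Qed.

Section OdeSolution.
Variable B : nat -> C.

(** The solution u of z u' = (B - B 0) u with constant term 1 satisfies a recursion that refers to
    all earlier coefficients; the list keeps them available to a structural recursion. *)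
Fixpoint ode_seq (n : nat) : seq C :=
  if n is m.+1 then let s := ode_seq m in
    rcons s (if m is 0 then 1 else m%:R^-1 * \sum_(i < m) nth 0 s i * B (m - i)%N)
  else [::].
Definition odes n := nth 0 (ode_seq n.+1) n.

Lemma size_ode_seq n : size (ode_seq n) = n.
Proof. by elim: n => //= n IH; rewrite size_rcons IH. Qed.

Lemma nth_ode_seq n i : (i < n)%N -> nth 0 (ode_seq n) i = odes i.
Proof.
elim: n => // n IH; rewrite ltnS leq_eqVlt => /orP[/eqP -> //|hi].
by rewrite /= nth_rcons size_ode_seq hi IH.
Qed.

Lemma odes0 : odes 0 = 1. Proof. by []. Qed.

Lemma odes_rec n : (0 < n)%N -> n%:R * odes n = \sum_(i < n) odes i * B (n - i)%N.
Proof.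
case: n => // n _; rewrite /odes [ode_seq _]/= nth_rcons size_rcons size_ode_seq ltnn eqxx.
rewrite mulrA divff ?pnatr_eq0 // mul1r; apply: eq_bigr => i _; congr (_ * _).
exact: (@nth_ode_seq n.+1).
Qed.

(** Let S n be the partial sums of the moduli at a radius t. The recursion yields S (n + 2) <= (1 +
    K / (n + 1)) S (n + 1), a growth slower than any exponential; so S (n + 1) s^n eventually
    decreases for every s < 1, which bounds the terms at the radius r = t s. *)
Lemma disc_odes : disc B -> disc odes.
Proof.
move=> hB; apply: disc_bd => r /andP[r0 r1].
pose t := (1 + r) / 2.
have t0 : 0 < t by rewrite /t; lra.
have t1 : 0 <= t < 1 by rewrite /t; apply/andP; split; lra.
have [K0 hK0] := summable_bounded (hB _ t1).
pose K := Num.max K0 0.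
have K00 : 0 <= K by rewrite le_max lexx orbT.
have hK n : md (B n) * t ^+ n <= K by apply: le_trans (hK0 n) _; rewrite le_max lexx.
pose s := r / t.
have s0 : 0 <= s by rewrite divr_ge0 // ltW.
have s1 : s < 1 by rewrite ltr_pdivrMr // mul1r /t; lra.
pose v n := md (odes n) * t ^+ n; pose S n := \sum_(i < n) v i.
have v0 n : 0 <= v n by rewrite mulr_ge0 ?md_ge0 ?exprn_ge0 // ltW.
have S0 n : 0 <= S n by rewrite sumr_ge0.
have step n : n.+1%:R * v n.+1 <= K * S n.+1.
  rewrite /v -{1}(md_nat R n.+1) mulrA -mdM odes_rec //.
  apply: le_trans (ler_wpM2r (exprn_ge0 _ (ltW t0)) (md_sum _ _ _)) _.
  rewrite mulr_suml mulr_sumr; apply: ler_sum => i _.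
  have -> : t ^+ n.+1 = t ^+ i * t ^+ (n.+1 - i) by rewrite -exprD subnKC // ltnW.
  by rewrite mdM mulrACA [X in _ <= X]mulrC ler_wpM2l //; exact: v0.
have [N hN] : exists N : nat, K * s <= (1 - s) * N%:R.
  exists (Num.bound (K * s / (1 - s))).
  have s10 : 0 < 1 - s by rewrite subr_gt0.
  rewrite [X in _ <= X]mulrC -ler_pdivrMr //; apply: ltW; apply: archi_boundP.
  by apply: divr_ge0; [exact: mulr_ge0 | exact: ltW].
have mono n : (N <= n.+1)%N -> S n.+2 * s ^+ n.+1 <= S n.+1 * s ^+ n.
  move=> hn; rewrite exprS mulrA ler_wpM2r ?exprn_ge0 // /S big_ord_recr /= -/(S n.+1).
  have n0 : 0 < n.+1%:R :> R by rewrite ltr0n.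
  rewrite -(ler_pM2l n0) mulrA mulrDr.
  have h1 : K * s <= (1 - s) * n.+1%:R.
    apply: le_trans hN _; rewrite ler_wpM2l ?ler_nat // subr_ge0 ltW //.
  have := step n; have := S0 n.+1; move: (S n.+1) (v n.+1) (n.+1%:R : R) h1 n0 => a b m h1 n0 a0 st.
  apply: (@le_trans _ _ ((m * a + K * a) * s)).
    by rewrite ler_wpM2r // lerD2l.
  have : a * (K * s) <= a * ((1 - s) * m) by rewrite ler_wpM2l.
  by move=> h2; lra.
pose M := \sum_(i < N.+1) S i.+1 * s ^+ i.
exists M => n; apply: (@le_trans _ _ (S n.+1 * s ^+ n)).
  have -> : md (odes n) * r ^+ n = v n * s ^+ n.
    rewrite /v /s (expr_div_n r t); have : t ^+ n != 0 by rewrite expf_neq0 // gt_eqF.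
    by move: (t ^+ n) (r ^+ n) (md _) => x y w x0; field.
  by rewrite ler_wpM2r ?exprn_ge0 // /S big_ord_recr /= lerDr sumr_ge0.
have [hn|hn] := leqP n N.
  rewrite /M (bigD1 (Ordinal (hn : (n < N.+1)%N))) //= lerDl sumr_ge0 // => i _.
  by rewrite mulr_ge0 ?exprn_ge0.
have : S n.+1 * s ^+ n <= S N.+1 * s ^+ N.
  rewrite -(subnKC (ltnW hn)); elim: (n - N)%N => [|m IH]; first by rewrite addn0.
  by apply: le_trans IH; rewrite addnS; apply: mono; rewrite -addnS leq_addr.
move=> h; apply: le_trans h _.
by rewrite /M big_ord_recr /= lerDr sumr_ge0 // => i _; rewrite mulr_ge0 ?exprn_ge0.
Qed.

End OdeSolution.

End DiscSeries.

(** * Complex derivatives of the exponential and of power series *)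

Section Derivatives.
Variable R : realType.
Local Notation C := (CC R).
Local Notation cexp := (@cexp R).
Implicit Types (f g : C -> C) (x y z d e : C).

(** The neighbourhood filter of x, described by real radii to match [md]. *)
Definition cnb (x : C) : set_system C :=
  fun P => exists2 r : R, 0 < r & forall y, md (y - x) < r -> P y.

#[global] Instance cnb_pfilter (x : C) : ProperFilter (cnb x).
Proof.
split; first by case=> r r0 /(_ x); apply; rewrite subrr md0.
split.
- by exists 1.
- move=> P Q [r r0 hr] [s s0 hs]; exists (Num.min r s); first by rewrite lt_min r0.
  by move=> y; rewrite lt_min => /andP[y1 y2]; split; [exact: hr | exact: hs].
- by move=> P Q PQ [r r0 hr]; exists r => // y hy; apply: PQ; exact: hr.
Qed.

#[global] Instance cnb_filter (x : C) : Filter (cnb x).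
Proof. exact: (cnb_pfilter x). Qed.

#[global] Instance dnbhsC_pfilter (x : C) : ProperFilter (x^'%classic).
Proof. exact: Proper_dnbhs_numFieldType. Qed.

(* Caratheodory's form of the complex derivative. *)
Definition hasd f x d := exists ph : C -> C,
  [/\ ph x = d, (ph y @[y --> cnb x] --> d)%classic
    & \forall y \near cnb x, f y - f x = ph y * (y - x)].

Lemma nearC x (P : C -> Prop) : (\forall y \near x, P y) <-> cnb x P.
Proof.
split=> [/nbhs_ballP[e /= e0 h]|[r r0 h]].
  move: e0; rewrite ltcE /= => /andP[/eqP e1 e2].
  exists (complex.Re e) => // y hy; apply: h; rewrite -ball_normE /=.
  have -> : e = (complex.Re e)%:C%C by apply: complex_ext.
  by rewrite normE ltcR mdB.
apply/nbhs_ballP; exists r%:C%C => /=; first by rewrite ltcR.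
by move=> y; rewrite -ball_normE /= normE ltcR mdB => /h.
Qed.

Lemma dnearC (P : C -> Prop) :
  (\forall y \near (0 : C)^'%classic, P y) <->
  exists2 r : R, 0 < r & forall y, y != 0 -> md y < r -> P y.
Proof.
have -> : (\forall y \near (0 : C)^'%classic, P y) <-> (\forall y \near (0 : C), y != 0 -> P y).
  by rewrite near_withinE.
rewrite nearC; split=> -[r r0 h]; exists r => // y.
  by move=> y0 hy; apply: h => //; rewrite subr0.
by rewrite subr0 => hy y0; apply: h.
Qed.

Lemma cvgC_id x : (y @[y --> cnb x] --> x)%classic.
Proof. by apply/cvgCP => e e0; exists e. Qed.

Lemma hasd_cont f x d : hasd f x d -> (f y @[y --> cnb x] --> f x)%classic.
Proof.
move=> [ph [_ h1 h2]].
pose proof (h := cvgC_D (cvgC_cst (f x)) (cvgC_M h1 (cvgC_D (@cvgC_id x) (cvgC_cst (- x))))).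
rewrite subrr mulr0 addr0 in h; apply/cvgCP => e e0.
pose proof (h3 := cvgCP.1 h e e0); apply: filterS2 h2 h3 => y h2 h3.
by rewrite -h2 addrC addKr in h3.
Qed.

Lemma hasd_quot f x d : hasd f x d ->
  (h^-1 *: (f (h + x) - f x) @[h --> (0 : C)^'%classic] --> d)%classic.
Proof.
move=> [ph [_ /cvgCP h1 [r r0 h2]]]; apply/cvgCP => e e0.
have [s s0 hs] := h1 e e0.
apply/dnearC; exists (Num.min r s); first by rewrite lt_min r0.
move=> y y0; rewrite lt_min => /andP[yr ys].
rewrite h2 ?addrK // mulrC -[_ *: _]/(_ * _) mulrA mulVf // mul1r.
by apply: hs; rewrite addrK.
Qed.

Lemma quot_hasd f x d :
  (h^-1 *: (f (h + x) - f x) @[h --> (0 : C)^'%classic] --> d)%classic -> hasd f x d.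
Proof.
move=> /cvgCP h; exists (fun y => if y == x then d else (f y - f x) / (y - x)).
split; first by rewrite eqxx.
  apply/cvgCP => e e0; have /dnearC[r r0 hr] := h e e0.
  exists r => // y hy; case: eqVneq => [_|yx]; first by rewrite subrr md0.
  by have := hr (y - x); rewrite subr_eq0 subrK -[_ *: _]/(_ * _) mulrC; apply.
apply: nearW => y; case: eqVneq => [->|yx]; first by rewrite !subrr mulr0.
by rewrite divfK // subr_eq0.
Qed.

Lemma hasd_derive1 f x d : hasd f x d -> derive1 f x = d.
Proof. by move/hasd_quot => h; apply/cvg_lim => //; exact: norm_hausdorff. Qed.

Lemma quotE f x : (fun h : C => h^-1 *: ((f \o shift x) (h *: 1) - f x)) =
  (fun h : C => h^-1 *: (f (h + x) - f x)).
Proof. by apply/funext => h /=; rewrite -[h *: 1]/(h * 1) mulr1. Qed.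

Lemma hasd_derivable f x d : hasd f x d -> derivable f x 1.
Proof.
move/hasd_quot => h; apply/cvg_ex; exists d; move: h; rewrite -quotE; exact.
Qed.

Lemma hasd_uniq f x d e : hasd f x d -> hasd f x e -> d = e.
Proof. by move=> /hasd_derive1 <- /hasd_derive1 <-. Qed.

Lemma hasd_ext f g x d : cnb x (fun y => f y = g y) -> hasd f x d -> hasd g x d.
Proof.
move=> hfg [ph [h0 h1 h2]]; exists ph; split=> //.
have [r r0 hr] := hfg; have fx : f x = g x by apply: hr; rewrite subrr md0.
by apply: filterS2 (hfg : nbhs (cnb x) _) h2 => y <-; rewrite -fx.
Qed.

Lemma hasd_cst c x : hasd (fun=> c) x 0.
Proof.
exists (fun=> 0); split=> //; first exact: (@cvgC_cst R C (cnb x) _ 0).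
by apply: nearW => y; rewrite subrr mul0r.
Qed.

Lemma hasd_id x : hasd id x 1.
Proof.
exists (fun=> 1); split=> //; first exact: (@cvgC_cst R C (cnb x) _ 1).
by apply: nearW => y; rewrite mul1r.
Qed.

Lemma hasdD f g x d e : hasd f x d -> hasd g x e -> hasd (fun y => f y + g y) x (d + e).
Proof.
move=> [p [p0 p1 p2]] [q [q0 q1 q2]]; exists (fun y => p y + q y); split.
- by rewrite p0 q0.
- exact: (cvgC_D p1 q1).
- apply: filterS2 p2 q2 => y p2 q2.
  by rewrite mulrDl -p2 -q2; ring.
Qed.

Lemma hasdM f g x d e : hasd f x d -> hasd g x e ->
  hasd (fun y => f y * g y) x (d * g x + f x * e).
Proof.
move=> hf hg; have cg := hasd_cont hg.
case: hf => [p [p0 p1 p2]]; case: hg => [q [q0 q1 q2]].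
exists (fun y => p y * g y + f x * q y); split.
- by rewrite p0 q0.
- exact: (cvgC_D (cvgC_M p1 cg) (cvgC_Z (f x) q1)).
- apply: filterS2 p2 q2 => y p2 q2.
  by rewrite mulrDl mulrAC -p2 -mulrA -q2; ring.
Qed.

Lemma hasdZ c f x d : hasd f x d -> hasd (fun y => c * f y) x (c * d).
Proof. by move=> h; have := hasdM (hasd_cst c x) h; rewrite mul0r add0r. Qed.

Lemma hasd_comp f g x d e : hasd g x d -> hasd f (g x) e ->
  hasd (fun y => f (g y)) x (e * d).
Proof.
move=> hg; have cg := hasd_cont hg; case: hg => [q [q0 q1 q2]] [p [p0 p1 p2]].
exists (fun y => p (g y) * q y); split.
- by rewrite p0 q0.
- apply: (cvgC_M (f := fun y => p (g y)) _ q1).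
  apply/cvgCP => r r0; have [s s0 hs] := cvgCP.1 p1 r r0.
  by apply: filterS (cvgCP.1 cg s s0) => y; exact: hs.
- have [s s0 hs] := p2; pose proof (p3 := cvgCP.1 cg s s0).
  apply: filterS2 q2 p3 => y q2 /hs p3.
  by rewrite p3 q2 mulrA.
Qed.

Lemma hasdV f x d : f x != 0 -> hasd f x d -> hasd (fun y => (f y)^-1) x (- d / f x ^+ 2).
Proof.
move=> fx hf; have cf := hasd_cont hf; case: hf => [p [p0 p1 p2]].
exists (fun y => - (f x)^-1 * (p y * (f y)^-1)).
pose proof (cV := cvgC_V fx cf).
have e : - d / f x ^+ 2 = - (f x)^-1 * (d * (f x)^-1) by field.
split.
- by rewrite p0 e.
- by rewrite e; exact: (cvgC_Z _ (cvgC_M p1 cV)).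
- have fn : \forall y \near cnb x, f y != 0.
    have m0 : 0 < md (f x) by rewrite md_gt0.
    apply: filterS (cvgCP.1 cf _ m0) => y hy; apply/eqP => fy0.
    by rewrite fy0 sub0r mdN ltxx in hy.
  apply: filterS2 p2 fn => y p2 fy.
  have -> : - (f x)^-1 * (p y * (f y)^-1) * (y - x) = - (f x)^-1 * (f y)^-1 * (p y * (y - x)) by ring.
  by rewrite -p2; field; rewrite fy.
Qed.

Lemma hasdX n x : hasd (fun y => y ^+ n) x (n%:R * x ^+ n.-1).
Proof.
elim: n => [|n IH]; first by rewrite mul0r; exact: hasd_cst.
have := hasdM (hasd_id x) IH; rewrite mul1r.
have -> : x ^+ n + x * (n%:R * x ^+ n.-1) = n.+1%:R * x ^+ n.
  by case: n {IH} => [|n]; rewrite ?mul0r ?mulr0 ?addr0 ?expr0 ?mul1r //= exprS -natr1; ring.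
by under eq_fun do rewrite -exprS.
Qed.

Lemma hasd_expz (k : int) x : x != 0 -> hasd (fun y => y ^ k) x (k%:~R * x ^ k / x).
Proof.
move=> x0; case: k => n.
  have := hasdX n x; congr hasd; case: n => [|n]; first by rewrite /= !mul0r.
  by rewrite -exprnP /= exprSr; field.
have h := @hasdV (fun y => y ^+ n.+1) x _ (expf_neq0 n.+1 x0) (hasdX n.+1 x).
have e : - (n.+1%:R * x ^+ n) / (x ^+ n.+1) ^+ 2 = (Negz n)%:~R * x ^ Negz n / x.
  have ew : x ^+ n.+1 = x * x ^+ n by rewrite exprS.
  rewrite NegzE rmorphN /= -exprnN -pmulrn ew; set w := x ^+ n.
  have w0 : w != 0 by rewrite expf_neq0.
  by field; rewrite x0 w0.
by rewrite -e.
Qed.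

Lemma real_derive_bound (f : R -> R) (x d : R) : is_derive x (1 : R) f d -> forall e : R, 0 < e ->
  exists2 r : R, 0 < r & forall h : R, `|h| < r -> `|f (x + h) - f x - d * h| <= e * `|h|.
Proof.
move=> hd e e0; have := @ex_derive _ _ _ _ _ _ _ hd; have := @derive_val _ _ _ _ _ _ _ hd.
rewrite /derive => hl hc.
have : ((fun h : R => h^-1 *: ((f \o shift x) (h *: 1) - f x)) h @[h --> 0^'] --> d)%classic.
  by rewrite -hl; exact: hc.
move/cvgrPdist_le => /(_ e e0); rewrite near_withinE => /nbhs_ballP[r /= r0 hr].
exists r => // h hh; have [->|h0] := eqVneq h 0.
  by rewrite addr0 subrr mulr0 subr0 normr0 mulr0.
have := hr h; rewrite -ball_normE /= sub0r normrN => /(_ hh h0).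
rewrite -[h *: 1]/(h * 1) mulr1 -[_ *: _]/(h^-1 * _) => h1; rewrite (addrC x).
have -> : f (h + x) - f x - d * h = - h * (d - h^-1 * (f (h + x) - f x)) by field.
by rewrite normrM normrN mulrC ler_wpM2r.
Qed.

Lemma cexp_bound (e : R) : 0 < e -> exists2 r : R, 0 < r &
  forall w : C, md w < r -> md (cexp w - 1 - w) <= e * md w.
Proof.
(* The errors of the real and imaginary parts come out at most 4 d and 5 d times the modulus of w,
   together less than 10 d. *)
move=> e0; pose d := Num.min 1 (e / 10).
have d0 : 0 < d by rewrite lt_min ltr01 /=; lra.
have d1 : d <= 1 by rewrite ge_min lexx.
have d2 : d <= e / 10 by rewrite ge_min lexx orbT.
have [r1 r10 h1] := real_derive_bound (is_derive_expR (0 : R)) d0.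
have [r2 r20 h2] := real_derive_bound (is_derive_cos (0 : R)) d0.
have [r3 r30 h3] := real_derive_bound (is_derive_sin (0 : R)) d0.
exists (Num.min (Num.min r1 d) (Num.min r2 r3)); first by rewrite lt_min [0 < Num.min r1 d]lt_min [0 < Num.min r2 r3]lt_min r10 r20 r30 d0.
move=> w; rewrite lt_min [_ < Num.min r1 d]lt_min [_ < Num.min r2 r3]lt_min => /andP[/andP[w1 w4] /andP[w2 w3]].
have Rw := md_Re w; have Iw := md_Im w; have mw := md_ge0 w.
set x := complex.Re w in Rw; set y := complex.Im w in Iw.
have := h1 x (le_lt_trans Rw w1); have := h2 y (le_lt_trans Iw w2).
have := h3 y (le_lt_trans Iw w3).
rewrite !add0r expR0 cos0 sin0 oppr0 mul0r !mul1r !subr0.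
set E := expR x; set c := cos y; set s := sin y; set m := md w in Rw Iw mw w4 *.
rewrite addr0 => hs hc hE.
have [hs1 hs2] : s - y <= d * m /\ - (d * m) <= s - y.
  suff : `|s - y| <= d * m by rewrite ler_norml => /andP[].
  by apply: le_trans hs _; rewrite ler_wpM2l // ltW.
have [hc1 hc2] : c - 1 <= d * m /\ - (d * m) <= c - 1.
  suff : `|c - 1| <= d * m by rewrite ler_norml => /andP[].
  by apply: le_trans hc _; rewrite ler_wpM2l // ltW.
have [hE1 hE2] : E - 1 - x <= d * m /\ - (d * m) <= E - 1 - x.
  suff : `|E - 1 - x| <= d * m by rewrite ler_norml => /andP[].
  by apply: le_trans hE _; rewrite ler_wpM2l // ltW.
move: Rw Iw; rewrite !ler_norml => /andP[x1 x2] /andP[y1 y2].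
have E3 : `|E| <= 3 by rewrite ler_norml; apply/andP; split; nra.
apply: le_trans (md_le _) _; rewrite !cReD !cImD !cReN !cImN /= -/x -/y -/E -/c -/s.
have b1 : `|E * c - 1 - x| <= 4 * d * m.
  have -> : E * c - 1 - x = (E - 1 - x) + E * (c - 1) by ring.
  apply: le_trans (ler_normD _ _) _; rewrite normrM.
  have : `|E - 1 - x| <= d * m by rewrite ler_norml hE1 hE2.
  have : `|c - 1| <= d * m by rewrite ler_norml hc1 hc2.
  have := normr_ge0 E; have := normr_ge0 (c - 1); nra.
have b2 : `|E * s - 0 - y| <= 5 * d * m.
  have -> : E * s - 0 - y = E * (s - y) + (E - 1 - x) * y + x * y by ring.
  apply: le_trans (ler_normD _ _) _; apply: le_trans (lerD (ler_normD _ _) (lexx _)) _.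
  rewrite !normrM.
  have : `|E - 1 - x| <= d * m by rewrite ler_norml hE1 hE2.
  have : `|s - y| <= d * m by rewrite ler_norml hs1 hs2.
  have : `|x| <= m by rewrite ler_norml x1 x2.
  have : `|y| <= m by rewrite ler_norml y1 y2.
  move: (normr_ge0 E) (normr_ge0 (s - y)) (normr_ge0 (E - 1 - x)) (normr_ge0 x) (normr_ge0 y) E3.
  move: `|E| `|s - y| `|E - 1 - x| `|x| `|y| => a1 a2 a3 a4 a5 p1 p2 p3 p4 p5 q1 q2 q3 q4 q5.
  have i1 : a1 * a2 <= 3 * (d * m) by apply: ler_pM.
  have i2 : a3 * a5 <= (d * m) * 1 by apply: ler_pM => //; nra.
  have i3 : a4 * a5 <= d * m by apply: ler_pM => //; nra.
  nra.
nra.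
Qed.

Lemma hasd_cexp0 : hasd cexp 0 1.
Proof.
apply: quot_hasd; apply/cvgCP => e e0.
have e20 : 0 < e / 2 by lra.
have [r r0 hr] := cexp_bound e20.
apply/dnearC; exists r => // h h0 hh; rewrite addr0 cexp0 -[_ *: _]/(_ * _).
have -> : h^-1 * (cexp h - 1) - 1 = h^-1 * (cexp h - 1 - h) by field.
rewrite mdM mdV mulrC ltr_pdivrMr ?md_gt0 //; apply: le_lt_trans (hr h hh) _.
by rewrite ltr_pM2r ?md_gt0 //; lra.
Qed.

Lemma hasd_cexp z : hasd cexp z (cexp z).
Proof.
have h1 : hasd (fun y => y - z) z 1.
  by have := hasdD (hasd_id z) (hasd_cst (- z) z); rewrite addr0.
have h2 := hasd_comp h1 (f := cexp) (e := 1).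
rewrite subrr in h2; have := hasdZ (cexp z) (h2 hasd_cexp0); rewrite !mulr1.
by under eq_fun do rewrite -cexpD addrC subrK.
Qed.

Lemma hasd_lin (a b z : C) : hasd (fun y => a * y + b) z a.
Proof.
by have := hasdD (hasdZ a (hasd_id z)) (hasd_cst b z); rewrite mulr1 addr0.
Qed.

Lemma hasd_qpow s z : hasd (qpow s) z (twopii R * s * qpow s z).
Proof.
rewrite mulrC; apply: (hasd_comp (f := cexp) (g := fun t => twopii R * s * t)).
  by have := hasd_lin (twopii R * s) 0 z; under eq_fun do rewrite addr0.
exact: hasd_cexp.
Qed.

(** The quotients (y^n - z^n) / (y - z) are the polynomials [Q n y]; for y close to z they are
    dominated with a radius between the modulus of z and 1, so their sum is continuous at z. The
    derivative is recorded as z d because only q d/dq occurs later. *)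
Lemma hasd_ev (A : nat -> C) z : disc A -> md z < 1 ->
  exists2 d, hasd (ev A) z d & z * d = ev (theta 0 A) z.
Proof.
move=> hA hz; pose d := csum (fun n => A n * (n%:R * z ^+ n.-1)).
pose Q n y := \sum_(i < n) y ^+ (n.-1 - i) * z ^+ i.
pose rho := (1 + md z) / 2; have mz := md_ge0 z.
have rho0 : 0 < rho by rewrite /rho; lra.
have rho1 : 0 <= rho < 1 by rewrite /rho; apply/andP; split; lra.
have hT := disc_theta0 hA rho1.
pose b n := (rho^-1 : R) * (md (n%:R * A n) * rho ^+ n).
have hb : summable b by apply: summableZ hT; rewrite invr_ge0 ltW.
have Qb n y : md y <= rho -> md (A n * Q n y) <= b n.
  move=> hy; rewrite mdM /b mdM md_nat.
  case: n => [|n].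
    by rewrite /Q big_ord0 md0 mulr0 !mul0r mulr0.
  have -> : rho^-1 * (n.+1%:R * md (A n.+1) * rho ^+ n.+1) = md (A n.+1) * (n.+1%:R * rho ^+ n).
    by rewrite exprS; field; rewrite gt_eqF.
  rewrite ler_wpM2l ?md_ge0 // /Q; apply: le_trans (md_sum _ _ _) _.
  rewrite -[X in X%:R * _](card_ord n.+1) -sum1_card natr_sum mulr_suml.
  apply: ler_sum => i _; rewrite mul1r mdM !mdX /=.
  have -> : rho ^+ n = rho ^+ (n - i) * rho ^+ i by rewrite -exprD subnK // -ltnS.
  have zr : md z <= rho by rewrite /rho; lra.
  by apply: ler_pM; rewrite ?exprn_ge0 ?md_ge0 //; apply: lerXn2r;
    rewrite ?nnegrE ?md_ge0 ?(ltW rho0).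
have near_rho : \forall y \near cnb z, md y <= rho.
  exists (rho - md z); first by rewrite /rho; lra.
  move=> y hy; rewrite -[y](subrK z); apply: le_trans (mdD _ _) _; lra.
have hQ n : (A n * Q n y @[y --> cnb z] --> A n * (n%:R * z ^+ n.-1))%classic.
  apply: (cvgC_Z (A n)).
  have -> : n%:R * z ^+ n.-1 = \sum_(i < n) z ^+ (n.-1 - i) * z ^+ i.
    rewrite (eq_bigr (fun=> z ^+ n.-1)); first by rewrite sumr_const card_ord mulr_natl.
    by move=> i _; rewrite -exprD subnK //; case: n i => [[]//|n] i; rewrite -ltnS.
  apply: (@cvgC_sum R C (cnb z) _ n (fun y i => y ^+ (n.-1 - i) * z ^+ i) (fun i => z ^+ (n.-1 - i) * z ^+ i)) => i.
  exact: (cvgC_M (hasd_cont (hasdX (n.-1 - i) z)) (cvgC_cst (z ^+ i))).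
have [|ad hd] := @tannery R C (cnb z) _ (fun y n => A n * Q n y) _ _ hb _ hQ.
  by apply: filterS near_rho => y hy n; apply: Qb.
exists d; last first.
  rewrite /d /ev -csumZ //; apply: eq_csum => n; rewrite /theta add0r.
  by case: n => [|n]; rewrite ?mul0r ?mulr0 ?mul0r // exprS; ring.
exists (fun y => csum (fun n => A n * Q n y)); split=> //.
  apply: eq_csum => n; congr (_ * _); rewrite /Q (eq_bigr (fun=> z ^+ n.-1)).
    by rewrite sumr_const card_ord mulr_natl.
  by move=> i _; rewrite -exprD subnK //; case: n i => [[]//|n] i; rewrite -ltnS.
apply: filterS near_rho => y hy.
have hy1 : md y < 1 by apply: le_lt_trans hy _; case/andP: rho1.
have aQ : asum (fun n => A n * Q n y) by apply: asum_le hb _ => n; apply: Qb.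
rewrite mulrC -csumZ //.
have -> : ev A y - ev A z = ev A y + -1 * ev A z by rewrite mulN1r.
rewrite /ev -csumZ; last exact: disc_asum.
rewrite -csumD; [|exact: disc_asum|by apply: asumZ; exact: disc_asum].
apply: eq_csum => n; have : y ^+ n - z ^+ n = (y - z) * Q n y by exact: subrXX.
move=> e.
by rewrite [RHS]mulrCA -e mulN1r mulrBr.
Qed.

Lemma Im_convex (a b : C) (t : R) : upper_half a -> upper_half b -> 0 <= t <= 1 ->
  upper_half (a + t%:C%C * (b - a)).
Proof.
rewrite /upper_half => ha hb /andP[t0 t1].
rewrite cImD cImM cImD cImN /= mul0r addr0; nra.
Qed.

Lemma upper_open x : upper_half x -> cnb x (@upper_half R).
Proof.
move=> hx; exists (complex.Im x) => // y hy.
have := md_Im (y - x); rewrite cImD cImN => h; have := le_lt_trans h hy.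
by rewrite ltr_norml /upper_half => /andP[]; lra.
Qed.

(** On the segment from a to b the real mean value theorem applies to the real part of u f; the
    choices u = 1 and u = - i recover both parts of f. *)
Lemma hasd0_cst f : (forall z, upper_half z -> hasd f z 0) ->
  forall a b, upper_half a -> upper_half b -> f a = f b.
Proof.
move=> h a b ha hb.
suff key (u : C) : complex.Re (u * f a) = complex.Re (u * f b).
  apply: complex_ext; first by have := key 1; rewrite !mul1r.
  by have := key ((0 -i* 1)%C); rewrite !cReM /= !mul0r !sub0r !mulN1r !opprK.
pose g (t : R) := complex.Re (u * f (a + t%:C%C * (b - a))).
have gd (t : R) : 0 <= t <= 1 -> is_derive t (1 : R) g (0 : R).
  move=> ht; have hz := h _ (Im_convex ha hb ht).
  have hu : hasd (fun s => u * f (a + s * (b - a))) t%:C%C 0.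
    have h2 : hasd (fun s => a + s * (b - a)) t%:C%C (b - a).
      have := hasd_lin (b - a) a t%:C%C.
      by under eq_fun do rewrite mulrC addrC.
    by have := hasdZ u (hasd_comp h2 hz); rewrite mul0r mulr0.
  have /hasd_quot/cvgCP hq := hu.
  have hg : ((fun k : R => k^-1 *: ((g \o shift t) (k *: 1) - g t)) k @[k --> 0^'] --> (0 : R))%classic.
    apply/cvgrPdist_lt => e e0; have /dnearC[r r0 hr] := hq e e0.
    rewrite near_withinE; apply/nbhs_ballP; exists r => // k; rewrite -ball_normE /= sub0r normrN => hk k0.
    have := hr (k%:C%C); rewrite md_real => /(_ _ hk).
    have k00 : (k%:C%C : C) != 0 by rewrite eq_complex /= (negbTE (k0 : k != 0)).
    move=> /(_ k00); apply: le_lt_trans; rewrite subr0 sub0r normrN.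
    rewrite -[_ *: 1]/(k * 1) mulr1 /g -cReN -cReD -rmorphD.
    rewrite mdM mdV md_real -[_ *: (_ : R)]/(k^-1 * _) normrM normfV.
    by rewrite ler_wpM2l ?invr_ge0 // md_Re.
  by split; [apply/cvg_ex; exists 0|apply/cvg_lim].
have [||c _] := @MVT_segment R g (fun=> 0) 0 1 ler01.
- move=> x; rewrite in_itv /= => /andP[x0 x1]; apply: gd; by rewrite !ltW.
- apply: derivable_within_continuous => x; rewrite in_itv /= => hx.
  by have := gd x hx; case.
rewrite mul0r /g rmorph0 rmorph1 mul0r mul1r addr0 [a + _]addrC subrK.
by move/eqP; rewrite subr_eq0 => /eqP.
Qed.

End Derivatives.

(** * Expansions in powers of q^(1/h) *)

Section QSeries.
Variable R : realType.
Local Notation C := (CC R).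
Local Notation twopii := (twopii R).
Local Notation upper_half := (@upper_half R).
Implicit Types (A B : nat -> C) (s mu nu tau : C) (h : nat).

Lemma qpowD s s' tau : qpow (s + s') tau = qpow s tau * qpow s' tau.
Proof. by rewrite /qpow -cexpD; congr cexp; ring. Qed.

Lemma qpow_add s tau t : qpow s (tau + t) = qpow s tau * qpow s t.
Proof. by rewrite /qpow -cexpD; congr cexp; ring. Qed.

Lemma qpow_neq0 s tau : qpow s tau != 0. Proof. exact: cexp_neq0. Qed.

Lemma qpow0 tau : qpow 0 tau = 1.
Proof. by rewrite /qpow mulr0 mul0r cexp0. Qed.

Lemma qpowMn s n tau : qpow (s * n%:R) tau = qpow s tau ^+ n.
Proof. by rewrite /qpow -cexpMn; congr cexp; ring. Qed.

Lemma md_qpow_real (t : R) tau : md (qpow t%:C%C tau) = expR (- (2 * pi * t * complex.Im tau)).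
Proof. by rewrite md_cexp !cReM !cImM /=; congr expR; ring. Qed.

Lemma md_qpow_lt1 h tau : (0 < h)%N -> upper_half tau -> md (qpow h%:R^-1 tau) < 1.
Proof.
move=> h0 ht; rewrite natC -fmorphV md_qpow_real expR_lt1 oppr_lt0.
by rewrite !mulr_gt0 ?pi_gt0 ?invr_gt0 ?ltr0n.
Qed.

(** A series in the local parameter q^(1/h) of a cusp of width h, multiplied by q^(mu/h). The scalar
    forms use h = 1 at infinity and h = 2 at the cusp 0. *)
Definition qs h mu A tau : C := qpow (mu / h%:R) tau * ev A (qpow h%:R^-1 tau).

Lemma qsD h mu A B tau : (0 < h)%N -> upper_half tau -> disc A -> disc B ->
  qs h mu (fun n => A n + B n) tau = qs h mu A tau + qs h mu B tau.
Proof. by move=> h0 ht hA hB; rewrite /qs evD ?mulrDr // md_qpow_lt1. Qed.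

Lemma qsZ h mu k A tau : (0 < h)%N -> upper_half tau -> disc A ->
  qs h mu (fun n => k * A n) tau = k * qs h mu A tau.
Proof. by move=> h0 ht hA; rewrite /qs evZ ?md_qpow_lt1 // mulrCA. Qed.

Lemma qsM h mu nu A B tau : (0 < h)%N -> upper_half tau -> disc A -> disc B ->
  qs h (mu + nu) (pm A B) tau = qs h mu A tau * qs h nu B tau.
Proof.
move=> h0 ht hA hB; rewrite /qs evM ?md_qpow_lt1 // mulrDl qpowD; ring.
Qed.

Lemma qs_cst h c tau : qs h 0 (cst0 c) tau = c.
Proof. by rewrite /qs mul0r qpow0 ev_cst0 mul1r. Qed.

Lemma qs_zshift h mu j A tau : (0 < h)%N -> upper_half tau -> disc A ->
  qs h mu (zshift j A) tau = qs h (mu + j%:R) A tau.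
Proof.
move=> h0 ht hA; rewrite /qs ev_zshift ?md_qpow_lt1 // mulrDl qpowD.
by rewrite [j%:R / _]mulrC qpowMn; ring.
Qed.

Lemma qs_period h mu A tau : (0 < h)%N ->
  qs h mu A (tau + h%:R) = cexp (twopii * mu) * qs h mu A tau.
Proof.
move=> h0; have h1 : (h%:R : C) != 0 by rewrite pnatr_eq0 -lt0n.
rewrite /qs !qpow_add.
have -> : qpow (mu / h%:R) h%:R = cexp (twopii * mu).
  by rewrite /qpow; congr cexp; field.
have -> : qpow (h%:R^-1) h%:R = (1 : C).
  by rewrite /qpow -mulrA mulVf // mulr1 cexp_twopii.
by rewrite mulr1; ring.
Qed.

Lemma hasd_qs h mu A tau : (0 < h)%N -> upper_half tau -> disc A ->
  hasd (qs h mu A) tau (twopii / h%:R * qs h mu (theta mu A) tau).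
Proof.
move=> h0 ht hA; have hq := md_qpow_lt1 h0 ht.
have [d hd ed] := hasd_ev hA hq.
have h1 := hasdM (hasd_qpow (mu / h%:R) tau) (hasd_comp (hasd_qpow h%:R^-1 tau) hd).
have e : twopii / h%:R * qs h mu (theta mu A) tau = twopii * (mu / h%:R) * qpow (mu / h%:R) tau * ev A (qpow h%:R^-1 tau) +
      qpow (mu / h%:R) tau * (d * (twopii * h%:R^-1 * qpow h%:R^-1 tau)).
  have -> : theta mu A = fun n => mu * A n + theta 0 A n.
    by apply/funext => n; rewrite /theta add0r mulrDl.
  rewrite qsD ?qsZ //; [|exact: discZ|exact: disc_theta].
  rewrite /qs -ed; ring.
by rewrite e; exact: h1.
Qed.

(** The imaginary axis already covers the interval (0, 1), on which a power series determines its
    coefficients by [ev_inj]. *)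
Lemma qpow_onto h (t : R) : (0 < h)%N -> 0 < t < 1 ->
  exists2 tau, upper_half tau & qpow h%:R^-1 tau = t%:C%C.
Proof.
move=> h0 /andP[t0 t1]; have [x hx] := expR_total t0.
have x0 : x < 0 by rewrite -expR_lt1 hx.
have pi0 := pi_gt0 R.
have hh : (0 : R) < h%:R by rewrite ltr0n.
exists ((0 +i* (- x * h%:R / (2 * pi)))%C : C).
  by rewrite /Defs.upper_half /= divr_gt0 ?mulr_gt0 ?oppr_gt0.
rewrite /qpow natC -fmorphV.
have -> : twopii * (h%:R^-1)%:C%C * (0 +i* (- x * h%:R / (2 * pi)))%C = (x%:C%C : C).
  apply: complex_ext; rewrite ?cReM ?cImM ?cReM ?cImM /=.
    have p1 : (pi : R) != 0 by rewrite gt_eqF.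
    have p2 : (h%:R : R) != 0 by rewrite gt_eqF.
    by move: (pi : R) (h%:R : R) p1 p2 => p w p1 p2; field; rewrite p1 p2.
  by rewrite !mul0r mulr0 subr0 mul0r !mulr0 addr0.
by apply: complex_ext; rewrite /= ?cos0 ?sin0 ?mulr1 ?mulr0.
Qed.

Lemma qs_inj h mu A B : (0 < h)%N -> disc A -> disc B ->
  (forall tau, upper_half tau -> qs h mu A tau = qs h mu B tau) -> A = B.
Proof.
move=> h0 hA hB H; apply: ev_inj => // t /(qpow_onto h0)[tau ht <-].
by have := H tau ht; rewrite /qs => /(mulfI (qpow_neq0 _ _)).
Qed.

Lemma qs_eq0 h mu A : (0 < h)%N -> disc A ->
  (forall tau, upper_half tau -> qs h mu A tau = 0) -> forall n, A n = 0.
Proof.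
move=> h0 hA H n; suff -> : A = fun=> 0 by [].
have d0 : disc (fun=> 0 : C) by apply: eq_disc (discZ 0 hA) => i; rewrite mul0r.
apply: (@qs_inj h mu) => // tau ht; rewrite H // /qs /ev.
by rewrite (@csum_finite R _ 0) ?big_ord0 ?mulr0 // => i _; rewrite mul0r.
Qed.

Lemma qs_dil mu A tau : upper_half tau -> disc A ->
  qs 2 (2 * mu) (dil A) tau = qs 1 mu A tau.
Proof.
move=> ht hA; have hq : md (qpow 2%:R^-1 tau) < 1 by exact: md_qpow_lt1.
have e : qpow 2%:R^-1 tau ^+ 2 = qpow 1%:R^-1 tau :> C.
  have e2 : 2%:R^-1 * 2%:R = 1%:R^-1 :> C by rewrite mulVf ?pnatr_eq0 // invr1.
  by rewrite -(qpowMn _ 2) e2.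
have e3 : 2 * mu / 2%:R = mu / 1%:R by field.
by rewrite /qs (ev_dil hA hq) e e3.
Qed.

Lemma qs0E h A tau : qs h 0 A tau = ev A (qpow h%:R^-1 tau).
Proof. by rewrite /qs (mul0r (h%:R^-1 : C)) (qpow0 tau) mul1r. Qed.

Lemma upper_scale (t : R) tau : 0 < t -> upper_half tau -> upper_half (t%:C%C * tau).
Proof. by rewrite /Defs.upper_half cImM /= mul0r addr0 => *; rewrite mulr_gt0. Qed.

Lemma upper_add_real (t : R) tau : upper_half tau -> upper_half (tau + t%:C%C).
Proof. by rewrite /Defs.upper_half cImD /= addr0. Qed.

Lemma upper_addn (n : nat) tau : upper_half tau -> upper_half (tau + n%:R).
Proof. by rewrite natC; exact: upper_add_real. Qed.

Lemma upper_neq0 tau : upper_half tau -> tau != 0.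
Proof. by apply: contraTN => /eqP ->; rewrite /Defs.upper_half ltxx. Qed.

Lemma Im_inv tau : complex.Im (- tau^-1) = complex.Im tau / md tau ^+ 2.
Proof.
rewrite mdE sqr_sqrtr ?addr_ge0 ?sqr_ge0 // cImN.
by case: tau => x y; rewrite -[(_ +i* _)%C^-1]/(invc _) /= opprK.
Qed.

Lemma upper_inv tau : upper_half tau -> upper_half (- tau^-1).
Proof.
move=> ht; rewrite /Defs.upper_half Im_inv divr_gt0 // exprn_gt0 // md_gt0.
exact: upper_neq0.
Qed.

Definition sigma_coef (c : C) (k n : nat) : C := if n is 0 then 1 else c * (divisor_sum k n)%:R.
Definition e2s := sigma_coef (-24) 1.
Definition e4s := sigma_coef 240 3.

Lemma divisor_sum_le k n : (0 < n)%N -> (divisor_sum k n <= n ^ k.+1)%N.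
Proof.
move=> n0; rewrite /divisor_sum.
apply: (@leq_trans (\sum_(d <- divisors n) n ^ k)).
  rewrite big_seq [X in (_ <= X)%N]big_seq; apply: leq_sum => d.
  rewrite -dvdn_divisors // => /(dvdn_leq n0) hd.
  by case: k => // k; rewrite leq_exp2r.
rewrite big_const_seq count_predT iter_addn_0 mulnC expnS leq_mul2r; apply/orP; right.
rewrite -[X in (_ <= X)%N](size_iota 1 n); apply: uniq_leq_size => [|d].
  exact: divisors_uniq.
rewrite -dvdn_divisors // => hd; rewrite mem_iota add1n ltnS (dvdn_leq n0 hd) andbT.
exact: dvdn_gt0 hd.
Qed.

Lemma disc_pow k : disc (fun n => (n%:R : C) ^+ k).
Proof.
elim: k => [|k IH]; first by under eq_fun do rewrite expr0; exact: disc_one.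
by under eq_fun do rewrite exprS; exact: disc_theta0.
Qed.

Lemma disc_sigma c k : disc (sigma_coef c k).
Proof.
have h := discD (disc_cst0 (1 : C)) (discZ c (disc_pow k.+1)).
pose B n : C := (if n is 0 then 1 else 0) + (md c)%:C%C * n%:R ^+ k.+1.
have hB : disc B by apply: (discD (disc_cst0 (1 : C))); apply: discZ; exact: disc_pow.
apply: (disc_le hB) => -[|n].
  by rewrite /B expr0n mulr0 addr0.
rewrite /B add0r !mdM md_real ger0_norm ?md_ge0 // md_nat mdX md_nat.
by rewrite ler_wpM2l ?md_ge0 // -natrX ler_nat divisor_sum_le.
Qed.

Lemma qs_sigma c k tau : upper_half tau ->
  qs 1 0 (sigma_coef c k) tau =
  1 + c * limn (series (fun n : nat => (divisor_sum k n.+1)%:R * qpow n.+1%:R tau : C)).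
Proof.
move=> ht; have hq := md_qpow_lt1 (ltn0Sn 0) ht.
rewrite /qs mul0r qpow0 mul1r /ev csum_recl; last exact: disc_asum (disc_sigma _ _) _.
rewrite /= mul1r; congr (_ + _).
have e n : qpow n.+1%:R tau = qpow (1%N%:R^-1) tau ^+ n.+1 :> C.
  by rewrite -qpowMn invr1 mul1r.
rewrite -[limn _]/(csum _) -csumZ; first by apply: eq_csum => n; rewrite e mulrA.
have [_|c0] := eqVneq c 0.
  have := asum_shift 1 (disc_asum (disc_sigma 1 k) hq).
  by congr asum; apply/funext => n; rewrite /= mul1r e add1n.
have := asumZ c^-1 (asum_shift 1 (disc_asum (disc_sigma c k) hq)).
by congr asum; apply/funext => n; rewrite /= e !mulrA mulVf // mul1r.
Qed.

Lemma E2_qs tau : upper_half tau -> E2 tau = qs 1 0 e2s tau.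
Proof. by move=> ht; rewrite qs_sigma // /E2 mulNr. Qed.

Lemma E4_qs tau : upper_half tau -> E4 tau = qs 1 0 e4s tau.
Proof. by move=> ht; rewrite qs_sigma. Qed.

Lemma E2_double tau : upper_half tau -> E2 (2 * tau) = qs 1 0 (dil e2s) tau.
Proof.
move=> ht; have h2 : upper_half (2 * tau).
  by rewrite (natC R 2); apply: upper_scale.
have hq : md (qpow 1%:R^-1 tau) < 1 by exact: md_qpow_lt1.
rewrite (E2_qs h2) !qs0E (ev_dil (disc_sigma _ _) hq) -(qpowMn _ 2).
by congr (ev _ _); rewrite /qpow; congr cexp; rewrite invr1; ring.
Qed.

Lemma E2_half tau : upper_half tau -> E2 (tau / 2) = qs 2 0 e2s tau.
Proof.
move=> ht; have h2 : upper_half (tau / 2).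
  by rewrite mulrC (natC R 2) -fmorphV; apply: upper_scale; rewrite ?invr_gt0.
rewrite (E2_qs h2) !qs0E.
by congr (ev _ _); rewrite /qpow; congr cexp; rewrite invr1; ring.
Qed.

Lemma E2_qs2 tau : upper_half tau -> E2 tau = qs 2 0 (dil e2s) tau.
Proof.
by move=> ht; rewrite (E2_qs ht) -(qs_dil _ ht (disc_sigma _ _)) mulr0.
Qed.

End QSeries.

(** * The transformation law of E2 *)

Section Lipschitz.
Variable R : realType.
Local Notation C := (CC R).
Local Notation twopii := (twopii R).
Local Notation upper_half := (@upper_half R).
Implicit Types (x y z w tau : C).

Definition ee z : C := cexp (twopii * z).

Lemma eeD z w : ee (z + w) = ee z * ee w.
Proof. by rewrite /ee mulrDr cexpD. Qed.
Lemma ee1 : ee 1 = 1. Proof. by rewrite /ee mulr1 cexp_twopii. Qed.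
Lemma ee0 : ee 0 = 1. Proof. by rewrite /ee mulr0 cexp0. Qed.
Lemma ee_natr n : ee n%:R = 1.
Proof. exact: (cexp_int R n). Qed.
Lemma eeN z : ee (- z) = (ee z)^-1.
Proof. by rewrite /ee mulrN cexpN. Qed.
Lemma eeMn z n : ee (z * n%:R) = ee z ^+ n.
Proof. by rewrite /ee mulrA cexpMn. Qed.
Lemma ee_half : ee 2^-1 = -1.
Proof.
rewrite /ee; have -> : twopii * 2^-1 = ((0 +i* pi)%C : C).
  rewrite (natC R 2) -fmorphV; apply: complex_ext; rewrite ?cReM ?cImM /=; first ring.
  by rewrite mul0r add0r; field.
apply: complex_ext; rewrite /= expR0 mul1r ?cospi ?sinpi //.
by rewrite oppr0.
Qed.
Lemma md_ee z : md (ee z) = expR (- (2 * pi * complex.Im z)).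
Proof. by rewrite /ee md_cexp cReM /= mul0r sub0r. Qed.

(** Halving the angle gives the constant: both the cosine of y / 2 and the slope of the sine between
    0 and y / 2 are at least cos (pi / 4). *)
Lemma sin_lower (y : R) : 0 <= y <= pi / 2 -> cos (pi / 4) ^+ 2 * y <= sin y.
Proof.
move=> /andP[y0 y1]; have pi0 := pi_gt0 R.
set s := cos _; have s0 : 0 < s by apply: cos_gt0_pihalf; apply/andP; split; lra.
have cm (t : R) : 0 <= t <= pi / 4 -> s <= cos t.
  move=> /andP[t0]; rewrite le_eqVlt => /orP[/eqP -> //|t1]; apply: ltW.
  by rewrite ltr_cos // in_itv /=; apply/andP; split; lra.
have h : s * (y / 2) <= sin (y / 2).
  have y20 : 0 <= y / 2 by lra.
  have [|c] := @MVT_segment R sin cos 0 (y / 2) y20.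
    by apply: continuous_subspaceT; exact: continuous_sin.
  rewrite in_itv /= => /andP[c0 c1]; rewrite sin0 !subr0 => ->.
  by rewrite ler_wpM2r //; apply: cm; apply/andP; split => //; lra.
have -> : sin y = 2 * (cos (y / 2) * sin (y / 2)).
  have e : y = (y / 2) *+ 2 by rewrite mulr2n; lra.
  by rewrite {1}e sin_mulr2n mulr2n; ring.
have h2 : s <= cos (y / 2) by apply: cm; apply/andP; split; lra.
have : s * (s * (y / 2)) <= cos (y / 2) * sin (y / 2).
  by apply: ler_pM => //; [exact: ltW | rewrite mulr_ge0 ?(ltW s0) //; lra].
rewrite expr2; lra.
Qed.

(** In this strip 0 is the only zero of 1 - [ee x], and it is simple. The width 3 / 4 instead of 1 /
    2 leaves room for a perturbation z / N of the points i / N with i <= N / 2. *)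
Lemma ee_lower : exists2 c : R, 0 < c & forall x, `|complex.Re x| <= 3 / 4 ->
  `|complex.Im x| <= 1 -> c * md x <= md (1 - ee x).
Proof.
have pi0 := pi_gt0 R; have pi2 := pi_ge2 R.
pose s := cos (pi / 4 : R) ^+ 2.
have s0 : 0 < s by rewrite exprn_gt0 //; apply: cos_gt0_pihalf; apply/andP; split; lra.
have s1 : s <= 1 by rewrite expr_le1 ?cos_le1 // ltW //; apply: cos_gt0_pihalf; apply/andP; split; lra.
(* The real part of x is at most D / s and its imaginary part at most 2 D in absolute value, where D
   is the modulus of 1 - [ee x]. *)
exists (s^-1 + 2)^-1; first by rewrite invr_gt0 addr_gt0 ?invr_gt0.
move=> x; set a := complex.Re x; set b := complex.Im x => ha hb.
set D := md (1 - ee x); set r := expR (- (2 * pi * b)).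
have eex : ee x = ((r * cos (2 * pi * a)) +i* (r * sin (2 * pi * a)))%C.
  rewrite /ee /cexp cReM cImM /= -/a -/b !mul0r sub0r add0r.
  by [].
have r0 : 0 < r by exact: expR_gt0.
have h1 : `|1 - r| <= D.
  have mr : md (ee x) = r by rewrite md_ee.
  have := md_tri 1 (ee x); have := md_tri (ee x) 1; rewrite md1 mr [md (ee x - 1)]mdB -/D.
  by move=> u v; rewrite ler_norml; apply/andP; split; lra.
have h2 : `|b| / 2 <= `|1 - r|.
  have [b0|b0] := leP 0 b.
    have hr : r * (1 + 2 * pi * b) <= 1.
      apply: (@le_trans _ _ (r * expR (2 * pi * b))).
        by rewrite ler_wpM2l ?(ltW r0) // expR_ge1Dx.
      by rewrite mulrC /r expRxMexpNx_1.
    rewrite ger0_norm // in hb *; apply: le_trans (ler_norm _).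
    rewrite leNgt; apply/negP => hc.
    have : (1 - b / 2) * (1 + 4 * b) < 1; last by nra.
    apply: lt_le_trans hr; apply: (@lt_le_trans _ _ (r * (1 + 4 * b))).
      by rewrite ltr_pM2r; lra.
    by rewrite ler_wpM2l ?(ltW r0) //; nra.
  rewrite ltr0_norm // -normrN opprB; apply: le_trans (ler_norm _).
  have := expR_ge1Dx (- (2 * pi * b)); rewrite -/r; nra.
have h3 : s * `|a| <= D.
  have Dsq : D ^+ 2 = (1 - r * cos (2 * pi * a)) ^+ 2 + (r * sin (2 * pi * a)) ^+ 2.
    by rewrite /D mdE sqr_sqrtr ?addr_ge0 ?sqr_ge0 // eex cReD cImD cReN cImN /= sub0r sqrrN.
  have D0 : 0 <= D by exact: md_ge0.
  have ca : cos (2 * pi * `|a|) = cos (2 * pi * a).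
    by rewrite -(cos_norm (2 * pi * a)) normrM (@ger0_norm _ (2 * pi)) // mulr_ge0 // ltW.
  have a0 := normr_ge0 a.
  (* Up to 1 / 4 the distance from 1 to [ee x] is at least the sine of the angle, which is the
     distance from 1 to the ray. Beyond 1 / 4 the cosine is not positive and the distance is at
     least 1. *)
  have [a4|a4] := leP `|a| 4^-1.
    have hs : s * (2 * pi * `|a|) <= sin (2 * pi * `|a|).
      by apply: sin_lower; apply/andP; split; nra.
    have cs := cos2Dsin2 (2 * pi * a); have cs' := cos2Dsin2 (2 * pi * `|a|).
    have hS : sin (2 * pi * `|a|) <= D.
      rewrite -(ler_sqr _ _) ?nnegrE //; last first.
        by apply: le_trans hs; rewrite mulr_ge0 ?(ltW s0) //; nra.
      rewrite Dsq; rewrite ca in cs'.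
      set cc := cos (2 * pi * a) in cs cs' *; set ss := sin (2 * pi * a) in cs *.
      have -> : sin (2 * pi * `|a|) ^+ 2 = ss ^+ 2 by lra.
      have -> : (1 - r * cc) ^+ 2 + (r * ss) ^+ 2 = ss ^+ 2 + (r - cc) ^+ 2 + (1 - r ^+ 2) * (1 - (cc ^+ 2 + ss ^+ 2)) by ring.
      by rewrite cs subrr mulr0 addr0 lerDl sqr_ge0.
    apply: le_trans hS; apply: le_trans hs; rewrite ler_wpM2l ?(ltW s0) //; nra.
  have cneg : cos (2 * pi * a) <= 0.
    rewrite -ca -[2 * pi * _](subrK pi) cosDpi oppr_le0; apply: cos_ge0_pihalf.
    by apply/andP; split; nra.
  apply: (@le_trans _ _ 1); first by nra.
  rewrite -(ler_sqr _ _) ?nnegrE // Dsq expr1n.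
  apply: (@le_trans _ _ ((1 - r * cos (2 * pi * a)) ^+ 2)); last by rewrite lerDl sqr_ge0.
  by rewrite expr2; nra.
have hx : md x <= `|a| + `|b| by exact: md_le.
rewrite mulrC ler_pdivrMr ?addr_gt0 ?invr_gt0 //; apply: le_trans hx _.
rewrite mulrDr; apply: lerD; last by lra.
by rewrite ler_pdivlMr // mulrC.
Qed.

Definition N2 (k : nat) : C := (2 ^ k)%:R.

Lemma N2_neq0 k : N2 k != 0.
Proof. by rewrite pnatr_eq0 -lt0n expn_gt0. Qed.

Lemma md_N2 k : md (N2 k) = (2 ^ k)%:R.
Proof. by rewrite md_nat. Qed.

Lemma pow2_large (M : R) : exists K, forall k, (K <= k)%N -> M < (2 ^ k)%:R.
Proof.
exists (Num.bound `|M|) => k hk.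
apply: le_lt_trans (ler_norm M) _; apply: lt_trans (archi_boundP (normr_ge0 M)) _.
by rewrite ltr_nat; apply: leq_ltn_trans hk (ltn_expl _ _).
Qed.

Lemma N2V_cvg : ((N2 k)^-1 @[k --> \oo] --> (0 : C))%classic.
Proof.
apply/cvgnC => e e0; have [K hK] := pow2_large e^-1.
exists K => k /hK h; rewrite subr0 mdV md_N2.
by rewrite invf_plt ?posrE // ?ltr0n ?expn_gt0.
Qed.

Lemma N2_ee_cvg x : (N2 k * (ee (x / N2 k) - 1) @[k --> \oo] --> twopii * x)%classic.
Proof.
apply/cvgnC => e e0; pose m := md (twopii * x) + 1.
have m0 : 0 < m by rewrite ltr_wpDl ?md_ge0.
have e1 : 0 < e / m by rewrite divr_gt0.
have [r r0 hr] := @cexp_bound R _ e1.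
have [K hK] := pow2_large (m / r).
exists K => k /hK h.
have Nk : (0 : R) < (2 ^ k)%:R by rewrite ltr0n expn_gt0.
have -> : N2 k * (ee (x / N2 k) - 1) - twopii * x =
    N2 k * (cexp (twopii * x / N2 k) - 1 - twopii * x / N2 k).
  rewrite /ee mulrA; set u := cexp _; set v := twopii * x; field; exact: N2_neq0.
rewrite mdM md_N2; have := hr (twopii * x / N2 k); rewrite mdM mdV md_N2.
have xm : md (twopii * x) < m by rewrite ltrDl.
have xr : md (twopii * x) / (2 ^ k)%:R < r.
  by rewrite ltr_pdivrMr // [X in _ < X]mulrC; apply: lt_trans xm _; rewrite -ltr_pdivrMr.
move=> /(_ xr) h2; rewrite mulrC -ltr_pdivlMr //; apply: le_lt_trans h2 _.
rewrite mulrA ltr_pM2r ?invr_gt0 // mulrAC ltr_pdivrMr //.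
by rewrite ltr_pM2l.
Qed.

Arguments N2_ee_cvg : clear implicits.

Lemma ee_cvg1 x : (ee (x / N2 k) @[k --> \oo] --> (1 : C))%classic.
Proof.
pose proof (h := cvgC_D (cvgC_M N2V_cvg (N2_ee_cvg x)) (cvgC_cst 1)).
rewrite mul0r add0r in h; apply: cvg_trans h; apply: near_eq_cvg; apply: nearW => k /=.
by rewrite mulrA mulVf ?N2_neq0 // mul1r subrK.
Qed.

Arguments ee_cvg1 : clear implicits.

Section Duplication.
Variables (r : nat) (Phi : C -> C).
Hypothesis dup : forall w, w ^+ 2 != 1 -> Phi w + Phi (- w) = 2 ^+ r * Phi (w ^+ 2).

(** Divided by 2^(k + 1), the points z + j and z + j + 2^k differ by 1 / 2, so [ee] sends them to w
    and - w; the duplication formula merges the pair into one point of level k. *)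
Lemma dupl_sum k z : ee z != 1 ->
  \sum_(j < 2 ^ k) Phi (ee ((z + j%:R) / N2 k)) = (2 ^+ r) ^+ k * Phi (ee z).
Proof.
move=> hz; elim: k => [|k IH].
  by rewrite expn0 big_ord1 expr0 mul1r addr0 /N2 expn0 divr1.
rewrite expnS mul2n -addnn big_split_ord /= -big_split /= exprS -mulrA -IH mulr_sumr.
apply: eq_bigr => j _; set w := ee ((z + j%:R) / N2 k.+1).
have N2S : N2 k.+1 = 2 * N2 k by rewrite /N2 expnS natrM.
have w2 : w ^+ 2 = ee ((z + j%:R) / N2 k).
  by rewrite /w -eeMn N2S; congr ee; field; exact: N2_neq0.
have -> : ee ((z + (2 ^ k + j)%:R) / N2 k.+1) = - w.
  have -> : (z + (2 ^ k + j)%:R) / N2 k.+1 = (z + j%:R) / N2 k.+1 + 2^-1.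
    by rewrite N2S natrD -/(N2 k); field; exact: N2_neq0.
  by rewrite eeD ee_half mulrN1.
rewrite dup w2 //; apply: contra_neq hz => h1.
have : ee ((z + j%:R) / N2 k) ^+ (2 ^ k) = 1 by rewrite h1 expr1n.
by rewrite -eeMn -/(N2 k) divfK ?N2_neq0 // eeD ee_natr mulr1.
Qed.

End Duplication.

(** Periodicity allows representatives of the residues placed symmetrically about 0, so that i and -
    i can be paired; the residue halfway around has no partner. *)
Lemma sym_sum (f : C -> C) (m : nat) z : (forall x, f (x + 1) = f x) ->
  \sum_(j < m.+1 + m.+1) f ((z + j%:R) / (m.+1 + m.+1)%:R) =
  f (z / (m.+1 + m.+1)%:R) +
  \sum_(i < m) (f ((z + i.+1%:R) / (m.+1 + m.+1)%:R) + f ((z - i.+1%:R) / (m.+1 + m.+1)%:R))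
  + f ((z - m.+1%:R) / (m.+1 + m.+1)%:R).
Proof.
move=> per; set N : C := (m.+1 + m.+1)%:R.
have N0 : N != 0 by rewrite pnatr_eq0.
rewrite big_split_ord /= big_ord_recl /= addr0 big_split /= -!addrA; congr (_ + (_ + _)).
rewrite (reindex_inj rev_ord_inj) /= big_ord_recr /= subSS subnn addn0; congr (_ + _).
  apply: eq_bigr => i _; rewrite -[RHS]per; congr f.
  have -> : (m.+1 + (m.+1 - i.+1))%:R = N - i.+1%:R :> C.
    rewrite -natrB; last by have := ltn_ord i; lia.
    by congr (_%:R); have := ltn_ord i; lia.
  by field.
rewrite -[RHS]per; congr f.
have -> : (m.+1 : nat)%:R = N - m.+1%:R :> C by rewrite /N natrD addrK.
by field.
Qed.

(** The pairing of i with - i provides the majorant 1 / i^2 even for r = 1, where single terms decay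
    only like 1 / i. *)
Lemma lip_limit (f : C -> C) (r : nat) (K z : C) (B : R) : 0 <= B ->
  (\forall k \near \oo%classic, forall i, (i.+1 < 2 ^ k)%N ->
     md ((N2 k.+1)^-1 ^+ r * (f ((z + i.+1%:R) / N2 k.+1) + f ((z - i.+1%:R) / N2 k.+1)))
       <= B * (i.+1%:R ^+ 2)^-1) ->
  (forall x, x != 0 -> ((N2 k.+1)^-1 ^+ r * f (x / N2 k.+1) @[k --> \oo] --> K * x^-1 ^+ r)%classic) ->
  (forall i, z + i.+1%:R != 0 /\ z - i.+1%:R != 0) ->
  let l i := K * ((z + i.+1%:R)^-1 ^+ r + (z - i.+1%:R)^-1 ^+ r) in
  asum l /\
  (\sum_(i < (2 ^ k).-1) (N2 k.+1)^-1 ^+ r *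
     (f ((z + i.+1%:R) / N2 k.+1) + f ((z - i.+1%:R) / N2 k.+1)) @[k --> \oo] --> csum l)%classic.
Proof.
move=> B0 hb hp hz l.
pose t k i := if (i < (2 ^ k).-1)%N then (N2 k.+1)^-1 ^+ r *
  (f ((z + i.+1%:R) / N2 k.+1) + f ((z - i.+1%:R) / N2 k.+1)) else 0.
have [||al hl] := @tannery R nat \oo%classic _ t l _ (summableZ B0 (summable_inv2 R)).
- apply: filterS hb => k hk i; rewrite /t; case: ifP => hi.
    by apply: hk; have := expn_gt0 2 k; lia.
  by rewrite md0 mulr_ge0 // invr_ge0 sqr_ge0.
- move=> i; rewrite /l mulrDr.
  have [h1 h2] := hz i.
  pose proof (h := cvgC_D (hp _ h1) (hp _ h2)).
  apply: cvg_trans h; apply: near_eq_cvg; exists i.+1 => // k /= hk.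
  rewrite /t; have : (i < (2 ^ k).-1)%N by have := @ltn_expl 2 k isT; lia.
  by move=> ->; rewrite mulrDr.
split=> //; apply: cvg_trans hl; apply: near_eq_cvg; apply: nearW => k /=.
rewrite (@csum_finite R _ (2 ^ k).-1); first by apply: eq_bigr => i _; rewrite /t ltn_ord.
by move=> n hn; rewrite /t ltnNge hn.
Qed.

(** The modulus of z + t is at least that of the imaginary part of z and at least [|t|] minus the
    modulus of z. The first bound serves for small t, the second for large t. *)
Lemma lattice_lower z : 0 < `|complex.Im z| -> exists2 d : R, 0 < d &
  forall t : R, d * `|t| <= md (z + t%:C%C).
Proof.
move=> h; set y := `|complex.Im z| in h; have m0 := md_ge0 z.
exists (2 + 2 * md z / y)^-1; first by rewrite invr_gt0 ltr_pwDl // divr_ge0 ?mulr_ge0 // ltW.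
move=> t; set D := md (z + t%:C%C).
have h1 : y <= D by have := md_Im (z + t%:C%C); rewrite cImD /= addr0.
have h2 : `|t| - md z <= D.
  by have := md_tri (t%:C%C) (- z); rewrite opprK mdN md_real (addrC _ z).
have D0 : 0 < D by apply: lt_le_trans h1.
have q0 : 0 <= 2 * md z / y by rewrite divr_ge0 ?mulr_ge0 // ltW.
rewrite mulrC ler_pdivrMr; last by lra.
have [ht|ht] := leP (2 * md z) `|t|; first by nra.
rewrite mulrDr; apply: le_trans (ltW ht) _.
apply: (@le_trans _ _ (D * (2 * md z / y))); last by lra.
rewrite mulrCA -[X in X <= _]mulr1 ler_wpM2l ?mulr_ge0 //.
by rewrite ler_pdivlMr // mul1r.
Qed.

(* Both functions satisfy a duplication formula Phi w + Phi (- w) = 2 ^ r Phi (w ^ 2); iterating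
   it k times and letting k tend to infinity gives their partial fraction expansions. *)
Definition Phi2 w : C := w / (1 - w) ^+ 2.
Definition Phi1 w : C := (w + 1) / (w - 1).

Lemma sqr_neq1 w : w ^+ 2 != 1 -> (1 - w != 0) /\ (1 + w != 0).
Proof.
move=> h; split; apply: contra_neq h => h.
  by have -> : w = 1 by [apply/eqP; rewrite eq_sym -subr_eq0 h]; rewrite expr1n.
by have -> : w = -1 by [apply/eqP; rewrite -addr_eq0 addrC h]; rewrite sqrrN expr1n.
Qed.

Lemma dup2 w : w ^+ 2 != 1 -> Phi2 w + Phi2 (- w) = 2 ^+ 2 * Phi2 (w ^+ 2).
Proof.
move=> h; have [h1 h2] := sqr_neq1 h; rewrite /Phi2 opprK.
have -> : 1 - w ^+ 2 = (1 - w) * (1 + w) by ring.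
by field; rewrite h1 h2.
Qed.

Lemma dup1 w : w ^+ 2 != 1 -> Phi1 w + Phi1 (- w) = 2 ^+ 1 * Phi1 (w ^+ 2).
Proof.
move=> h; have [h1 h2] := sqr_neq1 h; rewrite /Phi1.
have -> : w ^+ 2 - 1 = - (1 - w) * (1 + w) by ring.
have h3 : w - 1 != 0 by rewrite -oppr_eq0 opprB.
have h4 : - w - 1 != 0 by rewrite -oppr_eq0 opprB opprK addrC addrC.
have h5 : w + 1 != 0 by rewrite addrC.
by field; rewrite h1 h2 h3 ?h4 ?h5.
Qed.

End Lipschitz.

(** * Partial fractions, zeta(2) and the exchange of summation *)

Section E2Law.
Variable R : realType.
Local Notation C := (CC R).
Local Notation twopii := (twopii R).
Local Notation upper_half := (@upper_half R).
Local Notation N2 := (@N2 R).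
Implicit Types (x y z w tau : C).

Lemma cvgC_S (u : nat -> C) (l : C) :
  (u k @[k --> \oo] --> l)%classic -> (u k.+1 @[k --> \oo] --> l)%classic.
Proof. by move=> /cvgnC h; apply/cvgnC => e /h[N hN]; exists N => n hn; apply: hN; lia. Qed.

(** This separation from the nonzero integers holds on the upper half-plane and also at z = 0, so
    that one limit argument gives both the partial fractions and zeta(2). *)
Definition far z (d : R) := forall i : nat,
  d * i.+1%:R <= md (z + i.+1%:R) /\ d * i.+1%:R <= md (z - i.+1%:R).

Lemma far_upper z : upper_half z -> exists2 d : R, 0 < d & far z d.
Proof.
move=> hz; have [|d d0 h] := @lattice_lower R z; first by rewrite gtr0_norm.
exists d => // i; split; first by have := h i.+1%:R; rewrite natC ger0_norm.
by have := h (- i.+1%:R); rewrite natC normrN ger0_norm // rmorphN.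
Qed.

Lemma far0 : far 0 1.
Proof. by move=> i; rewrite add0r sub0r mdN md_nat mul1r. Qed.

Lemma divN2_bounds z k i : 4 * md z < (2 ^ k.+1)%:R -> (i.+1 < 2 ^ k)%N ->
  forall s : C, s = i.+1%:R \/ s = - i.+1%:R ->
  `|complex.Re ((z + s) / N2 k.+1)| <= 3 / 4 /\ `|complex.Im ((z + s) / N2 k.+1)| <= 1.
Proof.
move=> hz hi s hs; set n : R := (2 ^ k.+1)%:R in hz *.
have n0 : 0 < n by rewrite ltr0n expn_gt0.
have hi' : i.+1%:R <= n / 2.
  by rewrite ler_pdivlMr // /n -natrM ler_nat expnS; lia.
have e : (N2 k.+1)^-1 = (n^-1)%:C%C :> C by rewrite /N2 natC fmorphV.
rewrite e cReM cImM /= mulr0 subr0 mulr0 add0r !normrM !(@ger0_norm _ n^-1) ?invr_ge0 ?(ltW n0) //.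
have hRe : `|complex.Re (z + s)| <= md z + i.+1%:R.
  rewrite cReD; apply: le_trans (ler_normD _ _) _; apply: lerD; first exact: md_Re.
  by case: hs => ->; rewrite ?cReN natC /= ?normrN ger0_norm.
have hIm : `|complex.Im (z + s)| <= md z.
  rewrite cImD; have -> : complex.Im s = 0 by case: hs => ->; rewrite ?cImN natC /= ?oppr0.
  by rewrite addr0; exact: md_Im.
have m0 := md_ge0 z.
by rewrite !ler_pdivrMr //; split; lra.
Qed.

Lemma near_N2 (M : R) : \forall k \near \oo%classic, M < (2 ^ k.+1)%:R.
Proof. by have [K hK] := @pow2_large R M; exists K => // k /= hk; apply: hK; lia. Qed.

Lemma lower_far z d : 0 < d -> far z d -> exists2 c : R, 0 < c & forall k i,
  4 * md z < (2 ^ k.+1)%:R -> (i.+1 < 2 ^ k)%N ->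
  c * i.+1%:R / (2 ^ k.+1)%:R <= md (1 - ee ((z + i.+1%:R) / N2 k.+1)) /\
  c * i.+1%:R / (2 ^ k.+1)%:R <= md (1 - ee ((z - i.+1%:R) / N2 k.+1)).
Proof.
move=> d0 hd; have [c c0 hc] := ee_lower R; exists (c * d); first by rewrite mulr_gt0.
move=> k i hz hi; have n0 : (0 : R) < (2 ^ k.+1)%:R by rewrite ltr0n expn_gt0.
have [h1 h2] := hd i; split.
  have [b1 b2] := divN2_bounds hz hi (or_introl (erefl _)).
  apply: le_trans (hc _ b1 b2); rewrite mdM mdV md_N2 mulrA ler_pM2r ?invr_gt0 //.
  by rewrite -mulrA ler_pM2l.
have [b1 b2] := divN2_bounds hz hi (or_intror (erefl _)).
apply: le_trans (hc _ b1 b2); rewrite mdM mdV md_N2 mulrA ler_pM2r ?invr_gt0 //.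
by rewrite -mulrA ler_pM2l.
Qed.

Lemma far_neq0 z d : 0 < d -> far z d -> forall i : nat, z + i.+1%:R != 0 /\ z - i.+1%:R != 0.
Proof.
move=> d0 hd i; have [h1 h2] := hd i; rewrite -!md_gt0.
by split; [apply: lt_le_trans h1|apply: lt_le_trans h2]; rewrite mulr_gt0 ?ltr0n.
Qed.

Definition U2 z := csum (fun i : nat => (z + i.+1%:R)^-1 ^+ 2 + (z - i.+1%:R)^-1 ^+ 2).
Definition U1 z := csum (fun i : nat => (z + i.+1%:R)^-1 ^+ 1 + (z - i.+1%:R)^-1 ^+ 1).

Lemma point2 x : x != 0 ->
  ((N2 k.+1)^-1 ^+ 2 * Phi2 (ee (x / N2 k.+1)) @[k --> \oo] --> (twopii^-1) ^+ 2 * x^-1 ^+ 2)%classic.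
Proof.
move=> x0; have tx : twopii * x != 0 by rewrite mulf_neq0 ?twopii_neq0.
pose proof (hV := cvgC_V tx (@N2_ee_cvg R x)).
pose proof (h := cvgC_M (@ee_cvg1 R x) (cvgC_M hV hV)).
have -> : (twopii^-1) ^+ 2 * x^-1 ^+ 2 = 1 * ((twopii * x)^-1 * (twopii * x)^-1).
  by rewrite mul1r -expr2 invfM exprMn.
apply: (cvgC_S (u := fun k => (N2 k)^-1 ^+ 2 * Phi2 (ee (x / N2 k)))).
apply: cvg_trans h; apply: near_eq_cvg; apply: nearW => k /=.
rewrite /Phi2 invfM; set e := ee _.
have -> : (1 - e) ^+ 2 = (e - 1) ^+ 2 by ring.
rewrite -exprVn; ring.
Qed.

Lemma point1 x : x != 0 ->
  ((N2 k.+1)^-1 ^+ 1 * Phi1 (ee (x / N2 k.+1)) @[k --> \oo] --> (2 / twopii) * x^-1 ^+ 1)%classic.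
Proof.
move=> x0; have tx : twopii * x != 0 by rewrite mulf_neq0 ?twopii_neq0.
pose proof (hV := cvgC_V tx (@N2_ee_cvg R x)).
pose proof (h := cvgC_M (cvgC_D (@ee_cvg1 R x) (cvgC_cst 1)) hV).
have -> : 2 / twopii * x^-1 ^+ 1 = (1 + 1) * (twopii * x)^-1.
  by rewrite expr1 invfM; ring.
apply: (cvgC_S (u := fun k => (N2 k)^-1 ^+ 1 * Phi1 (ee (x / N2 k)))).
apply: cvg_trans h; apply: near_eq_cvg; apply: nearW => k /=.
rewrite invfM expr1 /Phi1; ring.
Qed.

Lemma bound2 z d : 0 < d -> far z d -> exists2 B : R, 0 <= B &
  \forall k \near \oo%classic, forall i, (i.+1 < 2 ^ k)%N ->
   md ((N2 k.+1)^-1 ^+ 2 * (Phi2 (ee ((z + i.+1%:R) / N2 k.+1)) + Phi2 (ee ((z - i.+1%:R) / N2 k.+1))))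
       <= B * (i.+1%:R ^+ 2)^-1.
Proof.
move=> d0 hd; have [c c0 hc] := lower_far d0 hd.
exists (2 * (expR (2 * pi) / c ^+ 2)).
  by rewrite mulr_ge0 // divr_ge0 ?expR_ge0 ?sqr_ge0.
apply: filterS (near_N2 (4 * md z)) => k hk i hi.
set n : R := (2 ^ k.+1)%:R in hk *; have n0 : 0 < n by rewrite ltr0n expn_gt0.
have j0 : (0 : R) < i.+1%:R by rewrite ltr0n.
have [h1 h2] := hc k i hk hi.
have key s : s = i.+1%:R \/ s = - i.+1%:R ->
    c * i.+1%:R / n <= md (1 - ee ((z + s) / N2 k.+1)) ->
    n ^- 2 * md (Phi2 (ee ((z + s) / N2 k.+1))) <= expR (2 * pi) / c ^+ 2 * (i.+1%:R ^+ 2)^-1.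
  move=> hs hl; have [_ b2] := divN2_bounds hk hi hs.
  have q0 : 0 < c * i.+1%:R / n by rewrite divr_gt0 ?mulr_gt0.
  rewrite /Phi2 mdM mdV mdX md_ee; set E := expR _; set D := md _ in hl *.
  (* The imaginary part of the argument is at least -1, which bounds the numerator of [Phi2]. *)
  have hE : E <= expR (2 * pi).
    rewrite /E ler_expR; have := pi_gt0 R; move: b2; rewrite ler_norml => /andP[]; nra.
  have D0 : 0 < D by apply: lt_le_trans hl.
  have -> : expR (2 * pi) / c ^+ 2 * (i.+1%:R ^+ 2)^-1 = n ^- 2 * (expR (2 * pi) / (c * i.+1%:R / n) ^+ 2).
    by field; rewrite !gt_eqF.
  rewrite ler_wpM2l ?invr_ge0 ?sqr_ge0 //; apply: ler_pM => //.
  - exact: expR_ge0.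
  - by rewrite invr_ge0 sqr_ge0.
  - by rewrite lef_pV2 ?posrE ?exprn_gt0 // ler_sqr ?nnegrE // ltW.
rewrite mdM mdX mdV md_N2 exprVn; apply: le_trans (ler_wpM2l _ (mdD _ _)) _.
  by rewrite invr_ge0 sqr_ge0.
rewrite mulrDr.
have -> : 2 * (expR (2 * pi) / c ^+ 2) / i.+1%:R ^+ 2 = expR (2 * pi) / c ^+ 2 * (i.+1%:R ^+ 2)^-1 + expR (2 * pi) / c ^+ 2 * (i.+1%:R ^+ 2)^-1 by ring.
apply: lerD.
  by apply: key h1; left.
by apply: key h2; right.
Qed.

(** The integer i cancels in the product u v = [ee (2 z / N)], which is therefore within O(1 / N) of
    1; and Phi1 u + Phi1 v = 2 (u v - 1) / ((u - 1) (v - 1)) turns this into the extra order of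
    decay. *)
Lemma bound1 z d : 0 < d -> far z d -> exists2 B : R, 0 <= B &
  \forall k \near \oo%classic, forall i, (i.+1 < 2 ^ k)%N ->
   md ((N2 k.+1)^-1 ^+ 1 * (Phi1 (ee ((z + i.+1%:R) / N2 k.+1)) + Phi1 (ee ((z - i.+1%:R) / N2 k.+1))))
       <= B * (i.+1%:R ^+ 2)^-1.
Proof.
move=> d0 hd; have [c c0 hc] := lower_far d0 hd.
have [r r0 hr] := @cexp_bound R 1 ltr01.
set w := twopii * (2 * z); have w0 := md_ge0 w.
exists (4 * md w / c ^+ 2); first by rewrite divr_ge0 ?sqr_ge0 // mulr_ge0.
apply: filterS2 (near_N2 (4 * md z)) (near_N2 (md w / r)) => k hk hk2 i hi.
set n : R := (2 ^ k.+1)%:R in hk hk2 *; have n0 : 0 < n by rewrite ltr0n expn_gt0.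
have j0 : (0 : R) < i.+1%:R by rewrite ltr0n.
have [h1 h2] := hc k i hk hi; rewrite -/n in h1 h2.
have q0 : 0 < c * i.+1%:R / n by rewrite divr_gt0 ?mulr_gt0.
set u := ee _ in h1 *; set v := ee ((z - _) / _) in h2 *.
have uv : u * v = cexp (w / N2 k.+1).
  by rewrite /u /v -eeD /ee; congr cexp; rewrite /w; ring.
have uvb : md (u * v - 1) <= 2 * md w / n.
  have hw : md (w / N2 k.+1) < r.
    by rewrite mdM mdV md_N2 ltr_pdivrMr // mulrC -ltr_pdivrMr.
  have := hr _ hw; rewrite -uv; set x := w / N2 k.+1 in hw *; move=> h.
  have mx : md x = md w / n by rewrite mdM mdV md_N2.
  have -> : u * v - 1 = (u * v - 1 - x) + x by ring.
  by apply: le_trans (mdD _ _) _; rewrite mx in h *; lra.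
have u1 : u - 1 != 0.
  by rewrite -md_gt0 mdB; apply: lt_le_trans h1.
have v1 : v - 1 != 0.
  by rewrite -md_gt0 mdB; apply: lt_le_trans h2.
have -> : Phi1 u + Phi1 v = 2 * (u * v - 1) / ((u - 1) * (v - 1)).
  by rewrite /Phi1; field; rewrite u1 v1.
rewrite expr1 mdM mdV md_N2 -/n mdM mdM md_nat mdV mdM [md (u - 1)]mdB [md (v - 1)]mdB.
have -> : 4 * md w / c ^+ 2 * (i.+1%:R ^+ 2)^-1 =
    n^-1 * (2 * (2 * md w / n) / ((c * i.+1%:R / n) * (c * i.+1%:R / n))).
  by field; rewrite !gt_eqF.
rewrite ler_wpM2l ?invr_ge0 ?(ltW n0) //; apply: ler_pM.
- by rewrite mulr_ge0 ?md_ge0.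
- by rewrite invr_ge0 mulr_ge0 ?md_ge0.
- by rewrite ler_wpM2l.
- have p1 : 0 < md (1 - u) by apply: lt_le_trans h1.
  have p2 : 0 < md (1 - v) by apply: lt_le_trans h2.
  rewrite lef_pV2; [|by rewrite posrE mulr_gt0|by rewrite posrE mulr_gt0].
  by apply: ler_pM; [exact: ltW|exact: ltW|exact: h1|exact: h2].
Qed.

Lemma ee_upper_neq1 z : upper_half z -> ee z != 1.
Proof.
move=> hz; apply/eqP => h; have := md_ee z; rewrite h md1 => /esym h1.
have : expR (- (2 * pi * complex.Im z)) < 1.
  by rewrite expR_lt1 oppr_lt0 !mulr_gt0 ?pi_gt0.
by rewrite h1 ltxx.
Qed.

(** The 2^(k + 1) points of the iterated duplication formula split into the central one, with limit
    K, the symmetric pairs, with limit L, and the halfway one near -1, whose contribution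
    vanishes. *)
Lemma lip_general (Phi : C -> C) (r : nat) (K L z : C) :
  (forall w, w ^+ 2 != 1 -> Phi w + Phi (- w) = 2 ^+ r * Phi (w ^+ 2)) ->
  upper_half z ->
  ((N2 k.+1)^-1 ^+ r * Phi (ee (z / N2 k.+1)) @[k --> \oo] --> K)%classic ->
  ((N2 k.+1)^-1 ^+ r * Phi (- ee (z / N2 k.+1)) @[k --> \oo] --> (0 : C))%classic ->
  (\sum_(i < (2 ^ k).-1) (N2 k.+1)^-1 ^+ r *
     (Phi (ee ((z + i.+1%:R) / N2 k.+1)) + Phi (ee ((z - i.+1%:R) / N2 k.+1)))
       @[k --> \oo] --> L)%classic ->
  Phi (ee z) = K + L.
Proof.
move=> dup hz h1 h2 h3.
pose proof (h := cvgC_D (cvgC_D h1 h3) h2); rewrite addr0 in h.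
apply: (cvgC_uniq (F := \oo%classic) (f := fun=> Phi (ee z))); first exact: cvgC_cst.
apply: cvg_trans h; apply: near_eq_cvg; apply: nearW => k /=.
have e : Phi (ee z) = (N2 k.+1)^-1 ^+ r * \sum_(j < 2 ^ k.+1) Phi (ee ((z + j%:R) / N2 k.+1)).
  rewrite (dupl_sum dup k.+1 (ee_upper_neq1 hz)) mulrA.
  have -> : (2 ^+ r) ^+ k.+1 = N2 k.+1 ^+ r :> C by rewrite /N2 natrX exprAC.
  by rewrite -exprMn mulVf ?N2_neq0 // expr1n mul1r.
have [m hm] : exists m, (2 ^ k = m.+1)%N by exists (2 ^ k).-1; rewrite prednK ?expn_gt0.
have per x : Phi (ee (x + 1)) = Phi (ee x) by rewrite eeD ee1 mulr1.
have hN : N2 k.+1 = (m.+1 + m.+1)%:R by rewrite /N2 expnS mul2n -addnn hm.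
have := sym_sum m z (f := fun x => Phi (ee x)) per.
rewrite -hN => hs.
have es : \sum_(j < 2 ^ k.+1) Phi (ee ((z + j%:R) / N2 k.+1)) =
    \sum_(j < m.+1 + m.+1) Phi (ee ((z + j%:R) / N2 k.+1)).
  by rewrite expnS mul2n -addnn hm.
rewrite e es hs hm /= -mulr_sumr -!mulrDr; congr (_ * (_ + Phi _)).
have -> : (z - m.+1%:R) / N2 k.+1 = z / N2 k.+1 - 2^-1.
  have -> : N2 k.+1 = 2 * m.+1%:R by rewrite hN natrD; ring.
  have M0 : (m.+1%:R : C) != 0 by rewrite pnatr_eq0.
  by field.
by rewrite eeD eeN ee_half invrN1 mulrN1.
Qed.

Lemma N2S_cvg0 r : ((N2 k.+1)^-1 ^+ r.+1 @[k --> \oo] --> (0 : C))%classic.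
Proof.
elim: r => [|r IH]; first by under eq_fun do rewrite expr1; exact: (cvgC_S (@N2V_cvg R)).
pose proof (h := cvgC_M (cvgC_S (@N2V_cvg R)) IH); rewrite mul0r in h.
by under eq_fun do rewrite exprS.
Qed.
Arguments N2S_cvg0 : clear implicits.

Lemma asum_unscale (K : C) u : K != 0 -> asum (fun i => K * u i) -> asum u.
Proof.
move=> K0 h; have := asumZ K^-1 h; congr asum; apply/funext => i.
by rewrite mulrA mulVf // mul1r.
Qed.

(** The left-hand side is pi^2 / sin^2 (pi z), written in e^(2 pi i z). *)
Lemma lipschitz2 z : upper_half z ->
  asum (fun i : nat => (z + i.+1%:R)^-1 ^+ 2 + (z - i.+1%:R)^-1 ^+ 2) /\
  twopii ^+ 2 * Phi2 (ee z) = z^-1 ^+ 2 + U2 z.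
Proof.
move=> hz; have [d d0 hd] := far_upper hz; have [B B0 hB] := bound2 d0 hd.
have [al hl] := lip_limit (f := fun x => Phi2 (ee x)) B0 hB point2 (far_neq0 d0 hd).
have K0 : (twopii^-1) ^+ 2 != 0 by rewrite expf_neq0 // invr_eq0 twopii_neq0.
have al' := asum_unscale K0 al; split=> //.
rewrite csumZ // -/(U2 z) in hl.
have h0 : ((N2 k.+1)^-1 ^+ 2 * Phi2 (- ee (z / N2 k.+1)) @[k --> \oo] --> (0 : C))%classic.
  have two0 : (1 - -1 : C) != 0 by rewrite opprK -(natrD _ 1 1) pnatr_eq0.
  pose proof (h1 := cvgC_Z (-1) (cvgC_S (@ee_cvg1 R z))); rewrite mulr1 in h1.
  pose proof (h2 := cvgC_Z (-1) h1).
  rewrite mulrN1 in h2.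
  pose proof (h3 := cvgC_V two0 (cvgC_D (cvgC_cst 1) h2)).
  pose proof (h4 := cvgC_M (N2S_cvg0 1) (cvgC_M h1 (cvgC_M h3 h3))).
  rewrite mul0r in h4; apply: cvg_trans h4; apply: near_eq_cvg; apply: nearW => k /=.
  by rewrite /Phi2 !mulN1r -exprVn expr2.
have := @lip_general (@Phi2 R) 2 _ _ z (@dup2 R) hz (point2 (upper_neq0 hz)) h0 hl.
move=> ->; rewrite -mulrDr mulrA -exprMn divff ?twopii_neq0 // expr1n mul1r.
by [].
Qed.

(** The left-hand side is pi cot (pi z), written in e^(2 pi i z). *)
Lemma lipschitz1 z : upper_half z ->
  asum (fun i : nat => (z + i.+1%:R)^-1 ^+ 1 + (z - i.+1%:R)^-1 ^+ 1) /\
  twopii / 2 * Phi1 (ee z) = z^-1 + U1 z.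
Proof.
move=> hz; have [d d0 hd] := far_upper hz; have [B B0 hB] := bound1 d0 hd.
have [al hl] := lip_limit (f := fun x => Phi1 (ee x)) B0 hB point1 (far_neq0 d0 hd).
have two0 : (2 : C) != 0 by rewrite pnatr_eq0.
have K0 : 2 / twopii != 0 by rewrite mulf_neq0 ?invr_eq0 ?twopii_neq0.
have al' := asum_unscale K0 al; split=> //.
rewrite csumZ // -/(U1 z) in hl.
have h0 : ((N2 k.+1)^-1 ^+ 1 * Phi1 (- ee (z / N2 k.+1)) @[k --> \oo] --> (0 : C))%classic.
  have t0 : (-1 + -1 : C) != 0 by rewrite -opprD oppr_eq0 -(natrD _ 1 1) pnatr_eq0.
  pose proof (h1 := cvgC_Z (-1) (cvgC_S (@ee_cvg1 R z))); rewrite mulr1 in h1.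
  pose proof (h3 := cvgC_V t0 (cvgC_D h1 (cvgC_cst (-1)))).
  pose proof (h4 := cvgC_M (N2S_cvg0 0) (cvgC_M (cvgC_D h1 (cvgC_cst 1)) h3)).
  rewrite mul0r in h4; apply: cvg_trans h4; apply: near_eq_cvg; apply: nearW => k /=.
  by rewrite /Phi1 !mulN1r.
have := @lip_general (@Phi1 R) 1 _ _ z (@dup1 R) hz (point1 (upper_neq0 hz)) h0 hl.
move=> ->; rewrite -mulrDr mulrA expr1.
have -> : twopii / 2 * (2 / twopii) = 1 by field; exact: twopii_neq0.
by rewrite mul1r.
Qed.

Lemma Phi2_1 : Phi2 (1 : C) = 0.
Proof. by rewrite /Phi2 subrr expr2 mulr0 invr0 mulr0. Qed.

Lemma Phi2_N1 : Phi2 (-1 : C) = - 4^-1.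
Proof. by rewrite /Phi2 opprK -[1 + 1]/(2%:R : C); field. Qed.

(* The term j = 0 vanishes because Phi2 1 = 1 / 0 = 0. *)
Lemma zeta_sum k : \sum_(j < 2 ^ k) Phi2 (ee ((0 + j%:R) / N2 k)) = - (4 ^+ k - 1) / 12.
Proof.
elim: k => [|k IH].
  by rewrite expn0 big_ord1 addr0 mul0r ee0 Phi2_1 expr0 subrr oppr0 mul0r.
rewrite expnS mul2n -addnn big_split_ord /= -big_split /=.
have N2S : N2 k.+1 = 2 * N2 k by rewrite /N2 expnS natrM.
have e (j : 'I_(2 ^ k)) : Phi2 (ee ((0 + j%:R) / N2 k.+1)) + Phi2 (ee ((0 + (2 ^ k + j)%:R) / N2 k.+1)) =
    4 * Phi2 (ee ((0 + j%:R) / N2 k)) - (if (j : nat) == 0%N then 4^-1 else 0).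
  rewrite !add0r; set w := ee (j%:R / N2 k.+1).
  have w2 : ee (j%:R / N2 k) = w ^+ 2.
    by rewrite /w -eeMn N2S; congr ee; field; exact: N2_neq0.
  have -> : ee ((2 ^ k + j)%:R / N2 k.+1) = - w.
    have -> : (2 ^ k + j)%:R / N2 k.+1 = j%:R / N2 k.+1 + 2^-1.
      by rewrite N2S natrD -/(N2 k); field; exact: N2_neq0.
    by rewrite eeD ee_half mulrN1.
  rewrite w2; case: eqP => [j0|/eqP j0].
    have -> : w = 1 by rewrite /w j0 mul0r ee0.
    by rewrite expr1n Phi2_1 Phi2_N1 mulr0 !add0r.
  rewrite dup2 ?subr0 //; first by congr (_ * _); ring.
  rewrite -w2; apply/eqP => /cexp_eq1[n hn].
  have : (j%:R : C) = n%:~R * N2 k by rewrite -hn divfK // N2_neq0.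
  rewrite /N2 => hj.
  have /intr_inj h : ((j : nat)%:Z)%:~R = (n * (2 ^ k)%N%:Z)%:~R :> C.
    by rewrite intrM -!pmulrn.
  have := ltn_ord j; have : (j > 0)%N by rewrite lt0n.
  move: h; case: n {hn hj} => n; last by lia.
  by rewrite -PoszM => -[->]; case: n => [|n]; nia.
rewrite (eq_bigr _ (fun j _ => e j)) sumrB -mulr_sumr IH.
have -> : \sum_(j < 2 ^ k) (if (j : nat) == 0%N then 4^-1 else 0) = 4^-1 :> C.
  have [m hm] : exists m, (2 ^ k = m.+1)%N by exists (2 ^ k).-1; rewrite prednK ?expn_gt0.
  by rewrite hm big_ord_recl /= big1 ?addr0.
by rewrite exprS; field.
Qed.

(** [U2 0] is 2 zeta(2), so this is the value pi^2 / 6. At z = 0 the iterated duplication formula is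
    blocked by the pole, and the exact finite sum of [zeta_sum] takes its place. *)
Lemma zeta2 : asum (fun i : nat => (0 + i.+1%:R)^-1 ^+ 2 + (0 - i.+1%:R)^-1 ^+ 2 : C) /\
  U2 0 = - twopii ^+ 2 / 12.
Proof.
have [B B0 hB] := bound2 ltr01 far0.
have [al hl] := lip_limit (f := fun x => Phi2 (ee x)) B0 hB point2 (far_neq0 ltr01 far0).
have K0 : (twopii^-1) ^+ 2 != 0 by rewrite expf_neq0 // invr_eq0 twopii_neq0.
have al' := asum_unscale K0 al; split=> //.
rewrite csumZ // -/(U2 0) in hl.
suff h : (twopii^-1) ^+ 2 * U2 0 = - 12^-1.
  have -> : U2 0 = twopii ^+ 2 * ((twopii^-1) ^+ 2 * U2 0).
    by rewrite mulrA -exprMn divff ?twopii_neq0 // expr1n mul1r.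
  by rewrite h; ring.
apply: (cvgC_uniq hl).
have h1 : (- 12^-1 + 3^-1 * ((N2 k.+1)^-1 ^+ 2) @[k --> \oo] --> (- 12^-1 : C))%classic.
  by pose proof (h := cvgC_D (cvgC_cst (- 12^-1)) (cvgC_Z 3^-1 (N2S_cvg0 1)));
     rewrite mulr0 addr0 in h.
apply: cvg_trans h1; apply: near_eq_cvg; apply: nearW => k /=.
have [m hm] : exists m, (2 ^ k = m.+1)%N by exists (2 ^ k).-1; rewrite prednK ?expn_gt0.
have per x : Phi2 (ee (x + 1)) = Phi2 (ee x) by rewrite eeD ee1 mulr1.
have hN : N2 k.+1 = (m.+1 + m.+1)%:R by rewrite /N2 expnS mul2n -addnn hm.
have := sym_sum m 0 (f := fun x => Phi2 (ee x)) per.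
rewrite -hN => hs.
have es : \sum_(j < 2 ^ k.+1) Phi2 (ee ((0 + j%:R) / N2 k.+1)) =
    \sum_(j < m.+1 + m.+1) Phi2 (ee ((0 + j%:R) / N2 k.+1)).
  by rewrite expnS mul2n -addnn hm.
rewrite -mulr_sumr hm /=.
set S := \sum_(i < m) _ in hs *.
have e1 : Phi2 (ee (0 / N2 k.+1)) = 0 by rewrite mul0r ee0 Phi2_1.
have e2 : Phi2 (ee ((0 - m.+1%:R) / N2 k.+1)) = - 4^-1.
  have -> : (0 - m.+1%:R) / N2 k.+1 = - 2^-1.
    have -> : N2 k.+1 = 2 * m.+1%:R by rewrite hN natrD; ring.
    have M0 : (m.+1%:R : C) != 0 by rewrite pnatr_eq0.
    by field.
  by rewrite eeN ee_half invrN1 Phi2_N1.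
rewrite e1 e2 add0r -es zeta_sum in hs.
have -> : S = - (4 ^+ k.+1 - 1) / 12 + 4^-1 by rewrite hs; ring.
have -> : 4 ^+ k.+1 = N2 k.+1 ^+ 2.
  have -> : (4 : C) = 2 ^+ 2 by ring.
  by rewrite /N2 natrX -!exprM mulnC.
by field; exact: N2_neq0.
Qed.

Lemma csum_sum N (e : nat -> nat -> C) : (forall n, asum (fun m => e m n)) ->
  csum (fun m => \sum_(n < N) e m n) = \sum_(n < N) csum (fun m => e m n).
Proof.
move=> h; suff [] : asum (fun m => \sum_(n < N) e m n) /\
  csum (fun m => \sum_(n < N) e m n) = \sum_(n < N) csum (fun m => e m n) by [].
elim: N => [|N [IH1 IH2]].
  rewrite big_ord0; under eq_fun do rewrite big_ord0.
  split; last by rewrite (@csum_finite R _ 0) ?big_ord0.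
  by exists 0; split=> n; rewrite md0 // big1.
rewrite big_ord_recr /= -IH2; under eq_fun do rewrite big_ord_recr /=.
by split; [exact: asumD | rewrite csumD].
Qed.

(** A partial sum over the columns is a sum over m of truncated rows, and each truncated row is
    bounded by [b m]; so [tannery] applies in the row index. *)
Lemma fubini (e : nat -> nat -> C) (b : nat -> R) : summable b ->
  (forall m, rbd (fun n => md (e m n)) (b m)) ->
  (series (fun n => csum (fun m => e m n)) N @[N --> \oo] --> csum (fun m => csum (e m)))%classic.
Proof.
move=> hb he.
have hcol n : asum (fun m => e m n).
  apply: asum_le hb _ => m; have [h0 h] := he m; apply: le_trans (h n.+1).
  by rewrite big_ord_recr /= lerDr sumr_ge0.
have [||_] := @tannery R nat \oo%classic _ (fun N m => \sum_(n < N) e m n) (fun m => csum (e m)) _ hb.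
- by apply: nearW => N m; apply: le_trans (md_sum _ _ _) _; exact: (he m).2.
- move=> m; have ha : asum (e m) by exists (b m).
  have -> : (fun x : nat => \sum_(n < x) e m n) = series (e m).
    by apply/funext => N; rewrite /series /= big_mkord.
  exact: asum_cvg.
move=> h; apply: cvg_trans h; apply: near_eq_cvg; apply: nearW => N /=.
by rewrite csum_sum // /series /= big_mkord.
Qed.

Lemma ev_one w : md w < 1 -> ev (fun=> 1) w = (1 - w)^-1.
Proof.
move=> hw; have w1 : 1 - w != 0.
  by rewrite subr_eq0; apply: contraTneq hw => <-; rewrite md1 ltxx.
apply: (mulIf w1); rewrite mulVf // mulrBr mulr1 {1}ev_tail //; last exact: disc_one.
by rewrite [w * _]mulrC addrK.
Qed.

Lemma ev_nat w : md w < 1 -> ev (fun n => n%:R) w = Phi2 w.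
Proof.
move=> hw; have w1 : 1 - w != 0.
  by rewrite subr_eq0; apply: contraTneq hw => <-; rewrite md1 ltxx.
have dn : disc (fun n => n%:R : C).
  by apply: eq_disc (disc_theta0 (@disc_one R)) => n; rewrite mulr1.
have e : ev (fun n => n%:R) w = w * (ev (fun n => n%:R) w + ev (fun=> 1) w).
  rewrite {1}ev_tail // add0r -evD //; last exact: disc_one.
  have -> // : (fun n => n.+1%:R : C) = (fun n => n%:R + 1).
  by apply/funext => n; rewrite natr1.
rewrite ev_one // in e.
apply: (mulIf w1); rewrite /Phi2; apply: (mulfI w1).
have -> : (1 - w) * (w / (1 - w) ^+ 2 * (1 - w)) = w by field.
set X := ev _ _ in e *.
have : (1 - w) * X = w * (1 - w)^-1 by rewrite mulrBl mul1r {1}e; ring.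
move=> h; rewrite mulrA h; by field.
Qed.

Lemma Phi2_sum w : md w < 1 -> asum (fun d => d.+1%:R * w ^+ d.+1) /\
  csum (fun d => d.+1%:R * w ^+ d.+1) = Phi2 w.
Proof.
move=> hw; have dn : disc (fun n => n%:R : C).
  by apply: eq_disc (disc_theta0 (@disc_one R)) => n; rewrite mulr1.
have ha := disc_asum dn hw; split; first exact: (asum_shift 1 ha).
have e := csum_recl ha; rewrite mulr0n mul0r add0r in e.
by rewrite -ev_nat // /ev e.
Qed.

Lemma divisor_sum1E N n : (n < N)%N -> ((divisor_sum 1 n.+1)%:R : C) =
  \sum_(m < N) \sum_(d < N) (if (m.+1 * d.+1 == n.+1)%N then d.+1%:R else 0).
Proof.
move=> hn; rewrite exchange_big /=.
have -> : \sum_(d < N) \sum_(m < N) (if (m.+1 * d.+1 == n.+1)%N then (d.+1%:R : C) else 0) =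
    \sum_(d < N) (if (d.+1 %| n.+1)%N then d.+1%:R else 0).
  apply: eq_bigr => d _; case: ifP => hd.
    have [q hq] := dvdnP hd.
    have q0 : (0 < q)%N by case: q hq.
    have qN : (q.-1 < N)%N by rewrite prednK // (leq_trans _ hn) // hq leq_pmulr.
    rewrite (bigD1 (Ordinal qN)) //= prednK // -hq eqxx big1 ?addr0 // => m hm.
    case: eqP => // h; exfalso; move/eqP: hm; apply; apply/val_inj => /=.
    by move: h; rewrite hq => /eqP; rewrite eqn_pmul2r // => /eqP <-.
  rewrite big1 // => m _; case: eqP => // h; exfalso.
  by move/negP: hd; apply; rewrite -h dvdn_mull.
rewrite -big_mkcond /= /divisor_sum natr_sum.
rewrite -(big_mkord (fun d => (d.+1 %| n.+1)%N) (fun d => d.+1%:R)) -[X in _ = X]big_filter.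
set r := [seq d <- index_iota 0 N | _].
have -> : \sum_(d <- r) (d.+1%:R : C) = \sum_(d <- map succn r) (d ^ 1)%:R.
  by rewrite big_map; apply: eq_bigr => d _; rewrite expn1.
apply: perm_big; apply: uniq_perm.
- exact: divisors_uniq.
- by rewrite map_inj_uniq ?filter_uniq ?iota_uniq // => x y [].
move=> d; rewrite -dvdn_divisors //; apply/idP/mapP => [hd|[x]].
  have d0 : (0 < d)%N := dvdn_gt0 (ltn0Sn n) hd.
  exists d.-1; last by rewrite prednK.
  rewrite mem_filter prednK // hd mem_index_iota /=.
  by have := dvdn_leq (ltn0Sn n) hd; lia.
by rewrite mem_filter => /andP[h _] ->.
Qed.

(** The partial sum up to N of the divisor series collects the pairs (m, d) with m d <= N; for fixed
    m these form the series of [Phi2 (q ^ m)] cut off at N / m. *)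
Lemma lambert (q : C) : md q < 1 -> asum (fun m => Phi2 (q ^+ m.+1)) /\
  csum (fun n => (divisor_sum 1 n.+1)%:R * q ^+ n.+1) = csum (fun m => Phi2 (q ^+ m.+1)).
Proof.
move=> hq; set p := md q in hq; have p0 : 0 <= p := md_ge0 q.
have hp : 0 <= p < 1 by rewrite p0.
have dn : disc (fun n => n%:R : C).
  by apply: eq_disc (disc_theta0 (@disc_one R)) => n; rewrite mulr1.
have [M [_ hM]] := disc_tail dn hp.
have M0 : 0 <= M by have := hM 0%N; rewrite big_ord0.
pose t N m : C := \sum_(d < N %/ m.+1) d.+1%:R * (q ^+ m.+1) ^+ d.+1.
have hqm m : md (q ^+ m.+1) < 1 by rewrite mdX exprn_ilt1 // -/p.
have [||al hl] := @tannery R nat \oo%classic _ t (fun m => Phi2 (q ^+ m.+1)) _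
    (summableZ M0 (summable_geo hp)).
- apply: nearW => N m; apply: le_trans (md_sum _ _ _) _.
  apply: (@le_trans _ _ (\sum_(d < N %/ m.+1) (md (d.+1%:R : C) * p ^+ d) * p ^+ m)).
    apply: ler_sum => d _; rewrite mdM -exprM mdX -/p -mulrA ler_wpM2l ?md_ge0 // -exprD.
    by apply: ler_wiXn2l => //; [exact: ltW | nia].
  by rewrite -mulr_suml ler_wpM2r ?exprn_ge0.
- move=> m; have [ha hs] := Phi2_sum (hqm m).
  rewrite -hs; have /cvgnC h := asum_cvg ha; apply/cvgnC => e /h[K hK].
  exists (K * m.+1)%N => N hN; have := hK (N %/ m.+1)%N; rewrite leq_divRL // => /(_ hN).
  by rewrite /series /= big_mkord.
split=> //; apply: csum_uniq; apply: cvg_trans hl; apply: near_eq_cvg; apply: nearW => N /=.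
rewrite (@csum_finite R _ N); last first.
  by move=> m hm; rewrite /t divn_small ?big_ord0.
rewrite /series /= big_mkord.
have e1 (n : 'I_N) : (divisor_sum 1 n.+1)%:R * q ^+ n.+1 =
   \sum_(m < N) \sum_(d < N) (if (m.+1 * d.+1 == n.+1)%N then d.+1%:R * q ^+ (m.+1 * d.+1) else 0).
  rewrite (divisor_sum1E (ltn_ord n)) mulr_suml; apply: eq_bigr => m _.
  rewrite mulr_suml; apply: eq_bigr => d _.
  by case: eqP => [->|_] //; rewrite mul0r.
rewrite [RHS](eq_bigr _ (fun n _ => e1 n)) [RHS]exchange_big /=.
apply: eq_bigr => m _; rewrite exchange_big /= /t.
rewrite (big_ord_widen N (fun d => d.+1%:R * (q ^+ m.+1) ^+ d.+1)); last exact: leq_div.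
rewrite big_mkcond /=; apply: eq_bigr => d _.
rewrite leq_divRL // -exprM; case: ifP => hd; last first.
  rewrite big1 // => n _; case: eqP => // h; exfalso.
  by move/negP: hd; apply; rewrite mulnC h; exact: ltn_ord.
have [k hk] : exists k, (m.+1 * d.+1 = k.+1)%N.
  by exists (m.+1 * d.+1).-1; rewrite prednK ?muln_gt0.
have hn : (k < N)%N by rewrite -hk mulnC.
rewrite mulnC in hd; rewrite hk (bigD1 (Ordinal hn)) // [nat_of_ord _]/= eqxx /=.
rewrite big1 ?addr0 // => n hn'; case: eqP => // -[h]; exfalso.
by move/eqP: hn'; apply; apply/val_inj.
Qed.

Lemma lattice2 tau : upper_half tau -> exists2 L : R, 0 < L & forall m n : nat,
  (m.+1 + n)%:R <= L * md (m.+1%:R * tau + n%:R) /\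
  (m.+1 + n)%:R <= L * md (m.+1%:R * tau - n%:R).
Proof.
move=> ht; have [|d d0 hd] := @lattice_lower R tau; first by rewrite gtr0_norm.
set y := complex.Im tau in ht; have y0 : 0 < y := ht.
exists (y^-1 + d^-1); first by rewrite addr_gt0 ?invr_gt0.
move=> m n; set M : R := m.+1%:R; have M0 : 0 < M by rewrite ltr0n.
have key (s : R) : `|s| = n%:R -> (m.+1 + n)%:R <= (y^-1 + d^-1) * md (m.+1%:R * tau + s%:C%C).
  move=> hs; have e : m.+1%:R * tau + s%:C%C = m.+1%:R * (tau + (s / M)%:C%C).
    rewrite mulrDr; congr (_ + _); rewrite natC -rmorphM; congr (_%:C)%C.
    by rewrite mulrC divfK // gt_eqF.
  rewrite e mdM md_nat -/M natrD mulrDl -/M; apply: lerD.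
    rewrite mulrC ler_pdivlMr // ler_wpM2l ?(ltW M0) //.
    by apply: le_trans (md_Im _); rewrite cImD /= addr0 ler_norm.
  rewrite mulrC ler_pdivlMr // -hs.
  have := hd (s / M); rewrite normrM normfV (gtr0_norm M0) => h.
  have := ler_wpM2l (ltW M0) h; apply: le_trans.
  by rewrite mulrCA [X in _ <= d * X]mulrC divfK ?gt_eqF // mulrC.
split; first by rewrite (natC R n); apply: key; rewrite ger0_norm.
by rewrite (natC R n) -rmorphN; apply: key; rewrite normrN ger0_norm.
Qed.

Definition latP tau (m n : nat) : C :=
  (m.+1%:R * tau + n.+1%:R)^-1 ^+ 2 + (m.+1%:R * tau - n.+1%:R)^-1 ^+ 2.
Definition latg tau (m n : nat) : C := (m.+1%:R * tau - n%:R)^-1 - (m.+1%:R * tau + n%:R)^-1.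
(* The sums over n of the differences of latg telescope; late is what remains
   and is absolutely summable. *)
Definition late tau (m n : nat) : C := latP tau m n - (latg tau m n.+1 - latg tau m n).

Section Exchange.
Variable tau : C.
Hypothesis ht : upper_half tau.
Local Notation tau' := (- tau^-1).
Local Notation P := (latP tau).
Local Notation g := (latg tau).
Local Notation e := (late tau).

Let t0 : tau != 0. Proof. exact: upper_neq0. Qed.
Let ht' : upper_half tau'. Proof. exact: upper_inv. Qed.

Lemma upper_mul (n : nat) z : upper_half z -> upper_half (n.+1%:R * z).
Proof. by rewrite natC; apply: upper_scale; rewrite ltr0n. Qed.

Let lat_neq0 m n : m.+1%:R * tau + n%:R != 0 /\ m.+1%:R * tau - n%:R != 0.
Proof.
have h := upper_mul m ht; split; apply: upper_neq0; first exact: upper_addn.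
by rewrite (natC R n) -rmorphN; apply: upper_add_real.
Qed.

(** With u and v for m tau - n and m tau + n, where m and n start at 1, the difference equals 1 /
    (u^2 (u + 1)) - 1 / (v^2 (v - 1)), of cubic decay. Its bound telescopes in n and leaves a
    multiple of 1 / m^2. *)
Lemma e_bound : exists2 b : nat -> R, summable b & forall m, rbd (fun n => md (e m n)) (b m).
Proof.
have [L L0 hL] := lattice2 ht.
exists (fun m => 2 * L ^+ 3 * (m.+1%:R ^+ 2)^-1).
  by apply: summableZ; [rewrite mulr_ge0 // exprn_ge0 // ltW | exact: summable_inv2].
move=> m; split=> [n|N]; first exact: md_ge0.
pose K : R := 2 * L ^+ 3 / m.+1%:R.
have K0 : 0 <= K by rewrite divr_ge0 // mulr_ge0 // exprn_ge0 // ltW.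
have step n : md (e m n) <= K * ((m + n).+1%:R^-1 - (m + n).+2%:R^-1).
  set u := m.+1%:R * tau - n.+1%:R; set v := m.+1%:R * tau + n.+1%:R.
  have [v0 u0] := lat_neq0 m n.+1; have [v1 u1] := lat_neq0 m n.
  rewrite -/u -/v in v0 u0.
  have eu : m.+1%:R * tau - n%:R = u + 1 by rewrite /u -natr1; ring.
  have ev : m.+1%:R * tau + n%:R = v - 1 by rewrite /v -natr1; ring.
  rewrite eu in u1; rewrite ev in v1.
  have -> : e m n = (u ^+ 2 * (u + 1))^-1 - (v ^+ 2 * (v - 1))^-1.
    by rewrite /late /latP /latg -/u -/v eu ev; field; rewrite u0 u1 v0 v1.
  have [hv hu] := hL m n.+1; have [hv1 hu1] := hL m n.
  rewrite -/u -/v eu ev addnS addSn in hv hu hv1 hu1.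
  set A : R := (m + n).+1%:R in hv1 hu1 *; set B : R := (m + n).+2%:R in hv hu *.
  have A0 : 0 < A by rewrite ltr0n.
  have B0 : 0 < B by rewrite ltr0n.
  have mA : m.+1%:R <= B by rewrite ler_nat ltnS leqW // leq_addr.
  have m0 : (0 : R) < m.+1%:R by rewrite ltr0n.
  have BA : B = A + 1 by rewrite /A /B -natr1.
  have key (x y : C) : B <= L * md x -> A <= L * md y -> x != 0 -> y != 0 ->
      md (x ^+ 2 * y)^-1 <= L ^+ 3 / m.+1%:R * (A^-1 - B^-1).
    move=> hx hy x0 y0; rewrite mdV mdM mdX.
    have -> : L ^+ 3 / m.+1%:R * (A^-1 - B^-1) = L ^+ 3 / (m.+1%:R * B * A).
      by rewrite BA; field; rewrite !gt_eqF //; lra.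
    have X0 : 0 < md x by rewrite md_gt0.
    have Y0 : 0 < md y by rewrite md_gt0.
    rewrite -[X in X <= _]mul1r ler_pdivlMr ?mulr_gt0 // mulrAC ler_pdivrMr ?mulr_gt0 ?exprn_gt0 //.
    rewrite mul1r.
    have -> : L ^+ 3 * (md x ^+ 2 * md y) = (L * md x) * (L * md x) * (L * md y) by ring.
    apply: ler_pM; [by rewrite mulr_ge0 // ltW | exact: ltW | | exact: hy].
    by apply: ler_pM; [exact: ltW | exact: ltW | exact: le_trans hx | exact: hx].
  have -> : K * (A^-1 - B^-1) = L ^+ 3 / m.+1%:R * (A^-1 - B^-1) + L ^+ 3 / m.+1%:R * (A^-1 - B^-1).
    by rewrite /K; ring.
  apply: le_trans (mdD _ _) _; rewrite mdN; apply: lerD; exact: key.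
have tele : \sum_(n < N) md (e m n) <= K * (m.+1%:R^-1 - (m + N).+1%:R^-1).
  elim: N => [|N IH]; first by rewrite big_ord0 addn0 subrr mulr0.
  rewrite big_ord_recr /= addnS; apply: le_trans (lerD IH (step N)) _.
  by rewrite -mulrDr addrA subrK.
apply: le_trans tele _.
have -> : 2 * L ^+ 3 / m.+1%:R ^+ 2 = K * m.+1%:R^-1.
  have m0 : (m.+1%:R : R) != 0 by rewrite pnatr_eq0.
  by rewrite /K; move: (m.+1%:R : R) m0 => x x0; field.
by rewrite ler_wpM2l // lerBlDr lerDl invr_ge0.
Qed.

(** Along a row the correction sums to 0, since [latg] vanishes at n = 0 and tends to 0. *)
Lemma row_sum m : U2 (m.+1%:R * tau) = csum (e m).
Proof.
have [b hb he] := e_bound; have [L L0 hL] := lattice2 ht.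
have ae : asum (e m) by exists (b m).
have [aP _] := lipschitz2 (upper_mul m ht).
apply: csum_uniq.
have gc : (g m N @[N --> \oo] --> (0 : C))%classic.
  apply/cvgnC => d d0; exists (Num.bound (2 * L / d)) => N hN.
  have [v0 u0] := lat_neq0 m N; have [hv hu] := hL m N.
  rewrite subr0 /latg; apply: le_lt_trans (mdD _ _) _; rewrite mdN !mdV.
  set A : R := (m.+1 + N)%:R in hv hu.
  have A0 : 0 < A by rewrite ltr0n.
  have hb2 : 2 * L / d < A.
    apply: lt_le_trans (archi_boundP _) _; first by rewrite divr_ge0 ?mulr_ge0 // ltW.
    by rewrite /A ler_nat (leq_trans hN) // leq_addl.
  have bnd (x : C) : x != 0 -> A <= L * md x -> (md x)^-1 <= L / A.
    move=> x0 hx; rewrite ler_pdivlMr // mulrC ler_pdivrMr ?md_gt0 //.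
  apply: le_lt_trans (lerD (bnd _ u0 hu) (bnd _ v0 hv)) _.
  have -> : L / A + L / A = 2 * L / A by ring.
  by rewrite ltr_pdivrMr // [X in _ < X]mulrC -ltr_pdivrMr.
pose proof (h := cvgC_D (asum_cvg ae) gc); rewrite addr0 in h.
apply: cvg_trans h; apply: near_eq_cvg; apply: nearW => N /=.
rewrite /series /= !big_mkord; elim: N => [|N IH].
  by rewrite !big_ord0 add0r /latg subr0 addr0 subrr.
by rewrite !big_ord_recr /= -IH /late /latP; ring.
Qed.

(** Up to the factor tau, the columns of the lattice of tau are the rows of the lattice of - 1 /
    tau. *)
Let inv_lat (m n : nat) : (n%:R * tau' + m.+1%:R)^-1 = tau * (m.+1%:R * tau - n%:R)^-1 /\
  (n%:R * tau' - m.+1%:R)^-1 = - tau * (m.+1%:R * tau + n%:R)^-1.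
Proof.
have [v0 u0] := lat_neq0 m n.
have -> : n%:R * tau' + m.+1%:R = (m.+1%:R * tau - n%:R) / tau by field.
have -> : n%:R * tau' - m.+1%:R = - (m.+1%:R * tau + n%:R) / tau by field.
move: (_ + _) (_ - _) v0 u0 => v u v0 u0.
by split; field; rewrite ?u0 ?v0 t0.
Qed.

Lemma col_P n : asum (P ^~ n) /\ csum (P ^~ n) = tau^-1 ^+ 2 * U2 (n.+1%:R * tau').
Proof.
have [aP _] := lipschitz2 (upper_mul n ht').
have E : P ^~ n = fun m => tau^-1 ^+ 2 * ((n.+1%:R * tau' + m.+1%:R)^-1 ^+ 2 + (n.+1%:R * tau' - m.+1%:R)^-1 ^+ 2).
  apply/funext => m; have [-> ->] := inv_lat m n.+1.
  by rewrite /latP; move: (_ + _)^-1 (_ - _)^-1 => u v; field.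
by rewrite E; split; [exact: asumZ | rewrite csumZ].
Qed.

Let G (n : nat) := csum (g ^~ n).

Lemma col_g n : asum (g ^~ n.+1) /\ G n.+1 = tau^-1 * U1 (n.+1%:R * tau').
Proof.
have [aP _] := lipschitz1 (upper_mul n ht').
have E : g ^~ n.+1 = fun m => tau^-1 * ((n.+1%:R * tau' + m.+1%:R)^-1 ^+ 1 + (n.+1%:R * tau' - m.+1%:R)^-1 ^+ 1).
  apply/funext => m; have [-> ->] := inv_lat m n.+1.
  by rewrite /latg; move: (_ + _)^-1 (_ - _)^-1 => u v; field.
by rewrite /G E; split; [exact: asumZ | rewrite csumZ].
Qed.

Lemma col_g0 : asum (g ^~ 0%N) /\ G 0 = 0.
Proof.
have E : g ^~ 0%N = fun=> 0 by apply/funext => m; rewrite /latg subr0 addr0 subrr.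
rewrite /G E; split; last by rewrite (@csum_finite R _ 0) ?big_ord0.
by exists 0; split=> n; rewrite md0 // big1.
Qed.

(** Along the columns the correction does not disappear: its sums are values of the cotangent series
    at N tau', and the cotangent has a nonzero limit high in the half-plane. This limit is the
    non-modular term of E2. *)
Lemma G_limit : (G N @[N --> \oo] --> - twopii / (2 * tau))%classic.
Proof.
have hq : md (ee tau') < 1.
  by rewrite md_ee expR_lt1 oppr_lt0 !mulr_gt0 ?pi_gt0.
have qn : ((ee tau') ^+ N.+1 @[N --> \oo] --> (0 : C))%classic.
  have hs : summable (fun n => md (ee tau') ^+ n) by apply: summable_geo; rewrite md_ge0.
  apply/cvgnC => d d0; have [N [_ hN]] := summable_tail hs (e := d / 2) ltac:(lra).
  exists N => n hn; rewrite subr0 mdX; apply: (@le_lt_trans _ _ (d / 2)); last by lra.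
  apply: le_trans (hN (n.+1 - N).+1); rewrite big_ord_recr /= subnKC; last by lia.
  by rewrite lerDr sumr_ge0 // => i _; rewrite exprn_ge0 ?md_ge0.
have n1 : (0 - 1 : C) != 0 by rewrite sub0r oppr_eq0 oner_eq0.
pose proof (h1 := cvgC_M (cvgC_D qn (cvgC_cst 1)) (cvgC_V n1 (cvgC_D qn (cvgC_cst (-1))))).
have hn : ((N.+1%:R : C)^-1 @[N --> \oo] --> (0 : C))%classic.
  apply/cvgnC => d d0; exists (Num.bound d^-1) => N hN; rewrite subr0 mdV md_nat.
  rewrite invf_plt ?posrE ?ltr0n //.
  apply: lt_le_trans (archi_boundP _) _; first by rewrite invr_ge0 ltW.
  by rewrite ler_nat leqW.
pose proof (h := cvgC_Z tau^-1 (cvgC_D (cvgC_Z (twopii / 2) h1) (cvgC_Z (- tau'^-1) hn))).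
have hl : tau^-1 * (twopii / 2 * ((0 + 1) * (0 - 1)^-1) + - tau'^-1 * 0) = - twopii / (2 * tau).
  by field.
rewrite hl in h.
have hS : (G N.+1 @[N --> \oo] --> - twopii / (2 * tau))%classic.
  apply: cvg_trans h; apply: near_eq_cvg; apply: nearW => N /=.
  have [_ ->] := col_g N; congr (_ * _).
  have [_ hU] := lipschitz1 (upper_mul N ht').
  have -> : U1 (N.+1%:R * tau') = twopii / 2 * Phi1 (ee (N.+1%:R * tau')) - (N.+1%:R * tau')^-1.
    by rewrite hU addrC addKr.
  by rewrite /Phi1 [N.+1%:R * tau']mulrC eeMn invfM mulNr.
apply/cvgnC => d d0; have [N hN] := cvgnC.1 hS d d0.
by exists N.+1 => -[//|n] hn2; apply: hN.
Qed.

Lemma exchange : (series (fun n => tau^-1 ^+ 2 * U2 (n.+1%:R * tau')) N @[N --> \oo] -->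
  csum (fun m => U2 (m.+1%:R * tau)) - twopii / (2 * tau))%classic.
Proof.
have [b hb he] := e_bound.
have -> : (fun m => U2 (m.+1%:R * tau)) = fun m => csum (e m) by apply/funext => m; exact: row_sum.
pose proof (h := cvgC_D (fubini hb he) G_limit); rewrite mulNr in h.
apply: cvg_trans h; apply: near_eq_cvg; apply: nearW => N /=.
rewrite /series /= !big_mkord; elim: N => [|N IH].
  by rewrite !big_ord0 add0r (col_g0).2.
rewrite !big_ord_recr /= -IH -(col_P N).2.
have ag n : asum (g ^~ n) by case: n => [|n]; [exact: col_g0.1 | exact: (col_g n).1].
have E : P ^~ N = fun m => e m N + (g m N.+1 + -1 * g m N).
  by apply/funext => m; rewrite /late; ring.
have ag2 : asum (fun m => g m N.+1 + -1 * g m N) by apply: asumD; [|apply: asumZ].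
have ae : asum (e ^~ N).
  have := asumD (col_P N).1 (asumZ (-1) ag2).
  by congr asum; apply/funext => m; rewrite /late; ring.
have -> : csum (P ^~ N) = csum (e ^~ N) + (G N.+1 + -1 * G N).
  by rewrite E csumD // csumD // ?csumZ //; apply: asumZ.
by ring.
Qed.

End Exchange.

(** The Lambert series expresses E2 by [Phi2] at the powers of q, and [lipschitz2] turns these
    values into lattice rows. The points with n = 0 are missing from [U2] and contribute zeta(2) /
    tau^2. *)
Lemma E2_U2 tau : upper_half tau -> asum (fun m => U2 (m.+1%:R * tau)) /\
  twopii ^+ 2 * ((1 - E2 tau) / 24) =
  - twopii ^+ 2 / 24 * tau^-1 ^+ 2 + csum (fun m => U2 (m.+1%:R * tau)).
Proof.
move=> ht; have hq : md (ee tau) < 1.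
  by rewrite md_ee expR_lt1 oppr_lt0 !mulr_gt0 ?pi_gt0.
have [aL hL] := lambert hq.
have E2e : (1 - E2 tau) / 24 = csum (fun m => Phi2 (ee tau ^+ m.+1)).
  have -> : E2 tau = 1 - 24 * csum (fun n => (divisor_sum 1 n.+1)%:R * ee tau ^+ n.+1).
    rewrite /E2 -[limn _]/(csum _); congr (1 - 24 * _); apply: eq_csum => n.
    by rewrite -eeMn /qpow /ee; congr (_ * cexp _); ring.
  by rewrite hL; field.
have [az hz] := zeta2.
have az' : asum (fun m : nat => (m.+1%:R * tau)^-1 ^+ 2 : C).
  have := asumZ (2^-1 * tau^-1 ^+ 2) az; congr asum; apply/funext => m.
  have m0 : (m.+1%:R : C) != 0 by rewrite pnatr_eq0.
  by move: (m.+1%:R : C) m0 => x x0; rewrite add0r sub0r; field; rewrite x0 (upper_neq0 ht).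
have sz : csum (fun m : nat => (m.+1%:R * tau)^-1 ^+ 2 : C) = - twopii ^+ 2 / 24 * tau^-1 ^+ 2.
  have -> : - twopii ^+ 2 / 24 * tau^-1 ^+ 2 = (2^-1 * tau^-1 ^+ 2) * U2 0.
    by rewrite hz; field; exact: upper_neq0.
  rewrite -csumZ //; apply: eq_csum => m.
  have m0 : (m.+1%:R : C) != 0 by rewrite pnatr_eq0.
  by move: (m.+1%:R : C) m0 => x x0; rewrite add0r sub0r; field; rewrite x0 (upper_neq0 ht).
have EU : (fun m => U2 (m.+1%:R * tau)) =
    fun m => twopii ^+ 2 * Phi2 (ee tau ^+ m.+1) + -1 * (m.+1%:R * tau)^-1 ^+ 2.
  apply/funext => m; have [_ h] := lipschitz2 (upper_mul m ht).
  by rewrite -eeMn [tau * _]mulrC h; ring.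
have aU : asum (fun m => U2 (m.+1%:R * tau)).
  by rewrite EU; apply: asumD; exact: asumZ.
split=> //; rewrite E2e -sz -csumZ // -csumD //; apply: eq_csum => m.
by move/(congr1 (fun f => f m)): EU => ->; ring.
Qed.

Theorem E2_inv tau : upper_half tau -> E2 (- tau^-1) = tau ^+ 2 * E2 tau + 12 * tau / twopii.
Proof.
move=> ht; have t0 := upper_neq0 ht; have T0 := @twopii_neq0 R.
have [a1 h1] := E2_U2 ht; have [a2 h2] := E2_U2 (upper_inv ht).
have hx := exchange ht.
have := csum_uniq hx; rewrite csumZ // => h3.
set S := csum (fun m => U2 (m.+1%:R * tau)) in h1 h3.
set S' := csum _ in h2 h3.
have eS : S = twopii ^+ 2 * ((1 - E2 tau) / 24) + twopii ^+ 2 / 24 * tau^-1 ^+ 2.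
  by rewrite h1; ring.
have eS' : S' = twopii ^+ 2 * ((1 - E2 (- tau^-1)) / 24) + twopii ^+ 2 / 24 * (- tau^-1)^-1 ^+ 2.
  by rewrite h2; ring.
rewrite eS eS' invrN invrK in h3.
have h4 : E2 (- tau^-1) = 1 + tau ^+ 2 - 24 / twopii ^+ 2 * tau ^+ 2 *
   (tau^-1 ^+ 2 * (twopii ^+ 2 * ((1 - E2 (- tau^-1)) / 24) + twopii ^+ 2 / 24 * (- tau) ^+ 2)).
  by field; rewrite T0 t0.
by rewrite h4 h3; field; rewrite T0 t0.
Qed.

End E2Law.

(** * Gamma0(2) and the slash action *)

Section Matrix2.
Variable K : comNzRingType.

Definition mx2 (a b c d : K) : 'M[K]_2 :=
  \matrix_(i, j) (if i == 0 then if j == 0 then a else b else if j == 0 then c else d).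

Lemma ord2P (i : 'I_2) : i = 0 \/ i = 1.
Proof. by case: i => -[|[|//]] hi; [left|right]; apply/val_inj. Qed.

Lemma sum2 (V : nmodType) (F : 'I_2 -> V) : \sum_i F i = F 0 + F 1.
Proof. by rewrite big_ord_recl big_ord1; congr (_ + F _); apply/val_inj. Qed.

Lemma mx2P (A B : 'M[K]_2) : A 0 0 = B 0 0 -> A 0 1 = B 0 1 -> A 1 0 = B 1 0 ->
  A 1 1 = B 1 1 -> A = B.
Proof.
by move=> h1 h2 h3 h4; apply/matrixP => i j; case: (ord2P i) => ->; case: (ord2P j) => ->.
Qed.

Lemma mx2_eta (A : 'M[K]_2) : A = mx2 (A 0 0) (A 0 1) (A 1 0) (A 1 1).
Proof. by apply: mx2P; rewrite mxE. Qed.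

Lemma mx2M a b c d a' b' c' d' : mx2 a b c d *m mx2 a' b' c' d' =
  mx2 (a * a' + b * c') (a * b' + b * d') (c * a' + d * c') (c * b' + d * d').
Proof. by apply: mx2P; rewrite !mxE sum2 !mxE. Qed.

Lemma det2 (A : 'M[K]_2) : \det A = A 0 0 * A 1 1 - A 0 1 * A 1 0.
Proof.
rewrite (expand_det_row _ 0) sum2 /cofactor !det_mx11 !mxE /= expr0 mul1r expr1 mulN1r.
have -> : lift 0 0 = 1 :> 'I_2 by apply/val_inj.
have -> : lift 1 0 = 0 :> 'I_2 by apply/val_inj.
by rewrite mulrN.
Qed.

Lemma mx2_1 : 1%:M = mx2 1 0 0 1.
Proof. by apply: mx2P; rewrite !mxE. Qed.

End Matrix2.

Definition Smx : 'M[int]_2 := mx2 0 (-1) 1 0.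
Definition Tn (n : int) : 'M[int]_2 := mx2 1 n 0 1.
(** This is S T^(-2 n) S^(-1), so [Un] gives the translations at the cusp 0, of width 2. *)
Definition Un (n : int) : 'M[int]_2 := mx2 1 0 (2 * n) 1.
Definition N1mx : 'M[int]_2 := mx2 (-1) 0 0 (-1).

Lemma TmxE : Tmx = Tn 1.
Proof. by apply: mx2P; rewrite !mxE. Qed.

Lemma in_SL2Z a b c d : (mx2 a b c d \in SL2Z) = (a * d - b * c == 1).
Proof. by rewrite inE det2 !mxE. Qed.

Lemma in_Gamma0 a b c d : (mx2 a b c d \in Gamma0_2) = (a * d - b * c == 1) && (2 %| c)%Z.
Proof. by rewrite [LHS]inE in_SL2Z mxE. Qed.

Lemma SL2Z_mul g h : g \in SL2Z -> h \in SL2Z -> g *m h \in SL2Z.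
Proof. by rewrite !inE det_mulmx => /eqP -> /eqP ->. Qed.

Lemma Gamma0_SL2Z g : g \in Gamma0_2 -> g \in SL2Z.
Proof. by rewrite inE => /andP[]. Qed.

Lemma Gamma0_mul g h : g \in Gamma0_2 -> h \in Gamma0_2 -> g *m h \in Gamma0_2.
Proof.
move=> hg hh; rewrite inE SL2Z_mul ?Gamma0_SL2Z //=.
move: hg hh; rewrite [g]mx2_eta [h]mx2_eta mx2M !in_Gamma0 mxE /=.
by move=> /andP[_ h1] /andP[_ h2]; apply: rpredD; [exact: dvdz_mulr | exact: dvdz_mull].
Qed.

Lemma Tn_Gamma0 n : Tn n \in Gamma0_2.
Proof. by rewrite in_Gamma0; apply/andP; split; first lia. Qed.
Lemma Un_Gamma0 n : Un n \in Gamma0_2.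
Proof. by rewrite in_Gamma0; apply/andP; split; [lia | rewrite dvdz_mulr]. Qed.
Lemma N1_Gamma0 : N1mx \in Gamma0_2.
Proof. by rewrite in_Gamma0. Qed.

Lemma TnD m n : Tn m *m Tn n = Tn (m + n).
Proof. by rewrite mx2M; congr mx2; ring. Qed.
Lemma UnD m n : Un m *m Un n = Un (m + n).
Proof. by rewrite mx2M; congr mx2; ring. Qed.

Lemma TmxX n : Tmx ^+ n = Tn n%:Z.
Proof.
elim: n => [|n IH]; first by rewrite expr0 [1]mx2_1.
by rewrite exprSr IH TmxE -[_ * _]/(_ *m _) TnD -PoszD addn1.
Qed.

Lemma nearest_div (c d : int) : c != 0 -> exists n : int, `|d - n * c| * 2 <= `|c|.
Proof.
move=> c0; have := divz_eq d c; have := modz_ge0 d c0; have := ltz_mod d c0.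
move: (d %/ c)%Z (d %% c)%Z => q r r1 r0 ->.
have [h|h] := leP (r * 2) `|c|.
  by exists q; have -> : q * c + r - q * c = r by [ring|]; rewrite ger0_norm.
have [c1|c1] := leP 0 c.
  exists (q + 1); have -> : q * c + r - (q + 1) * c = r - c by ring.
  by rewrite (ger0_norm c1) in r1 h *; rewrite ler0_norm; lia.
exists (q - 1); have -> : q * c + r - (q - 1) * c = r + c by ring.
by rewrite (ltr0_norm c1) in r1 h *; rewrite ler0_norm; lia.
Qed.

Section Generation.
Variable Pr : 'M[int]_2 -> Prop.
Hypothesis PrM : forall g h, g \in Gamma0_2 -> h \in Gamma0_2 -> Pr g -> Pr h -> Pr (g *m h).
Hypothesis PrV : forall g h, g \in Gamma0_2 -> h \in Gamma0_2 -> g *m h = 1%:M -> Pr g -> Pr h.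
Hypothesis PrT : Pr (Tn 1).
Hypothesis PrU : Pr (Un 1).
Hypothesis PrN : Pr N1mx.

Lemma Pr1 : Pr 1%:M.
Proof.
have -> : 1%:M = N1mx *m N1mx by rewrite mx2M mx2_1; congr mx2; ring.
by apply: PrM; rewrite ?N1_Gamma0.
Qed.

Lemma PrTn n : Pr (Tn n).
Proof.
have pos k : Pr (Tn k%:Z).
  elim: k => [|k IH]; first by have := Pr1; rewrite mx2_1.
  by rewrite -addn1 PoszD -TnD; apply: PrM; rewrite ?Tn_Gamma0.
case: n => k //; apply: (@PrV (Tn k.+1)); rewrite ?Tn_Gamma0 //.
by rewrite TnD NegzE subrr mx2_1.
Qed.

Lemma PrUn n : Pr (Un n).
Proof.
have pos k : Pr (Un k%:Z).
  by elim: k => [|k IH]; [have := Pr1; rewrite mx2_1 |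
     rewrite -addn1 PoszD -UnD; apply: PrM; rewrite ?Un_Gamma0].
case: n => k //; apply: (@PrV (Un k.+1)); rewrite ?Un_Gamma0 //.
by rewrite UnD NegzE subrr mx2_1.
Qed.

(* Euclid's algorithm on the bottom row: d is reduced modulo c, then c modulo 2 d;
   d stays odd, so it never vanishes. *)
Lemma Gamma0_gen g : g \in Gamma0_2 -> Pr g.
Proof.
have [n] := ubnP `|g 1%R 0%R|%N; elim: n g => // n IH g hn hg.
have := hg; rewrite {1}[g]mx2_eta in_Gamma0 => /andP[/eqP dg /dvdzP[c' hc]].
have [c0|c0] := eqVneq (g 1 0) 0.
  rewrite c0 mulr0 subr0 in dg.
  have [[a1 d1]|[a1 d1]] : (g 0 0 = 1 /\ g 1 1 = 1) \/ (g 0 0 = -1 /\ g 1 1 = -1).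
  - have : `|g 0%R 0%R|%N = 1%N by have := congr1 absz dg; rewrite abszM => /eqP; rewrite muln_eq1 => /andP[/eqP].
    move: (g 0 0) (g 1 1) dg => a d dg ha.
    have [a1|a1] : a = 1 \/ a = -1 by lia.
      by left; rewrite a1 mul1r in dg.
    by right; rewrite a1 in dg *; split=> //; lia.
  - have -> : g = Tn (g 0 1) by rewrite {1}[g]mx2_eta a1 d1 c0.
    exact: PrTn.
  - have -> : g = N1mx *m Tn (- g 0 1).
      by rewrite {1}[g]mx2_eta a1 d1 c0 mx2M; congr mx2; ring.
    by apply: PrM; rewrite ?N1_Gamma0 ?Tn_Gamma0 //; exact: PrTn.
have [k hk] := @nearest_div (g 1 0) (g 1 1) c0.
set d' := g 1 1 - k * g 1 0 in hk.
have d0 : d' != 0.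
  apply/eqP => h; have e : g 1 1 = k * g 1 0 by move/eqP: h; rewrite subr_eq0 => /eqP.
  have h1 : (g 0 0 * k - g 0 1) * c' * 2 = 1.
    by transitivity (g 0 0 * g 1 1 - g 0 1 * g 1 0) => //; rewrite e hc; ring.
  lia.
have d20 : 2 * d' != 0 by rewrite mulf_neq0.
have [l hl] := @nearest_div (2 * d') (g 1 0) d20.
pose g' := g *m Tn (- k) *m Un (- l).
have hg' : g' \in Gamma0_2 by rewrite !Gamma0_mul ?Tn_Gamma0 ?Un_Gamma0.
have e10 : g' 1 0 = g 1 0 - l * (2 * d').
  by rewrite /g' {1}[g]mx2_eta !mx2M mxE /= /d'; ring.
(* Rounding to the nearest multiple gives [|2 d'|] <= [|c|], and then a new entry of size at most
   [|d'|], so at most half of [|c|]. *)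
have hlt : (`|g' 1%R 0%R| < n)%N by rewrite e10; lia.
have -> : g = g' *m Un l *m Tn k.
  rewrite /g' -!mulmxA (mulmxA (Un (- l))) UnD addNr.
  have -> : Un 0 = 1%:M by rewrite mx2_1.
  rewrite mul1mx TnD addNr; have -> : Tn 0 = 1%:M by rewrite mx2_1.
  by rewrite mulmx1.
have hU := Un_Gamma0 l; have hT := Tn_Gamma0 k.
apply: PrM => //; [exact: Gamma0_mul | | exact: PrTn].
by apply: PrM => //; [exact: IH | exact: PrUn].
Qed.

End Generation.

(** The parities of the bottom row decide: c even, d even, or both odd. *)
Lemma SL2Z_coset g : g \in SL2Z -> exists2 y, y \in Gamma0_2 &
  [\/ g = y, g = y *m Smx | g = y *m Smx *m Tn 1].
Proof.
move=> hg; have := hg; rewrite {1}[g]mx2_eta in_SL2Z => /eqP dg.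
have [c0|c1] := boolP (2 %| g 1%R 0%R)%Z.
  by exists g; [rewrite inE hg | constructor 1].
have [d0|d1] := boolP (2 %| g 1%R 1%R)%Z.
  exists (mx2 (- g 0 1) (g 0 0) (- g 1 1) (g 1 0)).
    by rewrite in_Gamma0 rpredN d0 andbT; apply/eqP; rewrite -dg; ring.
  by constructor 2; rewrite {1}[g]mx2_eta mx2M; congr mx2; ring.
exists (mx2 (g 0 0 - g 0 1) (g 0 0) (g 1 0 - g 1 1) (g 1 0)).
  rewrite in_Gamma0; apply/andP; split; first by apply/eqP; rewrite -dg; ring.
  move: c1 d1; rewrite !dvdzE /=; move: (g 1 0) (g 1 1) => c d; lia.
by constructor 3; rewrite {1}[g]mx2_eta !mx2M; congr mx2; ring.
Qed.

(** * The slash action and its reduction to generators *)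

Section Slash.
Variable R : realType.
Local Notation C := (CC R).
Local Notation upper_half := (@upper_half R).
Implicit Types (g h : 'M[int]_2) (tau : C) (F : C -> 'cV[C]_2).

Definition jf g tau : C := (g 1 0)%:~R * tau + (g 1 1)%:~R.
Definition mob g tau : C := ((g 0 0)%:~R * tau + (g 0 1)%:~R) / jf g tau.

Lemma slashE k g F tau : slash k g F tau = jf g tau ^ (- k) *: F (mob g tau).
Proof. by []. Qed.

Lemma jf_neq0 g tau : g \in SL2Z -> upper_half tau -> jf g tau != 0.
Proof.
rewrite [g]mx2_eta in_SL2Z /jf !mxE /=; move: (g 0 0) (g 0 1) (g 1 0) (g 1 1) => a b c d /eqP h ht.
apply/eqP => h0; have := congr1 (@complex.Im R) h0.
rewrite !intC cImD cImM /= mul0r !addr0 => /eqP; rewrite mulf_eq0 (gt_eqF ht) orbF intr_eq0 => /eqP c0.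
move: h0 h; rewrite c0 mul0r add0r => /eqP; rewrite intr_eq0 => /eqP ->.
by rewrite !mulr0.
Qed.

Lemma mob_upper g tau : g \in SL2Z -> upper_half tau -> upper_half (mob g tau).
Proof.
move=> hg ht; have j0 := jf_neq0 hg ht.
have : complex.Im (mob g tau) = complex.Im tau / md (jf g tau) ^+ 2.
  move: hg j0; rewrite [g]mx2_eta in_SL2Z /mob /jf !mxE /= => /eqP h.
  move: (g 0 0) (g 0 1) (g 1 0) (g 1 1) h => a b c d h.
  pose num : C := a%:~R * tau + b%:~R; pose j : C := c%:~R * tau + d%:~R.
  rewrite -/num -/j => j0.
  have jV : j^-1 = (md j ^- 2)%:C%C * (j^*)%C.
    rewrite invc_norm normE; congr (_ * _); rewrite -rmorphXn -rmorphV ?unitfE //.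
    by rewrite expf_neq0 // md_eq0.
  have hR : (a%:~R * d%:~R - b%:~R * c%:~R : R) = 1 by rewrite -!intrM -intrB h.
  rewrite jV mulrCA cImM /= mul0r addr0 mulrC; congr (_ / _).
  rewrite cImM /num /j !intC; case: tau ht {num j0 jV j} => x y ht.
  rewrite !cReD !cImD !cReM !cImM /= !mul0r !subr0 !addr0.
  set A : R := a%:~R in hR *; set B : R := b%:~R in hR *; set CC := c%:~R in hR *; set D := d%:~R in hR *.
  rewrite -[RHS]mul1r -hR; ring.
by rewrite /Defs.upper_half => ->; rewrite divr_gt0 // exprn_gt0 // md_gt0.
Qed.

Lemma jfM g h tau : h \in SL2Z -> upper_half tau ->
  jf (g *m h) tau = jf g (mob h tau) * jf h tau.
Proof.
move=> hh ht; have j0 := jf_neq0 hh ht; rewrite {1}/jf !mxE !sum2 !rmorphD !rmorphM /=.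
have -> : jf g (mob h tau) = (g 1 0)%:~R * (((h 0 0)%:~R * tau + (h 0 1)%:~R) / jf h tau)
    + (g 1 1)%:~R by [].
by rewrite [RHS]mulrDl -[_ * _ * jf h tau]mulrA divfK // /jf; ring.
Qed.

Lemma mobM g h tau : g \in SL2Z -> h \in SL2Z -> upper_half tau ->
  mob (g *m h) tau = mob g (mob h tau).
Proof.
move=> hg hh ht; have j0 := jf_neq0 hh ht; have j1 := jf_neq0 hg (mob_upper hh ht).
rewrite {1 2}/mob jfM // !mxE !sum2 !rmorphD !rmorphM /=.
have e : (g 0 0)%:~R * mob h tau + (g 0 1)%:~R =
   (((g 0 0)%:~R * (h 0 0)%:~R + (g 0 1)%:~R * (h 1 0)%:~R) * tau +
    ((g 0 0)%:~R * (h 0 1)%:~R + (g 0 1)%:~R * (h 1 1)%:~R)) / jf h tau.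
  apply: (mulIf j0); rewrite divfK // mulrDl {1}/mob mulrA divfK // /jf; ring.
by rewrite e invfM mulrA mulrAC.
Qed.

Lemma slashM k g h F tau : g \in SL2Z -> h \in SL2Z -> upper_half tau ->
  slash k (g *m h) F tau = slash k h (slash k g F) tau.
Proof.
move=> hg hh ht; have hm := mob_upper hh ht.
rewrite !slashE (jfM g hh ht) (mobM hg hh ht) scalerA; congr (_ *: _).
by rewrite mulrC expfzMl.
Qed.

Lemma slash_ext k g F G tau : g \in SL2Z -> upper_half tau ->
  (forall t, upper_half t -> F t = G t) -> slash k g F tau = slash k g G tau.
Proof. by move=> hg ht h; rewrite !slashE; congr (_ *: _); apply: h; exact: mob_upper. Qed.

Lemma slash_mul k g F (M : 'M[C]_2) tau :
  slash k g (fun t => M *m F t) tau = M *m slash k g F tau.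
Proof. by rewrite !slashE scalemxAr. Qed.

Lemma slash1 k F tau : slash k 1%:M F tau = F tau.
Proof.
by rewrite slashE /mob /jf !mxE /= mul0r add0r divr1 mul1r addr0 exp1rz scale1r.
Qed.

Lemma slashT k n F tau : slash k (Tn n) F tau = F (tau + n%:~R).
Proof.
by rewrite slashE /mob /jf !mxE /= mul0r add0r divr1 mul1r exp1rz scale1r.
Qed.

Lemma slashS k F tau : slash k Smx F tau = tau ^ (- k) *: F (- tau^-1).
Proof.
by rewrite slashE /mob /jf !mxE /= mul0r add0r mul1r addr0 mulN1r.
Qed.

Lemma slashN1 k F tau : slash k N1mx F tau = (-1) ^ (- k) *: F tau.
Proof.
rewrite slashE /mob /jf !mxE /= mul0r add0r addr0.
by congr (_ *: F _); rewrite mulN1r mulrN1z divrNN divr1.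
Qed.

Lemma Smx_SL2Z : Smx \in SL2Z. Proof. by rewrite in_SL2Z. Qed.
Lemma Tn_SL2Z n : Tn n \in SL2Z. Proof. exact: Gamma0_SL2Z (Tn_Gamma0 n). Qed.

Lemma ST2 : Smx *m Tn 2 = Un (-1) *m Smx.
Proof. by rewrite !mx2M; congr mx2. Qed.

(** Because S T^2 = U^(-1) S, invariance under U is equivalent to a translation law for F|S. In this
    form every condition except that for -1 concerns a translation and can be read from an
    expansion. *)
Lemma modular_from_generators k (sigma : 'M[int]_2 -> 'M[C]_2) F : is_rep sigma ->
  (forall tau, upper_half tau -> F (tau + 1) = sigma Tmx *m F tau) ->
  (forall tau, upper_half tau ->
     slash k Smx F (tau + 2) = sigma (Un (-1)) *m slash k Smx F tau) ->
  (forall tau, upper_half tau -> (-1) ^ (- k) *: F tau = sigma N1mx *m F tau) ->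
  forall g tau, g \in Gamma0_2 -> upper_half tau -> slash k g F tau = sigma g *m F tau.
Proof.
move=> [su s1 sM] hT hU hN g tau hg; move: g hg tau.
pose Pr g := forall tau, upper_half tau -> slash k g F tau = sigma g *m F tau.
have PrV g h : g \in Gamma0_2 -> h \in Gamma0_2 -> g *m h = 1%:M -> Pr g -> Pr h.
  move=> hg hh e hp tau ht.
  have e2 : sigma g *m sigma h = 1%:M by rewrite -sM // e.
  have : slash k h (slash k g F) tau = F tau.
    by rewrite -slashM ?Gamma0_SL2Z // e slash1.
  rewrite (@slash_ext k h (slash k g F) (fun t => sigma g *m F t)) ?Gamma0_SL2Z //.
  rewrite slash_mul => e3; rewrite -[LHS]mul1mx -[in LHS](mulmx1C e2) -mulmxA e3.
  by [].
apply: (@Gamma0_gen Pr).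
- move=> g h hg hh pg ph tau ht; rewrite slashM ?Gamma0_SL2Z //.
  rewrite (@slash_ext k h (slash k g F) (fun t => sigma g *m F t)) ?Gamma0_SL2Z //.
  by rewrite slash_mul ph // mulmxA -sM.
- exact: PrV.
- by move=> tau ht; rewrite slashT hT // TmxE.
- apply: (@PrV (Un (-1))); rewrite ?Un_Gamma0 //.
    by rewrite UnD addNr mx2_1.
  move=> tau ht; have ht' := upper_inv ht.
  have := hU _ ht'; rewrite -(slashT k 2) -slashM ?Smx_SL2Z ?Tn_SL2Z // ST2.
  rewrite slashM ?Smx_SL2Z ?Gamma0_SL2Z ?Un_Gamma0 // !slashS invrN invrK opprK.
  rewrite -scalemxAr => /scalerI; apply.
  by rewrite expfz_neq0 // oppr_eq0 invr_eq0 upper_neq0.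
- by move=> tau ht; rewrite slashN1 hN.
Qed.

Lemma modular_generators k (sigma : 'M[int]_2 -> 'M[C]_2) F :
  (forall g tau, g \in Gamma0_2 -> upper_half tau -> slash k g F tau = sigma g *m F tau) ->
  [/\ forall tau, upper_half tau -> F (tau + 1) = sigma Tmx *m F tau,
      forall tau, upper_half tau ->
        slash k Smx F (tau + 2) = sigma (Un (-1)) *m slash k Smx F tau
    & forall tau, upper_half tau -> (-1) ^ (- k) *: F tau = sigma N1mx *m F tau].
Proof.
move=> h; split=> tau ht.
- by rewrite -h ?TmxE ?Tn_Gamma0 // slashT.
- rewrite -(slashT k 2) -slashM ?Smx_SL2Z ?Tn_SL2Z // ST2 slashM ?Smx_SL2Z ?Gamma0_SL2Z ?Un_Gamma0 //.
  rewrite (@slash_ext _ _ _ (fun t => sigma (Un (-1)) *m F t)) ?Smx_SL2Z // ?slash_mul //.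
  by move=> t ht2; rewrite h ?Un_Gamma0.
- by rewrite -(h N1mx tau N1_Gamma0 ht) slashN1.
Qed.

End Slash.

(** * Expansions at the cusps *)

Section CuspExpansion.
Variable R : realType.
Local Notation C := (CC R).
Local Notation twopii := (twopii R).
Local Notation upper_half := (@upper_half R).
Local Notation Re := (@complex.Re R).
Implicit Types (A B : nat -> C) (s mu nu tau t : C) (f g : C -> C).

(** The substitution of z^k, which rewrites a series in q^(1/h) as one in q^(1/(k h)). *)
Definition spread (k : nat) A n : C := if (k %| n)%N then A (n %/ k)%N else 0.

Lemma disc_spread k A : (0 < k)%N -> disc A -> disc (spread k A).
Proof.
move=> k0 hA; apply: disc_bd => t /andP[t0 t1].
have t2 : 0 <= t ^+ k < 1 by rewrite exprn_ge0 //= expr_lt1.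
have [M hM] := summable_bounded (hA _ t2).
have M0 : 0 <= M by apply: le_trans (hM 0%N); rewrite mulr_ge0 ?md_ge0 ?exprn_ge0.
exists M => n; rewrite /spread; case: ifP => o; last by rewrite md0 mul0r.
by apply: le_trans (hM (n %/ k)%N); rewrite -exprM mulnC divnK.
Qed.

Lemma sum_spread k A z n : (0 < k)%N ->
  \sum_(i < k * n) spread k A i * z ^+ i = \sum_(i < n) A i * (z ^+ k) ^+ i.
Proof.
move=> k0; elim: n => [|n IH]; first by rewrite muln0 !big_ord0.
rewrite mulnS addnC big_split_ord /= IH big_ord_recr /=; congr (_ + _).
case: k k0 {IH} => // k _; rewrite big_ord_recl /= big1 ?addr0.
  by rewrite /spread addn0 dvdn_mulr // mulKn // exprM.
move=> i _; rewrite /spread /bump /= add1n dvdn_addr ?dvdn_mulr //.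
by rewrite gtnNdvd ?mul0r // ltnS.
Qed.

Lemma ev_spread k A z : (0 < k)%N -> disc A -> md z < 1 -> ev (spread k A) z = ev A (z ^+ k).
Proof.
move=> k0 hA hz.
have /asum_cvg := disc_asum (disc_spread k0 hA) hz.
move=> /cvgnC h1; symmetry; apply: csum_uniq; apply/cvgnC => e /h1 [N hN].
exists N => n hn; have := hN (k * n)%N ltac:(nia); rewrite /series /= !big_mkord.
by rewrite sum_spread.
Qed.

Lemma qs_spread k h mu A tau : (0 < k)%N -> (0 < h)%N -> upper_half tau -> disc A ->
  qs (k * h) (k%:R * mu) (spread k A) tau = qs h mu A tau.
Proof.
move=> k0 h0 ht hA; have kh : (0 < k * h)%N by rewrite muln_gt0 k0.
have k1 : (k%:R : C) != 0 by rewrite pnatr_eq0 -lt0n.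
have h1 : (h%:R : C) != 0 by rewrite pnatr_eq0 -lt0n.
rewrite /qs (ev_spread k0 hA (md_qpow_lt1 kh ht)) -qpowMn natrM.
have -> : k%:R * mu / (k%:R * h%:R) = mu / h%:R by move: (k%:R : C) (h%:R : C) k1 h1 => x y *; field; apply/andP.
have -> // : (k%:R * h%:R)^-1 * k%:R = (h%:R^-1 : C).
by move: (k%:R : C) (h%:R : C) k1 h1 => x y *; field; apply/andP.
Qed.

Variables (S : C -> Prop) (N : nat).
Hypothesis N_gt0 : (0 < N)%N.

(* The powers of tau come from monodromies that are not diagonalizable; S restricts the
   exponents, to Re mu >= 0 for holomorphy at the cusp. *)
Inductive cusp_sum : (C -> C) -> Prop :=
  | cusp_sum_qs mu A of S mu & disc A : cusp_sum (qs N mu A)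
  | cusp_sum_add f g of cusp_sum f & cusp_sum g : cusp_sum (fun t => f t + g t)
  | cusp_sum_tau f of cusp_sum f : cusp_sum (fun t => t * f t)
  | cusp_sum_ext f g of (forall t, upper_half t -> f t = g t) & cusp_sum f : cusp_sum g.

Lemma cusp_sumZ c f : cusp_sum f -> cusp_sum (fun t => c * f t).
Proof.
elim=> {f} [mu A hm hA|f g _ hf _ hg|f _ hf|f g e _ hf].
- apply: cusp_sum_ext (cusp_sum_qs hm (discZ c hA)) => t ht; exact: qsZ.
- by apply: cusp_sum_ext (cusp_sum_add hf hg) => t ht; rewrite mulrDr.
- by apply: cusp_sum_ext (cusp_sum_tau hf) => t ht; rewrite mulrCA.
- by apply: cusp_sum_ext hf => t ht; rewrite e.
Qed.

Lemma cusp_sum_deriv f : cusp_sum f -> exists2 g, cusp_sum g & forall t, upper_half t -> hasd f t (g t).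
Proof.
elim=> {f} [mu A hm hA|f g _ [f1 h1 h2] _ [g1 h3 h4]|f hf [f1 h1 h2]|f g e _ [f1 h1 h2]].
- exists (fun t => twopii / N%:R * qs N mu (theta mu A) t).
    by apply: cusp_sumZ; apply: cusp_sum_qs => //; exact: disc_theta.
  by move=> t ht; exact: hasd_qs.
- exists (fun t => f1 t + g1 t); first exact: cusp_sum_add.
  by move=> t ht; apply: hasdD; [exact: h2|exact: h4].
- exists (fun t => f t + t * f1 t); first by apply: cusp_sum_add hf _; exact: cusp_sum_tau.
  by move=> t ht; have := hasdM (hasd_id t) (h2 t ht); rewrite mul1r.
- exists f1 => // t ht; apply: hasd_ext (h2 t ht).
  by have [r r0 hr] := upper_open ht; exists r => // y /hr; exact: e.
Qed.

Lemma cusp_sum_shift (k : nat) f : cusp_sum f -> cusp_sum (fun t => f (t + k%:R)).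
Proof.
have N1 : (N%:R : C) != 0 by rewrite pnatr_eq0 -lt0n.
elim=> {f} [mu A hm hA|f g _ hf _ hg|f _ hf|f g e _ hf].
- pose u := qpow N%:R^-1 (k%:R : C).
  have u1 : md u = 1.
    by rewrite /u (natC R N) -fmorphV md_qpow_real (natC R k) /= mulr0 oppr0 expR0.
  have hB : disc (fun n => A n * u ^+ n).
    by apply: disc_le hA _ => n; rewrite mdM mdX u1 expr1n mulr1.
  apply: cusp_sum_ext (cusp_sumZ (qpow (mu / N%:R) k%:R) (cusp_sum_qs hm hB)) => t ht.
  have ee z : ev (fun n => A n * u ^+ n) z = ev A (z * u).
    by apply: eq_csum => n; rewrite exprMn [z ^+ n * _]mulrC mulrA.
  rewrite /qs ee !qpow_add -/u; move: (ev A _) (qpow _ t) (qpow _ k%:R) => x y z.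
  by rewrite mulrCA mulrA.
- exact: cusp_sum_add.
- by apply: cusp_sum_ext (cusp_sum_add (cusp_sum_tau hf) (cusp_sumZ k%:R hf)) => t ht; rewrite mulrDl.
- by apply: cusp_sum_ext hf => t ht; rewrite e //; exact: upper_addn.
Qed.

End CuspExpansion.

Arguments cusp_sum {R} S N f.

Section HolomorphicCusp.
Variable R : realType.
Local Notation C := (CC R).
Local Notation twopii := (twopii R).
Local Notation upper_half := (@upper_half R).
Local Notation Re := (@complex.Re R).
Implicit Types (A B : nat -> C) (s mu nu tau t : C) (f g : C -> C) (N : nat).

Definition Re_ge0 mu := 0 <= Re mu.

Lemma cusp_sum_mul_qs N nu B f : (0 < N)%N -> Re_ge0 nu -> disc B -> cusp_sum Re_ge0 N f ->
  cusp_sum Re_ge0 N (fun t => qs N nu B t * f t).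
Proof.
move=> N0 hn hB; elim=> {f} [mu A hm hA|f g _ hf _ hg|f _ hf|f g e _ hf].
- have hmn : Re_ge0 (nu + mu) by rewrite /Re_ge0 cReD addr_ge0.
  apply: cusp_sum_ext (cusp_sum_qs N hmn (discM hB hA)) => t ht; exact: qsM.
- by apply: cusp_sum_ext (cusp_sum_add hf hg) => t ht; rewrite mulrDr.
- by apply: cusp_sum_ext (cusp_sum_tau hf) => t ht; rewrite mulrCA.
- by apply: cusp_sum_ext hf => t ht; rewrite e.
Qed.

Lemma cusp_sumM N f g : (0 < N)%N -> cusp_sum Re_ge0 N f -> cusp_sum Re_ge0 N g -> cusp_sum Re_ge0 N (fun t => f t * g t).
Proof.
move=> N0 hf hg; elim: hf => {f} [mu A hm hA|f f' _ hf _ hf'|f _ hf|f f' e _ hf].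
- exact: cusp_sum_mul_qs.
- by apply: cusp_sum_ext (cusp_sum_add hf hf') => t ht; rewrite mulrDl.
- by apply: cusp_sum_ext (cusp_sum_tau hf) => t ht; rewrite mulrA.
- by apply: cusp_sum_ext hf => t ht; rewrite e.
Qed.

Lemma cusp_sum_lift k N f : (0 < k)%N -> (0 < N)%N -> cusp_sum Re_ge0 N f -> cusp_sum Re_ge0 (k * N) f.
Proof.
move=> k0 N0; elim=> {f} [mu A hm hA|f g _ hf _ hg|f _ hf|f g e _ hf].
- have hkm : Re_ge0 (k%:R * mu).
    by rewrite /Re_ge0 natC cReM /= mul0r subr0 mulr_ge0.
  apply: cusp_sum_ext (cusp_sum_qs (k * N) hkm (disc_spread k0 hA)) => t ht; exact: qs_spread.
- exact: cusp_sum_add.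
- exact: cusp_sum_tau.
- exact: cusp_sum_ext e hf.
Qed.

Lemma asum_qs N mu A tau : (0 < N)%N -> disc A -> upper_half tau ->
  asum (fun n => A n * qpow ((mu + n%:R) / N%:R) tau).
Proof.
move=> N0 hA ht; have := asumZ (qpow (mu / N%:R) tau) (disc_asum hA (md_qpow_lt1 N0 ht)).
by congr asum; apply/funext => k; rewrite mulrDl qpowD [k%:R / _]mulrC qpowMn mulrCA.
Qed.

Lemma qs_csum N mu A tau : (0 < N)%N -> disc A -> upper_half tau ->
  qs N mu A tau = csum (fun n => A n * qpow ((mu + n%:R) / N%:R) tau).
Proof.
move=> N0 hA ht; rewrite /qs /ev -csumZ; last exact: disc_asum (md_qpow_lt1 N0 ht).
by apply: eq_csum => k; rewrite mulrDl qpowD [k%:R / _]mulrC qpowMn mulrCA.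
Qed.

Lemma qs_trim N mu A j : (0 < N)%N -> disc A -> (forall n, (n < j)%N -> A n = 0) ->
  forall tau, upper_half tau -> qs N mu A tau = qs N (mu + j%:R) (fun n => A (j + n)%N) tau.
Proof.
move=> N0 hA h tau ht; have hB : disc (fun n => A (j + n)%N).
  elim: j {h} => [|j IH] //; apply: eq_disc (disc_tail IH) => n.
  by rewrite addSnnS.
rewrite -(qs_zshift _ _ N0 ht hB); congr qs; apply/funext => n; rewrite /zshift.
by case: ltnP => [/h //|hn]; rewrite subnKC.
Qed.

(** The series may be written with a starting exponent of negative real part and vanishing first
    coefficients; dropping them moves the exponent to where [Re_ge0] holds. *)
Lemma cusp_sum_trim N mu A : (0 < N)%N -> disc A -> (forall n, Re (mu + n%:R) < 0 -> A n = 0) ->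
  cusp_sum Re_ge0 N (qs N mu A).
Proof.
move=> N0 hA h.
have hRe n : Re (mu + n%:R) = Re mu + n%:R by rewrite natC cReD.
have hex : exists n, Re_ge0 (mu + n%:R).
  exists `|Num.floor (- Re mu)|.+1%N; rewrite /Re_ge0 hRe.
  have := @floorD1_gt R (- Re mu); move: (Num.floor _) => z hz.
  have : (z + 1)%:~R <= (`|z|%N.+1%:R : R) by rewrite -[X in _ <= X]/((Posz _)%:~R) ler_int; lia.
  lra.
have hex2 : exists n, `[< Re_ge0 (mu + n%:R) >] by have [n hn] := hex; exists n; apply/asboolP.
case: (ex_minnP hex2) => j /asboolP hj hmin.
have hz n : (n < j)%N -> A n = 0.
  move=> hn; apply: h; rewrite ltNge; apply/negP => h2.
  by have := hmin n (asboolT h2); rewrite leqNgt hn.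
have hB : disc (fun n => A (j + n)%N).
  elim: j {hj hmin hz} => [|j IH] //; apply: eq_disc (disc_tail IH) => n.
  by rewrite addSnnS.
by apply: cusp_sum_ext (cusp_sum_qs N hj hB) => t ht; rewrite -qs_trim.
Qed.

Lemma disc_of_cvg N mu A : (0 < N)%N ->
  (forall tau, upper_half tau -> exists M, forall n, md (A n * qpow ((mu + n%:R) / N%:R) tau) <= M) ->
  disc A.
Proof.
move=> N0 h; apply: disc_bd => t /andP[t0 t1].
have [t_0|t_0] := eqVneq t 0.
  exists (md (A 0%N)) => n; rewrite t_0; case: n => [|n]; first by rewrite mulr1.
  by rewrite exprS mul0r mulr0 md_ge0.
have tt : 0 < t < 1 by rewrite lt_neqAle eq_sym t_0 t0.
have [tau ht e] := qpow_onto N0 tt; have [M hM] := h tau ht.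
have q0 : 0 < md (qpow (mu / N%:R) tau) by rewrite md_gt0 qpow_neq0.
exists (M / md (qpow (mu / N%:R) tau)) => n; rewrite ler_pdivlMr //.
apply: le_trans (hM n); rewrite mulrDl qpowD [n%:R / _]mulrC qpowMn e !mdM mdX md_real.
by rewrite ger0_norm // -mulrA [_ * md _]mulrC.
Qed.

Lemma cvgn_bounded (u : nat -> C) (l : C) : (series u n @[n --> \oo] --> l)%classic ->
  exists M, forall n, md (u n) <= M.
Proof.
move=> /cvgnC h; have [n0 hn0] := h 1 ltr01.
pose b n := md (u n).
exists (2 + \sum_(i < n0) b i) => n; case: (ltnP n n0) => hn.
  rewrite (bigD1 (Ordinal hn)) //= /b.
  have : 0 <= \sum_(i < n0 | i != Ordinal hn) b i by apply: sumr_ge0 => i _; exact: md_ge0.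
  rewrite /b; lra.
have h1 := hn0 n hn; have h2 := hn0 n.+1 (leqW hn).
have e : u n = (series u n.+1 - l) - (series u n - l).
  by rewrite /series /= big_nat_recr //=; ring.
have h3 := mdD (series u n.+1 - l) (- (series u n - l)); rewrite mdN -e in h3.
have : 0 <= \sum_(i < n0) b i by apply: sumr_ge0 => i _; exact: md_ge0.
move: h1 h2 h3; lra.
Qed.

Lemma cusp_sum_of_expansion N f : (0 < N)%N -> holomorphic_expansion N f -> cusp_sum Re_ge0 N f.
Proof.
move=> N0 [M [j [mu [c [hc hf]]]]].
have key m : exists2 g, cusp_sum Re_ge0 N g &
    forall tau h, upper_half tau -> zseries_to (fun n => c m n * qpow ((n%:~R + mu m) / N%:R) tau) h ->
      g tau = h.
  (* All coefficients with index below - p vanish, so the two-sided series is a one-sided one that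
     starts at the exponent mu - p. *)
  pose p := `|Num.floor (Re (mu m))|.+1%N.
  have hp n : (n < - p%:Z) -> c m n = 0.
    move=> hn; apply: hc; rewrite intC cReD /=.
    have := @floorD1_gt R (Re (mu m)) => hz.
    have : (n + (Num.floor (Re (mu m)) + 1))%:~R <= ((-1)%:~R : R) by rewrite ler_int; lia.
    rewrite rmorphD /=; lra.
  pose A k := c m (k%:Z - p%:Z); pose nu := mu m - p%:R.
  have eA k tau : A k * qpow ((nu + k%:R) / N%:R) tau =
      c m (k%:Z - p%:Z) * qpow (((k%:Z - p%:Z)%:~R + mu m) / N%:R) tau.
    have -> // : nu + k%:R = (k%:Z - p%:Z)%:~R + mu m.
    by rewrite /nu rmorphB /= -!pmulrn; move: (k%:R : C) (p%:R : C) => x y; ring.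
  have hA : disc A.
    apply: (@disc_of_cvg N nu) => // tau ht.
    have [h [/(_ m) [lp [ln [/cvgn_bounded [B hB] _ _]]] _]] := hf tau ht.
    exists (B + \sum_(i < p) md (A i * qpow ((nu + i%:R) / N%:R) tau)) => n.
    have s0 (P : pred 'I_p) : 0 <= \sum_(i < p | P i) md (A i * qpow ((nu + i%:R) / N%:R) tau).
      by apply: sumr_ge0 => i _; exact: md_ge0.
    have B0 : 0 <= B by apply: le_trans (hB 0%N); exact: md_ge0.
    case: (ltnP n p) => hn.
      by rewrite (bigD1 (Ordinal hn)) //=; have := s0 (fun i => i != Ordinal hn); lra.
    have := hB (n - p)%N; rewrite eA.
    have -> : (n - p)%N%:Z = n%:Z - p%:Z by lia.
    by have := s0 predT; move=> *; lra.
  exists (qs N nu A).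
    apply: cusp_sum_trim => // n hn; apply: hc; move: hn; rewrite /nu rmorphB /= -!pmulrn.
    by have -> : mu m - p%:R + n%:R = n%:R - p%:R + mu m by move: (n%:R : C) (p%:R : C) => x y; ring.
  move=> tau h ht [lp [ln [h1 h2 ->]]].
  have as1 := asum_qs nu N0 hA ht.
  rewrite qs_csum // (csum_split p as1) addrC; congr (_ + _).
    rewrite -(csum_uniq h1); apply: eq_csum => k; rewrite eA.
    by have -> : (p + k)%N%:Z - p%:Z = k%:Z by lia.
  rewrite -(csum_uniq h2) (@csum_finite R _ p).
    rewrite (reindex_inj rev_ord_inj); apply: eq_bigr => i _; rewrite eA /=.
    by have -> : (p - i.+1)%N%:Z - p%:Z = - i.+1%:Z by have := ltn_ord i; lia.
  by move=> n hn; rewrite hp ?mul0r //; lia.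
have [g hg] := choice (fun m => let: ex_intro2 g h1 h2 := key m in ex_intro _ g (conj h1 h2)).
have fxp k (u : C -> C) : cusp_sum Re_ge0 N u -> cusp_sum Re_ge0 N (fun t => t ^+ k * u t).
  elim: k => [|k IH] hu; first by apply: cusp_sum_ext hu => t _; rewrite mul1r.
  by apply: cusp_sum_ext (cusp_sum_tau (IH hu)) => t _; rewrite exprS mulrA.
have : cusp_sum Re_ge0 N (fun t => \sum_m t ^+ j m * g m t).
  have : forall s : seq 'I_M, cusp_sum Re_ge0 N (fun t => \sum_(m <- s) t ^+ j m * g m t).
    elim=> [|m s IH].
      apply: cusp_sum_ext (cusp_sumZ N0 0 (@cusp_sum_qs R Re_ge0 N 0 (cst0 0) _ _)) => [t _||].
      - by rewrite big_nil mul0r.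
      - by rewrite /Re_ge0.
      - exact: disc_cst0.
    by apply: cusp_sum_ext (cusp_sum_add (fxp (j m) _ (hg m).1) IH) => t _; rewrite big_cons.
  by move/(_ (index_enum _)).
apply: cusp_sum_ext => t ht; have [h [h1 ->]] := hf t ht.
by apply: eq_bigr => m _; rewrite ((hg m).2 t (h m)).
Qed.

Lemma expansion_of_fx N f : (0 < N)%N -> cusp_sum Re_ge0 N f -> holomorphic_expansion N f.
Proof.
move=> N0; elim=> {f} [mu A hm hA|f g _ [M [j [mu [c [h1 h2]]]]] _ [M' [j' [mu' [c' [h3 h4]]]]]
   |f _ [M [j [mu [c [h1 h2]]]]]|f g e _ [M [j [mu [c [h1 h2]]]]]].
- exists 1%N, (fun=> 0%N), (fun=> mu), (fun=> fun n => if n is Posz k then A k else 0).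
  split=> [_ [n|//]|tau ht].
    rewrite intC cReD /= -pmulrn; have : (0 : R) <= n%:R by [].
    by move: hm; rewrite /Re_ge0; move: (n%:R : R) => x *; exfalso; lra.
  exists (fun=> qs N mu A tau); split; last by rewrite big_ord1 mul1r.
  move=> _; exists (qs N mu A tau), 0; split; last by rewrite addr0.
  + rewrite qs_csum //.
    have -> : (fun n : nat => A n * qpow (((Posz n)%:~R + mu) / N%:R) tau) =
       (fun n => A n * qpow ((mu + n%:R) / N%:R) tau) by apply/funext => n; rewrite addrC.
    exact: asum_cvg (asum_qs mu N0 hA ht).
  + apply/cvgnC => e e0; exists 0%N => n _; rewrite /series /= big1 ?subr0 ?md0 // => i _.
    by rewrite mul0r.
- exists (M + M')%N, (fun m => match fintype.split m with inl i => j i | inr i => j' i end),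
    (fun m => match fintype.split m with inl i => mu i | inr i => mu' i end),
    (fun m => match fintype.split m with inl i => c i | inr i => c' i end).
  split=> [m n|tau ht]; first by case: (fintype.split m) => i; [exact: h1|exact: h3].
  have [u [u1 u2]] := h2 tau ht; have [v [v1 v2]] := h4 tau ht.
  exists (fun m => match fintype.split m with inl i => u i | inr i => v i end); split.
    by move=> m; case: (fintype.split m) => i; [exact: u1|exact: v1].
  rewrite big_split_ord /= u2 v2; congr (_ + _); apply: eq_bigr => i _.
    by have := unsplitK (inl i : 'I_M + 'I_M') => /= ->.
  by have := unsplitK (inr i : 'I_M + 'I_M') => /= ->.
- exists M, (fun m => (j m).+1), mu, c; split=> // tau ht.
  have [u [u1 u2]] := h2 tau ht; exists u; split=> //; rewrite u2 mulr_sumr.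
  by apply: eq_bigr => m _; rewrite exprS mulrA.
- exists M, j, mu, c; split=> // tau ht; have [u [u1 u2]] := h2 tau ht.
  by exists u; split=> //; rewrite -e.
Qed.

End HolomorphicCusp.

(** * Periodicity removes the powers of tau *)

Section ExponentialPolynomials.
Variable R : realType.
Local Notation C := (CC R).
Local Notation twopii := (twopii R).
Local Notation upper_half := (@upper_half R).
Local Notation Re := (@complex.Re R).
Implicit Types (A B : nat -> C) (mu nu la tau t : C) (f g : C -> C) (s : seq C).

Variable N : nat.
Hypothesis N_gt0 : (0 < N)%N.

(** The operator (translation by N) - nu, which annihilates the series with multiplier nu. These
    operators commute, and [shs] is a product of them. *)
Definition sh nu f t : C := f (t + N%:R) - nu * f t.
Definition shs s f := foldr sh f s.

Lemma shC nu nu' f : sh nu (sh nu' f) = sh nu' (sh nu f).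
Proof. by apply/funext => t; rewrite /sh; ring. Qed.

Lemma shs_sh s nu f : shs s (sh nu f) = sh nu (shs s f).
Proof. by elim: s => //= a s ->; rewrite shC. Qed.

Lemma shs_cat s s' f : shs (s ++ s') f = shs s (shs s' f).
Proof. by rewrite /shs foldr_cat. Qed.

Lemma shs_comm s s' f : shs s (shs s' f) = shs s' (shs s f).
Proof. by elim: s' => //= a s' IH; rewrite shs_sh IH. Qed.

Lemma shsD s f g : shs s (fun t => f t + g t) = fun t => shs s f t + shs s g t.
Proof. by elim: s => //= a s ->; apply/funext => t; rewrite /sh; ring. Qed.

Lemma shsZ s c f : shs s (fun t => c * f t) = fun t => c * shs s f t.
Proof. by elim: s => //= a s ->; apply/funext => t; rewrite /sh; ring. Qed.

Lemma shs_trans s f : shs s (fun t => f (t + N%:R)) = fun t => shs s f (t + N%:R).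
Proof. by elim: s => //= a s ->; apply/funext => t; rewrite /sh; ring. Qed.

Lemma eq_shs s f g : (forall t, upper_half t -> f t = g t) ->
  forall t, upper_half t -> shs s f t = shs s g t.
Proof.
elim: s => //= a s IH h t ht; have h2 := IH h; rewrite /sh h2 ?h2 //; exact: upper_addn.
Qed.

Lemma shs0 s f : (forall t, upper_half t -> f t = 0) -> forall t, upper_half t -> shs s f t = 0.
Proof.
move=> h t ht; rewrite (@eq_shs s f (fun=> 0 * 0)) // => [|u hu]; last by rewrite h ?mul0r.
by rewrite shsZ mul0r.
Qed.

(** By a Leibniz rule, the operator for a sends u f(u) to u times its value on f plus N f(u + N);
    the second copy of the list absorbs the extra term. *)
Lemma shs_tau s f : (forall t, upper_half t -> shs s f t = 0) ->
  forall t, upper_half t -> shs (s ++ s) (fun u => u * f u) t = 0.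
Proof.
elim: s f => [|a s IH] f h t ht; first by rewrite /= [f t](h t ht) mulr0.
have h2 u : upper_half u -> shs s (sh a f) u = 0 by move=> hu; rewrite shs_sh; exact: h.
rewrite shs_cat /= -!shs_sh.
have -> : sh a (fun u => u * f u) = fun u => u * sh a f u + N%:R * f (u + N%:R).
  by apply/funext => u; rewrite /sh; ring.
rewrite -shs_cat shs_sh shsD [LHS]/sh (IH _ h2 _ ht) (IH _ h2 _ (upper_addn N ht)) !add0r.
rewrite shsZ shs_trans.
have h3 u : upper_half u -> sh a (shs (s ++ s) f) u = 0.
  by move=> hu; rewrite shs_cat -shs_sh; apply: shs0 hu => v hv; exact: h.
have := h3 _ (upper_addn N ht); rewrite [X in X = 0 -> _]/sh => h4.
by rewrite mulrCA -mulrBr h4 mulr0.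
Qed.

Definition eig1 mu := Re_ge0 mu /\ cexp (twopii * mu) = 1.

(** Exponents of multiplier 1 are separated from the others. The multipliers in [s] all differ from
    1, so their product of operators acts invertibly on periodic functions. *)
Lemma cusp_sum_decomp f : cusp_sum (@Re_ge0 R) N f -> exists f1 f2 s,
  [/\ cusp_sum (eig1) N f1, forall t, upper_half t -> f t = f1 t + f2 t,
      all (fun nu => nu != 1) s & forall t, upper_half t -> shs s f2 t = 0].
Proof.
elim=> {f} [mu A hm hA|f g _ [f1 [f2 [s [h1 h2 h3 h4]]]] _ [g1 [g2 [s' [h1' h2' h3' h4']]]]
   |f _ [f1 [f2 [s [h1 h2 h3 h4]]]]|f g e _ [f1 [f2 [s [h1 h2 h3 h4]]]]].
- have [e|ne] := eqVneq (cexp (twopii * mu)) 1.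
    exists (qs N mu A), (fun=> 0), [::]; split=> //.
      exact: cusp_sum_qs.
    by move=> t _; rewrite addr0.
  have z2 : cusp_sum (eig1) N (fun=> 0).
    have h0 : eig1 0 by split; rewrite ?mulr0 ?cexp0 // /Re_ge0.
    by apply: cusp_sum_ext (cusp_sumZ N_gt0 0 (cusp_sum_qs N h0 (disc_cst0 0))) => t _; rewrite mul0r.
  exists (fun=> 0), (qs N mu A), [:: cexp (twopii * mu)]; split=> //=.
  + by move=> t _; rewrite add0r.
  + by rewrite ne.
  + by move=> t _; rewrite /sh qs_period // subrr.
- exists (fun t => f1 t + g1 t), (fun t => f2 t + g2 t), (s ++ s'); split.
  + exact: cusp_sum_add.
  + by move=> t ht; rewrite h2 // h2' //; ring.
  + by rewrite all_cat h3.
  + move=> t ht; rewrite shs_cat; have -> : 0 = 0 + 0 :> C by rewrite addr0.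
    rewrite !shsD; congr (_ + _); last exact: shs0.
    by rewrite shs_comm; exact: shs0.
- exists (fun t => t * f1 t), (fun t => t * f2 t), (s ++ s); split.
  + exact: cusp_sum_tau.
  + by move=> t ht; rewrite h2 //; ring.
  + by rewrite all_cat h3.
  + exact: shs_tau.
- exists f1, f2, s; split=> // t ht; by rewrite -e // h2.
Qed.

(** On the periodic f the product of operators is the nonzero scalar prod (1 - nu). It annihilates
    [f2], so up to this scalar f is the image of [f1]. *)
Lemma cusp_sum_eig1 f : cusp_sum (@Re_ge0 R) N f ->
  (forall t, upper_half t -> f (t + N%:R) = f t) -> cusp_sum eig1 N f.
Proof.
move=> /cusp_sum_decomp [f1 [f2 [s [h1 h2 h3 h4]]]] hf.
have e t : upper_half t -> shs s f t = (\prod_(nu <- s) (1 - nu)) * f t.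
  elim: s {h3 h4} t => [|a s IH] t ht; first by rewrite big_nil mul1r.
  by rewrite big_cons /= /sh IH ?IH ?hf //; [ring|exact: upper_addn].
have p0 : \prod_(nu <- s) (1 - nu) != 0.
  elim: s h3 {h4 e} => [|a s IH] /=; first by rewrite big_nil oner_neq0.
  by move=> /andP[ha hs]; rewrite big_cons mulf_neq0 ?IH // subr_eq0 eq_sym.
have h5 : cusp_sum eig1 N (shs s f1).
  elim: s {h3 h4 e p0} => //= a s IH.
  apply: cusp_sum_ext (cusp_sum_add (cusp_sum_shift N_gt0 N IH) (cusp_sumZ N_gt0 (- a) IH)) => t _.
  by rewrite /sh mulNr.
apply: cusp_sum_ext (cusp_sumZ N_gt0 (\prod_(nu <- s) (1 - nu))^-1 h5) => t ht.
apply: (mulfI p0); rewrite mulrA divff // mul1r -e // (eq_shs s h2) // shsD h4 //.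
by rewrite addr0.
Qed.

Lemma disc0 : disc (fun=> 0 : C).
Proof. by apply: eq_disc (discZ 0 (@disc_one R)) => i; rewrite mul0r. Qed.

Lemma qs_zero h mu tau : qs h mu (fun=> 0) tau = 0 :> C.
Proof. by rewrite /qs /ev (@csum_finite R _ 0) ?big_ord0 ?mulr0 // => i _; rewrite mul0r. Qed.

Lemma cusp_sum_eig1_poly f : cusp_sum eig1 N f -> exists (J : nat) (A : nat -> nat -> C),
  [/\ forall j, disc (A j), forall j, (J <= j)%N -> A j = fun=> 0 &
      forall t, upper_half t -> f t = \sum_(j < J) t ^+ j * qs N 0 (A j) t].
Proof.
have ext (J J' : nat) (A : nat -> nat -> C) t : (forall j, (J <= j)%N -> A j = fun=> 0) ->
    \sum_(j < J + J') t ^+ j * qs N 0 (A j) t = \sum_(j < J) t ^+ j * qs N 0 (A j) t.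
  move=> h; rewrite big_split_ord /= [X in _ + X]big1 ?addr0 // => i _.
  by rewrite h ?leq_addr // qs_zero mulr0.
elim=> {f} [mu A [hm he] hA|f g _ [J [A [h1 h2 h3]]] _ [J' [A' [h1' h2' h3']]]
   |f _ [J [A [h1 h2 h3]]]|f g e _ [J [A [h1 h2 h3]]]].
- have [n hn] := cexp_eq1 he; case: n hn => n hn.
    exists 1%N, (fun j => if j is 0 then zshift n A else fun=> 0); split.
    + by case=> [|j]; [exact: disc_zshift | exact: disc0].
    + by case.
    + move=> t ht; rewrite big_ord1 mul1r qs_zshift // add0r hn.
      by [].
  exfalso; move: hm; rewrite /Re_ge0 hn NegzE intC /= rmorphN /= oppr_ge0 -pmulrn.
  by rewrite leNgt ltr0n.
- exists (J + J')%N, (fun j n => A j n + A' j n); split.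
  + by move=> j; exact: discD.
  + move=> j hj; apply/funext => n; rewrite h2 ?h2' ?addr0 //; lia.
  + move=> t ht; rewrite h3 // h3' // -(ext J J' A) // -(ext J' J A') // [(J' + J)%N]addnC.
    by rewrite -big_split; apply: eq_bigr => j _; rewrite /= qsD // mulrDr.
- exists J.+1, (fun j => if j is j'.+1 then A j' else fun=> 0); split.
  + by case=> [|j]; [exact: disc0 | exact: h1].
  + by case=> // j hj; exact: h2.
  + move=> t ht; rewrite big_ord_recl /= qs_zero mulr0 add0r h3 // mulr_sumr.
    by apply: eq_bigr => j _; rewrite exprS mulrA.
- exists J, A; split=> // t ht; by rewrite -e // h3.
Qed.

(* For fixed t the polynomial with coefficients qs N 0 (A j) t takes the value f t at all
   t + n * N, so it is constant. *)
Lemma cusp_sum_periodic f : cusp_sum (@Re_ge0 R) N f ->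
  (forall t, upper_half t -> f (t + N%:R) = f t) ->
  exists2 A, disc A & forall t, upper_half t -> f t = qs N 0 A t.
Proof.
move=> h hp; have [J [A [h1 h2 h3]]] := cusp_sum_eig1_poly (cusp_sum_eig1 h hp).
exists (A 0%N) => // t ht; pose p := \poly_(j < J) qs N 0 (A j) t.
have pt n : p.[t + (n * N)%:R] = f t.
  have ht' : upper_half (t + (n * N)%:R) by exact: upper_addn.
  have -> : f t = f (t + (n * N)%:R).
    elim: n {ht'} => [|n IH]; first by rewrite addr0.
    by rewrite mulSnr natrD addrA hp //; exact: upper_addn.
  have qp j : qs N 0 (A j) (t + (n * N)%:R) = qs N 0 (A j) t.
    elim: n {ht'} => [|n IH]; first by rewrite addr0.
    by rewrite mulSnr natrD addrA qs_period // mulr0 cexp0 mul1r.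
  by rewrite (h3 _ ht') horner_poly; apply: eq_bigr => j _; rewrite qp; exact: mulrC.
have p0 : p - (f t)%:P = 0.
  apply: (@roots_geq_poly_eq0 _ _ [seq t + (i * N)%:R | i <- iota 0 (size (p - (f t)%:P))]).
  - by apply/allP => x /mapP[i _ ->]; rewrite /root !hornerE pt subrr.
  - rewrite map_inj_uniq ?iota_uniq // => i j /addrI /eqP; rewrite eqr_nat eqn_mul2r.
    by rewrite (gtn_eqF N_gt0) => /eqP.
  - by rewrite size_map size_iota.
have : (p - (f t)%:P)`_0 = 0 by rewrite p0 coef0.
rewrite coefB coefC coef_poly /=; case: ltnP => hJ /eqP; rewrite subr_eq0 => /eqP <- //.
by rewrite h2 // qs_zero.
Qed.

End ExponentialPolynomials.

Section Periodic.
Variable R : realType.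
Local Notation C := (CC R).
Local Notation twopii := (twopii R).
Local Notation upper_half := (@upper_half R).
Implicit Types (A B : nat -> C) (mu nu la tau t : C) (f g : C -> C).

Lemma bernoulli_sub (x : R) k : 0 <= x <= 1 -> 1 - k%:R * x <= (1 - x) ^+ k.
Proof.
move=> /andP[x0 x1]; elim: k => [|k IH]; first by rewrite mul0r subr0.
rewrite exprSr; have : (1 - k%:R * x) * (1 - x) <= (1 - x) ^+ k * (1 - x).
  by rewrite ler_wpM2r // subr_ge0.
apply: le_trans; rewrite -natr1; have : 0 <= k%:R * x * x by rewrite !mulr_ge0.
move: (k%:R : R) => y; nra.
Qed.

Lemma disc_subseq k A : (0 < k)%N -> disc A -> disc (fun n => A (k * n)%N).
Proof.
move=> k0 hA; apply: disc_bd => t /andP[t0 t1].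
have kR : (1 : R) <= k%:R by rewrite ler1n.
have k0R : (0 : R) < k%:R by rewrite ltr0n.
have t2 : 0 <= (1 - t) / k%:R <= 1.
  by rewrite divr_ge0 ?subr_ge0 ?(ltW t1) ?(ltW k0R) // andTb ler_pdivrMr // mul1r; lra.
have t3 : 0 < (1 - t) / k%:R by rewrite divr_gt0 ?subr_gt0.
(* By Bernoulli the k-th power of this radius is at least t. *)
have hs : 0 <= 1 - (1 - t) / k%:R < 1 by move: t2 t3; lra.
have [M hM] := summable_bounded (hA _ hs); exists M => n; apply: le_trans (hM (k * n)%N).
rewrite ler_wpM2l ?md_ge0 // exprM lerXn2r ?nnegrE ?exprn_ge0 //; first by case/andP: hs.
have := bernoulli_sub k t2; rewrite mulrCA divff ?mulr1; last by rewrite gt_eqF.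
by rewrite opprB addrCA subrr addr0.
Qed.

Lemma qs_add h k A tau : (0 < h)%N -> upper_half tau -> disc A ->
  qs h 0 A (tau + k) = ev (fun n => A n * qpow h%:R^-1 k ^+ n) (qpow h%:R^-1 tau).
Proof.
move=> h0 ht hA; rewrite qs0E qpow_add; apply: eq_csum => n.
by rewrite exprMn [X in _ * X]mulrC mulrA.
Qed.

(** Translation by h multiplies the coefficient of index n by the n-th power of a primitive k-th
    root of unity; invariance leaves only the indices divisible by k. *)
Lemma cusp_sum_period (k h : nat) f : (0 < k)%N -> (0 < h)%N -> cusp_sum (@Re_ge0 R) (k * h) f ->
  (forall t, upper_half t -> f (t + h%:R) = f t) ->
  exists2 A, disc A & forall t, upper_half t -> f t = qs h 0 A t.
Proof.
move=> k0 h0 hf hp; have kh : (0 < k * h)%N by rewrite muln_gt0 k0.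
have hp2 t : upper_half t -> f (t + (k * h)%:R) = f t.
  move=> ht; elim: (k) => [|i IH]; first by rewrite addr0.
  by rewrite mulSnr natrD addrA hp //; exact: upper_addn.
have [A hA e] := cusp_sum_periodic kh hf hp2.
pose z := qpow (k * h)%:R^-1 (h%:R : C).
have k1 : (k%:R : C) != 0 by rewrite pnatr_eq0 -lt0n.
have h1 : (h%:R : C) != 0 by rewrite pnatr_eq0 -lt0n.
have ez : z = cexp (twopii * k%:R^-1).
  rewrite /z /qpow; congr cexp; rewrite natrM; move: (k%:R : C) (h%:R : C) k1 h1 => x y x0 y0.
  by field; apply/andP.
have mz : md z = 1.
  by rewrite ez md_cexp (natC R k) -fmorphV !cReM /= mulr0 mul0r subr0 expR0.
have hAz : disc (fun n => A n * z ^+ n).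
  by apply: disc_le hA _ => n; rewrite mdM mdX mz expr1n mulr1.
have eA : (fun n => A n * z ^+ n) = A.
  apply: (@qs_inj R (k * h) 0) => // t ht; rewrite -e // -hp // e; last exact: upper_addn.
  by rewrite qs0E qs_add.
have eS : A = spread k (fun i => A (k * i)%N).
  apply/funext => n; rewrite /spread; case: ifP => hn; first by rewrite mulnC divnK.
  have := congr1 (fun B => B n) eA; rewrite -[X in _ = X]mulr1 => /eqP.
  have [//|a0] := eqVneq (A n) 0; rewrite (inj_eq (mulfI a0)) ez -cexpMn -mulrA => /eqP /cexp_eq1.
  move=> [m hm]; exfalso; move/negP: hn; apply.
  have : (n%:R : C) = m%:~R * k%:R by rewrite -hm mulrAC mulVf // mul1r.
  rewrite [X in X = _]pmulrn [in X in _ = X](pmulrn _ k) -intrM => /eqP; rewrite eqr_int => /eqP e2.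
  by have := congr1 absz e2; rewrite abszM /= => ->; rewrite dvdn_mull.
have hB := disc_subseq k0 hA.
exists (fun i => A (k * i)%N); first exact: hB.
move=> t ht.
by have := qs_spread 0 k0 h0 ht hB; rewrite mulr0 -eS => <-; exact: e.
Qed.

End Periodic.

(** * Scalar modular forms on Gamma0(2) *)

Section EtaQuotients.
Variable R : realType.
Local Notation C := (CC R).
Local Notation twopii := (twopii R).
Local Notation upper_half := (@upper_half R).
Local Notation e2s := (@e2s R).
Implicit Types (A B : nat -> C) (x y tau t : C) (f g : C -> C) (k l : int).

Definition slS k f t : C := t ^ (- k) * f (- t^-1).

Local Opaque qs.

Lemma hasd_eq f (t d e : C) : hasd f t d -> d = e -> hasd f t e.
Proof. by move=> h <-. Qed.

Lemma slSM k l f g t : upper_half t ->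
  slS (k + l) (fun u => f u * g u) t = slS k f t * slS l g t.
Proof.
move=> /upper_neq0 t0; rewrite /slS opprD expfzDr //.
move: (t ^ _) (t ^ _) (f _) (g _) => a b c d; ring.
Qed.

Lemma slSD k f g t : slS k (fun u => f u + g u) t = slS k f t + slS k g t.
Proof. exact: mulrDr. Qed.

Lemma slSZ k c f t : slS k (fun u => c * f u) t = c * slS k f t.
Proof. exact: mulrCA. Qed.

Lemma slS_ext k f g t : upper_half t -> (forall u, upper_half u -> f u = g u) ->
  slS k f t = slS k g t.
Proof. by move=> ht h; rewrite /slS (h _ (upper_inv ht)). Qed.

Lemma slS_inj k f : (forall t, upper_half t -> slS k f t = 0) -> forall t, upper_half t -> f t = 0.
Proof.
move=> h t ht; have := h _ (upper_inv ht); rewrite /slS invrN invrK opprK => /eqP.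
rewrite mulf_eq0 expfz_eq0 oppr_eq0 invr_eq0 => /orP[/andP[_ /eqP t0]|/eqP //].
by have := upper_neq0 (upper_inv ht); rewrite t0 eqxx.
Qed.

(* The logarithmic derivative of eta(t)^(24 x) eta(2 t)^(24 y), divided by 2 pi i. *)
Definition eta_log x y n := x * e2s n + 2 * y * dil e2s n.

Lemma disc_e2s : disc e2s. Proof. exact: disc_sigma. Qed.

Lemma disc_eta_log x y : disc (eta_log x y).
Proof.
apply: discD; first exact: discZ disc_e2s.
by apply: discZ; apply: disc_dil; exact: disc_e2s.
Qed.

Lemma eta_log0 x y : eta_log x y 0%N = x + 2 * y.
Proof. by rewrite /eta_log /= !mulr1. Qed.

Lemma qs_eta_log1 x y tau : upper_half tau -> qs 1 0 (eta_log x y) tau = x * E2 tau + 2 * y * E2 (2 * tau).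
Proof.
move=> ht; have h1 := disc_e2s; have h2 := disc_dil h1.
rewrite (qsD _ (ltn0Sn 0) ht (discZ x h1) (discZ (2 * y) h2)) (qsZ _ _ _ ht h1) // (qsZ _ _ _ ht h2) //.
by rewrite E2_qs // E2_double.
Qed.

Lemma qs_eta_log2 x y tau : upper_half tau -> qs 2 0 (eta_log x y) tau = x * E2 (tau / 2) + 2 * y * E2 tau.
Proof.
move=> ht; have h1 := disc_e2s; have h2 := disc_dil h1.
rewrite (qsD _ (ltn0Sn 1) ht (discZ x h1) (discZ (2 * y) h2)) (qsZ _ _ _ ht h1) // (qsZ _ _ _ ht h2) //.
by rewrite E2_half // E2_qs2.
Qed.

(* The solution of f' = (2 pi i / h) * qs h 0 B * f with leading coefficient 1. *)
Definition eta_quot h B := qs h (B 0%N) (odes B).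

Lemma eta_quotE h B t : eta_quot h B t = qs h (B 0%N) (odes B) t.
Proof. by []. Qed.

Local Opaque eta_quot odes.

Lemma theta_odes B : theta (B 0%N) (odes B) = pm (odes B) B.
Proof.
apply/funext => n; rewrite /theta /pm big_ord_recr /= subnn mulrDl.
case: n => [|n]; first by rewrite big_ord0 mul0r addr0 add0r mulrC.
by rewrite odes_rec // addrC [B 0%N * _]mulrC.
Qed.

Lemma hasd_eta_quot h B tau : (0 < h)%N -> upper_half tau -> disc B ->
  hasd (eta_quot h B) tau (twopii / h%:R * qs h 0 B tau * eta_quot h B tau).
Proof.
move=> h0 ht hB; have hu := disc_odes hB.
have := hasd_qs (B 0%N) h0 ht hu; rewrite theta_odes.
have := qsM (B 0%N) 0 h0 ht hu hB; rewrite addr0 => -> hd.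
have h2 : hasd (eta_quot h B) tau (twopii / h%:R * (eta_quot h B tau * qs h 0 B tau)) by exact: hd.
apply: hasd_eq h2 _; by rewrite [eta_quot h B tau * _]mulrC mulrA.
Qed.

Lemma discN B : disc B -> disc (fun n => - B n).
Proof. by move=> hB; apply: eq_disc (discZ (-1) hB) => n; rewrite mulN1r. Qed.

Lemma qsN h mu B tau : (0 < h)%N -> upper_half tau -> disc B ->
  qs h mu (fun n => - B n) tau = - qs h mu B tau.
Proof.
move=> h0 ht hB; rewrite -mulN1r -(qsZ mu (-1) h0 ht hB).
by have -> : (fun n => - B n) = (fun n => -1 * B n) by apply/funext => n; rewrite mulN1r.
Qed.

(** The logarithmic derivatives cancel, so the product is constant, and its leading coefficient is
    1. This takes the place of the product formula in showing that eta quotients have no zeros. *)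
Lemma eta_quot_opp h B tau : (0 < h)%N -> upper_half tau -> disc B ->
  eta_quot h B tau * eta_quot h (fun n => - B n) tau = 1.
Proof.
move=> h0 ht hB; have hN := discN hB; pose P t := eta_quot h B t * eta_quot h (fun n => - B n) t.
have dP t : upper_half t -> hasd P t 0.
  move=> ht'; apply: hasd_eq (hasdM (hasd_eta_quot h0 ht' hB) (hasd_eta_quot h0 ht' hN)) _.
  rewrite (qsN 0 h0 ht' hB).
  by move: (twopii / _) (qs _ _ B _) (eta_quot _ _ _) (eta_quot _ _ _) => a b c d; ring.
have eP t : upper_half t -> P t = qs h 0 (pm (odes B) (odes (fun n => - B n))) t.
  move=> ht'; rewrite /P !eta_quotE -qsM ?subrr //; exact: disc_odes.
have hpm : disc (pm (odes B) (odes (fun n => - B n))) by apply: discM; exact: disc_odes.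
have e : pm (odes B) (odes (fun n => - B n)) = cst0 (P tau).
  apply: (@qs_inj R h 0) => //; first exact: disc_cst0.
  by move=> t ht'; rewrite -eP // qs_cst; exact: hasd0_cst.
have := congr1 (fun A => A 0%N) e; rewrite /pm big_ord1 /= !odes0 mulr1.
by move/esym.
Qed.

Lemma eta_quot_neq0 h B tau : (0 < h)%N -> upper_half tau -> disc B -> eta_quot h B tau != 0.
Proof.
move=> h0 ht hB; apply/eqP => e; have := eta_quot_opp h0 ht hB; rewrite e mul0r => /eqP.
by rewrite eq_sym oner_eq0.
Qed.

Lemma upper_i : upper_half ((0 +i* 1)%C : C).
Proof. by rewrite /Defs.upper_half /=. Qed.

Lemma eta_quot_solve h B f : (0 < h)%N -> disc B ->
  (forall t, upper_half t -> hasd f t (twopii / h%:R * qs h 0 B t * f t)) ->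
  exists c, forall t, upper_half t -> f t = c * eta_quot h B t.
Proof.
move=> h0 hB hf; have hN := discN hB; pose P t := f t * eta_quot h (fun n => - B n) t.
have dP t : upper_half t -> hasd P t 0.
  move=> ht; apply: hasd_eq (hasdM (hf t ht) (hasd_eta_quot h0 ht hN)) _.
  rewrite (qsN 0 h0 ht hB).
  by move: (twopii / _) (qs _ _ B _) (eta_quot _ _ _) (f _) => a b c d; ring.
exists (P (0 +i* 1)%C) => t ht; rewrite (hasd0_cst dP upper_i ht) /P.
by rewrite -mulrA [eta_quot _ _ t * _]mulrC eta_quot_opp // mulr1.
Qed.

Lemma hasd_slS k f d t : upper_half t -> hasd f (- t^-1) d ->
  hasd (slS k f) t ((- k)%:~R * t ^ (- k) / t * f (- t^-1) + t ^ (- k) * (d / t ^+ 2)).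
Proof.
move=> ht hd; have t0 := upper_neq0 ht.
have h1 : hasd (fun u => - u^-1) t (t ^- 2).
  have := hasdZ (-1) (hasdV (f := id) t0 (hasd_id t)).
  have -> : (fun y => -1 * (id y)^-1) = (fun u => - u^-1 : C) by apply/funext => u; rewrite mulN1r.
  by congr hasd; rewrite !mulNr !mul1r opprK.
exact: hasdM (hasd_expz (- k) t0) (hasd_comp h1 hd).
Qed.

(* E2(2 t) turns into E2(t / 2) / 4 up to the non-modular term, so that x and y are swapped. *)
Lemma eta_S k x y f : k%:~R = 12 * (x + y) ->
  (forall t, upper_half t -> hasd f t (twopii * (x * E2 t + 2 * y * E2 (2 * t)) * f t)) ->
  exists c, forall t, upper_half t -> slS k f t = c * eta_quot 2 (eta_log y x) t.
Proof.
move=> hk hf; apply: eta_quot_solve => //; first exact: disc_eta_log.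
move=> t ht; have t0 := upper_neq0 ht; have hi := upper_inv ht.
have h2 : upper_half (t / 2).
  by rewrite mulrC (natC R 2) -fmorphV; apply: upper_scale; rewrite ?invr_gt0.
apply: hasd_eq (hasd_slS k ht (hf _ hi)) _.
have -> : 2 * - t^-1 = - (t / 2)^-1 by field.
rewrite (E2_inv ht) (E2_inv h2) (qs_eta_log2 _ _ ht) rmorphN /= hk /slS.
move: (E2 t) (E2 (t / 2)) (t ^ (- k)) (f _) (twopii_neq0 R) => a b p u.
move: twopii => w w0; field.
by rewrite t0 w0.
Qed.

(* A modular form of weight k on Gamma0(2), given by its expansions at both cusps: its
   invariance under the generators T and S T^2 S^-1 can be read off from them. *)
Definition sform k f A B := [/\ disc A, disc B, forall t, upper_half t -> f t = qs 1 0 A t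
  & forall t, upper_half t -> slS k f t = qs 2 0 B t].

Lemma sformD k f g A B A' B' : sform k f A B -> sform k g A' B' ->
  sform k (fun t => f t + g t) (fun n => A n + A' n) (fun n => B n + B' n).
Proof.
move=> [h1 h2 h3 h4] [h5 h6 h7 h8]; split; try exact: discD.
  by move=> t ht; rewrite h3 // h7 // qsD.
by move=> t ht; rewrite slSD h4 // h8 // qsD.
Qed.

Lemma sformZ k c f A B : sform k f A B ->
  sform k (fun t => c * f t) (fun n => c * A n) (fun n => c * B n).
Proof.
move=> [h1 h2 h3 h4]; split; try exact: discZ.
  by move=> t ht; rewrite h3 // qsZ.
by move=> t ht; rewrite slSZ h4 // qsZ.
Qed.

Lemma sformM k l f g A B A' B' : sform k f A B -> sform l g A' B' ->
  sform (k + l) (fun t => f t * g t) (pm A A') (pm B B').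
Proof.
move=> [h1 h2 h3 h4] [h5 h6 h7 h8]; split; try exact: discM.
  by move=> t ht; rewrite h3 // h7 // -qsM // addr0.
by move=> t ht; rewrite slSM // h4 // h8 // -qsM // addr0.
Qed.

Lemma sform_cst c : sform 0 (fun=> c) (cst0 c) (cst0 c).
Proof.
split; try exact: disc_cst0; first by move=> t _; rewrite qs_cst.
by move=> t _; rewrite qs_cst /slS oppr0 expr0z mul1r.
Qed.

(** G is itself a logarithmic derivative, that of (eta(2 t) / eta(t))^24. *)
Definition gs := eta_log (-1) 1.

Lemma gs0 : gs 0%N = 1.
Proof. by rewrite /gs eta_log0; ring. Qed.

Lemma G_sform : sform 2 (@Gform R) gs (fun n => - 2^-1 * gs n).
Proof.
have hg : disc gs by exact: disc_eta_log.
split=> //; first exact: discZ.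
  by move=> t ht; rewrite qs_eta_log1 // /Gform; move: (E2 t) (E2 (2 * t)) => a b; ring.
move=> t ht; rewrite qsZ // qs_eta_log2 // /slS /Gform.
have t0 := upper_neq0 ht.
have h2 : upper_half (t / 2).
  by rewrite mulrC (natC R 2) -fmorphV; apply: upper_scale; rewrite ?invr_gt0.
have -> : 2 * - t^-1 = - (t / 2)^-1 by field.
rewrite (E2_inv ht) (E2_inv h2) -[(- 2 : int)]/(- (Posz 2)) -exprnN.
move: (E2 t) (E2 (t / 2)) (twopii_neq0 R) => a b.
by move: twopii => w w0; field; rewrite t0 w0.
Qed.

(* eta(2 t)^16 / eta(t)^8 and eta(t)^16 / eta(2 t)^8: without zeros in the half-plane, and with
   a simple zero at the cusp infinity, respectively 0, and none at the other cusp. *)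
Definition dinf := eta_quot 1 (eta_log (- 3^-1) (2 / 3)).
Definition dzero := eta_quot 1 (eta_log (2 / 3) (- 3^-1)).

Lemma hasd_eta_quot1 x y t : upper_half t ->
  hasd (eta_quot 1 (eta_log x y)) t (twopii * (x * E2 t + 2 * y * E2 (2 * t)) * eta_quot 1 (eta_log x y) t).
Proof.
move=> ht; apply: hasd_eq (hasd_eta_quot (ltn0Sn 0) ht (disc_eta_log x y)) _.
by rewrite (qs_eta_log1 x y ht) divr1.
Qed.

Lemma eta_S_neq0 k x y : k%:~R = 12 * (x + y) ->
  exists2 c, c != 0 & forall t, upper_half t -> slS k (eta_quot 1 (eta_log x y)) t = c * eta_quot 2 (eta_log y x) t.
Proof.
move=> hk; have [c hc] := eta_S hk (hasd_eta_quot1 x y); exists c => //.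
apply/eqP => c0; have hz t : upper_half t -> slS k (eta_quot 1 (eta_log x y)) t = 0 by move=> ht; rewrite hc // c0 mul0r.
have := slS_inj hz upper_i => /eqP.
by rewrite (negbTE (eta_quot_neq0 _ upper_i (disc_eta_log _ _))).
Qed.

Lemma dinf0 : eta_log (- 3^-1) (2 / 3) 0%N = 1 :> C.
Proof. by rewrite eta_log0; field. Qed.
Lemma dzero0 : eta_log (2 / 3) (- 3^-1) 0%N = 0 :> C.
Proof. by rewrite eta_log0; field. Qed.

Lemma dinfE t : dinf t = qs 1 1 (odes (eta_log (- 3^-1) (2 / 3))) t.
Proof. by rewrite /dinf eta_quotE dinf0. Qed.
Lemma dzeroE t : dzero t = qs 1 0 (odes (eta_log (2 / 3) (- 3^-1))) t.
Proof. by rewrite /dzero eta_quotE dzero0. Qed.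

Lemma dinf_neq0 t : upper_half t -> dinf t != 0.
Proof. by move=> ht; exact: eta_quot_neq0 (disc_eta_log _ _). Qed.
Lemma dzero_neq0 t : upper_half t -> dzero t != 0.
Proof. by move=> ht; exact: eta_quot_neq0 (disc_eta_log _ _). Qed.

Lemma dinf_S : exists2 c, c != 0 & forall t, upper_half t ->
  slS 4 dinf t = c * eta_quot 2 (eta_log (2 / 3) (- 3^-1)) t.
Proof. by apply: eta_S_neq0; field. Qed.
Lemma dzero_S : exists2 c, c != 0 & forall t, upper_half t ->
  slS 4 dzero t = c * eta_quot 2 (eta_log (- 3^-1) (2 / 3)) t.
Proof. by apply: eta_S_neq0; field. Qed.

Lemma qs_shift1 h A t : (0 < h)%N -> upper_half t -> disc A -> qs h 1 A t = qs h 0 (zshift 1 A) t.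
Proof. by move=> h0 ht hA; rewrite qs_zshift // add0r. Qed.

Lemma dinf_sform : exists2 c, c != 0 & sform 4 dinf
  (zshift 1 (odes (eta_log (- 3^-1) (2 / 3)))) (fun n => c * odes (eta_log (2 / 3) (- 3^-1)) n).
Proof.
have [c c0 hc] := dinf_S; exists c => //.
have h1 := disc_odes (disc_eta_log (- 3^-1) (2 / 3)); have h2 := disc_odes (disc_eta_log (2 / 3) (- 3^-1)).
split; [exact: disc_zshift|exact: discZ| |] => t ht.
  by rewrite /dinf eta_quotE dinf0 qs_shift1.
by rewrite hc // eta_quotE dzero0 qsZ.
Qed.

Lemma dzero_sform : exists2 c, c != 0 & sform 4 dzero
  (odes (eta_log (2 / 3) (- 3^-1))) (fun n => c * zshift 1 (odes (eta_log (- 3^-1) (2 / 3))) n).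
Proof.
have [c c0 hc] := dzero_S; exists c => //.
have h1 := disc_odes (disc_eta_log (- 3^-1) (2 / 3)); have h2 := disc_odes (disc_eta_log (2 / 3) (- 3^-1)).
have h3 := disc_zshift 1 h1.
split; [exact: h2|exact: discZ| |] => t ht.
  by rewrite /dzero eta_quotE dzero0.
by rewrite hc // eta_quotE dinf0 qsZ // qs_shift1.
Qed.

End EtaQuotients.

(** * Forms of weight 0 are constant *)

Section Liouville.
Variable R : realType.
Local Notation C := (CC R).
Local Notation twopii := (twopii R).
Local Notation upper_half := (@upper_half R).
Local Notation Re := (@complex.Re R).
Local Notation Im := (@complex.Im R).
Implicit Types (A B : nat -> C) (x y tau t : C) (f g : C -> C) (k l : int).

Definition rootavg (N : nat) (p : int) : C := N%:R^-1 * \sum_(j < N) ee (j%:R * p%:~R / N%:R).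

Lemma rootavg_dvd N p : (0 < N)%N -> rootavg N p = if (N%:Z %| p)%Z then 1 else 0.
Proof.
move=> N0; have N1 : (N%:R : C) != 0 by rewrite pnatr_eq0 -lt0n.
pose u : C := ee (p%:~R / N%:R).
have eu j : ee (j%:R * p%:~R / N%:R) = u ^+ j :> C.
  by rewrite /u -eeMn -mulrA [j%:R * _]mulrC.
rewrite /rootavg; under eq_bigr do rewrite eu.
have uN : u ^+ N = 1.
  by rewrite -eeMn mulfVK //; exact: cexp_int.
case: ifP => hd.
  have -> : u = 1.
    rewrite /u; move/dvdzP: hd => [q ->]; rewrite rmorphM /= -pmulrn mulfK //; exact: cexp_int.
  by under eq_bigr do rewrite expr1n; rewrite sumr_const card_ord mulVf.
have u1 : u != 1.
  apply/eqP => /cexp_eq1 [q hq]; move/negP: hd; apply; apply/dvdzP; exists q.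
  have : (p%:~R : C) = (q * N%:Z)%:~R by rewrite rmorphM /= -pmulrn -hq mulfVK.
  by move=> /eqP; rewrite eqr_int => /eqP.
have : (u - 1) * \sum_(j < N) u ^+ j = 0 by rewrite -subrX1 uN subrr.
move/eqP; rewrite mulf_eq0 subr_eq0 (negbTE u1) /= => /eqP ->.
by rewrite mulr0.
Qed.

(** A Riemann sum for the Fourier coefficient of index - p on the circle of radius r; averages over
    N-th roots of unity with N growing replace the Cauchy integral. *)
Definition circavg A (r : R) (p : int) (N : nat) : C :=
  N%:R^-1 * \sum_(j < N) ev A (r%:C%C * ee (j%:R / N%:R)) * ee (j%:R * p%:~R / N%:R).

Lemma md_ee_real (x : R) : md (ee (x%:C%C : C)) = 1.
Proof. by rewrite md_ee /= mulr0 oppr0 expR0. Qed.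

Lemma natdivC (j N : nat) : (j%:R / N%:R : C) = (j%:R / N%:R : R)%:C%C.
Proof. by rewrite !natC -fmorphV -rmorphM. Qed.

Lemma circavg_csum A r p N : disc A -> 0 <= r < 1 -> (0 < N)%N ->
  circavg A r p N = csum (fun n => A n * r%:C%C ^+ n * rootavg N (n%:Z + p)).
Proof.
move=> hA /andP[r0 r1] N0; have N1 : (N%:R : C) != 0 by rewrite pnatr_eq0 -lt0n.
have mz j : md (r%:C%C * ee (j%:R / N%:R) : C) < 1.
  by rewrite mdM natdivC md_ee_real mulr1 md_real ger0_norm.
pose e n j := ee (j%:R * p%:~R / N%:R) * (A n * (r%:C%C * ee (j%:R / N%:R)) ^+ n).
have as1 j : asum (fun n => e n j) by apply: asumZ; exact: disc_asum.
have as2 : asum (fun n => \sum_(j < N) e n j).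
  elim: (N) => [|M IH]; last first.
    by under eq_fun do rewrite big_ord_recr /=; exact: asumD.
  exists 0; split=> n; first by rewrite md_ge0.
  by rewrite big1 // => i _; rewrite big_ord0 md0.
have -> : circavg A r p N = N%:R^-1 * csum (fun n => \sum_(j < N) e n j).
  rewrite csum_sum // /circavg; congr (_ * _); apply: eq_bigr => j _.
  by rewrite /e csumZ; [exact: mulrC | exact: disc_asum].
rewrite -csumZ //; apply: eq_csum => n; rewrite /rootavg mulrCA; congr (_ * _).
rewrite mulr_sumr; apply: eq_bigr => j _; rewrite /e exprMn -eeMn.
have -> : j%:R * (n%:Z + p)%:~R / N%:R = j%:R * p%:~R / N%:R + j%:R / N%:R * n%:R :> C.
  by rewrite rmorphD /= -pmulrn; move: (p%:~R : C) (j%:R : C) (n%:R : C) => a b c; field.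
rewrite eeD; move: (ee _) (ee _) (A n) (r%:C%C ^+ n) => a b c d; ring.
Qed.

Definition circlim A (r : R) (p : int) : C := if p is Posz m.+1 then 0 else A `|p|%N * r%:C%C ^+ `|p|%N.

Lemma circavg_lim A r p : disc A -> 0 <= r < 1 -> forall e : R, 0 < e ->
  exists N0, forall N, (N0 < N)%N -> md (circavg A r p N - circlim A r p) < e.
Proof.
move=> hA hr e e0; case/andP: (hr) => r0 r1.
pose l n := A n * r%:C%C ^+ n * (if (n%:Z + p == 0) then 1 else 0).
have hl : csum l = circlim A r p.
  rewrite (@csum_finite R _ `|p|.+1) => [|n hn]; last first.
    by rewrite /l ifF ?mulr0 //; apply/negP => /eqP; lia.
  rewrite big_ord_recr /= big1 ?add0r => [|i _]; last first.
    by rewrite /l ifF ?mulr0 //; apply/negP => /eqP; have := ltn_ord i; lia.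
  rewrite /l /circlim; case: p {l} => [[|m]|m] /=.
  - by rewrite mulr1.
  - by rewrite mulr0.
  - by rewrite NegzE addrN eqxx mulr1.
have mr N n : (0 < N)%N -> md (rootavg N (n%:Z + p)) <= 1.
  by move=> N0; rewrite rootavg_dvd //; case: ifP; rewrite ?md1 ?md0.
have b1 : \forall N \near \oo%classic, forall n,
    md (A n * r%:C%C ^+ n * rootavg N (n%:Z + p)) <= md (A n) * r ^+ n.
  exists 1%N => // N /= hN n; rewrite mdM [md (A n * _)]mdM mdX md_real ger0_norm //.
  by rewrite ler_piMr ?mr // mulr_ge0 ?md_ge0 ?exprn_ge0.
have pt n : (A n * r%:C%C ^+ n * rootavg N (n%:Z + p) @[N --> \oo] --> l n)%classic.
  apply/cvgnC => d d0; exists (n + `|p|).+1 => N hN.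
  rewrite rootavg_dvd; last lia.
  suff -> : (N%:Z %| n%:Z + p)%Z = (n%:Z + p == 0) by rewrite subrr md0.
  apply/idP/eqP => [/dvdzP[q hq]|->]; last exact: dvdz0.
  by apply/eqP; have [q0|q0] := eqVneq q 0; [rewrite hq q0 mul0r|exfalso; move: hq q0 hN; nia].
have [_ h] := tannery (hA r hr) b1 pt; rewrite hl in h.
move/cvgnC: h => /(_ e e0) [N0 hN0]; exists N0 => N hN; rewrite circavg_csum //; last lia.
by apply: hN0; lia.
Qed.

(* On the circle of radius r the values of ev A have nonnegative real part h; averaging
   2 h(j) ee(- j n / N) gives A n r^n up to o(1), averaging 2 h gives 2 Re (A 0). *)
Lemma caratheodory A (r : R) n : disc A -> 0 <= r < 1 -> (0 < n)%N ->
  (forall x : R, 0 <= Re (ev A (r%:C%C * ee x%:C%C))) ->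
  md (A n) * r ^+ n <= 2 * Re (A 0%N).
Proof.
move=> hA hr n0 hRe; rewrite leNgt; apply/negP => hlt; case/andP: (hr) => r0 r1.
pose e := (md (A n) * r ^+ n - 2 * Re (A 0%N)) / 4.
have e0 : 0 < e by rewrite /e; lra.
have [N1 h1] := circavg_lim 0 hA hr e0.
have [N2 h2] := circavg_lim n%:Z hA hr e0.
have [N3 h3] := circavg_lim (- n%:Z) hA hr e0.
pose N := (N1 + N2 + N3).+1.
have /h1 {}h1 : (N1 < N)%N by rewrite /N; lia.
have /h2 {}h2 : (N2 < N)%N by rewrite /N; lia.
have /h3 {}h3 : (N3 < N)%N by rewrite /N; lia.
have l1 : circlim A r 0 = A 0%N by rewrite /circlim /= mulr1.
have l2 : circlim A r n%:Z = 0 by rewrite /circlim; case: (n) n0.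
have l3 : md (circlim A r (- n%:Z)) = md (A n) * r ^+ n.
  by rewrite /circlim; case: (n) n0 => // m _; rewrite /= mdM mdX md_real ger0_norm.
have N0 : (0 < N)%N by [].
have NR : (0 : R) < N%:R by rewrite ltr0n.
pose u j : C := ev A (r%:C%C * ee (j%:R / N%:R)); pose z j : C := ee (j%:R * n%:R / N%:R).
have mz j : md (z j) = 1 by rewrite /z -natrM natdivC md_ee_real.
have eu j : 0 <= Re (u j) by rewrite /u natdivC.
have c1 : circavg A r 0 N = N%:R^-1 * \sum_(j < N) u j.
  by congr (_ * _); apply: eq_bigr => j _; rewrite mulr0 mul0r ee0 mulr1.
have c2 : circavg A r n%:Z N = N%:R^-1 * \sum_(j < N) u j * z j by [].
have c3 : circavg A r (- n%:Z) N = N%:R^-1 * \sum_(j < N) u j * (z j)^-1.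
  by congr (_ * _); apply: eq_bigr => j _; rewrite rmorphN /= mulrN mulNr eeN.
have zz j : (z j)^-1 = ((z j)^*)%C.
  by rewrite invc_norm normE mz rmorph1 expr1n invr1 mul1r.
have cj : ((circavg A r n%:Z N)^*)%C = N%:R^-1 * \sum_(j < N) ((u j)^*)%C * (z j)^-1.
  rewrite c2 rmorphM rmorph_sum /=; congr (_ * _).
    by rewrite natC -fmorphV /= oppr0.
  by apply: eq_bigr => j _; rewrite rmorphM /= zz.
have mconj (w : C) : md (w^*)%C = md w by rewrite !mdE; case: w => a b /=; rewrite sqrrN.
have uj j : u j + ((u j)^*)%C = (2 * Re (u j))%:C%C.
  by case: (u j) => a b; apply: complex_ext => /=; ring.
have key : md (circavg A r (- n%:Z) N + ((circavg A r n%:Z N)^*)%C) <= 2 * Re (circavg A r 0 N).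
  rewrite cj c3 -mulrDr -big_split /=.
  have -> : \sum_(j < N) (u j / z j + ((u j)^*)%C / z j) =
            \sum_(j < N) ((2 * Re (u j))%:C%C / z j) :> C.
    by apply: eq_bigr => j _; rewrite -mulrDl uj.
  have s1 : md (\sum_(j < N) ((2 * Re (u j))%:C%C / z j)) <= \sum_(j < N) 2 * Re (u j).
    apply: (le_trans (md_sum _ _ _)); apply: ler_sum => j _.
    by rewrite mdM mdV mz invr1 mulr1 md_real ger0_norm // mulr_ge0.
  have s2 : Re (circavg A r 0 N) = N%:R^-1 * \sum_(j < N) Re (u j).
    by rewrite c1 (natC R N) -fmorphV cReM /= mul0r subr0 Re_sum.
  rewrite s2 mdM mdV md_nat [X in _ <= X]mulrCA mulr_sumr.
  by apply: ler_wpM2l s1; rewrite invr_ge0 ltW.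
rewrite l1 in h1; rewrite l2 subr0 in h2.
have k1 := md_Re (circavg A r 0 N - A 0%N); rewrite cReD cReN in k1.
have k3 := md_tri (circlim A r (- n%:Z)) (circavg A r (- n%:Z) N); rewrite mdB l3 in k3.
have k4 := md_tri (circavg A r (- n%:Z) N) (- ((circavg A r n%:Z N)^*)%C).
rewrite opprK mdN mconj in k4.
have k5 := ler_norm (Re (circavg A r 0 N) - Re (A 0%N)).
move: e0 h1 h2 h3 key k1 k3 k4 k5; rewrite /e; lra.
Qed.

(** Since 1 / 4 = 7 / 8 * 2 / 7, the terms are dominated by 2 K (2 / 7)^n, whose sum over n >= 1 is
    4 K / 5. What matters is that the factor 4 / 5 is less than 1. *)
Lemma disc_bound_small A (K : R) z : disc A ->
  (forall n, (0 < n)%N -> md (A n) * (7 / 8) ^+ n <= 2 * K) -> md z <= 4^-1 ->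
  md (ev A z - A 0%N) <= 4 / 5 * K.
Proof.
move=> hA h hz; have z1 : md z < 1 by apply: le_lt_trans hz _; lra.
rewrite /ev csum_recl; last exact: disc_asum.
rewrite expr0 mulr1 addrC addKr; apply: csum_md; split=> n; first exact: md_ge0.
have b n' : md (A n'.+1 * z ^+ n'.+1) <= 2 * K * (2 / 7) ^+ n'.+1.
  rewrite mdM mdX; have := h n'.+1 isT => h1.
  have p0 : 0 <= (2 / 7 : R) ^+ n'.+1 by rewrite exprn_ge0 //; lra.
  have e : (4^-1 : R) ^+ n'.+1 = (7 / 8) ^+ n'.+1 * (2 / 7) ^+ n'.+1.
    by rewrite -exprMn; congr (_ ^+ _); field.
  apply: (@le_trans _ _ (md (A n'.+1) * (4^-1) ^+ n'.+1)).
    by rewrite ler_wpM2l ?md_ge0 // lerXn2r ?nnegrE ?md_ge0 //; lra.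
  by rewrite e mulrA ler_wpM2r.
apply: (@le_trans _ _ (4 / 5 * K * (1 - (2 / 7) ^+ n))).
  elim: n => [|n IH]; first by rewrite big_ord0 expr0 subrr mulr0.
  rewrite big_ord_recr /=; have := b n; rewrite !exprS => b'.
  by move: ((2 / 7 : R) ^+ n) IH b' => w IH b'; lra.
have K0 : 0 <= K.
  by have := h 1%N isT; have := md_ge0 (A 1%N); rewrite expr1; lra.
have : 0 <= 4 / 5 * K * (2 / 7) ^+ n by rewrite !mulr_ge0 // exprn_ge0 //; lra.
lra.
Qed.

Lemma qs_coef_bound h A (M : R) n : (0 < h)%N -> disc A -> (0 < n)%N ->
  (forall t, upper_half t -> Re (qs h 0 A t) <= M) ->
  md (A n) * (7 / 8) ^+ n <= 2 * (M - Re (A 0%N)).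
Proof.
move=> h0 hA n0 hM; pose B m := cst0 (M%:C%C : C) m + -1 * A m.
have hB : disc B by apply: discD; [exact: disc_cst0|exact: discZ].
have r1 : 0 <= (7 / 8 : R) < 1 by apply/andP; split; lra.
have r2 : 0 < (7 / 8 : R) < 1 by apply/andP; split; lra.
have := @caratheodory B (7 / 8) n hB r1 n0.
have -> : md (B n) = md (A n) by rewrite /B; case: (n) n0 => // m _; rewrite /= add0r mulN1r mdN.
have -> : Re (B 0%N) = M - Re (A 0%N) by rewrite /B /= mulN1r cReD cReN.
apply=> x; have [tau ht e] := qpow_onto h0 r2.
have h1 : (h%:R : C) != 0 by rewrite pnatr_eq0 -lt0n.
have ht' : upper_half (tau + (h%:R * x)%:C%C) by exact: upper_add_real.
have eq : (7 / 8)%:C%C * ee (x%:C%C : C) = qpow h%:R^-1 (tau + (h%:R * x)%:C%C).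
  rewrite qpow_add e; congr (_ * _); rewrite /ee /qpow; congr cexp.
  by rewrite rmorphM /= -natC; move: (h%:R : C) (x%:C%C : C) h1 => a b a0; field.
rewrite eq evD ?evZ ?ev_cst0; try exact: md_qpow_lt1; try exact: discZ; try exact: hA; last exact: disc_cst0.
by rewrite mulN1r cReD cReN subr_ge0 -qs0E hM.
Qed.

Lemma qpow_small h tau : (0 < h <= 2)%N -> 3 / 4 <= Im tau -> md (qpow h%:R^-1 tau) <= 4^-1.
Proof.
move=> /andP[h0 h2] hI; rewrite natC -fmorphV md_qpow_real.
have pi2 := pi_ge2 R; have hR : (0 : R) < h%:R by rewrite ltr0n.
have hR2 : (h%:R : R) <= 2 by rewrite (ler_nat R h 2).
have hV : 2^-1 <= (h%:R^-1 : R) by rewrite lef_pV2 ?posrE.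
have key : 3 / 2 <= 2 * pi * h%:R^-1 * Im tau.
  have p1 : 2 <= 2 * pi * (h%:R^-1 : R).
    apply: (@le_trans _ _ (2 * pi * 2^-1)); first lra.
    by rewrite ler_wpM2l //; lra.
  by move: (2 * pi * h%:R^-1) p1 => w w1; nra.
rewrite expRN lef_pV2 ?posrE ?expR_gt0 //.
(* Here exp (3 / 2) is at least (1 + 1 / 10)^15, which exceeds 4. *)
apply: (@le_trans _ _ (expR (10^-1) ^+ 15)).
  apply: (@le_trans _ _ ((1 + 10^-1) ^+ 15)); first lra.
  rewrite lerXn2r ?nnegrE ?expR_ge0 ?expR_ge1Dx //; lra.
by rewrite -expRM_natl ler_expR; lra.
Qed.

(** After a translation the real part is at most 1 / 2 in absolute value. If the height is still
    below 3 / 4, the squared modulus is at most 1 / 4 + 9 / 16 = 13 / 16, so an inversion multiplies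
    the height by at least 16 / 13. Staying below the optimal height of the fundamental domain
    secures this fixed factor. *)
Lemma upper_reduction (Q : C -> Prop) :
  (forall t, upper_half t -> Q (t + 1) <-> Q t) ->
  (forall t, upper_half t -> Q (- t^-1) -> Q t) ->
  (forall t, 3 / 4 <= Im t -> Q t) -> forall t, upper_half t -> Q t.
Proof.
move=> hT hS h0.
have hTn (n : nat) t : upper_half t -> Q (t + n%:R) <-> Q t.
  move=> ht; elim: n => [|n IH]; first by rewrite addr0.
  rewrite -natr1 addrA; apply: iff_trans IH; apply: hT; exact: upper_addn.
have hTz (n : int) t : upper_half t -> Q (t + n%:~R) -> Q t.
  move=> ht; case: n => n; first by move/(hTn n _ ht).
  rewrite NegzE rmorphN /= -pmulrn => hq.
  have ht' : upper_half (t - n.+1%:R) by rewrite natC -rmorphN; exact: upper_add_real.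
  by have := (hTn n.+1 _ ht').2 hq; rewrite subrK.
have main (n : nat) : forall t, upper_half t -> 3 / 4 <= (16 / 13) ^+ n * Im t -> Q t.
  elim: n => [|n IH] t ht hn; first by apply: h0; move: hn; rewrite expr0 mul1r.
  pose m : int := - Num.floor (Re t + 2^-1).
  apply: (hTz m) => //; pose s := t + m%:~R.
  have Is : Im s = Im t by rewrite /s intC cImD /= addr0.
  have hs : upper_half s by rewrite /Defs.upper_half Is.
  have Rs : - 2^-1 <= Re s <= 2^-1.
    have := floor_itv (Re t + 2^-1); rewrite /s intC cReD /= /m rmorphN /=.
    by move=> /andP[h1 h2]; rewrite rmorphD /= in h2; apply/andP; split; lra.
  have [hI|hI] := leP (3 / 4) (Im s); first exact: h0.
  apply: hS => //; apply: IH; first exact: upper_inv.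
  rewrite Im_inv -/s; have ms : md s ^+ 2 <= 13 / 16.
    rewrite mdE sqr_sqrtr ?addr_ge0 ?sqr_ge0 //; case/andP: Rs => R1 R2.
    by have : 0 < Im s by []; nra.
  have m0 : 0 < md s ^+ 2 by rewrite exprn_gt0 // md_gt0 upper_neq0.
  rewrite Is; apply: le_trans hn _; rewrite exprSr -[X in X <= _]mulrA.
  apply: ler_wpM2l; first by rewrite exprn_ge0 //; lra.
  rewrite ler_pdivlMr //; have : 0 < Im t by [].
  by move: ms; nra.
move=> t ht; have I0 : 0 < Im t by [].
have [n hn] : exists n : nat, 3 / 4 / Im t <= (16 / 13) ^+ n.
  have : 0 <= 3 / 4 / Im t by rewrite divr_ge0 //; lra.
  move: (3 / 4 / Im t) => w w0; have hw : 0 <= w * (13 / 3) by rewrite mulr_ge0 //; lra.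
  have hw2 := archi_boundP hw; exists (Num.bound (w * (13 / 3))).
  move: (Num.bound _) hw2 => n hw2.
  suff : 1 + 3 / 13 * n%:R <= (16 / 13 : R) ^+ n by lra.
  elim: n {hw2} => [|n IH]; first by rewrite mulr0 addr0.
  rewrite exprS -[n.+1%:R]natr1; have : (0 : R) <= n%:R by []; move: (n%:R : R) ((16 / 13 : R) ^+ n) IH => a b; lra.
by apply: (main n) => //; rewrite -ler_pdivrMr.
Qed.

Local Opaque qs ev.

Lemma slS0 f t : slS 0 f t = f (- t^-1).
Proof. by rewrite /slS oppr0 expr0z mul1r. Qed.

(** A maximum principle for the real part. Let M be its supremum and a the larger of the real parts
    at the two cusps. Every value of f occurs near a cusp, where the coefficient bounds give at most
    a / 5 + 4 M / 5. Hence M <= a, and then the same bounds annihilate all higher coefficients at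
    the cusp where a is attained. *)
Lemma sform0_cst f A B : sform 0 f A B -> exists c, forall t, upper_half t -> f t = c.
Proof.
move=> [hA hB hf hg]; have hg' t : upper_half t -> f (- t^-1) = qs 2 0 B t.
  by move=> ht; rewrite -hg // slS0.
have fT t : upper_half t -> f (t + 1) = f t.
  move=> ht; have ht1 : upper_half (t + 1) := upper_addn 1 ht.
  rewrite (hf _ ht) (hf _ ht1); have := qs_period 0 A t (ltn0Sn 0).
  by rewrite mulr0 cexp0 mul1r.
pose p := qs 2 0 B.
have pT t : p (t + 1 + 1) = p t.
  have -> : t + 1 + 1 = t + 2%:R by rewrite -addrA.
  by rewrite /p qs_period // mulr0 cexp0 mul1r.
have fp t : upper_half t -> f t = p (- t^-1).
  move=> ht; rewrite /p -hg' ?invrN ?invrK ?opprK //; exact: upper_inv.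
have pf t : upper_half t -> p t = f (- t^-1) by move=> ht; rewrite hg'.
have red (V : C -> Prop) : (forall t, 3 / 4 <= Im t -> V (f t)) ->
    (forall t, 3 / 4 <= Im t -> V (p t)) -> forall t, upper_half t -> V (f t).
  (* The three values belong to the three cosets of Gamma0(2), which the generators T and S
     permute. *)
  move=> h1 h2 t ht; pose Q t := [/\ V (f t), V (p t) & V (p (t + 1))].
  suff [] : Q t by [].
  apply: (upper_reduction (Q := Q)) ht => {}t ht.
  - rewrite /Q fT // pT; split=> -[]; by split.
  - have hi := upper_inv ht.
    rewrite /Q -(pf t ht) -(fp t ht) => -[q1 q2 q3]; split=> //.
    have ht1 : upper_half (t + 1) by exact: (upper_addn 1).
    have hi1 : upper_half (- t^-1 + 1) by exact: (upper_addn 1).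
    (* Both sides are values of f: the left one at - 1 / (t - 1), after a shift of p by its period
       2, and the right one at - 1 - 1 / (t - 1). *)
    suff -> : p (t + 1) = p (- t^-1 + 1) by [].
    have hm : upper_half (t - 1) by have := upper_add_real (-1) ht; rewrite rmorphN rmorph1.
    have -> : p (t + 1) = p (t - 1) by rewrite -(pT (t - 1)) subrK.
    rewrite (pf _ hm) (pf _ hi1) -[RHS]fT; last exact: upper_inv.
    have t0 := upper_neq0 ht; have t1 := upper_neq0 hm.
    congr f; field.
    by rewrite t0 [-1 + t]addrC t1.
  - split; [exact: h1|exact: h2|apply: h2].
    by rewrite cImD /= addr0.
have z14 : 0 <= (4^-1 : R) < 1 by apply/andP; split; lra.
have [M1 hM1] := ev_bound z14 hA; have [M2 hM2] := ev_bound z14 hB.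
have up t : 3 / 4 <= Im t -> upper_half t by rewrite /Defs.upper_half; lra.
have fs t : 3 / 4 <= Im t -> f t = ev A (qpow 1%:R^-1 t) by move=> /up ht; rewrite hf // qs0E.
have ps t : p t = ev B (qpow 2%:R^-1 t) by rewrite /p qs0E.
have bd t : upper_half t -> md (f t) <= Num.max M1 M2.
  apply: (red (fun w => md w <= Num.max M1 M2)) => {}t ht.
    by rewrite fs // le_max hM1 //; exact: qpow_small.
  by rewrite ps le_max hM2 ?orbT //; exact: qpow_small.
pose E : set R := [set Re (f t) | t in upper_half]%classic.
have hE : has_sup E.
  split; first by exists (Re (f (0 +i* 1)%C)); exists (0 +i* 1)%C => //; exact: upper_i.
  exists (Num.max M1 M2) => _ [t ht <-]; apply: le_trans (bd t ht).
  by apply: le_trans (ler_norm _) (md_Re _).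
pose M := sup E.
have fM t : upper_half t -> Re (f t) <= M by move=> ht; apply: sup_upper_bound => //; exists t.
have pM t : upper_half t -> Re (p t) <= M by move=> ht; rewrite pf // fM //; exact: upper_inv.
have cA n : (0 < n)%N -> md (A n) * (7 / 8) ^+ n <= 2 * (M - Re (A 0%N)).
  by move=> n0; apply: (@qs_coef_bound 1) => // t ht; rewrite -hf // fM.
have cB n : (0 < n)%N -> md (B n) * (7 / 8) ^+ n <= 2 * (M - Re (B 0%N)).
  by move=> n0; apply: (@qs_coef_bound 2).
(* Which cusp has the larger value is unknown, so both expansions are estimated against the
   maximum. *)
pose a := Num.max (Re (A 0%N)) (Re (B 0%N)).
have key D (z : C) : disc D -> md z <= 4^-1 -> Re (D 0%N) <= a ->
    (forall n, (0 < n)%N -> md (D n) * (7 / 8) ^+ n <= 2 * (M - Re (D 0%N))) ->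
    Re (ev D z) <= a / 5 + 4 / 5 * M.
  move=> hD hz hDa hDn; have := disc_bound_small hD hDn hz.
  have := md_Re (ev D z - D 0%N); rewrite cReD cReN.
  have := ler_norm (Re (ev D z) - Re (D 0%N)).
  move: (Re (D 0%N)) hDa (md _) (`|_|) => d hDa w v *; lra.
have le5 t : upper_half t -> Re (f t) <= a / 5 + 4 / 5 * M.
  apply: (red (fun w => Re w <= a / 5 + 4 / 5 * M)) => {}t ht.
    by rewrite fs //; apply: key => //; [exact: qpow_small|rewrite le_max lexx].
  by rewrite ps; apply: key => //; [exact: qpow_small|rewrite le_max lexx orbT].
have : M <= a.
  suff : M <= a / 5 + 4 / 5 * M by lra.
  by apply: ge_sup => [|_ [t ht <-]]; [exact: hE.1|exact: le5].
have van D : (forall n, (0 < n)%N -> md (D n) * (7 / 8) ^+ n <= 2 * (M - Re (D 0%N))) ->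
    M <= Re (D 0%N) -> D = cst0 (D 0%N).
  move=> hD hM; apply/funext => -[//|n]; apply/eqP; rewrite -md_eq0 eq_le md_ge0 andbT /=.
  have := hD n.+1 isT; have p0 : 0 < (7 / 8 : R) ^+ n.+1 by rewrite exprn_gt0 //; lra.
  by move=> h; rewrite -(ler_pM2r p0) mul0r; lra.
rewrite /a le_max => /orP[] h.
  exists (A 0%N) => t ht; rewrite hf // [A](van A) //; exact: qs_cst.
exists (B 0%N) => t ht; rewrite fp // /p [B](van B) //; exact: qs_cst.
Qed.

End Liouville.

(** * The ring of scalar forms *)

Section ScalarForms.
Variable R : realType.
Local Notation C := (CC R).
Local Notation twopii := (twopii R).
Local Notation upper_half := (@upper_half R).
Local Notation dinf := (@dinf R).
Local Notation dzero := (@dzero R).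
Implicit Types (A B : nat -> C) (x y tau t : C) (f g : C -> C) (k l : int).
Local Opaque qs eta_quot odes.

Lemma expN1z k : (-1 : C) ^ k = (-1) ^+ odd `|k|%N.
Proof.
case: k => n; first by rewrite signr_odd.
by rewrite -[LHS]/((-1) ^- n.+1) -exprVn invrN1 -[LHS]signr_odd.
Qed.

(** The map [phi] comes from an element of Gamma0(2) of determinant 1 whose square is -1. Applying
    it twice fixes s and gives f = (-1)^k f; the invariance under it is derived from the
    translations at the two cusps. *)
Lemma sform_odd k f A B : sform k f A B -> odd `|k|%N -> forall t, upper_half t -> f t = 0.
Proof.
move=> [hA hB hf hg] hk.
have fT t : upper_half t -> f (t + 1) = f t.
  move=> ht; have ht1 : upper_half (t + 1) := upper_addn 1 ht.
  rewrite (hf _ ht) (hf _ ht1); have := qs_period 0 A t (ltn0Sn 0).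
  by rewrite mulr0 cexp0 mul1r.
pose phi s : C := (1 - s) / (1 - 2 * s).
have key s : upper_half s -> [/\ 1 - 2 * s != 0, upper_half (phi s) & f (phi s) = (1 - 2 * s) ^ k * f s].
  move=> hs; have s0 := upper_neq0 hs; have hi := upper_inv hs; have hi2 := upper_addn 2 hi.
  have e1 : 1 - 2 * s = (- s^-1 + 2) * (- s) by field.
  have n0 : 1 - 2 * s != 0 by rewrite e1 mulf_neq0 ?oppr_eq0 //; exact: upper_neq0 hi2.
  have ep : phi s = - (- s^-1 + 2%:R)^-1 + 1.
    have -> : - s^-1 + 2%:R = - ((1 - 2 * s) / s) by field.
    rewrite invrN opprK invf_div /phi; apply: (mulIf n0).
    by rewrite divfK // mulrDl divfK //; ring.
  have hu : upper_half (- (- s^-1 + 2%:R)^-1) := upper_inv hi2.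
  have hp : upper_half (phi s) by rewrite ep; exact: (upper_addn 1 hu).
  split=> //; rewrite ep fT //.
  have := hg _ hi2; have := qs_period 0 B (- s^-1) (ltn0Sn 1).
  rewrite mulr0 cexp0 mul1r => -> ; rewrite -(hg _ hi) /slS invrN invrK opprK.
  rewrite e1 expfzMl => h1.
  have p0 : (- s^-1 + 2) ^ (- k) != 0 by rewrite expfz_neq0 //; exact: upper_neq0 hi2.
  apply: (mulfI p0); rewrite h1 mulrA mulrA -expfzDr ?addNr ?expr0z ?mul1r; last exact: upper_neq0 hi2.
  congr (_ * _); by rewrite -invrN -exprz_inv invrK.
move=> s hs; have [n0 hp e1] := key s hs; have [n1 _ e2] := key _ hp.
have e3 : phi (phi s) = s.
  have n1' := n1; move: n1'; rewrite /phi => n1'.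
  have -> : 1 - 2 * ((1 - s) / (1 - 2 * s)) = - (1 - 2 * s)^-1 by field.
  have -> : 1 - (1 - s) / (1 - 2 * s) = - s / (1 - 2 * s) by field.
  by rewrite invrN invrK mulrN mulNr mulNr opprK mulfVK.
have e4 : 1 - 2 * phi s = - (1 - 2 * s)^-1 by rewrite /phi; field.
have : f s = - f s.
  rewrite -{1}e3 e2 e1 mulrA -expfzMl e4 mulNr mulVf //.
  by rewrite expN1z hk expr1 mulN1r.
move=> /eqP; rewrite -subr_eq0 opprK -mulr2n mulrn_eq0 /= => /eqP //.
Qed.

Lemma sform_pow k f A B n : sform k f A B ->
  exists A' B', sform (n%:Z * k) (fun t => f t ^+ n) A' B'.
Proof.
move=> h; elim: n => [|n [A' [B' IH]]].
  exists (cst0 1), (cst0 1); rewrite mul0r; exact: sform_cst.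
exists (pm A A'), (pm B B'); have := sformM h IH.
have -> : k + n%:Z * k = n.+1%:Z * k by lia.
by under [X in sform _ X]eq_fun do rewrite -exprS.
Qed.

Lemma qs_const0 h A c : (0 < h)%N -> disc A -> (forall t, upper_half t -> qs h 0 A t = c) -> c = A 0%N.
Proof.
move=> h0 hA hc; suff -> : A = cst0 c by [].
by apply: (@qs_inj R h 0) => //; [exact: disc_cst0|move=> t ht; rewrite qs_cst; exact: hc].
Qed.

(* f ^ 4 * dzero ^ |k| has weight 0 and vanishes at the cusp 0. *)
Lemma sform_neg k f A B : sform k f A B -> k < 0 -> forall t, upper_half t -> f t = 0.
Proof.
move=> h hk; have [c c0 hd] := dzero_sform R.
have [A1 [B1 h1]] := sform_pow 4 h; have [A2 [B2 h2]] := sform_pow `|k|.-1%N hd.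
have := sformM (sformM h1 h2) hd.
have -> : 4%:Z * k + `|k|.-1%:Z * 4 + 4 = 0 by lia.
move=> h3; have [w hw] := sform0_cst h3; case: h3 => [h4 h5 h6 h7].
have w0 : w = 0.
  rewrite (@qs_const0 2 (pm (pm B1 B2) (fun n => c * zshift 1 (odes (eta_log (- 3^-1) (2 / 3))) n)) w) //.
    by rewrite /pm big_ord1 /= mulr0 mulr0.
  move=> t ht; rewrite -h7 // slS0 hw //; exact: upper_inv.
move=> t ht; have := hw t ht; rewrite w0 => /eqP; have d0 := negbTE (dzero_neq0 ht).
by rewrite mulf_eq0 d0 orbF mulf_eq0 [dzero t ^+ _ == 0]expf_eq0 d0 andbF orbF expf_eq0 => /andP[_ /eqP].
Qed.

Lemma eta_quotN_inv h B t : (0 < h)%N -> upper_half t -> disc B -> eta_quot h (fun n => - B n) t = (eta_quot h B t)^-1.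
Proof.
move=> h0 ht hB; apply: (mulfI (eta_quot_neq0 h0 ht hB)); rewrite eta_quot_opp // divff //; exact: eta_quot_neq0.
Qed.

Lemma slS_div k l f d t : upper_half t -> (forall u, upper_half u -> d u != 0) ->
  slS (k - l) (fun u => f u / d u) t = slS k f t / slS l d t.
Proof.
move=> ht hd; have n0 : slS l d t != 0.
  by rewrite /slS mulf_neq0 ?hd ?expfz_neq0 ?upper_neq0 //; exact: upper_inv.
apply: (mulIf n0); rewrite divfK // -slSM // subrK; apply: slS_ext => // u hu.
by rewrite divfK // hd.
Qed.

Lemma qs_tail h A t : (0 < h)%N -> upper_half t -> disc A -> A 0%N = 0 ->
  qs h 0 A t = qs h 1 (fun n => A n.+1) t.
Proof.
move=> h0 ht hA A0; rewrite qs_shift1 //; last exact: disc_tail.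
congr qs; apply/funext => -[|n]; rewrite /zshift //= subn1 //.
Qed.

Lemma dinfV t : upper_half t -> (dinf t)^-1 = qs 1 (-1) (odes (fun n => - eta_log (- 3^-1) (2 / 3) n)) t.
Proof. by move=> ht; rewrite -eta_quotN_inv ?eta_quotE ?dinf0 //; exact: disc_eta_log. Qed.

Lemma dzeroV t : upper_half t -> (dzero t)^-1 = qs 1 0 (odes (fun n => - eta_log (2 / 3) (- 3^-1) n)) t.
Proof. by move=> ht; rewrite -eta_quotN_inv ?eta_quotE ?dzero0 ?oppr0 //; exact: disc_eta_log. Qed.

Lemma dinfSV : exists c : C, forall t, upper_half t ->
  (slS 4 dinf t)^-1 = c * qs 2 0 (odes (fun n => - eta_log (2 / 3) (- 3^-1) n)) t.
Proof.
have [c c0 hc] := dinf_S R; exists c^-1 => t ht.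
by rewrite hc // invfM -eta_quotN_inv ?eta_quotE ?dzero0 ?oppr0 //; exact: disc_eta_log.
Qed.

Lemma dzeroSV : exists c : C, forall t, upper_half t ->
  (slS 4 dzero t)^-1 = c * qs 2 (-1) (odes (fun n => - eta_log (- 3^-1) (2 / 3) n)) t.
Proof.
have [c c0 hc] := dzero_S R; exists c^-1 => t ht.
by rewrite hc // invfM -eta_quotN_inv ?eta_quotE ?dinf0 //; exact: disc_eta_log.
Qed.

Lemma disc_odesN x y : disc (odes (fun n => - eta_log x y n : C)).
Proof. by apply: disc_odes; apply: discN; exact: disc_eta_log. Qed.

Lemma sform_div_inf k f A B : sform k f A B -> A 0%N = 0 -> exists A' B',
  sform (k - 4) (fun t => f t / dinf t) A' B'.
Proof.
move=> [hA hB hf hg] A0; have [c hc] := dinfSV.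
have h1 := disc_odesN (- 3^-1) (2 / 3); have h2 := disc_odesN (2 / 3) (- 3^-1).
exists (pm (fun n => A n.+1) (odes (fun n => - eta_log (- 3^-1) (2 / 3) n))),
  (fun n => c * pm B (odes (fun n => - eta_log (2 / 3) (- 3^-1) n)) n).
split; [|by apply: discZ; exact: discM| |].
- by apply: discM => //; exact: disc_tail.
- move=> t ht; rewrite (hf _ ht) (dinfV ht) (qs_tail (ltn0Sn 0) ht hA A0).
  by rewrite -(qsM _ _ _ ht (disc_tail hA) h1) // subrr.
- move=> t ht; rewrite (slS_div _ _ _ ht (@dinf_neq0 R)) (hc _ ht) (hg _ ht).
  by rewrite (qsZ _ _ _ ht (discM hB h2)) // mulrCA -(qsM _ _ _ ht hB h2) // addr0.
Qed.

Lemma sform_div_zero k f A B : sform k f A B -> B 0%N = 0 -> exists A' B',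
  sform (k - 4) (fun t => f t / dzero t) A' B'.
Proof.
move=> [hA hB hf hg] B0; have [c hc] := dzeroSV.
have h1 := disc_odesN (- 3^-1) (2 / 3); have h2 := disc_odesN (2 / 3) (- 3^-1).
exists (pm A (odes (fun n => - eta_log (2 / 3) (- 3^-1) n))),
  (fun n => c * pm (fun n => B n.+1) (odes (fun n => - eta_log (- 3^-1) (2 / 3) n)) n).
have hBt := disc_tail hB.
split; [exact: discM|by apply: discZ; exact: discM| |].
- move=> t ht; rewrite (hf _ ht) (dzeroV ht).
  by rewrite -(qsM _ _ _ ht hA h2) // addr0.
- move=> t ht; rewrite (slS_div _ _ _ ht (@dzero_neq0 R)) (hc _ ht) (hg _ ht).
  rewrite (qsZ _ _ _ ht (discM hBt h1)) // mulrCA (qs_tail (ltn0Sn 1) ht hB B0).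
  by rewrite -(qsM _ _ _ ht hBt h1) // subrr.
Qed.

(** The default value 0 stands for a missing monomial, so that sums can run to m whatever the parity
    of m. *)
Definition mono (m i : nat) t : C :=
  if (i.*2 <= m)%N then Gform t ^+ (m - i.*2) * dinf t ^+ i else 0.

(** Subtracting a multiple of G^m makes the form vanish at infinity; division by [dinf] then lowers
    the weight by 4, and negative weights contain only 0. *)
Lemma sform_span m f A B : sform (2 * m%:Z) f A B -> exists x : nat -> C,
  forall t, upper_half t -> f t = \sum_(i < m.+1) x i * mono m i t.
Proof.
have [n] := ubnP m; elim: n m f A B => // n IH m f A B hn hf.
have [A1 [B1 hG]] := sform_pow m (G_sform R).
have [A1' [B1' [hG0 hG1]]] : exists A' B', sform (m%:Z * 2) (fun t => @Gform R t ^+ m) A' B' /\ A' 0%N = 1.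
  elim: (m) => [|p [A' [B' [h1 h2]]]].
    by exists (cst0 1), (cst0 1); rewrite mul0r; split=> //; exact: sform_cst.
  exists (pm (@gs R) A'), (pm (fun n => - 2^-1 * @gs R n) B'); split.
    have := sformM (G_sform R) h1; have -> : 2 + p%:Z * 2 = p.+1%:Z * 2 by lia.
    by under [X in sform _ X]eq_fun do rewrite -exprS.
  by rewrite /pm big_ord1 /= h2 mulr1 gs0.
rewrite mulrC in hf; have h1 := sformD hf (sformZ (- A 0%N) hG0).
have [|A2 [B2 h2]] := sform_div_inf h1; first by rewrite hG1 mulr1 subrr.
have fE t : upper_half t -> f t = A 0%N * Gform t ^+ m +
    dinf t * ((f t + - A 0%N * Gform t ^+ m) / dinf t).
  by move=> ht; rewrite mulrCA divff ?dinf_neq0 // mulr1; ring.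
case: (ltnP m 2) => hm.
  have hz := sform_neg h2; exists (fun i => if i is 0 then A 0%N else 0) => t ht.
  rewrite fE // hz ?mulr0 ?addr0 //; last lia.
  rewrite big_ord_recl /= big1 ?addr0 => [|i _]; last by rewrite mul0r.
  by rewrite /mono subn0 mulr1.
have e2 : m%:Z * 2 - 4 = 2 * (m - 2)%N%:Z by lia.
rewrite e2 in h2; have [|x hx] := IH _ _ _ _ _ h2; first lia.
exists (fun i => if i is j.+1 then x j else A 0%N) => t ht.
rewrite fE // hx // [RHS]big_ord_recl /=; congr (_ + _); first by rewrite /mono subn0 mulr1.
have e3 : m = (m - 2).+2 by lia.
have -> : \sum_(i < m) x (0 + i)%N * mono m (bump 0 i) t =
    \sum_(i < (m - 2).+2) x i * mono m i.+1 t by rewrite -e3.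
have z0 : mono m (m - 2).+2 t = 0 by rewrite /mono ifF //; apply/negP; lia.
rewrite [RHS]big_ord_recr /= z0 mulr0 addr0.
rewrite mulr_sumr; apply: eq_bigr => i _; rewrite mulrCA; congr (_ * _).
rewrite /mono doubleS.
have -> : (i.*2.+2 <= m)%N = (i.*2 <= m - 2)%N by lia.
case: ifP => _; last by rewrite mulr0.
have -> : (m - i.*2.+2 = m - 2 - i.*2)%N by lia.
by rewrite exprS mulrCA.
Qed.

End ScalarForms.

(** * Vector-valued modular forms *)

Section VectorForms.
Variable R : realType.
Local Notation C := (CC R).
Local Notation twopii := (twopii R).
Local Notation upper_half := (@upper_half R).
Local Notation dinf := (@dinf R).
Local Notation dzero := (@dzero R).
Local Notation Re_ge0 := (@Re_ge0 R).
Implicit Types (A B : nat -> C) (x y tau t : C) (f g : C -> C) (k l : int).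
Local Opaque qs eta_quot odes.

(** The width 2 N is a multiple of the widths of both cusps; N stays existential so that expansions
    of different widths can be brought to a common one. *)
Definition cusp_hol f := exists2 N, (0 < N)%N & cusp_sum Re_ge0 (2 * N) f.

Lemma cusp_hol_merge f g : cusp_hol f -> cusp_hol g ->
  exists2 N, (0 < N)%N & cusp_sum Re_ge0 (2 * N) f /\ cusp_sum Re_ge0 (2 * N) g.
Proof.
move=> [N N0 hf] [M M0 hg]; exists (M * N)%N; first by rewrite muln_gt0 M0.
have n2 : (0 < 2 * N)%N by rewrite muln_gt0.
have m2 : (0 < 2 * M)%N by rewrite muln_gt0.
have := cusp_sum_lift M0 n2 hf; have := cusp_sum_lift N0 m2 hg.
have e1 : (N * (2 * M) = 2 * (M * N))%N by lia.
have e2 : (M * (2 * N) = 2 * (M * N))%N by lia.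
by rewrite e1 e2.
Qed.

Lemma cusp_hol_ext f g : (forall t, upper_half t -> f t = g t) -> cusp_hol f -> cusp_hol g.
Proof. by move=> e [N N0 h]; exists N => //; exact: cusp_sum_ext e h. Qed.

Lemma cusp_holD f g : cusp_hol f -> cusp_hol g -> cusp_hol (fun t => f t + g t).
Proof. by move=> hf hg; have [N N0 [h1 h2]] := cusp_hol_merge hf hg; exists N => //; exact: cusp_sum_add. Qed.

Lemma cusp_holM f g : cusp_hol f -> cusp_hol g -> cusp_hol (fun t => f t * g t).
Proof.
move=> hf hg; have [N N0 [h1 h2]] := cusp_hol_merge hf hg; exists N => //.
by apply: cusp_sumM => //; rewrite muln_gt0.
Qed.

Lemma cusp_holZ c f : cusp_hol f -> cusp_hol (fun t => c * f t).
Proof. by move=> [N N0 h]; exists N => //; apply: cusp_sumZ => //; rewrite muln_gt0. Qed.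

Lemma cusp_hol_deriv f : cusp_hol f -> exists2 g, cusp_hol g & forall t, upper_half t -> hasd f t (g t).
Proof.
move=> [N N0 h]; have n2 : (0 < 2 * N)%N by rewrite muln_gt0.
by have [g h1 h2] := cusp_sum_deriv n2 h; exists g => //; exists N.
Qed.

Lemma cusp_hol_shift1 f : cusp_hol f -> cusp_hol (fun t => f (t + 1)).
Proof.
move=> [N N0 h]; have n2 : (0 < 2 * N)%N by rewrite muln_gt0.
by exists N => //; exact: (cusp_sum_shift n2 1 h).
Qed.

Lemma cusp_hol_qs2 mu A : Re_ge0 mu -> disc A -> cusp_hol (qs 2 mu A).
Proof. by move=> hm hA; exists 1%N => //; exact: cusp_sum_qs. Qed.

Lemma cusp_hol_qs1 mu A : Re_ge0 mu -> disc A -> cusp_hol (qs 1 mu A).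
Proof. by move=> hm hA; exists 1%N => //; apply: (@cusp_sum_lift R 2 1) => //; exact: cusp_sum_qs. Qed.

Lemma Re_ge0_0 : Re_ge0 0. Proof. exact: (lexx (0 : R)). Qed.

Lemma cusp_hol_period1 f : cusp_hol f -> (forall t, upper_half t -> f (t + 1) = f t) ->
  exists2 A, disc A & forall t, upper_half t -> f t = qs 1 0 A t.
Proof.
move=> [N N0 h] hp; have n2 : (0 < 2 * N)%N by rewrite muln_gt0.
by apply: (@cusp_sum_period R (2 * N) 1) => //; rewrite muln1.
Qed.

Lemma cusp_hol_period2 f : cusp_hol f -> (forall t, upper_half t -> f (t + 2) = f t) ->
  exists2 A, disc A & forall t, upper_half t -> f t = qs 2 0 A t.
Proof. by move=> [N N0 h] hp; apply: (@cusp_sum_period R N 2) => //; rewrite mulnC. Qed.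

Definition both_cusps k f := cusp_hol f /\ cusp_hol (slS k f).

Lemma both_cusps_ext k f g : (forall t, upper_half t -> f t = g t) -> both_cusps k f -> both_cusps k g.
Proof.
move=> e [h1 h2]; split; first exact: cusp_hol_ext e h1.
by apply: cusp_hol_ext h2 => t ht; exact: slS_ext.
Qed.

Lemma both_cuspsD k f g : both_cusps k f -> both_cusps k g -> both_cusps k (fun t => f t + g t).
Proof.
move=> [h1 h2] [h3 h4]; split; first exact: cusp_holD.
by apply: cusp_hol_ext (cusp_holD h2 h4) => t _; rewrite slSD.
Qed.

Lemma both_cuspsZ k c f : both_cusps k f -> both_cusps k (fun t => c * f t).
Proof.
move=> [h1 h2]; split; first exact: cusp_holZ.
by apply: cusp_hol_ext (cusp_holZ c h2) => t _; rewrite slSZ.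
Qed.

Lemma both_cuspsM k l f g : both_cusps k f -> both_cusps l g -> both_cusps (k + l) (fun t => f t * g t).
Proof.
move=> [h1 h2] [h3 h4]; split; first exact: cusp_holM.
by apply: cusp_hol_ext (cusp_holM h2 h4) => t ht; rewrite slSM.
Qed.

Lemma both_cusps_sform k f A B : sform k f A B -> both_cusps k f.
Proof.
move=> [hA hB hf hg]; split.
  by apply: cusp_hol_ext (cusp_hol_qs1 Re_ge0_0 hA) => t ht; rewrite hf.
by apply: cusp_hol_ext (cusp_hol_qs2 Re_ge0_0 hB) => t ht; rewrite hg.
Qed.

Definition Ds k f t : C := twopii^-1 * derive1 f t - k%:~R / 12 * E2 t * f t.

Lemma cusp_hol_E2 : cusp_hol (@E2 R).
Proof. apply: (@cusp_hol_ext (qs 1 0 (@e2s R))); first by move=> t ht; rewrite E2_qs.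
exact: cusp_hol_qs1 Re_ge0_0 (@disc_e2s R). Qed.

Lemma cusp_hol_Ds k f : cusp_hol f -> cusp_hol (Ds k f).
Proof.
move=> hf; have [g h1 h2] := cusp_hol_deriv hf.
apply: cusp_hol_ext (cusp_holD (cusp_holZ twopii^-1 h1) (cusp_holZ (- (k%:~R / 12)) (cusp_holM cusp_hol_E2 hf))) => t ht.
by rewrite /Ds (hasd_derive1 (h2 t ht)) mulNr !mulrA.
Qed.

(** The derivative of the automorphy factor cancels against the non-modular term of [E2_inv]. *)
Lemma slS_Ds k f t : cusp_hol f -> upper_half t -> slS (k + 2) (Ds k f) t = Ds k (slS k f) t.
Proof.
move=> hf ht; have [g h1 h2] := cusp_hol_deriv hf; have hi := upper_inv ht.
have t0 := upper_neq0 ht.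
rewrite /Ds (hasd_derive1 (hasd_slS k ht (h2 _ hi))) /slS (hasd_derive1 (h2 _ hi)) (E2_inv ht).
have -> : t ^ (- (k + 2)) = t ^ (- k) / t ^+ 2.
  by rewrite opprD expfzDr // -exprnN.
rewrite rmorphN /=; move: (t ^ (- k)) (g _) (f _) (E2 t) (k%:~R : C) (twopii_neq0 R) => p a b e z.
move: twopii => w w0; field; by rewrite t0 w0.
Qed.

Lemma both_cusps_Ds k f : both_cusps k f -> both_cusps (k + 2) (Ds k f).
Proof.
move=> [h1 h2]; split; first exact: cusp_hol_Ds.
by apply: cusp_hol_ext (cusp_hol_Ds k h2) => t ht; rewrite slS_Ds.
Qed.

Lemma E2_period n t : upper_half t -> E2 (t + n%:R) = E2 t.
Proof.
move=> ht; elim: n => [|n IH]; first by rewrite addr0.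
have hn := upper_addn n ht.
have hn1 : upper_half (t + n%:R + 1) := upper_addn 1 hn.
rewrite -natr1 addrA -IH (E2_qs hn1) (E2_qs hn).
by have := qs_period 0 (@e2s R) (t + n%:R) (ltn0Sn 0); rewrite mulr0 cexp0 mul1r.
Qed.

Lemma Ds_ext k f g t : (forall u, upper_half u -> f u = g u) -> cusp_hol f -> upper_half t ->
  Ds k f t = Ds k g t.
Proof.
move=> e hf ht; have [f' _ h2] := cusp_hol_deriv hf.
have h3 : hasd g t (f' t).
  by apply: hasd_ext (h2 t ht); have [r r0 hr] := upper_open ht; exists r => // u /hr; exact: e.
by rewrite /Ds (hasd_derive1 (h2 t ht)) (hasd_derive1 h3) e.
Qed.

Lemma Ds_law k (n : nat) (M : 'M[C]_2) (Y : 'I_2 -> C -> C) : (forall i, cusp_hol (Y i)) ->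
  (forall i t, upper_half t -> Y i (t + n%:R) = \sum_j M i j * Y j t) ->
  forall i t, upper_half t -> Ds k (Y i) (t + n%:R) = \sum_j M i j * Ds k (Y j) t.
Proof.
move=> hY hL i t ht; have [Y' hY'] := choice (fun j => let: ex_intro2 g h1 h2 := cusp_hol_deriv (hY j) in ex_intro _ g h2).
have hn := upper_addn n ht.
have h1 : hasd (fun u => Y i (u + n%:R)) t (Y' i (t + n%:R)).
  have h2 : hasd (fun u => u + n%:R) t 1.
    by have := hasdD (hasd_id t) (hasd_cst n%:R t); rewrite addr0.
  by have := hasd_comp h2 (hY' i _ hn); rewrite mulr1.
have h3 : hasd (fun u => Y i (u + n%:R)) t (M i 0 * Y' 0 t + M i 1 * Y' 1 t).
  have h4 := hasdD (hasdZ (M i 0) (hY' 0 t ht)) (hasdZ (M i 1) (hY' 1 t ht)).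
  apply: hasd_ext h4; have [r r0 hr] := upper_open ht; exists r => // u /hr hu.
  by rewrite hL // sum2.
rewrite /Ds !sum2 (hasd_derive1 (hY' i _ hn)) (hasd_uniq h1 h3) E2_period // hL // sum2.
rewrite (hasd_derive1 (hY' 0 _ ht)) (hasd_derive1 (hY' 1 _ ht)).
move: (E2 t) (Y 0 t) (Y 1 t) (k%:~R / 12) (Y' 0 t) (Y' 1 t) (twopii^-1) => *; ring.
Qed.

Variable rho : 'M[int]_2 -> 'M[C]_2.
Hypothesis rho_rep : is_rep rho.

(** The space M_k(rho) in componentwise form, with the group reduced to generators and the cusps to
    infinity and 0; [modform_vform] and [vform_modform] translate both ways. *)
Definition vform k (Y : 'I_2 -> C -> C) := [/\ forall i, both_cusps k (Y i),
  forall i t, upper_half t -> Y i (t + 1) = \sum_j rho Tmx i j * Y j t,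
  forall i t, upper_half t -> slS k (Y i) (t + 2) = \sum_j rho (Un (-1)) i j * slS k (Y j) t
  & forall i t, upper_half t -> (-1) ^ (- k) * Y i t = \sum_j rho N1mx i j * Y j t].

Lemma vform_ext k Y Y' : (forall i t, upper_half t -> Y i t = Y' i t) -> vform k Y -> vform k Y'.
Proof.
move=> e [h1 h2 h3 h4]; split.
- by move=> i; apply: both_cusps_ext (h1 i); exact: e.
- move=> i t ht; have ht1 : upper_half (t + 1) := upper_addn 1 ht.
  by rewrite -e // h2 //; apply: eq_bigr => j _; rewrite e.
- move=> i t ht; have ht2 : upper_half (t + 2) := upper_addn 2 ht.
  rewrite -(slS_ext k ht2 (e i)) h3 //; apply: eq_bigr => j _.
  by rewrite (slS_ext k ht (e j)).
- by move=> i t ht; rewrite -e // h4 //; apply: eq_bigr => j _; rewrite e.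
Qed.

Lemma vformD k Y Y' : vform k Y -> vform k Y' -> vform k (fun i t => Y i t + Y' i t).
Proof.
move=> [h1 h2 h3 h4] [g1 g2 g3 g4]; split.
- by move=> i; exact: both_cuspsD.
- by move=> i t ht; rewrite h2 // g2 // -big_split; apply: eq_bigr => j _; rewrite mulrDr.
- by move=> i t ht; rewrite slSD h3 // g3 // -big_split; apply: eq_bigr => j _; rewrite slSD mulrDr.
- by move=> i t ht; rewrite mulrDr h4 // g4 // -big_split; apply: eq_bigr => j _; rewrite mulrDr.
Qed.

Lemma vformM k l f Y : (forall i, both_cusps (k + l) (fun t => f t * Y i t)) ->
  (forall t, upper_half t -> f (t + 1) = f t) ->
  (forall t, upper_half t -> slS l f (t + 2) = slS l f t) -> ~~ odd `|l|%N ->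
  vform k Y -> vform (k + l) (fun i t => f t * Y i t).
Proof.
move=> hc hT hS hl [h1 h2 h3 h4]; split=> //.
- by move=> i t ht; rewrite hT // h2 // mulr_sumr; apply: eq_bigr => j _; rewrite mulrCA.
- move=> i t ht; have ht2 : upper_half (t + 2) := upper_addn 2 ht.
  rewrite addrC slSM // hS // h3 // mulr_sumr; apply: eq_bigr => j _.
  by rewrite slSM // mulrCA.
- move=> i t ht; rewrite opprD expfzDr ?oppr_eq0 ?oner_eq0 //.
  have -> : (-1 : C) ^ (- l) = 1 by rewrite expN1z abszN (negbTE hl).
  rewrite mulr1 mulrCA h4 // mulr_sumr; apply: eq_bigr => j _; rewrite mulrCA //.
Qed.

Lemma sform_T k f A B : sform k f A B -> forall t, upper_half t -> f (t + 1) = f t.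
Proof.
move=> [hA hB hf hg] t ht; have ht1 : upper_half (t + 1) := upper_addn 1 ht.
rewrite (hf _ ht) (hf _ ht1); have := qs_period 0 A t (ltn0Sn 0).
by rewrite mulr0 cexp0 mul1r.
Qed.

Lemma sform_S k f A B : sform k f A B -> forall t, upper_half t -> slS k f (t + 2) = slS k f t.
Proof.
move=> [hA hB hf hg] t ht; have ht2 : upper_half (t + 2) := upper_addn 2 ht.
rewrite (hg _ ht) (hg _ ht2); have := qs_period 0 B t (ltn0Sn 1).
by rewrite mulr0 cexp0 mul1r.
Qed.

Lemma vform_sform k l f A B Y : sform l f A B -> ~~ odd `|l|%N -> vform k Y ->
  vform (k + l) (fun i t => f t * Y i t).
Proof.
move=> hf hl hY; apply: (vformM _ (sform_T hf) (sform_S hf) hl hY) => i.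
by rewrite addrC; apply: both_cuspsM (both_cusps_sform hf) _; case: hY.
Qed.

Lemma vformZ k c Y : vform k Y -> vform k (fun i t => c * Y i t).
Proof. by move=> h; have := vform_sform (sform_cst c) isT h; rewrite addr0. Qed.

Lemma vform_Ds k Y : vform k Y -> vform (k + 2) (fun i => Ds k (Y i)).
Proof.
move=> [h1 h2 h3 h4]; split.
- by move=> i; exact: both_cusps_Ds.
- by apply: (@Ds_law k 1) => // i; case: (h1 i).
- move=> i t ht; have ht2 : upper_half (t + 2) := upper_addn 2 ht.
  rewrite slS_Ds //; last by case: (h1 i).
  rewrite (@Ds_law k 2 (rho (Un (-1))) (fun i => slS k (Y i))) //; last by move=> j; case: (h1 j).
  by apply: eq_bigr => j _; rewrite slS_Ds //; case: (h1 j).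
- move=> i t ht; have e : forall u, upper_half u -> (-1) ^ (- k) * Y i u = \sum_j rho N1mx i j * Y j u by exact: h4.
  have fY j : cusp_hol (Y j) by case: (h1 j).
  rewrite opprD expfzDr ?oppr_eq0 ?oner_eq0 // -[X in _ * X * _]/((-1) ^- 2) sqrrN expr1n invr1 mulr1.
  have [Y' hY'] := choice (fun j => let: ex_intro2 g h1 h2 := cusp_hol_deriv (fY j) in ex_intro _ g h2).
  have d1 := hasdZ ((-1) ^ (- k)) (hY' i t ht).
  have d2 : hasd (fun u => (-1) ^ (- k) * Y i u) t (rho N1mx i 0 * Y' 0 t + rho N1mx i 1 * Y' 1 t).
    have h5 := hasdD (hasdZ (rho N1mx i 0) (hY' 0 t ht)) (hasdZ (rho N1mx i 1) (hY' 1 t ht)).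
    apply: hasd_ext h5; have [r r0 hr] := upper_open ht; exists r => // u /hr hu.
    by rewrite e // sum2.
  have e1 := hasd_uniq d1 d2; have e2 := e t ht.
  rewrite /Ds !sum2 !(hasd_derive1 (hY' _ _ ht)) mulrBr mulrCA e1 [X in _ - X]mulrCA e2 sum2.
  move: (E2 t) (Y 0 t) (Y 1 t) (k%:~R / 12) (Y' 0 t) (Y' 1 t) (twopii^-1) => *; ring.
Qed.

Lemma modform_vform k Z : modform k rho Z -> vform k (fun i t => Z t i 0).
Proof.
move=> [h1 h2 h3]; have [hT hS hN] := modular_generators h2.
have cusp_holc (g : 'M[int]_2) i : g \in SL2Z -> cusp_hol (fun t => slash k g Z t i 0).
  move=> hg; have [N [N0 _ hN2]] := h3 g hg; exists N => //.
  by apply: (@cusp_sum_lift R 2 N) => //; apply: cusp_sum_of_expansion.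
have eS i t : slS k (fun u => Z u i 0) t = slash k Smx Z t i 0 by rewrite slashS mxE.
split.
- move=> i; split.
    have s1 : 1%:M \in SL2Z by rewrite inE det1.
    by apply: cusp_hol_ext (cusp_holc 1%:M i s1) => t ht; rewrite slash1.
  by apply: cusp_hol_ext (cusp_holc Smx i Smx_SL2Z) => t ht; rewrite -eS.
- by move=> i t ht; rewrite hT // mxE.
- by move=> i t ht; rewrite eS hS // mxE; apply: eq_bigr => j _; rewrite eS.
- by move=> i t ht; have := congr1 (fun M : 'cV[C]_2 => M i 0) (hN t ht); rewrite !mxE.
Qed.

Lemma invmx_SL2Z (g : 'M[int]_2) : g \in SL2Z -> invmx g = mx2 (g 1 1) (- g 0 1) (- g 1 0) (g 0 0).
Proof.
move=> hg; have := hg; rewrite inE det2 => /eqP dg.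
have gu : g \in unitmx by rewrite unitmxE; move: hg; rewrite inE => /eqP ->; rewrite unitr1.
have e : g *m mx2 (g 1 1) (- g 0 1) (- g 1 0) (g 0 0) = 1%:M.
  by rewrite {1}[g]mx2_eta mx2M mx2_1; congr mx2; rewrite -?dg; ring.
by rewrite -[RHS]mul1mx -(mulVmx gu) -mulmxA e mulmx1.
Qed.

Lemma cusp_width (g : 'M[int]_2) N : g \in SL2Z -> g *m Tmx ^+ (2 * N) *m invmx g \in Gamma0_2.
Proof.
move=> hg; rewrite TmxX invmx_SL2Z //; have := hg; rewrite {1}[g]mx2_eta in_SL2Z => /eqP dg.
rewrite {1}[g]mx2_eta !mx2M in_Gamma0; apply/andP; split.
  apply/eqP; transitivity ((g 0 0 * g 1 1 - g 0 1 * g 1 0) ^+ 2); last by rewrite dg expr1n.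
  ring.
have -> : ((g 1 0 * 1 + g 1 1 * 0) * g 1 1 + (g 1 0 * (2 * N)%N%:Z + g 1 1 * 1) * - g 1 0) =
    2 * (- N%:Z * g 1 0 * g 1 0) by rewrite PoszM; ring.
exact: dvdz_mulr.
Qed.

Lemma vform_modform k Y : vform k Y -> modform k rho (fun t => \col_i Y i t).
Proof.
move=> [h1 h2 h3 h4]; set Z := fun t => _.
have hZ i t : Z t i 0 = Y i t by rewrite mxE.
have mod_ : forall (g : 'M[int]_2) tau, g \in Gamma0_2 -> upper_half tau -> slash k g Z tau = rho g *m Z tau.
  apply: modular_from_generators => // t ht; apply/colP => i.
  - by rewrite hZ h2 // mxE; apply: eq_bigr => j _; rewrite hZ.
  - rewrite !slashS !mxE -[LHS]/(slS k (Y i) (t + 2)) h3 //; apply: eq_bigr => j _.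
    by rewrite !mxE.
  - by rewrite !mxE h4 //; apply: eq_bigr => j _; rewrite !mxE.
split=> //.
  move=> i t ht; have [hf _] := h1 i; have [g _ /(_ t ht) hd] := cusp_hol_deriv hf.
  apply: hasd_derivable (g t) _.
  by have -> : (fun t => Z t i 0) = Y i by apply/funext => u; rewrite hZ.
move=> g hg; have [y hy hgy] := SL2Z_coset hg.
have hyS := Gamma0_SL2Z hy.
(* By [SL2Z_coset], a slash by any g is a constant matrix times Z, Z|S or Z|ST, so expansions of
   these three suffice. *)
have lin (W : 'I_2 -> C -> C) (G : C -> 'cV[C]_2) : (forall i, cusp_hol (W i)) ->
    (forall t, upper_half t -> slash k g Z t = rho y *m G t) ->
    (forall i t, upper_half t -> G t i 0 = W i t) ->
    exists N : nat, [/\ (0 < N)%N, g *m Tmx ^+ N *m invmx g \in Gamma0_2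
      & forall i, holomorphic_expansion N (fun tau => slash k g Z tau i 0)].
  move=> hW hG hGW; have [N N0 [w0 w1]] := cusp_hol_merge (hW 0) (hW 1).
  have n2 : (0 < 2 * N)%N by rewrite muln_gt0.
  exists (2 * N)%N; split=> //; first exact: cusp_width.
  move=> i; apply: expansion_of_fx => //.
  apply: cusp_sum_ext (cusp_sum_add (cusp_sumZ n2 (rho y i 0) w0) (cusp_sumZ n2 (rho y i 1) w1)) => t ht.
  by rewrite hG // mxE sum2 !hGW.
have fY i : cusp_hol (Y i) by case: (h1 i).
have fS i : cusp_hol (slS k (Y i)) by case: (h1 i).
have eS i t : slash k Smx Z t i 0 = slS k (Y i) t by rewrite slashS !mxE.
have yS t : upper_half t -> slash k (y *m Smx) Z t = rho y *m slash k Smx Z t.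
  move=> ht; rewrite slashM ?Smx_SL2Z // (@slash_ext _ _ _ _ (fun u => rho y *m Z u)) ?Smx_SL2Z //.
    exact: slash_mul.
  by move=> u hu; exact: mod_.
case: hgy => e.
- apply: (lin Y Z fY); last by move=> i t _; exact: hZ.
  by move=> t ht; rewrite e mod_.
- by apply: (lin _ (slash k Smx Z) fS) => [t ht|i t ht]; rewrite ?e ?yS ?eS.
- apply: (lin _ (fun t => slash k Smx Z (t + 1)) (fun i => cusp_hol_shift1 (fS i))) => [t ht|i t ht].
    have ht1 : upper_half (t + 1) := upper_addn 1 ht.
    rewrite e slashM ?Tn_SL2Z //; last by apply: SL2Z_mul => //; exact: Smx_SL2Z.
    by rewrite slashT; exact: (yS _ ht1).
  exact: eS.
Qed.

End VectorForms.

(** * Freeness over the ring of scalar forms *)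

Section FreeModule.
Variable R : realType.
Local Notation C := (CC R).
Local Notation twopii := (twopii R).
Local Notation upper_half := (@upper_half R).
Local Notation dinf := (@dinf R).
Local Notation dzero := (@dzero R).
Local Notation Re_ge0 := (@Re_ge0 R).
Implicit Types (A B : nat -> C) (x y tau t : C) (f g : C -> C) (k l : int).
Local Opaque qs eta_quot odes.

Variables (rho : 'M[int]_2 -> 'M[C]_2) (k0 : int) (F : 'I_2 -> C -> C) (a b c : C).
Local Notation vform := (@vform R rho).
Hypothesis F_form : vform k0 F.
Hypothesis k0_min : forall k Y, vform k Y -> (exists i t, upper_half t /\ Y i t <> 0) -> k0 <= k.
Hypothesis ode : forall i t, upper_half t ->
  Ds (k0 + 2) (Ds k0 (F i)) t + a * Gform t * Ds k0 (F i) t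
  + (b * Gform t ^+ 2 + c * E4 t) * F i t = 0.
Hypothesis rhoT_det : \det (rho Tmx) != 0.
Hypothesis rhoU_det : \det (rho (Un (-1))) != 0.

Definition DF i := Ds k0 (F i).
Definition wdet (U V : 'I_2 -> C -> C) t : C := U 0 t * V 1 t - U 1 t * V 0 t.
Definition W := wdet F DF.
Hypothesis W_neq0 : exists2 t, upper_half t & W t != 0.

Lemma DF_form : vform (k0 + 2) DF. Proof. exact: vform_Ds. Qed.

(** Abel's identity: the Serre derivative of W, of weight 2 k0 + 2, is - a G W. Writing G through
    E2(t) and E2(2 t), one reads off that W has the logarithmic derivative of an eta quotient with
    these parameters. *)
Let x0 : C := (k0%:~R + 1) / 6 + a.
Let y0 : C := - a.

Lemma W_hasd t : upper_half t -> hasd W t (twopii * (x0 * E2 t + 2 * y0 * E2 (2 * t)) * W t).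
Proof.
move=> ht; have w0 := twopii_neq0 R.
have fF i : cusp_hol (F i) by case: F_form => /(_ i) [].
have fD i : cusp_hol (DF i) by case: DF_form => /(_ i) [].
have dF i : hasd (F i) t (twopii * (DF i t + k0%:~R / 12 * E2 t * F i t)).
  have [g _ /(_ t ht) hg] := cusp_hol_deriv (fF i); apply: (hasd_eq hg).
  rewrite /DF /Ds (hasd_derive1 hg); move: (E2 t) (F i t) (k0%:~R : C) (g t) => *.
  by move: twopii w0 => w w0; field.
have dD i : hasd (DF i) t (twopii * (- (a * Gform t * DF i t)
    - (b * Gform t ^+ 2 + c * E4 t) * F i t + (k0 + 2)%:~R / 12 * E2 t * DF i t)).
  have [g _ /(_ t ht) hg] := cusp_hol_deriv (fD i); apply: (hasd_eq hg).
  have := ode i ht; rewrite -/(DF i) {1}/Ds (hasd_derive1 hg).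
  move: (E2 t) (F i t) ((k0 + 2)%:~R : C) (g t) (a * Gform t) (DF i t) (b * Gform t ^+ 2 + c * E4 t).
  move=> e u z d p v q; move: twopii w0 => w w0 h.
  have -> : - (p * v) - q * u = w^-1 * d - z / 12 * e * v.
    by apply/eqP; rewrite eq_sym -subr_eq0; apply/eqP; rewrite -[RHS]h; ring.
  by field.
have dW := hasdD (hasdM (dF 0) (dD 1)) (hasdZ (-1) (hasdM (dF 1) (dD 0))).
have eW : (fun u => F 0 u * DF 1 u + -1 * (F 1 u * DF 0 u)) = W.
  by apply/funext => u; rewrite mulN1r.
rewrite eW in dW; apply: (hasd_eq dW); rewrite /W /wdet /x0 /y0 rmorphD /= /Gform.
move: (E2 t) (E2 (2 * t)) (E4 t) (F 0 t) (F 1 t) (DF 0 t) (DF 1 t) (k0%:~R : C) => *.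
by move: twopii w0 => w w0; field.
Qed.

Lemma W_inf : exists2 cW, cW != 0 & forall t, upper_half t -> W t = cW * eta_quot 1 (eta_log x0 y0) t.
Proof.
have [|cW h] := @eta_quot_solve R 1 (eta_log x0 y0) W isT (disc_eta_log _ _).
  by move=> t ht; apply: (hasd_eq (W_hasd ht)); rewrite (qs_eta_log1 _ _ ht) divr1.
exists cW => //; have [t ht] := W_neq0; rewrite h //; apply: contraNneq => ->.
by rewrite mul0r.
Qed.

Lemma W_nz t : upper_half t -> W t != 0.
Proof.
by move=> ht; have [cW c1 ->] := W_inf; rewrite // mulf_neq0 // (eta_quot_neq0 _ ht (disc_eta_log _ _)).
Qed.

Let kW : int := k0 * 2 + 2.

Lemma W_zero : exists2 cW, cW != 0 & forall t, upper_half t -> slS kW W t = cW * eta_quot 2 (eta_log y0 x0) t.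
Proof.
have hk : kW%:~R = 12 * (x0 + y0) :> C.
  rewrite /kW /x0 /y0 rmorphD rmorphM /=; move: (k0%:~R : C) => z; by field.
have [cW h] := eta_S hk W_hasd; exists cW => //; apply/eqP => cW0.
have hz t : upper_half t -> slS kW W t = 0 by move=> ht; rewrite h // cW0 mul0r.
have [t ht] := W_neq0; by rewrite (slS_inj hz ht) eqxx.
Qed.

Lemma both_cusps_wdet k l U V : vform k U -> vform l V -> both_cusps (k + l) (wdet U V).
Proof.
move=> [u1 _ _ _] [v1 _ _ _].
apply: both_cusps_ext (both_cuspsD (both_cuspsM (u1 0) (v1 1)) (both_cuspsZ (-1) (both_cuspsM (u1 1) (v1 0)))) => t _.
by rewrite /wdet mulN1r.
Qed.

Lemma wdet_T k l U V t : vform k U -> vform l V -> upper_half t ->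
  wdet U V (t + 1) = \det (rho Tmx) * wdet U V t.
Proof.
move=> [_ u2 _ _] [_ v2 _ _] ht; rewrite /wdet !u2 // !v2 // !sum2 det2.
move: (U 0 t) (U 1 t) (V 0 t) (V 1 t) => *; ring.
Qed.

Lemma slS_wdet k l U V t : upper_half t -> slS (k + l) (wdet U V) t =
  slS k (U 0) t * slS l (V 1) t - slS k (U 1) t * slS l (V 0) t.
Proof.
move=> ht; rewrite -!slSM //.
have -> : wdet U V = fun u => U 0 u * V 1 u + -1 * (U 1 u * V 0 u).
  by apply/funext => u; rewrite mulN1r.
by rewrite slSD slSZ mulN1r.
Qed.

Lemma wdet_S k l U V t : vform k U -> vform l V -> upper_half t ->
  slS (k + l) (wdet U V) (t + 2) = \det (rho (Un (-1))) * slS (k + l) (wdet U V) t.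
Proof.
move=> [_ _ u2 _] [_ _ v2 _] ht; have ht2 : upper_half (t + 2) := upper_addn 2 ht.
rewrite (slS_wdet _ _ _ _ ht) (slS_wdet _ _ _ _ ht2) !u2 // !v2 // !sum2 det2.
move: (slS k _ t) (slS k _ t) (slS l _ t) (slS l _ t) => *; ring.
Qed.

(** The product is eta(t)^8 eta(2 t)^8, with a simple zero at each cusp; its powers clear the poles
    of 1 / W at both cusps at once. *)
Lemma pdelta : exists u v, [/\ disc u, disc v, forall t, upper_half t -> dinf t * dzero t = qs 1 1 u t
  & forall t, upper_half t -> slS 8 (fun s => dinf s * dzero s) t = qs 2 1 v t].
Proof.
have h1 := disc_odes (disc_eta_log (- 3^-1 : C) (2 / 3)); have h2 := disc_odes (disc_eta_log (2 / 3 : C) (- 3^-1)).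
have [c1 _ hc1] := dinf_S R; have [c2 _ hc2] := dzero_S R.
exists (pm (odes (eta_log (- 3^-1) (2 / 3))) (odes (eta_log (2 / 3) (- 3^-1)))).
exists (fun n => c1 * c2 * pm (odes (eta_log (2 / 3) (- 3^-1))) (odes (eta_log (- 3^-1) (2 / 3))) n).
split; [exact: discM|by apply: discZ; exact: discM| |].
- move=> t ht; rewrite dinfE dzeroE.
  by rewrite -(qsM _ _ _ ht h1 h2) // addr0.
- have e8 : (8%:R : int) = 4 + 4 by [].
  move=> t ht; rewrite e8 (slSM _ _ _ _ ht) (hc1 _ ht) (hc2 _ ht) !eta_quotE dinf0 dzero0.
  rewrite (qsZ _ _ _ ht (discM h2 h1)) //.
  have := qsM 0 1 (ltn0Sn 1) ht h2 h1; rewrite add0r => ->.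
  by move: (qs _ _ _ _) (qs _ _ _ _) => *; ring.
Qed.

Lemma qs_pow h u f : (0 < h)%N -> disc u -> (forall t, upper_half t -> f t = qs h 1 u t) ->
  forall j : nat, exists2 v, disc v & forall t, upper_half t -> f t ^+ j = qs h j%:R v t.
Proof.
move=> h0 hu hf; elim=> [|j [v hv IH]].
  by exists (cst0 1); [exact: disc_cst0|move=> t ht; rewrite qs_cst].
exists (pm u v); first exact: discM.
move=> t ht; rewrite exprS (IH _ ht) (hf _ ht) -(qsM _ _ h0 ht hu hv).
by rewrite -nat1r.
Qed.

Lemma slS_pow k f n t : upper_half t -> slS (n%:Z * k) (fun u => f u ^+ n) t = slS k f t ^+ n.
Proof.
move=> ht; elim: n => [|n IH]; first by rewrite mul0r slS0.
rewrite exprS -IH -slSM //; have -> : k + n%:Z * k = n.+1%:Z * k by lia.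
by apply: slS_ext => // u _; rewrite exprS.
Qed.

Let pd t : C := dinf t * dzero t.

Lemma large_nat (z : C) : exists j : nat, forall n, (j <= n)%N -> Re_ge0 (n%:R - z).
Proof.
exists (Num.bound `|complex.Re z|) => n hn.
suff : 0 <= complex.Re (n%:R - z) by [].
rewrite natC cReD cReN /= subr_ge0.
apply: le_trans (ler_norm _) _; apply: le_trans (ltW (archi_boundP (normr_ge0 _))) _.
by rewrite ler_nat.
Qed.

Lemma both_cusps_pdW : exists j0 : nat, forall j : nat, (j0 <= j)%N ->
  both_cusps (j%:Z * 8 - kW) (fun t => pd t ^+ j / W t).
Proof.
have [u [v [hu hv pu pv]]] := pdelta.
have [c1 c10 h1] := W_inf; have [c2 c20 h2] := W_zero.
have [j1 hj1] := large_nat (eta_log x0 y0 0%N); have [j2 hj2] := large_nat (eta_log y0 x0 0%N).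
exists (maxn j1 j2) => j hj.
have {}hj1 := hj1 j (leq_trans (leq_maxl _ _) hj).
have {}hj2 := hj2 j (leq_trans (leq_maxr _ _) hj).
have [u' hu' eu] := qs_pow (ltn0Sn 0) hu pu j; have [v' hv' ev] := qs_pow (ltn0Sn 1) hv pv j.
have d1 := disc_odesN x0 y0; have d2 := disc_odesN y0 x0.
split.
  apply: cusp_hol_ext (cusp_holZ c1^-1 (cusp_hol_qs1 hj1 (discM hu' d1))) => t ht.
  rewrite (qsM _ _ _ ht hu' d1) // -(eu _ ht) (h1 _ ht) invfM.
  rewrite -(eta_quotN_inv _ ht (disc_eta_log x0 y0)) // eta_quotE.
  by move: (qs _ _ _ _) => q; rewrite mulrCA.
apply: cusp_hol_ext (cusp_holZ c2^-1 (cusp_hol_qs2 hj2 (discM hv' d2))) => t ht.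
rewrite (slS_div _ _ _ ht W_nz) (slS_pow _ _ _ ht) (ev _ ht) (h2 _ ht) invfM.
rewrite -(eta_quotN_inv _ ht (disc_eta_log y0 x0)) // eta_quotE (qsM _ _ _ ht hv' d2) //.
by move: (qs _ _ _ _) (qs _ _ _ _) => q q'; rewrite mulrCA.
Qed.

Lemma sform_of_both_cusps k f : both_cusps k f -> (forall t, upper_half t -> f (t + 1) = f t) ->
  (forall t, upper_half t -> slS k f (t + 2) = slS k f t) -> exists A B, sform k f A B.
Proof.
move=> [h1 h2] hT hS; have [A hA eA] := cusp_hol_period1 h1 hT; have [B hB eB] := cusp_hol_period2 h2 hS.
by exists A, B.
Qed.

Lemma pd_sform : exists A B, sform 8 pd A B.
Proof.
have [c1 _ h1] := dinf_sform R; have [c2 _ h2] := dzero_sform R.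
by eexists; eexists; exact: (sformM h1 h2).
Qed.

(** Numerator and denominator are multiplied by the same determinant of rho under each translation,
    so the quotient is periodic at both cusps. *)
Lemma quot_sform k l U V : vform k U -> vform l V -> exists j0 : nat, forall j : nat, (j0 <= j)%N ->
  exists A B, sform (k + l - kW + j%:Z * 8) (fun t => pd t ^+ j * (wdet U V t / W t)) A B.
Proof.
move=> hU hV; have [j0 hj0] := both_cusps_pdW; exists j0 => j /hj0 hj.
have [Ap [Bp hp]] := pd_sform; have [A1 [B1 hpj]] := sform_pow j hp.
have hc := both_cusps_wdet hU hV.
have ew : k + l - kW + j%:Z * 8 = (j%:Z * 8 - kW) + (k + l) by ring.
have e t : pd t ^+ j / W t * wdet U V t = pd t ^+ j * (wdet U V t / W t) by rewrite mulrAC mulrA.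
have hT t : upper_half t -> pd (t + 1) ^+ j * (wdet U V (t + 1) / W (t + 1)) =
    pd t ^+ j * (wdet U V t / W t).
  move=> ht; rewrite (sform_T hpj ht) (wdet_T hU hV ht) [W (t + 1)](wdet_T F_form DF_form ht).
  by rewrite invfM mulrACA divff // mul1r.
apply: sform_of_both_cusps => //.
  by rewrite ew; apply: both_cusps_ext (both_cuspsM hj hc) => t _.
move=> t ht; have ht2 : upper_half (t + 2) := upper_addn 2 ht.
have es s : upper_half s -> slS (k + l - kW + j%:Z * 8) (fun t => pd t ^+ j * (wdet U V t / W t)) s =
    slS (j%:Z * 8) (fun t => pd t ^+ j) s * (slS (k + l) (wdet U V) s / slS kW W s).
  by move=> hs; rewrite addrC (slSM _ _ _ _ hs) (slS_div _ _ _ hs W_nz).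
have kWE : kW = k0 + (k0 + 2) by rewrite /kW; ring.
rewrite (es _ ht) (es _ ht2) (sform_S hpj ht) (wdet_S hU hV ht) kWE.
rewrite [slS _ W (t + 2)](wdet_S F_form DF_form ht) invfM.
by rewrite [_ * slS _ (wdet U V) t * _]mulrACA divff // mul1r.
Qed.

Lemma cramer Y i t : upper_half t ->
  Y i t = wdet Y DF t / W t * F i t + wdet F Y t / W t * DF i t.
Proof.
move=> ht; have w0 := W_nz ht; apply: (mulIf w0).
transitivity (wdet Y DF t * F i t + wdet F Y t * DF i t).
  by rewrite /W /wdet; case: (ord2P i) => ->; ring.
by move: (W t) w0 (wdet Y DF t) (wdet F Y t) => w w0 *; field.
Qed.

(* Otherwise the combination divided by d would be a nonzero form of weight k0 - 2. *)
Lemma min_indep d k x y : (forall t, upper_half t -> d t != 0) ->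
  (forall t, upper_half t -> d (t + 1) = d t) ->
  (forall t, upper_half t -> slS 4 d (t + 2) = slS 4 d t) ->
  (forall i, both_cusps (k0 + 2 - 4) (fun t => (x * Gform t * F i t + y * DF i t) / d t)) ->
  x = 0 /\ y = 0.
Proof.
move=> d0 dT dS hcf; pose V i t := x * Gform t * F i t + y * DF i t.
have hV : vform (k0 + 2) V.
  apply: vformD; last exact: vformZ DF_form.
  apply: vform_ext (vformZ x (vform_sform (G_sform R) isT F_form)) => i t ht.
  by rewrite mulrA.
have hVd : vform (k0 + 2 - 4) (fun i t => (d t)^-1 * V i t).
  apply: (vformM _ _ _ _ hV) => //.
  - by move=> i; apply: both_cusps_ext (hcf i) => t ht; rewrite mulrC.
  - by move=> t ht; rewrite dT.
  - have ed s : upper_half s -> slS (-4) (fun t => (d t)^-1) s = (slS 4 d s)^-1.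
      move=> hs; have := slS_div 0 4 (fun=> 1) hs d0; rewrite sub0r slS0 mul1r => <-.
      by apply: slS_ext => // u _; rewrite mul1r.
    move=> t ht; have ht2 : upper_half (t + 2) := upper_addn 2 ht.
    by rewrite (ed _ ht) (ed _ ht2) dS.
have Vz i t : upper_half t -> V i t = 0.
  move=> ht; apply: contrapT => v0.
  have : k0 <= k0 + 2 - 4.
    apply: (k0_min hVd); exists i, t; split=> // /eqP.
    by rewrite mulf_eq0 invr_eq0 (negbTE (d0 _ ht)) => /eqP.
  lia.
have e1 t : upper_half t -> y * W t = wdet F V t.
  by move=> ht; rewrite /W /wdet /V; ring.
have e2 t : upper_half t -> x * Gform t * W t = wdet V DF t.
  by move=> ht; rewrite /W /wdet /V; ring.
have wz U t : upper_half t -> wdet U V t = 0 by move=> ht; rewrite /wdet !Vz // !mulr0 subrr.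
have wz' U t : upper_half t -> wdet V U t = 0 by move=> ht; rewrite /wdet !Vz // !mul0r subrr.
split.
  have [hg _ eg _] := G_sform R.
  have h0 := @qs_eq0 R 1 0 _ isT (discZ x hg).
  have := fun h => h0 h 0%N; rewrite gs0 mulr1; apply=> t ht.
  rewrite (qsZ _ _ _ ht hg) // -(eg _ ht); have := e2 t ht; rewrite wz' // => /eqP.
  by rewrite mulf_eq0 (negbTE (W_nz ht)) orbF => /eqP.
have := e1 _ (upper_i R); rewrite wz; last exact: upper_i.
by move=> /eqP; rewrite mulf_eq0 (negbTE (W_nz (upper_i R))) orbF => /eqP.
Qed.

Lemma qs_sub_cst h A x t : (0 < h)%N -> upper_half t -> disc A ->
  qs h 0 A t - x = qs h 0 (fun n => A n + -1 * cst0 x n) t.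
Proof.
move=> h0 ht hA; rewrite (qsD _ h0 ht hA (discZ (-1) (disc_cst0 x))).
by rewrite (qsZ _ _ h0 ht (disc_cst0 x)) qs_cst mulN1r.
Qed.

Lemma cusp_hol_div_q h A u (v : C -> C) : (h = 1%N \/ h = 2%N) -> disc A -> disc u -> A 0%N = 0 ->
  (forall t, upper_half t -> v t = qs h (-1) u t) ->
  cusp_hol (fun t => qs h 0 A t * v t).
Proof.
move=> hh hA hu A0 e; have h0 : (0 < h)%N by case: hh => ->.
have hAt := disc_tail hA.
have key : cusp_hol (qs h 0 (pm (fun n => A n.+1) u)).
  by case: hh => ->; [apply: cusp_hol_qs1|apply: cusp_hol_qs2]; rewrite ?Re_ge0_0 //; exact: discM.
apply: cusp_hol_ext key => t ht; rewrite (e _ ht) (qs_tail h0 ht hA A0) -(qsM _ _ h0 ht hAt hu).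
by rewrite subrr.
Qed.

(** Subtracting from Y the part of (f F + g DF) / [dinf] in which f and g have been freed of [A 0] G
    and [A' 0] leaves the combination of [min_indep], which is thus holomorphic at infinity; at the
    cusp 0 [dinf] has no zero. That f and [A 0] G differ in weight does no harm, as only their
    expansions at infinity are compared. *)
Lemma cancel_inf k Y f g A B A' B' : vform k Y -> sform (k + 4 - k0) f A B ->
  sform (k + 2 - k0) g A' B' ->
  (forall i t, upper_half t -> dinf t * Y i t = f t * F i t + g t * DF i t) ->
  A 0%N = 0 /\ A' 0%N = 0.
Proof.
move=> hY [hA hB ef _] [hA' hB' eg _] e.
have [cd _ hd] := dinf_sform R; have [cs hcs] := dinfSV R.
have hGf := G_sform R; have [hgs _ eG _] := hGf.
apply: (@min_indep dinf k) => [t ht|||i]; first exact: dinf_neq0.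
- exact: sform_T hd.
- exact: sform_S hd.
have cF : both_cusps k0 (F i) by case: F_form.
have cD : both_cusps (k0 + 2) (DF i) by case: DF_form.
have d1 := disc_odesN (- 3^-1 : C) (2 / 3); have d2 := disc_odesN (2 / 3 : C) (- 3^-1).
have cG : both_cusps (k0 + 2) (fun t => A 0%N * Gform t * F i t).
  by rewrite addrC; apply: both_cusps_ext (both_cuspsZ (A 0%N) (both_cuspsM (both_cusps_sform hGf) cF)) => t _; rewrite mulrA.
split.
- pose A1 n := A n + -1 * (A 0%N * @gs R n); pose A2 n := A' n + -1 * cst0 (A' 0%N) n.
  have hA1 : disc A1 by apply: discD => //; do 2 apply: discZ; exact: hgs.
  have hA2 : disc A2 by apply: discD => //; apply: discZ; exact: disc_cst0.
  have f1 := cusp_hol_div_q (or_introl erefl) hA1 d1 _ (@dinfV R).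
  have f2 := cusp_hol_div_q (or_introl erefl) hA2 d1 _ (@dinfV R).
  have {}f1 := f1 ltac:(by rewrite /A1 gs0 mulr1 mulN1r subrr).
  have {}f2 := f2 ltac:(by rewrite /A2 /= mulN1r subrr).
  have fY : cusp_hol (Y i) by case: hY => /(_ i) [].
  have := cusp_holD fY (cusp_holZ (-1) (cusp_holD (cusp_holM f1 cF.1) (cusp_holM f2 cD.1))).
  apply: cusp_hol_ext => t ht; have dn := dinf_neq0 ht.
  rewrite -(qs_sub_cst _ _ ht hA') // -(eg _ ht).
  rewrite (qsD _ _ ht hA (discZ (-1) (discZ (A 0%N) hgs))) // (qsZ _ _ _ ht (discZ (A 0%N) hgs)) //.
  rewrite (qsZ _ _ _ ht hgs) // -(ef _ ht) -(eG _ ht).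
  apply: (mulfI dn); rewrite mulrDr e //.
  move: (dinf t) dn (f t) (g t) (F i t) (DF i t) (Gform t) (A 0%N) (A' 0%N) => w w0 *; by field.
- have := cusp_holM (both_cuspsD cG (both_cuspsZ (A' 0%N) cD)).2 (cusp_holZ cs (cusp_hol_qs2 (Re_ge0_0 R) d2)).
  by apply: cusp_hol_ext => t ht; rewrite (slS_div _ _ _ ht (@dinf_neq0 R)) (hcs _ ht).
Qed.

Lemma cancel_zero k Y f g A B A' B' : vform k Y -> sform (k + 4 - k0) f A B ->
  sform (k + 2 - k0) g A' B' ->
  (forall i t, upper_half t -> dzero t * Y i t = f t * F i t + g t * DF i t) ->
  B 0%N = 0 /\ B' 0%N = 0.
Proof.
move=> hY [hA hB _ ef] [hA' hB' _ eg] e.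
have [cd _ hd] := dzero_sform R; have [cs hcs] := dzeroSV R.
have hGf := G_sform R; have [hgs hgs2 _ eG] := hGf.
(* At the cusp 0 the constant term of G is -1/2, so -2 [B 0] G has the same constant term as f. *)
suff [] : - 2 * B 0%N = 0 /\ B' 0%N = 0.
  by move=> /eqP; rewrite mulf_eq0 oppr_eq0 pnatr_eq0 => /eqP.
apply: (@min_indep dzero k) => [t ht|||i]; first exact: dzero_neq0.
- exact: sform_T hd.
- exact: sform_S hd.
have cF : both_cusps k0 (F i) by case: F_form.
have cD : both_cusps (k0 + 2) (DF i) by case: DF_form.
have d1 := disc_odesN (- 3^-1 : C) (2 / 3); have d2 := disc_odesN (2 / 3 : C) (- 3^-1).
set x := - 2 * B 0%N.
have cG : both_cusps (k0 + 2) (fun t => x * Gform t * F i t).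
  by rewrite addrC; apply: both_cusps_ext (both_cuspsZ x (both_cuspsM (both_cusps_sform hGf) cF)) => t _; rewrite mulrA.
split.
- have := cusp_holM (both_cuspsD cG (both_cuspsZ (B' 0%N) cD)).1 (cusp_hol_qs1 (Re_ge0_0 R) d2).
  by apply: cusp_hol_ext => t ht; rewrite -(dzeroV ht).
- pose A1 n := B n + -1 * (x * (- 2^-1 * @gs R n)); pose A2 n := B' n + -1 * cst0 (B' 0%N) n.
  have hA1 : disc A1 by apply: discD => //; do 2 apply: discZ; exact: hgs2.
  have hA2 : disc A2 by apply: discD => //; apply: discZ; exact: disc_cst0.
  pose t1 t := qs 2 (-1) (odes (fun n => - eta_log (- 3^-1 : C) (2 / 3) n)) t.
  have f1 := @cusp_hol_div_q 2 A1 _ t1 (or_intror erefl) hA1 d1 _ (fun t _ => erefl).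
  have f2 := @cusp_hol_div_q 2 A2 _ t1 (or_intror erefl) hA2 d1 _ (fun t _ => erefl).
  have {}f1 := f1 ltac:(by rewrite /A1 gs0 /x; field).
  have {}f2 := f2 ltac:(by rewrite /A2 /= mulN1r subrr).
  have fY : cusp_hol (slS k (Y i)) by case: hY => /(_ i) [].
  have := cusp_holD fY (cusp_holZ (- cs) (cusp_holD (cusp_holM f1 cF.2) (cusp_holM f2 cD.2))).
  apply: cusp_hol_ext => t ht; have dn := dzero_neq0 ht.
  have dSn : slS 4 dzero t != 0.
    by rewrite /slS mulf_neq0 ?dzero_neq0 ?expfz_neq0 ?upper_neq0 //; exact: upper_inv.
  have eY : slS 4 dzero t * slS k (Y i) t = slS (k + 4 - k0) f t * slS k0 (F i) t +
      slS (k + 2 - k0) g t * slS (k0 + 2) (DF i) t.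
    rewrite -!slSM //; have -> : k + 4 - k0 + k0 = 4 + k by ring.
    have -> : k + 2 - k0 + (k0 + 2) = 4 + k by ring.
    by rewrite -slSD; apply: slS_ext => // u hu; exact: e.
  have eV : slS (k0 + 2 - 4) (fun t => (x * Gform t * F i t + B' 0%N * DF i t) / dzero t) t =
      (x * slS 2 (@Gform R) t * slS k0 (F i) t + B' 0%N * slS (k0 + 2) (DF i) t) * (slS 4 dzero t)^-1.
    rewrite (slS_div _ _ _ ht (@dzero_neq0 R)) slSD slSZ; congr ((_ + _) / _).
    by rewrite addrC (slSM _ _ _ _ ht) slSZ.
  rewrite eV -(qs_sub_cst _ _ ht hB') // -(eg _ ht).
  rewrite (qsD _ _ ht hB (discZ (-1) (discZ x hgs2))) // (qsZ _ _ _ ht (discZ x hgs2)) //.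
  rewrite (qsZ _ _ _ ht hgs2) // -(ef _ ht) -(eG _ ht).
  have et1 : cs * t1 t = (slS 4 dzero t)^-1 by rewrite (hcs _ ht).
  apply: (mulfI dSn); rewrite mulrDr eY.
  move: (slS 4 dzero t) dSn et1 (slS _ f t) (slS _ g t) (slS _ (F i) t) (slS _ (DF i) t) (slS 2 _ t).
  move: (t1 t) => q w w0 et1 p1 p2 p3 p4 p5.
  have -> : w * (- cs * ((p1 + -1 * (x * p5)) * q * p3 + (p2 - B' 0%N) * q * p4)) =
     - (w * (cs * q)) * ((p1 - x * p5) * p3 + (p2 - B' 0%N) * p4) by ring.
  rewrite et1 divff // mulrCA divff //; ring.
Qed.

(** Each factor of [pd ^ j] is removed in two halves, first [dinf] and then [dzero]; the other
    factors stay with Y, which only raises the weight of the form on the left. *)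
Lemma free_module_pd k Y (j : nat) f g A B A' B' : vform k Y ->
  sform (k - k0 + j%:Z * 8) f A B -> sform (k - 2 - k0 + j%:Z * 8) g A' B' ->
  (forall i t, upper_half t -> pd t ^+ j * Y i t = f t * F i t + g t * DF i t) ->
  exists f g A B A' B', [/\ sform (k - k0) f A B, sform (k - 2 - k0) g A' B' &
    forall i t, upper_half t -> Y i t = f t * F i t + g t * DF i t].
Proof.
move=> hY; elim: j f g A B A' B' => [|j IH] f g A B A' B'.
  rewrite mul0r !addr0 => h1 h2 h3; exists f, g, A, B, A', B'; split=> // i t ht.
  by rewrite -h3 // mul1r.
move=> hf hg e.
have [Ap [Bp hp]] := pd_sform; have [A1 [B1 hpj]] := sform_pow j hp.
have [c2 _ hz] := dzero_sform R.
have hYj : vform (k + j%:Z * 8) (fun i t => pd t ^+ j * Y i t).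
  by apply: vform_sform hpj _ hY; rewrite abszM oddM andbF.
have hYz : vform (k + j%:Z * 8 + 4) (fun i t => dzero t * (pd t ^+ j * Y i t)).
  exact: vform_sform hz _ hYj.
have w1 : k - k0 + j.+1%:Z * 8 = k + j%:Z * 8 + 4 + 4 - k0 by lia.
have w2 : k - 2 - k0 + j.+1%:Z * 8 = k + j%:Z * 8 + 4 + 2 - k0 by lia.
rewrite w1 in hf; rewrite w2 in hg.
have [|a1 a2] := cancel_inf hYz hf hg.
  by move=> i t ht; rewrite -e // exprS /pd; move: (dinf t) (dzero t) => *; ring.
have [A3 [B3 hf3]] := sform_div_inf hf a1; have [A4 [B4 hg4]] := sform_div_inf hg a2.
have e3 i t : upper_half t -> dzero t * (pd t ^+ j * Y i t) = f t / dinf t * F i t + g t / dinf t * DF i t.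
  move=> ht; have dn := dinf_neq0 ht; apply: (mulfI dn).
  have -> : dinf t * (f t / dinf t * F i t + g t / dinf t * DF i t) = f t * F i t + g t * DF i t.
    by move: (dinf t) dn => w w0; field.
  by rewrite -e // exprS /pd; move: (dinf t) (dzero t) => *; ring.
have w3 : k + j%:Z * 8 + 4 + 4 - k0 - 4 = k + j%:Z * 8 + 4 - k0 by ring.
have w4 : k + j%:Z * 8 + 4 + 2 - k0 - 4 = k + j%:Z * 8 + 2 - k0 by ring.
rewrite w3 in hf3; rewrite w4 in hg4.
have [b1 b2] := cancel_zero hYj hf3 hg4 e3.
have [A5 [B5 hf5]] := sform_div_zero hf3 b1; have [A6 [B6 hg6]] := sform_div_zero hg4 b2.
have w5 : k + j%:Z * 8 + 4 - k0 - 4 = k - k0 + j%:Z * 8 by ring.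
have w6 : k + j%:Z * 8 + 2 - k0 - 4 = k - 2 - k0 + j%:Z * 8 by ring.
rewrite w5 in hf5; rewrite w6 in hg6.
apply: (IH _ _ _ _ _ _ hf5 hg6) => i t ht.
have dn := dzero_neq0 ht; apply: (mulfI dn); rewrite e3 //.
by move: (f t / dinf t) (g t / dinf t) (dzero t) dn => u v w w0; field.
Qed.

Theorem free_module k Y : vform k Y ->
  exists f g A B A' B', [/\ sform (k - k0) f A B, sform (k - 2 - k0) g A' B' &
    forall i t, upper_half t -> Y i t = f t * F i t + g t * DF i t].
Proof.
move=> hY; have [j1 h1] := quot_sform hY DF_form; have [j2 h2] := quot_sform F_form hY.
pose j := maxn j1 j2.
have [A [B hf]] := h1 j (leq_maxl _ _); have [A' [B' hg]] := h2 j (leq_maxr _ _).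
have w1 : k + (k0 + 2) - kW + j%:Z * 8 = k - k0 + j%:Z * 8 by rewrite /kW; ring.
have w2 : k0 + k - kW + j%:Z * 8 = k - 2 - k0 + j%:Z * 8 by rewrite /kW; ring.
rewrite w1 in hf; rewrite w2 in hg.
apply: (free_module_pd hY hf hg) => i t ht; rewrite {1}(cramer Y i ht) mulrDr !mulrA.
by [].
Qed.

End FreeModule.

(** * Rationality of the Fourier coefficients *)

Section Rationality.
Variable R : realType.
Local Notation C := (CC R).
Local Notation twopii := (twopii R).
Local Notation upper_half := (@upper_half R).
Local Notation e2s := (@e2s R).
Local Notation e4s := (@e4s R).
Local Notation gs := (@gs R).
Implicit Types (A B : nat -> C) (x y mu t : C) (f g : C -> C) (k l : int) (K : C -> Prop).
Local Opaque qs eta_quot.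

Definition subfield K := [/\ K 1, forall x y, K x -> K y -> K (x - y),
  forall x y, K x -> K y -> K (x * y) & forall x, K x -> K x^-1].

Section Closure.
Variable K : C -> Prop.
Hypothesis hK : subfield K.

Lemma sub_0 : K 0. Proof. by case: hK => h1 hB _ _; rewrite -(subrr 1); exact: hB. Qed.
Lemma sub_1 : K 1. Proof. by case: hK. Qed.
Lemma sub_M x y : K x -> K y -> K (x * y). Proof. by case: hK => _ _ h _; exact: h. Qed.
Lemma sub_B x y : K x -> K y -> K (x - y). Proof. by case: hK => _ h _ _; exact: h. Qed.
Lemma sub_V x : K x -> K x^-1. Proof. by case: hK => _ _ _; exact. Qed.
Lemma sub_N x : K x -> K (- x). Proof. by rewrite -sub0r => h; apply: sub_B => //; exact: sub_0. Qed.
Lemma sub_D x y : K x -> K y -> K (x + y).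
Proof. by move=> hx hy; rewrite -[y]opprK; apply: sub_B => //; exact: sub_N. Qed.

Lemma sub_nat n : K n%:R.
Proof. by elim: n => [|n IH]; [exact: sub_0|rewrite -natr1; apply: sub_D => //; exact: sub_1]. Qed.

Lemma sub_int (z : int) : K z%:~R.
Proof.
case: z => n; first exact: sub_nat.
by rewrite NegzE rmorphN; apply: sub_N; exact: sub_nat.
Qed.

Lemma sub_sum n (u : nat -> C) : (forall i, (i < n)%N -> K (u i)) -> K (\sum_(i < n) u i).
Proof.
elim: n => [|n IH] h; first by rewrite big_ord0; exact: sub_0.
by rewrite big_ord_recr /=; apply: sub_D; [apply: IH => i hi; apply: h; exact: leqW|exact: h].
Qed.

Lemma sub_pm A B n : (forall i, (i <= n)%N -> K (A i)) -> (forall i, (i <= n)%N -> K (B i)) ->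
  K (pm A B n).
Proof.
move=> hA hB; apply: (@sub_sum n.+1 (fun i => A i * B (n - i)%N)) => i hi.
by apply: sub_M; [exact: hA|apply: hB; exact: leq_subr].
Qed.

Lemma sub_sigma (c : C) (k n : nat) : K c -> K (sigma_coef c k n).
Proof.
by move=> hc; case: n => [|n]; [exact: sub_1|apply: sub_M => //; exact: sub_nat].
Qed.

Lemma sub_e2s n : K (e2s n).
Proof. by apply: sub_sigma; apply: sub_N; exact: sub_nat. Qed.
Lemma sub_e4s n : K (e4s n).
Proof. by apply: sub_sigma; exact: sub_nat. Qed.

Lemma sub_eta_log x y n : K x -> K y -> K (eta_log x y n).
Proof.
move=> hx hy; apply: sub_D; first by apply: sub_M => //; exact: sub_e2s.
apply: sub_M; first by apply: sub_M => //; exact: (sub_nat 2).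
by rewrite /dil; case: ifP => _; [exact: sub_0|exact: sub_e2s].
Qed.

Lemma sub_gs n : K (gs n).
Proof. by apply: sub_eta_log; [apply: sub_N|]; exact: sub_1. Qed.

Lemma sub_odes B n : (forall i, K (B i)) -> K (odes B n).
Proof.
move=> hB; have [m] := ubnP n; elim: m n => // m IH n hn.
case: n hn => [|n] hn; first by rewrite odes0; exact: sub_1.
have n0 : (n.+1%:R : C) != 0 by rewrite pnatr_eq0.
have -> : odes B n.+1 = n.+1%:R^-1 * \sum_(i < n.+1) odes B i * B (n.+1 - i)%N.
  by rewrite -odes_rec // mulKf.
apply: sub_M; first by apply: sub_V; exact: sub_nat.
apply: (@sub_sum n.+1 (fun i => odes B i * B (n.+1 - i)%N)) => i hi.
by apply: sub_M => //; apply: IH; lia.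
Qed.

Lemma sub_zshift j A n : (forall i, K (A i)) -> K (zshift j A n).
Proof. by move=> hA; rewrite /zshift; case: ifP => _; [exact: sub_0|exact: hA]. Qed.

Lemma sform_powK k f A B n : sform k f A B -> (forall i, K (A i)) ->
  exists A' B', sform (n%:Z * k) (fun t => f t ^+ n) A' B' /\ forall i, K (A' i).
Proof.
move=> h hA; elim: n => [|n [A' [B' [IH IHK]]]].
  exists (cst0 1), (cst0 1); rewrite mul0r; split; first exact: sform_cst.
  by case=> [|i]; [exact: sub_1|exact: sub_0].
exists (pm A A'), (pm B B'); split; last by move=> i; apply: sub_pm.
have := sformM h IH; have -> : k + n%:Z * k = n.+1%:Z * k by lia.
by under [X in sform _ X]eq_fun do rewrite -exprS.
Qed.

Lemma mono_sform m i : exists A B, sform (2 * m%:Z) (@mono R m i) A B /\ forall n, K (A n).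
Proof.
rewrite /mono; case: (leqP i.*2 m) => hi; last first.
  exists (fun n => 0 * cst0 0 n), (fun n => 0 * cst0 0 n); split; last by move=> n; rewrite mul0r; exact: sub_0.
  split; try by apply: discZ; exact: disc_cst0.
    by move=> t ht; rewrite (qsZ _ _ _ ht (disc_cst0 0)) // mul0r.
  by move=> t ht; rewrite (qsZ _ _ _ ht (disc_cst0 0)) // mul0r /slS mulr0.
have [c _ hd] := dinf_sform R.
have [A1 [B1 [h1 k1]]] := sform_powK (m - i.*2) (G_sform R) sub_gs.
have hKd n : K (zshift 1 (odes (eta_log (- 3^-1) (2 / 3))) n).
  apply: sub_zshift => j; apply: sub_odes => p; have h3 : K 3^-1 by apply: sub_V; exact: (sub_nat 3).
  by apply: sub_eta_log; [exact: sub_N|apply: sub_M => //; exact: (sub_nat 2)].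
have [A2 [B2 [h2 k2]]] := sform_powK i hd hKd.
exists (pm A1 A2), (pm B1 B2); split; last by move=> n; apply: sub_pm.
have := sformM h1 h2; have -> // : (m - i.*2)%N%:Z * 2 + i%:Z * 4 = 2 * m%:Z by lia.
Qed.

End Closure.

Definition dser k mu A n : C := theta mu A n + - (k%:~R / 12) * pm e2s A n.

Lemma disc_dser k mu A : disc A -> disc (dser k mu A).
Proof.
move=> hA; apply: discD; first exact: disc_theta.
by apply: discZ; apply: discM => //; exact: disc_e2s.
Qed.

Lemma Ds_qs k mu A f : disc A -> (forall t, upper_half t -> f t = qs 1 mu A t) ->
  forall t, upper_half t -> Ds k f t = qs 1 mu (dser k mu A) t.
Proof.
move=> hA hf t ht; have hd : hasd f t (twopii * qs 1 mu (theta mu A) t).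
  have := hasd_qs mu (ltn0Sn 0) ht hA; rewrite divr1; apply: hasd_ext.
  by have [r r0 hr] := upper_open ht; exists r => // u /hr hu; rewrite hf.
rewrite /Ds (hasd_derive1 hd) mulKf ?twopii_neq0 // (hf _ ht) (E2_qs ht).
have h1 := disc_theta mu hA; have h2 := discM (@disc_e2s R) hA.
rewrite (qsD _ _ ht h1 (discZ _ h2)) // (qsZ _ _ _ ht h2) //.
have := qsM 0 mu (ltn0Sn 0) ht (@disc_e2s R) hA; rewrite add0r => ->.
by move: (qs _ _ _ _) (qs _ _ _ _) (qs _ _ _ _) => *; rewrite mulNr !mulrA.
Qed.

Lemma ode_series k mu A f a b c : disc A -> (forall t, upper_half t -> f t = qs 1 mu A t) ->
  (forall t, upper_half t -> Ds (k + 2) (Ds k f) t + a * Gform t * Ds k f t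
     + (b * Gform t ^+ 2 + c * E4 t) * f t = 0) ->
  forall n, dser (k + 2) mu (dser k mu A) n + a * pm gs (dser k mu A) n
     + (b * pm (pm gs gs) A n + c * pm e4s A n) = 0.
Proof.
move=> hA hf ho; have hf1 := Ds_qs k hA hf; have hA1 := disc_dser k mu hA.
have hf2 := Ds_qs (k + 2) hA1 hf1; have hA2 := disc_dser (k + 2) mu hA1.
have [hg _ eG _] := G_sform R; have h4 : disc e4s := @disc_sigma R _ _.
have d1 := discM hg hA1; have d2 := discM (discM hg hg) hA; have d3 := discM h4 hA.
have dd := discD (discD hA2 (discZ a d1)) (discD (discZ b d2) (discZ c d3)).
apply: (@qs_eq0 R 1 mu) => // t ht; rewrite -[RHS](ho _ ht).
rewrite (qsD _ _ ht (discD hA2 (discZ a d1)) (discD (discZ b d2) (discZ c d3))) //.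
rewrite (qsD _ _ ht hA2 (discZ a d1)) // (qsD _ _ ht (discZ b d2) (discZ c d3)) //.
rewrite (qsZ _ _ _ ht d1) // (qsZ _ _ _ ht d2) // (qsZ _ _ _ ht d3) //.
have m1 := qsM 0 mu (ltn0Sn 0) ht hg hA1; have m2 := qsM 0 mu (ltn0Sn 0) ht (discM hg hg) hA.
have m3 := qsM 0 mu (ltn0Sn 0) ht h4 hA; have m4 := qsM 0 0 (ltn0Sn 0) ht hg hg.
rewrite add0r in m1; rewrite add0r in m2; rewrite add0r in m3; rewrite addr0 in m4.
rewrite m1 m2 m3 m4 (hf2 _ ht) (hf1 _ ht) (hf _ ht) (E4_qs ht) (eG _ ht).
by move: (qs _ _ _ _) (qs _ _ _ _) (qs _ _ _ _) (qs _ _ _ _) (qs _ _ _ _) => *; ring.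
Qed.

Definition lo A B n : C := \sum_(i < n) A i.+1 * B (n - i.+1)%N.

Lemma pm_lo A B n : pm A B n = A 0%N * B n + lo A B n.
Proof. by rewrite /pm big_ord_recl /= subn0. Qed.

(** The indicial polynomial at infinity in the variable mu - k / 12; the shift 1 / 6 is the 2 / 12
    by which the second Serre derivative exceeds the first. *)
Definition indicial a b c x : C := x * (x - 6^-1) + a * x + b + c.

(** What coefficient n of the equation contains besides the multiple of [A n]; only coefficients of
    A below n occur. *)
Definition ode_rest k mu a b c A n : C := let l := mu - k%:~R / 12 in
  - (l + n%:R - 6^-1 + a) * (k%:~R / 12) * lo e2s A n
  - (k + 2)%:~R / 12 * lo e2s (dser k mu A) n + a * lo gs (dser k mu A) n
  + b * lo (pm gs gs) A n + c * lo e4s A n.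

Lemma ode_recursion k mu a b c A n :
  dser (k + 2) mu (dser k mu A) n + a * pm gs (dser k mu A) n
     + (b * pm (pm gs gs) A n + c * pm e4s A n) = 0 ->
  indicial a b c (mu - k%:~R / 12 + n%:R) * A n = - ode_rest k mu a b c A n.
Proof.
move=> h; apply/eqP; rewrite -subr_eq0 opprK; apply/eqP; rewrite -[RHS]h.
rewrite {1}/dser /theta !pm_lo.
have -> : dser k mu A n = (mu - k%:~R / 12 + n%:R) * A n - k%:~R / 12 * lo e2s A n.
  rewrite /dser /theta pm_lo (_ : e2s 0 = 1) //.
  move: (k%:~R : C) (lo _ _ _) => *; ring.
rewrite (_ : e2s 0 = 1) // (_ : e4s 0 = 1) // (_ : lo gs gs 0 = 0); last by rewrite /lo big_ord0.
rewrite gs0 /indicial /ode_rest rmorphD /=.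
move: (k%:~R : C) (lo _ _ _) (lo _ _ _) (lo _ _ _) (lo _ _ _) (lo _ _ _) (n%:R : C) => *; by field.
Qed.

Lemma frobenius K k mu a b c A : subfield K -> K mu -> K a -> K b -> K c -> K (A 0%N) ->
  (forall n, indicial a b c (mu - k%:~R / 12 + n%:R) * A n = - ode_rest k mu a b c A n) ->
  (forall n, (0 < n)%N -> indicial a b c (mu - k%:~R / 12 + n%:R) != 0) ->
  forall n, K (A n).
Proof.
move=> hK hmu ha hb hc hA0 hrec hI n; have [m] := ubnP n; elim: m n => // m IH n hn.
case: n hn => [|n] hn //.
have hk (z : int) : K (z%:~R / 12).
  by apply: sub_M => //; [exact: sub_int|apply: sub_V => //; exact: (sub_nat hK 12)].
have hA i : (i < n.+1)%N -> K (A i) by move=> hi; apply: IH; lia.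
have hD i : (i < n.+1)%N -> K (dser k mu A i).
  move=> hi; apply: sub_D => //.
    by apply: sub_M; [|apply: sub_D; [| |exact: sub_nat]|apply: hA].
  apply: sub_M => //; first exact: sub_N.
  by apply: sub_pm => // j hj; [exact: sub_e2s|apply: hA; lia].
have hlo B D : (forall i, K (B i)) -> (forall i, (i < n.+1)%N -> K (D i)) -> K (lo B D n.+1).
  move=> hB hD'; apply: (@sub_sum _ hK n.+1 (fun i => B i.+1 * D (n.+1 - i.+1)%N)) => i hi.
  by apply: sub_M => //; apply: hD'; lia.
have h6 : K 6^-1 by apply: sub_V => //; exact: (sub_nat hK 6).
have hl : K (mu - k%:~R / 12) by exact: sub_B.
have hn0 := sub_nat hK n.+1.
have hr : K (ode_rest k mu a b c A n.+1).
  rewrite /ode_rest; do ![apply: sub_D => // | apply: sub_M => // | apply: sub_N => // | apply: hlo => // ] => i; try exact: sub_e2s; try exact: sub_gs; try exact: sub_e4s.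
  by apply: sub_pm => // j _; exact: sub_gs.
have -> : A n.+1 = (indicial a b c (mu - k%:~R / 12 + n.+1%:R))^-1 * - ode_rest k mu a b c A n.+1.
  by rewrite -hrec mulKf // hI.
apply: sub_M => //; last exact: sub_N.
apply: sub_V => //; rewrite /indicial.
by do ![apply: sub_D => // | apply: sub_M => // | apply: sub_N => //].
Qed.

Lemma Qadjoin_subfield (r : C) : subfield (Qadjoin r).
Proof.
pose ev (P : {poly rat}) : C := (map_poly ratr P).[r].
have evM P Q : ev (P * Q) = ev P * ev Q by rewrite /ev rmorphM hornerM.
have evB P Q : ev (P - Q) = ev P - ev Q by rewrite /ev rmorphB hornerD hornerN.
have ev1 : ev 1 = 1 by rewrite /ev rmorph1 hornerC.
have ev0 : ev 0 = 0 by rewrite /ev rmorph0 horner0.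
have mk P Q : ev Q != 0 -> Qadjoin r (ev P / ev Q) by exists P, Q.
have el z : Qadjoin r z -> exists P Q, ev Q != 0 /\ z = ev P / ev Q by [].
split.
- by have := mk 1 1; rewrite ev1 divr1; apply; exact: oner_neq0.
- move=> x y /el [P [Q [q0 ->]]] /el [P' [Q' [q0' ->]]].
  have := mk (P * Q' - P' * Q) (Q * Q'); rewrite evB !evM => h.
  have -> : ev P / ev Q - ev P' / ev Q' = (ev P * ev Q' - ev P' * ev Q) / (ev Q * ev Q').
    by move: (ev P) (ev P') (ev Q) (ev Q') q0 q0' => *; field; apply/andP.
  by apply: h; exact: mulf_neq0.
- move=> x y /el [P [Q [q0 ->]]] /el [P' [Q' [q0' ->]]].
  by have := mk (P * P') (Q * Q'); rewrite !evM mulf_div; apply; exact: mulf_neq0.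
- move=> x /el [P [Q [q0 ->]]]; have [p0|p0] := eqVneq (ev P) 0.
    by have := mk 0 1; rewrite ev1 ev0 p0 !mul0r invr0; apply; exact: oner_neq0.
  by rewrite invf_div; exact: mk.
Qed.

Lemma Qadjoin_r (r : C) : Qadjoin r r.
Proof.
exists 'X, 1; rewrite map_polyX rmorph1 hornerX hornerC divr1.
by rewrite oner_neq0.
Qed.

Lemma Qadjoin_algebraic (r z : C) : algebraicOver ratr r -> Qadjoin r z -> algebraicOver ratr z.
Proof.
move=> hr [P [Q [_ ->]]].
have h (S : {poly rat}) : algebraicOver ratr (map_poly ratr S).[r].
  elim/poly_ind: S => [|S x IH]; first by rewrite rmorph0 horner0; exact: algebraic0.
  rewrite rmorphD rmorphM /= map_polyX map_polyC !hornerE.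
  by apply: algebraic_add; [exact: algebraic_mul|exact: algebraic_id].
by apply: algebraic_div.
Qed.

Lemma qexpansion_qs mu A f : qexpansion mu A f ->
  disc A /\ forall t, upper_half t -> f t = qs 1 mu A t.
Proof.
move=> h; have hA : disc A.
  apply: (@disc_of_cvg R 1 mu) => // t ht; have [M hM] := cvgn_bounded (h t ht).
  by exists M => n; rewrite divr1.
split=> // t ht; rewrite qs_csum //; symmetry; apply: csum_uniq.
have -> : (fun n => A n * qpow ((mu + n%:R) / 1%:R) t) = (fun n => A n * qpow (mu + n%:R) t).
  by apply/funext => n; rewrite divr1.
exact: h.
Qed.

Lemma qs_qexpansion mu A f : disc A -> (forall t, upper_half t -> f t = qs 1 mu A t) ->
  qexpansion mu A f.
Proof.
move=> hA hf t ht; rewrite hf // qs_csum //; have := asum_cvg (asum_qs mu (ltn0Sn 0) hA ht).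
have -> // : (fun n => A n * qpow ((mu + n%:R) / 1%:R) t) = (fun n => A n * qpow (mu + n%:R) t).
by apply/funext => n; rewrite divr1.
Qed.

(** The starting exponent of an expansion is not unique. For a nonzero f the multiplier under
    translation by 1 fixes it modulo integers, and two expansions then differ by a shift of index;
    for f = 0 all coefficients vanish. *)
Lemma fourier_in K mu A f : K 0 -> disc A -> (forall t, upper_half t -> f t = qs 1 mu A t) ->
  (forall n, K (A n)) -> fourier_coefs_in K f.
Proof.
move=> K0 hA hf hAK; split; first by exists mu, A; exact: qs_qexpansion.
move=> mu' B hB n; have [dB eB] := qexpansion_qs hB.
have [z|] := pselect (forall t, upper_half t -> f t = 0).
  by have hz := @qs_eq0 R 1 mu' B isT dB; rewrite hz // => t ht; rewrite -eB // z.
move=> /existsNP [t /not_implyP [ht f0]].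
have ht1 : upper_half (t + 1) := upper_addn 1 ht.
have e1 : cexp (twopii * mu') = cexp (twopii * mu).
  have := qs_period mu A t (ltn0Sn 0); have := qs_period mu' B t (ltn0Sn 0).
  rewrite -(hf _ ht1) -(eB _ ht1) -(hf _ ht) -(eB _ ht) => -> /eqP.
  by rewrite (inj_eq (mulIf _)) => [/eqP //|]; apply/eqP.
have [[p|p] hp] := cexp_eq e1.
  have e2 : zshift p B = A.
    apply: (@qs_inj R 1 mu) => //; first exact: disc_zshift.
    by move=> u hu; rewrite (qs_zshift _ _ _ hu dB) // -(hf _ hu) (eB _ hu) hp.
  by have := hAK (p + n)%N; rewrite -e2 /zshift ltnNge leq_addr /= addKn.
have e2 : zshift p.+1 A = B.
  apply: (@qs_inj R 1 mu') => //; first exact: disc_zshift.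
  move=> u hu; rewrite (qs_zshift _ _ _ hu hA) // -(eB _ hu) (hf _ hu) hp.
  by rewrite NegzE rmorphN /= -pmulrn subrK.
by rewrite -e2 /zshift; case: ifP.
Qed.

(** Dependent members of the spanning family are deleted and never combined, so the property [Q]
    survives. *)
Lemma extract_basis k sigma (Q : (C -> 'cV[C]_2) -> Prop) n (B : 'I_n -> C -> 'cV[C]_2) :
  (forall j, modform k sigma (B j)) -> (forall j, Q (B j)) ->
  (forall Z, modform k sigma Z -> exists x : 'I_n -> C,
     forall tau, upper_half tau -> Z tau = \sum_j x j *: B j tau) ->
  exists (n' : nat) (B' : 'I_n' -> C -> 'cV[C]_2), modform_basis k sigma B' /\ forall j, Q (B' j).
Proof.
elim: n B => [|n IH] B hB hQ hspan.
  by exists 0%N, B; split=> //; split=> // x _ [].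
have [hi|] := pselect (forall x : 'I_n.+1 -> C,
    (forall tau, upper_half tau -> \sum_j x j *: B j tau = 0) -> forall j, x j = 0).
  by exists n.+1, B.
move=> /existsNP [x /not_implyP [hx /existsNP [j /eqP xj]]].
apply: (IH (fun i => B (lift j i))) => // Z /hspan [y hy].
exists (fun i => y (lift j i) - y j * (x (lift j i) / x j)) => t ht.
have := hx t ht; rewrite (bigD1_ord j) //= => /eqP; rewrite addr_eq0 => /eqP hj.
have Bj : B j t = - \sum_(i < n) (x (lift j i) / x j) *: B (lift j i) t.
  apply: (scalerI xj); rewrite hj scalerN scaler_sumr; congr (- _); apply: eq_bigr => i _.
  by rewrite scalerA mulrCA divff // mulr1.
rewrite hy // (bigD1_ord j) //= Bj scalerN scaler_sumr addrC -sumrB; apply: eq_bigr => i _.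
by rewrite scalerBl scalerA.
Qed.

Lemma conj_law (E M : 'M[C]_2) (y z : 'I_2 -> C) : E \in unitmx ->
  (forall i, z i = \sum_j M i j * y j) ->
  forall i, \sum_j E i j * z j = \sum_j (E *m M *m invmx E) i j * (\sum_p E j p * y p).
Proof.
move=> hE hz i; pose v := \col_j y j; pose w := \col_j z j.
have ew : w = M *m v by apply/colP => j; rewrite !mxE hz; apply: eq_bigr => p _; rewrite mxE.
have -> : \sum_j E i j * z j = (E *m w) i 0 by rewrite mxE; apply: eq_bigr => j _; rewrite mxE.
have -> : \sum_j (E *m M *m invmx E) i j * (\sum_p E j p * y p) =
    ((E *m M *m invmx E) *m (E *m v)) i 0.
  rewrite [RHS]mxE; apply: eq_bigr => j _; congr (_ * _); rewrite mxE.
  by apply: eq_bigr => p _; rewrite mxE.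
by rewrite ew [in RHS]mulmxA mulmxKV // mulmxA.
Qed.

Lemma vform_conj rho E k Y : E \in unitmx -> @vform R rho k Y ->
  @vform R (conj_rep E rho) k (fun i t => \sum_j E i j * Y j t).
Proof.
move=> hE [h1 h2 h3 h4].
have eS i t : slS k (fun t => \sum_j E i j * Y j t) t = \sum_j E i j * slS k (Y j) t.
  rewrite sum2 -!slSZ -slSD; congr slS; apply/funext => u; exact: sum2.
split.
- move=> i; apply: both_cusps_ext (both_cuspsD (both_cuspsZ (E i 0) (h1 0)) (both_cuspsZ (E i 1) (h1 1))) => t _.
  by rewrite sum2.
- by move=> i t ht; apply: conj_law => // j; exact: h2.
- move=> i t ht; rewrite eS; under [RHS]eq_bigr do rewrite eS.
  by apply: (conj_law (z := fun j => slS k (Y j) (t + 2))) => // j; exact: h3.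
- move=> i t ht; rewrite mulr_sumr; under eq_bigr do rewrite mulrCA.
  by apply: (conj_law (z := fun j => (-1) ^ (- k) * Y j t)) => // j; exact: h4.
Qed.

Lemma is_rep_conj (rho : 'M[int]_2 -> 'M[C]_2) E : E \in unitmx -> is_rep rho -> is_rep (conj_rep E rho).
Proof.
move=> hE [h1 h2 h3]; split.
- by move=> g hg; rewrite /conj_rep !unitmx_mul hE unitmx_inv hE h1.
- by rewrite /conj_rep h2 mulmx1 mulmxV.
- by move=> g h hg hh; rewrite /conj_rep h3 // !mulmxA mulmxKV.
Qed.

Lemma conj_repK (rho : 'M[int]_2 -> 'M[C]_2) E : E \in unitmx ->
  conj_rep (invmx E) (conj_rep E rho) = rho.
Proof.
move=> hE; apply/funext => g.
by rewrite /conj_rep invmxK !mulmxA mulVmx // mul1mx mulmxKV.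
Qed.

Lemma Ds_lin k (x y : C) f g t : cusp_hol f -> cusp_hol g -> upper_half t ->
  Ds k (fun u => x * f u + y * g u) t = x * Ds k f t + y * Ds k g t.
Proof.
move=> hf hg ht; have [f' _ /(_ t ht) df] := cusp_hol_deriv hf; have [g' _ /(_ t ht) dg] := cusp_hol_deriv hg.
rewrite /Ds (hasd_derive1 (hasdD (hasdZ x df) (hasdZ y dg))) (hasd_derive1 df) (hasd_derive1 dg).
move: (twopii^-1) (k%:~R / 12) (E2 t) (f t) (g t) (f' t) (g' t) => *; ring.
Qed.

End Rationality.

(** * A basis with coefficients in a given field *)

Section Basis.
Variable R : realType.
Local Notation C := (CC R).
Local Notation upper_half := (@upper_half R).
Implicit Types (t : C) (k : int).
Local Opaque qs eta_quot.

Variables (rho : 'M[int]_2 -> 'M[C]_2) (k0 : int) (Y : 'I_2 -> C -> C) (a b c : C).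
Hypothesis rho_rep : is_rep rho.
Hypothesis Y_form : vform rho k0 Y.
Hypothesis k0_min : forall k V, vform rho k V -> (exists i t, upper_half t /\ V i t <> 0) -> k0 <= k.
Hypothesis ode : forall i t, upper_half t ->
  Ds (k0 + 2) (Ds k0 (Y i)) t + a * Gform t * Ds k0 (Y i) t
  + (b * Gform t ^+ 2 + c * E4 t) * Y i t = 0.
Variables (K : C -> Prop) (e : 'I_2 -> C) (A : 'I_2 -> nat -> C).
Hypothesis hK : subfield K.
Hypothesis e_K : forall i, K (e i).
Hypothesis A_disc : forall i, disc (A i).
Hypothesis A_K : forall i n, K (A i n).
Hypothesis Y_qs : forall i t, upper_half t -> Y i t = qs 1 (e i) (A i) t.
Hypothesis A0 : forall i, A i 0%N = 1.
Hypothesis e_neq : e 0 != e 1.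

(** The coefficient of the Wronskian at the exponent e 0 + e 1 is e 1 - e 0; the terms with k0 / 12
    cancel. *)
Lemma wronskian_neq0 : exists2 t, upper_half t & W k0 Y t != 0.
Proof.
apply: contrapT => h; pose D i := dser k0 (e i) (A i).
have hD i : disc (D i) by exact: disc_dser.
have eD i t : upper_half t -> DF k0 Y i t = qs 1 (e i) (D i) t.
  exact: (Ds_qs k0 (A_disc i) (Y_qs i)).
have h1 := discM (A_disc 0) (hD 1); have h2 := discM (A_disc 1) (hD 0).
have hz t : upper_half t ->
    qs 1 (e 0 + e 1) (fun n => pm (A 0) (D 1) n + -1 * pm (A 1) (D 0) n) t = 0.
  move=> ht; have w0 : W k0 Y t = 0.
    by apply: contrapT => w0; apply: h; exists t => //; apply/eqP.
  rewrite (qsD _ _ ht h1 (discZ (-1) h2)) // (qsZ _ _ _ ht h2) //.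
  rewrite (qsM _ _ _ ht (A_disc 0) (hD 1)) // -w0 [e 0 + e 1]addrC (qsM _ _ _ ht (A_disc 1) (hD 0)) //.
  by rewrite -!eD // -!Y_qs // mulN1r.
have := @qs_eq0 R 1 (e 0 + e 1) _ isT (discD h1 (discZ (-1) h2)) hz 0%N.
rewrite /pm !big_ord1 /= !A0 !mul1r /D /dser /theta /pm !big_ord1 /= !A0 => h0.
move/negP: e_neq; apply; rewrite -subr_eq0 -oppr_eq0; apply/eqP; rewrite -[RHS]h0.
by move: (k0%:~R / 12) => x; ring.
Qed.

Lemma rho_det (g : 'M[int]_2) : g \in Gamma0_2 -> \det (rho g) != 0.
Proof. by case: rho_rep => h _ _ /h; rewrite unitmxE unitfE. Qed.

Theorem rational_basis k : exists (n : nat) (B : 'I_n -> C -> 'cV[C]_2),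
  modform_basis k rho B /\ forall j i, fourier_coefs_in K (fun t => B j t i 0).
Proof.
have TG : Tmx \in Gamma0_2 by rewrite TmxE; exact: Tn_Gamma0.
have span := free_module Y_form k0_min ode (rho_det TG) (rho_det (Un_Gamma0 _)) wronskian_neq0.
pose Q (Z : C -> 'cV[C]_2) := forall i, fourier_coefs_in K (fun t => Z t i 0).
have zero_case : (forall Z, modform k rho Z -> forall t, upper_half t -> Z t = 0) ->
    exists (n : nat) (B : 'I_n -> C -> 'cV[C]_2), modform_basis k rho B /\ forall j, Q (B j).
  move=> h; exists 0%N, (fun _ _ => 0); split; last by case.
  split; [by case|by move=> x _ []|].
  by move=> Z /h hZ; exists (fun=> 0) => t ht; rewrite big_ord0 hZ.
have [k1|k1] := boolP (odd `|k - k0|%N).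
  apply: zero_case => Z /modform_vform /span [f [g [A1 [B1 [A2 [B2 [hf hg hZ]]]]]]] t ht.
  apply/colP => i; rewrite mxE; have := hZ i t ht => ->.
  rewrite (sform_odd hf) // (sform_odd hg) //; first by rewrite !mul0r addr0.
  by move: k1; lia.
have [k2|k2] := ltP (k - k0) 0.
  apply: zero_case => Z /modform_vform /span [f [g [A1 [B1 [A2 [B2 [hf hg hZ]]]]]]] t ht.
  apply/colP => i; rewrite mxE; have := hZ i t ht => ->.
  by rewrite (sform_neg hf) // (sform_neg hg) //; [rewrite !mul0r addr0|lia].
have [m hm] : exists m : nat, k - k0 = 2 * m%:Z by exists (`|k - k0|./2)%N; lia.
have D_form := DF_form Y_form.
(* The scalar factors have the weights 2 m and 2 (m - 1). For m = 0 the second block is empty, so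
   the truncated predecessor is never evaluated there. *)
pose B (j : 'I_(m.+1 + m)) : C -> 'cV[C]_2 := match fintype.split j with
  | inl i => fun t => \col_p (mono m i t * Y p t)
  | inr i => fun t => \col_p (mono m.-1 i t * DF k0 Y p t) end.
apply: (@extract_basis R k rho Q _ B).
- move=> j; rewrite /B; case: (fintype.split j) => i; apply: vform_modform => //.
    have [A1 [B1 [h1 _]]] := mono_sform hK m i.
    have -> : k = k0 + 2 * m%:Z by rewrite -hm; ring.
    by apply: vform_sform h1 _ Y_form; rewrite abszM oddM.
  have m0 : (0 < m)%N by case: (m) i => [[]|].
  have [A1 [B1 [h1 _]]] := mono_sform hK m.-1 i.
  have -> : k = k0 + 2 + 2 * m.-1%:Z by lia.
  by apply: vform_sform h1 _ D_form; rewrite abszM oddM.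
- have KA := A_K; have K0 := sub_0 hK.
  move=> j p; rewrite /B; case: (fintype.split j) => i.
    have [A1 [B1 [[h1 _ e1 _] hKA]]] := mono_sform hK m i.
    apply: (@fourier_in R K (e p) (pm A1 (A p))) => //; first exact: discM.
      move=> t ht; rewrite mxE e1 // Y_qs //.
      by have := qsM 0 (e p) (ltn0Sn 0) ht h1 (A_disc p); rewrite add0r.
    by move=> n; apply: sub_pm.
  have [A1 [B1 [[h1 _ e1 _] hKA]]] := mono_sform hK m.-1 i.
  have hD := disc_dser k0 (e p) (A_disc p).
  apply: (@fourier_in R K (e p) (pm A1 (dser k0 (e p) (A p)))) => //; first exact: discM.
    move=> t ht; rewrite mxE e1 // /DF (Ds_qs k0 (A_disc p) (Y_qs p)) //.
    by have := qsM 0 (e p) (ltn0Sn 0) ht h1 hD; rewrite add0r.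
  move=> n; apply: sub_pm => // q _; apply: sub_D => //.
    by apply: sub_M => //; apply: sub_D => //; exact: sub_nat.
  apply: sub_M => //; last by apply: sub_pm => // s _; exact: sub_e2s.
  apply: sub_N => //; apply: sub_M => //; first exact: sub_int.
  by apply: sub_V => //; exact: (sub_nat hK 12).
- move=> Z /modform_vform /span [f [g [A1 [B1 [A2 [B2 [hf hg hZ]]]]]]].
  rewrite hm in hf; have [x hx] := sform_span hf.
  have [y hy] : exists y : nat -> C, forall t, upper_half t -> g t = \sum_(i < m) y i * mono m.-1 i t.
    case: (posnP m) => m0.
      exists (fun=> 0) => t ht; rewrite (sform_neg hg) //; last by rewrite m0 in hm; lia.
      by rewrite m0 big_ord0.
    have e2 : k - 2 - k0 = 2 * m.-1%:Z by lia.
    rewrite e2 in hg; have [y hy] := sform_span hg; exists y => t ht; rewrite hy //.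
    by rewrite prednK.
  exists (fun j => match fintype.split j with inl i => x i | inr i => y i end) => t ht.
  apply/colP => p; rewrite [LHS](hZ p t ht) hx // hy // big_split_ord /= mxE; congr (_ + _).
  + rewrite summxE mulr_suml; apply: eq_bigr => i _.
    by rewrite /B; have -> := unsplitK (inl i : 'I_m.+1 + 'I_m); rewrite !mxE mulrA.
  + rewrite summxE mulr_suml; apply: eq_bigr => i _.
    by rewrite /B; have -> := unsplitK (inr i : 'I_m.+1 + 'I_m); rewrite !mxE mulrA.
Qed.

End Basis.

Theorem theorem1p6 (R : realType) (rho : 'M[int]_2 -> 'M[CC R]_2)
  (k0 : int) (F : CC R -> 'cV[CC R]_2) (a b c r : CC R)
  (m : 'I_2 -> CC R) (X : 'M[CC R]_2)
  (lam l : 'I_2 -> CC R) (coef : 'I_2 -> nat -> CC R)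
  (rho_rep : is_rep rho)
  (rho_irr : rep_irreducible rho)
  (rhoT_diag : diagonalizable (rho Tmx))
  (F_form : modform k0 rho F)
  (F_neq0 : nonzero_on_H F)
  (k0_min : forall (k : int) (Z : CC R -> 'cV[CC R]_2),
     modform k rho Z -> nonzero_on_H Z -> k0 <= k)
  (ode : forall tau, upper_half tau ->
     Dserre (k0 + 2) (Dserre k0 F) tau
     + (a * Gform tau) *: Dserre k0 F tau
     + (b * Gform tau ^+ 2 + c * E4 tau) *: F tau = 0)
  (r_root : r ^+ 2 - (a + 3^-1) * r + b + 4 * c = 0)
  (m_le : `|m 0| <= `|m 1|)
  (m_distinct : qpow (m 0) 1 <> qpow (m 1) 1)
  (X_unit : X \in unitmx)
  (X_diag : X *m rho Tmx *m invmx X = diag_mx (\row_i qpow (m i) 1))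
  (lam_neq0 : forall i, lam i != 0)
  (coef0 : forall i, coef i 0%N = 1)
  (XF_expansion : forall i,
     qexpansion (k0%:~R / 12 + l i) (fun n => lam i * coef i n)
       (fun tau => (X *m F tau) i 0))
  (rhoT_finite_order : exists2 n, (0 < n)%N & rho Tmx ^+ n = 1)
  (r_algebraic : algebraicOver ratr r) :
  let E := diag_mx (\row_i (lam i)^-1) *m X in
  let F' := fun tau => E *m F tau in
  let rho' := conj_rep E rho in
  (forall i, fourier_coefs_in (Qadjoin r) (fun tau => F' tau i 0)) /\
  (forall i, fourier_coefs_in (algebraicOver ratr) (fun tau => F' tau i 0)) /\
  (forall k : int, exists (n : nat) (B : 'I_n -> CC R -> 'cV[CC R]_2),
     modform_basis k rho' B /\
     forall j i, fourier_coefs_in (Qadjoin r) (fun tau => B j tau i 0)).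
Proof.
move=> E F' rho'; have hK := Qadjoin_subfield r; set K := Qadjoin r in hK *.
have Eu : E \in unitmx.
  rewrite unitmx_mul X_unit andbT unitmxE det_diag unitfE; apply/prodf_neq0 => i _.
  by rewrite mxE invr_eq0.
pose YF (i : 'I_2) t := F t i 0; pose Y (i : 'I_2) t := F' t i 0.
pose e i := k0%:~R / 12 + l i.
have vF : vform rho k0 YF by exact: modform_vform.
have rep' : is_rep rho' by exact: is_rep_conj.
have YE i t : \sum_j E i j * YF j t = Y i t by rewrite /Y mxE.
have vY : vform rho' k0 Y by apply: vform_ext (vform_conj Eu vF) => i t _; exact: YE.
have XY i t : (X *m F t) i 0 = lam i * Y i t.
  by rewrite /Y /F' /E -mulmxA mul_diag_mx [in RHS]mxE [X in _ = _ * (X * _)]mxE mulrA divff // mul1r.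
have hc i : disc (coef i).
  have [h _] := qexpansion_qs (XF_expansion i).
  apply: eq_disc (discZ (lam i)^-1 h) => n.
  by rewrite mulrA mulVf ?mul1r ?lam_neq0.
have Yq i t : upper_half t -> Y i t = qs 1 (e i) (coef i) t.
  move=> ht; have [_ h] := qexpansion_qs (XF_expansion i).
  by apply: (mulfI (lam_neq0 i)); rewrite -XY h // (qsZ _ _ _ ht (hc i)).
have Ynz i : exists2 t, upper_half t & Y i t != 0.
  apply: contrapT => h; have := @qs_eq0 R 1 (e i) (coef i) isT (hc i).
  move=> /(_ _ 0%N) hz; have /eqP := oner_neq0 R[i]%C; apply; rewrite -(coef0 i); apply: hz => t ht.
  by rewrite -Yq //; apply: contrapT => y0; apply: h; exists t => //; apply/eqP.
have FT t : upper_half t -> F (t + 1) = rho Tmx *m F t.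
  by case: F_form => _ h _; have [hT _ _] := modular_generators h; exact: hT.
have YT i t : upper_half t -> Y i (t + 1) = qpow (m i) 1 * Y i t.
  move=> ht; apply: (mulfI (lam_neq0 i)); rewrite -XY FT // mulrCA -XY.
  have -> : X *m (rho Tmx *m F t) = diag_mx (\row_i qpow (m i) 1) *m (X *m F t).
    by rewrite -X_diag !mulmxA mulmxKV.
  by rewrite mul_diag_mx mxE mxE.
have eE i : cexp (twopii R * e i) = qpow (m i) 1.
  have [t ht y0] := Ynz i; have ht1 : upper_half (t + 1%:R) := upper_addn 1 ht.
  have y1 : qs 1 (e i) (coef i) t != 0 by rewrite -(Yq i t ht).
  have yT : Y i (t + 1%:R) = qpow (m i) 1 * Y i t := YT i t ht.
  apply: (mulIf y1); rewrite -(qs_period (e i) (coef i) t (ltn0Sn 0)).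
  by rewrite -(Yq i _ ht1) yT (Yq i t ht).
(* If rho(T) has order dividing n, translation by n fixes the nonzero component, which makes n e i
   an integer. *)
have eK i : K (e i).
  have [n n0 hn] := rhoT_finite_order; have [t ht y0] := Ynz i.
  have FTn p : F (t + p%:R) = rho Tmx ^+ p *m F t.
    elim: p => [|p IH]; first by rewrite addr0 mul1mx.
    rewrite -natr1 addrA FT ?IH ?mulmxA; last exact: upper_addn.
    by rewrite exprS.
  have YTn p : Y i (t + p%:R) = qpow (m i) 1 ^+ p * Y i t.
    elim: p => [|p IH]; first by rewrite addr0 mul1r.
    by rewrite -natr1 addrA YT ?IH ?mulrA -?exprS //; exact: upper_addn.
  have q1 : qpow (m i) 1 ^+ n = 1.
    by apply: (mulIf y0); rewrite -YTn mul1r /Y /F' FTn hn mul1mx.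
  rewrite -eE -cexpMn -mulrA in q1; have [p hp] := cexp_eq1 q1.
  have n1 : (n%:R : R[i]%C) != 0 by rewrite pnatr_eq0 -lt0n.
  have -> : e i = p%:~R / n%:R by rewrite -hp mulfK.
  by apply: (sub_M hK); [exact: sub_int|apply: (sub_V hK); exact: sub_nat].
have kK : K (k0%:~R / 12) by apply: (sub_M hK); [exact: sub_int|apply: (sub_V hK); exact: (sub_nat hK 12)].
have lK i : K (l i).
  by have -> : l i = e i - k0%:~R / 12 by [rewrite /e addrC addKr]; exact: sub_B.
(* Exponents that differ by an integer would give the same eigenvalue. *)
have l_int (p : int) : l 0 - l 1 <> p%:~R.
  move=> h; apply: m_distinct; rewrite -!eE.
  have -> : e 0 = e 1 + p%:~R by rewrite -h /e; ring.
  by rewrite mulrDr cexpD cexp_int mulr1.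
have fYF i : cusp_hol (YF i) by case: vF => /(_ i) [].
have fDF i : cusp_hol (Ds k0 (YF i)) by exact: cusp_hol_Ds.
have DsE i : Ds k0 (YF i) = (fun t => Dserre k0 F t i 0) by apply/funext => t; rewrite mxE.
have odeF i t : upper_half t -> Ds (k0 + 2) (Ds k0 (YF i)) t + a * Gform t * Ds k0 (YF i) t
    + (b * Gform t ^+ 2 + c * E4 t) * YF i t = 0.
  move=> ht; have := congr1 (fun M : 'cV_2 => M i 0) (ode t ht).
  have mxD (M N : 'cV[CC R]_2) x : (M + x *: N) i 0 = M i 0 + x * N i 0 by rewrite !mxE.
  have D1 : Dserre k0 F t i 0 = Ds k0 (YF i) t by rewrite DsE.
  have D2 : Dserre (k0 + 2) (Dserre k0 F) t i 0 = Ds (k0 + 2) (Ds k0 (YF i)) t.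
    by rewrite mxE DsE.
  by rewrite !mxD D1 D2 mxE.
have Y2 i t : Y i t = E i 0 * YF 0 t + E i 1 * YF 1 t by rewrite -YE sum2.
have odeY i t : upper_half t -> Ds (k0 + 2) (Ds k0 (Y i)) t + a * Gform t * Ds k0 (Y i) t
    + (b * Gform t ^+ 2 + c * E4 t) * Y i t = 0.
  move=> ht; have -> : Y i = (fun t => E i 0 * YF 0 t + E i 1 * YF 1 t) by apply/funext; exact: Y2.
  have fl x y (f g : R[i]%C -> R[i]%C) : cusp_hol f -> cusp_hol g -> cusp_hol (fun t => x * f t + y * g t).
    by move=> hf hg; apply: cusp_holD; exact: cusp_holZ.
  rewrite (@Ds_ext _ _ _ (fun t => E i 0 * Ds k0 (YF 0) t + E i 1 * Ds k0 (YF 1) t)) //; last first.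
  - by apply: cusp_hol_Ds; exact: fl.
  - by move=> u hu; rewrite Ds_lin.
  rewrite !Ds_lin //; have h0 := odeF 0 t ht; have h1 := odeF 1 t ht.
  rewrite -[RHS](addr0 0) -{1}(mulr0 (E i 0)) -[X in _ = _ + X](mulr0 (E i 1)) -{1}h0 -[X in _ = _ + _ * X]h1.
  move: (Ds _ _ _) (Ds _ _ _) (Ds _ _ _) (Ds _ _ _) (E4 t) (Gform t) (YF 0 t) (YF 1 t) => *; ring.
have recur i := fun n => ode_recursion (ode_series (hc i) (Yq i) (odeY i) n).
have eL i : e i - k0%:~R / 12 = l i by rewrite /e addrC addKr.
have ind i : indicial a b c (l i) = 0.
  have := recur i 0%N; rewrite coef0 mulr1 addr0 eL => ->.
  by rewrite /ode_rest /lo !big_ord0 !mulr0 !addr0 subr0 oppr0.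
have l01 : l 0 - l 1 != 0 by apply/eqP; exact: (l_int 0).
(* Subtracting the two indicial equations leaves a multiple of l 0 - l 1, which can be cancelled. *)
have suml : l 0 + l 1 = 6^-1 - a.
  apply: (mulfI l01); apply/eqP; rewrite -subr_eq0; apply/eqP.
  rewrite -[RHS](subrr 0) -{1}(ind 0) -(ind 1) /indicial.
  by move: (l 0) (l 1) => x y; field.
have prodl : l 0 * l 1 = b + c.
  have := ind 0; rewrite /indicial; have -> : a = 6^-1 - (l 0 + l 1) by rewrite suml; ring.
  move=> h; apply/eqP; rewrite -subr_eq0 -oppr_eq0; apply/eqP; rewrite -[RHS]h.
  by move: (l 0) (l 1) => x y; field.
have h3 : K 3^-1 by apply: (sub_V hK); exact: (sub_nat hK 3).
have aK : K a.
  have -> : a = 6^-1 - (l 0 + l 1) by rewrite suml; ring.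
  apply: (sub_B hK); last exact: (sub_D hK).
  by apply: (sub_V hK); exact: (sub_nat hK 6).
have rK : K r by exact: Qadjoin_r.
(* The relations for b + c and b + 4 c determine c, since their difference is 3 c. *)
have cK : K c.
  have -> : c = 3^-1 * ((a + 3^-1) * r - r * r - l 0 * l 1).
    rewrite prodl; have -> : r * r = (a + 3^-1) * r - b - 4 * c.
      by apply/eqP; rewrite -subr_eq0; apply/eqP; rewrite -[RHS]r_root; ring.
    by field.
  apply: (sub_M hK) => //; apply: (sub_B hK); last exact: (sub_M hK).
  apply: (sub_B hK); last exact: (sub_M hK).
  by apply: (sub_M hK) => //; exact: (sub_D hK).
have bK : K b.
  have -> : b = l 0 * l 1 - c by rewrite prodl addrK.
  by apply: (sub_B hK) => //; exact: (sub_M hK).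
have coefK i n : K (coef i n).
  apply: (frobenius hK (eK i) aK bK cK _ (recur i)); first by rewrite coef0; exact: sub_1.
  move=> p p0; rewrite eL; apply/eqP => hI.
  (* Shifted by p from one root, the indicial polynomial is p times (difference of the roots plus
     p); it cannot vanish for p > 0, because the roots do not differ by an integer. *)
  have key (x y : R[i]%C) : x + y = 6^-1 - a -> indicial a b c x = 0 ->
      indicial a b c (x + p%:R) = p%:R * (x - y + p%:R).
    move=> hs hx; rewrite -[RHS]addr0 -[in RHS]hx /indicial.
    have -> : y = 6^-1 - a - x by rewrite -hs; ring.
    by move: (p%:R : R[i]%C) => z; field.
  have p1 : (p%:R : R[i]%C) != 0 by rewrite pnatr_eq0 -lt0n.
  move: hI; case: (ord2P i) => ->.
    rewrite (key _ _ suml (ind 0)) => /eqP; rewrite mulf_eq0 (negbTE p1) /= addr_eq0 => /eqP h.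
    by apply: (l_int (- p%:Z)); rewrite h rmorphN.
  rewrite (key (l 1) (l 0)) ?ind // 1?addrC // => /eqP; rewrite mulf_eq0 (negbTE p1) /= addr_eq0 => /eqP h.
  by apply: (l_int p%:Z); rewrite -pmulrn h opprB.
have e01 : e 0 != e 1 by rewrite /e (inj_eq (addrI _)) -subr_eq0.
split; first by move=> i; apply: (fourier_in (sub_0 hK) (hc i) (Yq i)).
split.
  move=> i; apply: (fourier_in _ (hc i) (Yq i)); first exact: algebraic0.
  by move=> n; exact: Qadjoin_algebraic (coefK i n).
move=> k; apply: (@rational_basis R rho' k0 Y a b c rep' vY _ odeY K e coef) => //.
(* Minimality of k0 is known for rho; conjugation by the inverse of E carries a nonzero form for
   rho' to one for rho of the same weight. *)
move=> k' V hV [i [t [ht v0]]].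
have EV : invmx E \in unitmx by rewrite unitmx_inv.
have hV2 := vform_conj EV hV; rewrite (conj_repK rho Eu) in hV2.
apply: (k0_min _ _ (vform_modform rho_rep hV2)); exists t => //.
apply/eqP => h0; apply: v0.
have hv : invmx E *m (\col_j V j t) = 0.
  by rewrite -h0; apply/colP => p; rewrite !mxE; apply: eq_bigr => q _; rewrite mxE.
have : \col_j V j t = 0 by rewrite -(mulKVmx Eu (\col_j V j t)) hv mulmx0.
by move/colP => /(_ i); rewrite !mxE.
Qed.
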